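(* Let $(H,\langle\cdot,\cdot\rangle_H,\|\cdot\|_H)$ and $(U,\langle\cdot,\cdot\rangle_U,\|\cdot\|_U)$ be separable $\mathbb R$-Hilbert spaces, let $\mathbb H\subseteq H$ be a non-empty orthonormal basis of $H$, let $T,\iota\in(0,\infty)$, let $(\Omega,\mathcal F,\mathbb P)$ be a probability space with a normal filtration $(\mathcal F_t)_{t\in[0,T]}$, let $(W_t)_{t\in[0,T]}$ be an $\operatorname{Id}_U$-cylindrical $(\Omega,\mathcal F,\mathbb P,(\mathcal F_t)_{t\in[0,T]})$-Wiener process, let $\lambda\colon\mathbb H\to\mathbb R$ satisfy $\sup_{h\in\mathbb H}\lambda_h<0$, let $A\colon D(A)\subseteq H\to H$ be the linear operator with $D(A)=\{v\in H\colon\sum_{h\in\mathbb H}|\lambda_h\langle h,v\rangle_H|^2<\infty\}$ and $Av=\sum_{h\in\mathbb H}\lambda_h\langle h,v\rangle_Hh$ for $v\in D(A)$, let $(H_r,\langle\cdot,\cdot\rangle_{H_r},\|\cdot\|_{H_r})$, $r\in\mathbb R$, be a family of interpolation spaces associated to $-A$, let $\gamma\in\mathbb R$, $\alpha\in[0,1)$, $\beta\in[0,\frac12)$, $\chi\in[\beta,\frac12)$, $F\in C(H_\gamma,H_{\gamma-\alpha})$, $B\in C(H_\gamma,\mathrm{HS}(U,H_{\gamma-\beta}))$ satisfy for all bounded sets $S\subseteq H_\gamma$ that $|F|_S|_{\mathcal C^1(S,\|\cdot\|_{H_{\gamma-\alpha}})}+|B|_S|_{\mathcal C^1(S,\|\cdot\|_{\mathrm{HS}(U,H_{\gamma-\beta})})}<\infty$,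 let $\mathbb H_N\subseteq\mathbb H$, $N\in\mathbb N_0$, be sets which satisfy $\mathbb H_0=\mathbb H$ and $\sup_{N\in\mathbb N}N^\iota\sup(\{1/|\lambda_h|\colon h\in\mathbb H\setminus\mathbb H_N\}\cup\{0\})<\infty$, let $P_N\in L(H_{\min\{0,\gamma-1\}})$, $N\in\mathbb N_0$, and $\mathscr P_N\in L(U)$, $N\in\mathbb N_0$, be bounded linear operators which satisfy for all $N\in\mathbb N_0$, $v\in H$ that $P_N(v)=\sum_{h\in\mathbb H_N}\langle h,v\rangle_Hh$, and let $X^N\colon[0,T]\times\Omega\to H_\gamma$, $N\in\mathbb N_0$, be $(\mathcal F_t)_{t\in[0,T]}$-adapted stochastic processes with continuous sample paths which satisfy for all $N\in\mathbb N_0$, $t\in[0,T]$ that $\mathbb P$-a.s. $$X^N_t=e^{tA}P_NX^0_0+\int_0^te^{(t-s)A}P_NF(X^N_s)\,ds+\int_0^te^{(t-s)A}P_NB(X^N_s)\mathscr P_N\,dW_s.$$ Let $\vartheta\in(0,\min\{1-\alpha,\frac12-\beta\})$, $p\in(\frac1\vartheta,\infty)$, and assume that $X^0_0(\Omega)\subseteq H_{\gamma+\vartheta}$, $\mathbb E[\|X^0_0\|^p_{H_{\gamma+\vartheta}}]<\infty$, $|F|_{\mathcal C^1(H_\gamma,\|\cdot\|_{H_{\gamma-\alpha}})}<\infty$, $|B|_{\mathcal C^1(H_\gamma,\|\cdot\|_{\mathrm{HS}(U,H_{\gamma-\beta})})}<\infty$, and $$\sup_{N\in\mathbb N}\sup_{v\in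 H_\gamma}\Bigl[\frac{\|B(v)\mathscr P_N\|_{\mathrm{HS}(U,H_{\gamma-\beta})}+N^{\iota\vartheta}\|B(v)(\mathscr P_0-\mathscr P_N)\|_{\mathrm{HS}(U,H_{\gamma-\chi})}}{1+\|v\|_{H_\gamma}}\Bigr]<\infty.$$ Then for all $\delta\in[0,\vartheta-\frac1p)$, $\varepsilon\in(0,\infty)$ it holds that $$\sup_{N\in\mathbb N}\Bigl[\mathbb E\bigl[\|X^N\|^p_{\mathcal C^\delta([0,T],\|\cdot\|_{H_\gamma})}\bigr]+N^{\iota(\vartheta-\delta-\frac1p-\varepsilon)}\Bigl(\mathbb E\bigl[\|X^0-X^N\|^p_{\mathcal C^\delta([0,T],\|\cdot\|_{H_\gamma})}\bigr]\Bigr)^{1/p}\Bigr]<\infty.$$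
   Context: $\mathbb N=\{1,2,\dots\}$, $\mathbb N_0=\mathbb N\cup\{0\}$. Interpolation spaces associated to $-A$: for $r\ge0$, $H_r=D((-A)^r)$ with $\langle u,v\rangle_{H_r}=\langle(-A)^ru,(-A)^rv\rangle_H$; for $r<0$, $H_r$ is the completion of $H$ with respect to the norm $\|(-A)^rv\|_H$. Thus $H_r\subseteq H_s$ for $r\ge s$, and the semigroup $e^{tA}$, $t\ge0$, acts on every $H_r$ (by restriction/extension). $\mathrm{HS}(U,V)$ is the Hilbert space of Hilbert-Schmidt operators from $U$ to $V$; $L(V)$ denotes the bounded linear operators on $V$; $C(V_1,V_2)$ denotes the continuous functions from $V_1$ to $V_2$. A normal filtration is right-continuous with $\mathcal F_0$ containing all $\mathbb P$-null sets of $\mathcal F$. For a metric space $(M,d)$, a normed space $(V,\|\cdot\|)$, $r\in[0,1]$, $f\colon M\to V$: $|f|_{\mathcal C^r(M,\|\cdot\|)}=\sup(\{\|f(x)-f(y)\|/d(x,y)^r\colon x\ne y\}\cup\{0\})\in[0,\infty]$ and $\|f\|_{\mathcal C^r(M,\|\cdot\|)}=\sup(\{\|f(x)\|\colon x\in M\}\cup\{0\})+|f|_{\mathcal C^r(M,\|\cdot\|)}$. Subsets of $H_\gamma$ carry the metric induced by $\|\cdot\|_{H_\gamma}$, so $|\cdot|_{\mathcal C^1}$ is the Lipschitz seminorm. Norms of processes in $\mathcal C^\delta([0,T],\|\cdot\|_{H_\gamma})$ are taken for each sample path. *)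

(* Defs.v *)
From HB Require Import structures.
From mathcomp Require Import all_boot all_order all_algebra.
From mathcomp Require Import sesquilinear.
From mathcomp Require Import all_classical all_reals all_analysis.
From mathcomp.analysis.showcase Require summability.

Set Implicit Arguments.
Unset Strict Implicit.
Unset Printing Implicit Defensive.

Import Order.TTheory GRing.Theory Num.Theory.
Import numFieldNormedType.Exports.

Local Open Scope classical_set_scope.
Local Open Scope ring_scope.

HB.mixin Record CompleteNormedModule_isHilbert (R : realType) (V : Type)
    of CompleteNormedModule R V := {
  inner : {dot V for (idfun : R -> R)} ;
  inner_norm : forall v : V, inner v v = `|v| ^+ 2
}.

#[short(type="hilbertType")]
HB.structure Definition Hilbert (R : realType) :=
  {V of CompleteNormedModule_isHilbert R V & CompleteNormedModule R V}.

Definition separable (E : topologicalType) : Prop :=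
  exists2 D : set E, countable D & dense D.

Definition borel (E : topologicalType) : set (set E) := <<s [set O | open O] >>.

Section Hilbert_space.
Context {R : realType} {H : hilbertType R}.
Implicit Types (B : set H) (v w : H).

(* Unconditional sums: limits along the directed set of finite subsets. *)
Definition on_set B (f : H -> H) : H -> H := fun h => if h \in B then f h else 0.

Definition has_vsum B (f : H -> H) v : Prop :=
  summability.partial_sum (on_set B f) @ summability.totally --> v.

Definition vsum B (f : H -> H) : H := summability.sum (on_set B f).

Definition orthonormal_set B : Prop :=
  forall e f, B e -> B f -> inner e f = (e == f)%:R.

Definition orthonormal_basis B : Prop :=
  orthonormal_set B /\ forall v, has_vsum B (fun e => inner e v *: e) v.

(* For an orthonormal basis B and m : B -> R, the (possibly unbounded) linear
   operator v |-> sum_{h in B} m_h <h, v> h on its maximal domain. *)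
Definition diag_dom B (m : H -> R) : set H :=
  [set v | (\esum_(h in B) (`|m h * inner h v| ^+ 2)%:E < +oo)%E].

Definition diag_op B (m : H -> R) v : H :=
  vsum B (fun h => (m h * inner h v) *: h).

(* The operator A is diag_op B lam with domain diag_dom B lam; the fractional
   powers of -A and the semigroup generated by A are given by the functional
   calculus of this diagonal operator.  Only the values of lam on B matter. *)
Definition negA_dom B (lam : H -> R) (r : R) : set H :=
  diag_dom B (fun h => (- lam h) `^ r).

Definition negA_pow B (lam : H -> R) (r : R) : H -> H :=
  diag_op B (fun h => (- lam h) `^ r).

Definition expA B (lam : H -> R) (t : R) : H -> H :=
  diag_op B (fun h => expR (t * lam h)).

End Hilbert_space.

(* A family of interpolation spaces associated to -A.  For r >= 0, [ires r]
   identifies H_r with the subspace D((-A)^r) of H; for r <= 0, [iemb r] exhibits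
   H_r as the completion of H for the norm |(-A)^r v|; for r >= s, [iincl r s] is
   the inclusion of H_r into H_s.  Outside the stated ranges of r and s these maps
   are arbitrary and are not to be used. *)
Record interpolation_family (R : realType) (H : hilbertType R) (B : set H)
    (lam : H -> R) := InterpolationFamily {
  ispace :> R -> hilbertType R ;
  ires : forall r, {linear ispace r -> H} ;
  iemb : forall r, {linear H -> ispace r} ;
  iincl : forall r s, {linear ispace r -> ispace s} ;
  ires_inj : forall r : R, 0 <= r -> injective (ires r) ;
  ires_range : forall r : R, 0 <= r -> range (ires r) = negA_dom B lam r ;
  ires_inner : forall r (u v : ispace r), 0 <= r ->
    inner u v =
    inner (negA_pow B lam r (ires r u)) (negA_pow B lam r (ires r v)) ;
  iemb_dense : forall r : R, r <= 0 -> dense (range (iemb r)) ;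
  iemb_inner : forall r (u v : H), r <= 0 ->
    inner (iemb r u) (iemb r v) =
    inner (negA_pow B lam r u) (negA_pow B lam r v) ;
  iemb_res0 : forall v : H, ires 0 (iemb 0 v) = v ;
  iincl_inj : forall r s : R, s <= r -> injective (iincl r s) ;
  iincl_cont : forall r s : R, s <= r -> continuous (iincl r s) ;
  iincl_res : forall r s (v : ispace r), 0 <= s -> s <= r ->
    ires s (iincl r s v) = ires r v ;
  iincl_emb : forall r s (v : H), s <= r -> r <= 0 ->
    iincl r s (iemb r v) = iemb s v ;
  iincl_res_emb : forall r s (v : ispace r), s <= 0 -> 0 <= r ->
    iincl r s v = iemb s (ires r v)
}.

(* The action of e^{tA}, t >= 0, on all the H_r: restriction of e^{tA} for r >= 0,
   extension by continuity for r <= 0.  These properties determine it. *)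
Record semigroup_action (R : realType) (H : hilbertType R) (B : set H)
    (lam : H -> R) (Hr : interpolation_family B lam) := SemigroupAction {
  sg :> forall r : R, R -> {linear Hr r -> Hr r} ;
  sg_cont : forall r t : R, 0 <= t -> continuous (sg r t) ;
  sg_res : forall r t (v : Hr r), 0 <= r -> 0 <= t ->
    ires Hr r (sg r t v) = expA B lam t (ires Hr r v) ;
  sg_emb : forall r t (v : H), r <= 0 -> 0 <= t ->
    sg r t (iemb Hr r v) = iemb Hr r (expA B lam t v)
}.

(* For r >= s, the element v of H_s regarded as an element of the smaller space H_r,
   when it lies in it (and 0 otherwise). *)
Definition ilift (R : realType) (H : hilbertType R) (B : set H) (lam : H -> R)
    (Hr : interpolation_family B lam) (r s : R) (v : Hr s) : Hr r :=
  xget 0 [set u : Hr r | iincl Hr r s u = v].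

Section Hilbert_Schmidt.
Context {R : realType} {U V : hilbertType R}.

(* The choice of the orthonormal basis is immaterial. *)
Definition some_onb : set U := xget set0 [set E : set U | orthonormal_basis E].

Definition hs_norm (L : U -> V) : \bar R :=
  ((\esum_(e in some_onb) (`|L e| ^+ 2)%:E) `^ 2^-1)%E.

End Hilbert_Schmidt.

Record hsop (R : realType) (U V : hilbertType R) := HSOp {
  hsfun :> {linear U -> V} ;
  hsfun_cont : continuous hsfun ;
  hsfun_fin : (hs_norm hsfun < +oo)%E
}.

Definition hs_continuous (R : realType) (M : topologicalType)
    (U V : hilbertType R) (f : M -> hsop U V) : Prop :=
  forall x, (hs_norm (fun u => f y u - f x u) @[y --> x] --> 0%E).

(* Hoelder seminorm and norm on the subset M of a metric space, for functions with
   values in a space W whose norm is nrm. *)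
Section Hoelder.
Context {R : realType} {E : normedZmodType R} {W : zmodType}.

Definition holder_semi (M : set E) (nrm : W -> \bar R) (r : R) (f : E -> W) :
    \bar R :=
  ereal_sup ([set (nrm (f z.1 - f z.2)%R * ((`|z.1 - z.2| `^ r)^-1)%:E)%E
               | z in [set z : E * E | [/\ M z.1, M z.2 & z.1 != z.2]]]
             `|` [set 0%E]).

Definition holder_norm (M : set E) (nrm : W -> \bar R) (r : R) (f : E -> W) :
    \bar R :=
  (ereal_sup ([set nrm (f x) | x in M] `|` [set 0%E]) + holder_semi M nrm r f)%E.

End Hoelder.

Definition enorm {R : realType} {V : normedModType R} (v : V) : \bar R := (`|v|)%:E.

Section Stochastics.
Context {R : realType} {d : measure_display} {Omega : measurableType d}.
Variables (P : probability Omega R) (T : R) (Fil : R -> set (set Omega)).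

Definition normal_filtration : Prop :=
  [/\ forall t : R, 0 <= t <= T ->
        sigma_algebra setT (Fil t) /\ Fil t `<=` measurable,
      forall s t : R, 0 <= s -> s <= t -> t <= T -> Fil s `<=` Fil t,
      forall t : R, 0 <= t < T -> Fil t = \bigcap_(s in `]t, T]) Fil s
    & forall N, measurable N -> P N = 0%E -> Fil 0 N].

Definition adapted (E : topologicalType) (X : R -> Omega -> E) : Prop :=
  forall (t : R) C, 0 <= t <= T -> borel C -> Fil t (X t @^-1` C).

(* An Id_U-cylindrical Wiener process is given by the real processes
   W t u = <u, W_t>, u in U. *)
Record cylindrical_wiener (U : hilbertType R) (W : R -> U -> Omega -> R) : Prop :=
  CylindricalWiener {
  cw_adapted : forall u : U, adapted (fun t => W t u) ;
  cw_zero : forall u : U, {ae P, forall w, W 0 u w = 0} ;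
  cw_linear : forall (t a : R) (u v : U), 0 <= t <= T ->
    {ae P, forall w, W t (a *: u + v) w = a * W t u w + W t v w} ;
  cw_continuous : forall u : U,
    {ae P, forall w, {within `[0, T], continuous (fun t => W t u w)}} ;
  cw_normal : forall (s t : R) (u : U) (C : set R), 0 <= s -> s < t -> t <= T -> u != 0 ->
    measurable C ->
    P [set w | C (W t u w - W s u w)] =
    normal_prob 0 (Num.sqrt (t - s) * `|u|) C ;
  cw_independent : forall (s t : R) (u : U) (A : set Omega) (C : set R),
    0 <= s -> s < t -> t <= T -> Fil s A -> measurable C ->
    P (A `&` [set w | C (W t u w - W s u w)]) =
    (P A * P [set w | C (W t u w - W s u w)%R])%E
}.

Definition predictable_rectangle (D : set (R * Omega)) : Prop :=
  (exists a b A, [/\ 0 <= a, a <= b, b <= T, Fil a A & D = `]a, b] `*` A]) \/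
  (exists2 A, Fil 0 A & D = [set 0] `*` A).

Definition predictable : set (set (R * Omega)) :=
  <<s `[0, T] `*` setT, [set D | predictable_rectangle D] >>.

(* Elementary L(U,V)-valued processes
   sum_i 1_{]a_i, b_i]}(s) 1_{A_i}(omega) <u_i, .> v_i. *)
Record elementary (U V : hilbertType R) := Elementary {
  el_size : nat ;
  el_a : 'I_el_size -> R ;
  el_b : 'I_el_size -> R ;
  el_A : 'I_el_size -> set Omega ;
  el_u : 'I_el_size -> U ;
  el_v : 'I_el_size -> V ;
  el_ab : forall i, [/\ 0 <= el_a i, el_a i <= el_b i & el_b i <= T] ;
  el_meas : forall i, Fil (el_a i) (el_A i)
}.

Arguments el_a {U V} _ _.
Arguments el_b {U V} _ _.
Arguments el_A {U V} _ _.
Arguments el_u {U V} _ _.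
Arguments el_v {U V} _ _.

Definition el_val (U V : hilbertType R) (Z : elementary U V) (s : R) (w : Omega)
    (u : U) : V :=
  \sum_i (\1_(`]el_a Z i, el_b Z i]) s * \1_(el_A Z i) w * inner (el_u Z i) u)
    *: el_v Z i.

Definition el_integral (U V : hilbertType R) (W : R -> U -> Omega -> R)
    (Z : elementary U V) (t : R) (w : Omega) : V :=
  \sum_i (\1_(el_A Z i) w *
      (W (Num.min (el_b Z i) t) (el_u Z i) w -
       W (Num.min (el_a Z i) t) (el_u Z i) w)) *: el_v Z i.

(* I is a version of the Ito integral of Phi over [0, t]: Phi is predictable, and for
   some elementary processes Z_n with int_0^t |Phi_s - Z_n(s)|_HS^2 ds -> 0 in
   probability, the integrals of the Z_n converge to I in probability.  Removing
   the time t from the domain of integration is harmless, and needed for the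
   stochastic convolution, whose integrand may be singular there. *)
Definition is_ito_integral (U V : hilbertType R) (W : R -> U -> Omega -> R)
    (t : R) (Phi : R -> Omega -> U -> V) (I : Omega -> V) : Prop :=
  [/\ forall u C, borel C ->
        predictable ((`[0, t[ `*` setT) `&` [set z | C (Phi z.1 z.2 u)]),
      forall C, borel C -> measurable (I @^-1` C)
    & exists Z : nat -> elementary U V,
      (forall e : R, 0 < e ->
        P [set w | (e%:E < \int[lebesgue_measure]_(s in `[0%R, t[)
             (hs_norm (fun u => Phi s w u - el_val (Z n) s w u)%R) `^ 2)%E]
        @[n --> \oo] --> 0%E) /\
      (forall e : R, 0 < e ->
        P [set w | e < `|el_integral W (Z n) t w - I w|] @[n --> \oo] --> 0%E)].

End Stochastics.

Record vsimple (R : realType) (V : normedModType R) := VSimple {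
  vs_size : nat ;
  vs_A : 'I_vs_size -> set R ;
  vs_v : 'I_vs_size -> V ;
  vs_meas : forall i, measurable (vs_A i)
}.

Arguments vs_A {R V} _ _.
Arguments vs_v {R V} _ _.

Definition vs_val (R : realType) (V : normedModType R) (g : vsimple V) (s : R) : V :=
  \sum_i \1_(vs_A g i) s *: vs_v g i.

Definition vs_integral (R : realType) (V : normedModType R) (g : vsimple V)
    (t : R) : V :=
  \sum_i fine (lebesgue_measure (vs_A g i `&` `[0, t[)) *: vs_v g i.

(* f is Bochner integrable over [0, t[ with integral I. *)
Definition is_bochner_integral (R : realType) (V : normedModType R) (t : R)
    (f : R -> V) (I : V) : Prop :=
  (forall C, borel C -> measurable (`[0, t[ `&` f @^-1` C)) /\
  exists g : nat -> vsimple V,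
    (\int[lebesgue_measure]_(s in `[0%R, t[) `|f s - vs_val (g n) s|%:E)%E
      @[n --> \oo] --> 0%E /\
    vs_integral (g n) t @[n --> \oo] --> I.

(* X_t = e^{tA} PN x + int_0^t e^{(t-s)A} PN F(X_s) ds
         + int_0^t e^{(t-s)A} PN B(X_s) QN dW_s   almost surely,
   with both integrals taken in H_gam.  PN acts on H_min(0, gam - 1), which contains
   H_gam, H_(gam-alp) and H_(gam-bet). *)
Definition mild_eq (R : realType) (H U : hilbertType R) (bas : set H)
    (lam : H -> R) (Hr : interpolation_family bas lam) (S : semigroup_action Hr)
    (d : measure_display) (Omega : measurableType d) (P : probability Omega R)
    (T : R) (Fil : R -> set (set Omega)) (W : R -> U -> Omega -> R)
    (gam alp bet : R) (F : Hr gam -> Hr (gam - alp))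
    (B : Hr gam -> hsop U (Hr (gam - bet)))
    (PN : Hr (Num.min 0 (gam - 1)) -> Hr (Num.min 0 (gam - 1))) (QN : U -> U)
    (x : Omega -> Hr gam) (X : R -> Omega -> Hr gam) (t : R) : Prop :=
  let m := Num.min 0 (gam - 1) in
  let G (s : R) (v : Hr m) : Hr gam := ilift gam (S m s (PN v)) in
  exists2 J : Omega -> Hr gam,
    is_ito_integral P T Fil W t
      (fun s w u => G (t - s) (iincl Hr (gam - bet) m (B (X s w) (QN u)))) J
  & {ae P, forall w, exists2 I : Hr gam,
      is_bochner_integral t
        (fun s => G (t - s) (iincl Hr (gam - alp) m (F (X s w)))) I
    & X t w = G t (iincl Hr gam m (x w)) + I + J w}.

(* Main.v *)
(* In the coordinates of the basis the operators e^{tA} P_N are multiplications by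
   e^{-mu t}, so the smoothing, temporal regularity and truncation error of e^{tA} P_N
   reduce to scalar inequalities; they produce singular kernels (t - s)^{-kap}, kap < 1.
   A p-th moment inequality for Ito integrals is proved first for martingales along finite
   grids, with a Taylor expansion of |x|^{2p} and the weight S^{-p/2}, S the bracket, in
   place of Doob's inequality, and extended to limits of elementary integrals.  With
   Jensen's inequality and a singular Gronwall lemma (after localization) it yields
   uniformly in N
     E |X^N_t|^p <= C,   E |X^N_t - X^N_s|^p <= C |t - s|^{vth p},
     E |X^0_t - X^N_t|^p <= C N^{- iota vth p}.
   Interpolating between the last two, the increments of X^0 - X^N have p-th moments of
   size |t - s|^{r p} N^{- iota (vth - r) p}, and Kolmogorov-Chentsov chaining with r
   slightly above delta + 1/p gives the rate in the Hoelder norm. *)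
Require Import Defs.
From HB Require Import structures.
From mathcomp Require Import all_boot all_order all_algebra.
From mathcomp Require Import finmap.
From mathcomp Require Import all_classical all_reals all_analysis measurable_realfun.
From mathcomp.analysis.showcase Require Import summability.
From mathcomp Require Import ring lra.

Set Implicit Arguments.
Unset Strict Implicit.
Unset Printing Implicit Defensive.

Import Order.TTheory GRing.Theory Num.Theory.
Import numFieldNormedType.Exports.

Local Open Scope classical_set_scope.
Local Open Scope ring_scope.

(** * Orthonormal sequences *)

(* One exponent [kap = max (alp + vth) (2 (bet + vth)) (2 chi)] below 1 serves everything:
   [(t - s)^{-kap}] weighs the drift integrand itself and the square of the Hilbert-Schmidt norm of
   the noise integrand. Jensen's inequality then turns both into the same integral of p-th moments,
   and a single Gronwall argument covers them. In it [vth] is the smoothness spent on a time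
   increment or on the truncation.

   The obstacle is that an Ito integral is known only as a limit in probability of elementary
   integrals, which inherit neither moments nor the localization of the solution. The coefficients
   of an elementary process are therefore multiplied by indicators of the localizing events and
   switched off once their bracket passes a level; the resulting martingale equals the elementary
   integral where the events hold and the level is not reached. Its moment bound must depend on the
   process through the bracket alone: whatever depends on the vectors in it is multiplied by a power
   of the mesh, which is then refined. *)
#[local] Existing Instance summability.totally_filter.

Section inner_product.
Context {R : realType} {H : hilbertType R}.
Implicit Types (u v w : H).

Lemma innerC u v : inner u v = inner v u.
Proof. by rewrite hermC /= expr0 mul1r. Qed.

Lemma innerDl u v w : inner (u + v) w = inner u w + inner v w.
Proof. by rewrite linearDl. Qed.

Lemma innerDr u v w : inner w (u + v) = inner w u + inner w v.
Proof. by rewrite innerC innerDl; congr (_ + _); apply: innerC. Qed.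

Lemma innerZl a u v : inner (a *: u) v = a * inner u v.
Proof. by rewrite linearZl_LR. Qed.

Lemma innerZr a u v : inner u (a *: v) = a * inner u v.
Proof. by rewrite innerC innerZl innerC. Qed.

Lemma inner0l v : inner 0 v = 0.
Proof. by rewrite linear0l. Qed.

Lemma inner0r v : inner v 0 = 0.
Proof. by rewrite innerC inner0l. Qed.

Lemma innerNl u v : inner (- u) v = - inner u v.
Proof. by rewrite -scaleN1r innerZl mulN1r. Qed.

Lemma innerNr u v : inner u (- v) = - inner u v.
Proof. by rewrite innerC innerNl innerC. Qed.

Lemma innerBl u v w : inner (u - v) w = inner u w - inner v w.
Proof. by rewrite innerDl innerNl. Qed.

Lemma innerBr u v w : inner w (u - v) = inner w u - inner w v.
Proof. by rewrite innerDr innerNr. Qed.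

Lemma inner_suml (I : Type) (r : seq I) (Q : pred I) (f : I -> H) v :
  inner (\sum_(i <- r | Q i) f i) v = \sum_(i <- r | Q i) inner (f i) v.
Proof.
apply: (big_morph (fun x => inner x v)) => [x y|]; first exact: innerDl.
exact: inner0l.
Qed.

Lemma inner_sumr (I : Type) (r : seq I) (Q : pred I) (f : I -> H) v :
  inner v (\sum_(i <- r | Q i) f i) = \sum_(i <- r | Q i) inner v (f i).
Proof. by rewrite innerC inner_suml; apply: eq_bigr => i _; exact: innerC. Qed.

Lemma normD2 u v : `|u + v| ^+ 2 = `|u| ^+ 2 + 2 * inner u v + `|v| ^+ 2.
Proof. by rewrite -!inner_norm innerDl !innerDr (innerC v u); ring. Qed.

Lemma normB2 u v : `|u - v| ^+ 2 = `|u| ^+ 2 - 2 * inner u v + `|v| ^+ 2.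
Proof. by rewrite normD2 innerNr normrN; ring. Qed.

Lemma cauchy_schwarz u v : `|inner u v| <= `|u| * `|v|.
Proof.
have [->|v0] := eqVneq v 0; first by rewrite inner0r normr0 mulr_ge0.
have vp : 0 < `|v| ^+ 2 by rewrite exprn_gt0// normr_gt0.
have h : 0 <= `|u - (inner u v / `|v| ^+ 2) *: v| ^+ 2 by rewrite sqr_ge0.
rewrite normB2 innerZr normrZ exprMn -normrX ger0_norm ?sqr_ge0// in h.
rewrite -ler_sqr ?nnegrE ?mulr_ge0// exprMn -normrX ger0_norm ?sqr_ge0//.
rewrite -(ler_pdivrMr _ _ vp).
suff e : `|u| ^+ 2 - 2 * (inner u v / `|v| ^+ 2 * inner u v) +
   (inner u v / `|v| ^+ 2) ^+ 2 * `|v| ^+ 2 = `|u| ^+ 2 - inner u v ^+ 2 / `|v| ^+ 2.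
  by move: h; rewrite e subr_ge0.
by field; rewrite normr_eq0.
Qed.

Lemma continuous_inner u : continuous (inner u).
Proof.
apply: bounded_linear_continuous.
apply/linear_boundedP; near=> r => v.
rewrite (le_trans (cauchy_schwarz u v))// ler_wpM2r//.
Unshelve. all: by end_near. Qed.

(** Stated for a duplicate-free list over any index type, to serve both the sums over ['I_n] in
    [proj] and those over finite subsets in [fproj]; a zero vector contributes 0 to both sides. *)
Lemma bessel_eq (I : eqType) (r : seq I) (e : I -> H) v : uniq r ->
  (forall i j, i \in r -> j \in r -> i != j -> inner (e i) (e j) = 0) ->
  (forall i, e i = 0 \/ `|e i| = 1) ->
  `|v - \sum_(i <- r) inner (e i) v *: e i| ^+ 2 =
  `|v| ^+ 2 - \sum_(i <- r) inner (e i) v ^+ 2.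
Proof.
move=> ur oe ne.
have n2 : `|\sum_(i <- r) inner (e i) v *: e i| ^+ 2 =
    \sum_(i <- r) inner (e i) v ^+ 2.
  rewrite -inner_norm inner_suml [LHS]big_seq [RHS]big_seq.
  apply: eq_bigr => i ir; rewrite inner_sumr (big_rem i)//=.
  rewrite big_seq big1 ?addr0 => [|j jr].
    rewrite innerZl innerZr inner_norm.
    by case: (ne i) => [->|->]; [rewrite inner0l; ring|ring].
  have ji : j != i.
    by move: jr; apply: contraTneq => ->; rewrite mem_rem_uniqF.
  by rewrite innerZl innerZr oe ?mulr0// ?(mem_rem jr)// eq_sym.
rewrite normB2 n2 inner_sumr.
under eq_bigr do rewrite innerZr (innerC v) -expr2.
ring.
Qed.

End inner_product.

Section orthonormal_sequences.
Context {R : realType} {H : hilbertType R}.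
Implicit Types (u v w : H) (b : nat -> H).

(* Vanishing terms are allowed, so that finite and infinite orthonormal families
   are both enumerated by nat. *)
Definition onseq b :=
  (forall i j, i != j -> inner (b i) (b j) = 0) /\ (forall i, b i = 0 \/ `|b i| = 1).

Definition proj b n v := \sum_(i < n) inner (b i) v *: b i.

Definition onseq_total b := onseq b /\ forall v, proj b n v @[n --> \oo] --> v.

Lemma projD b n u v : proj b n (u + v) = proj b n u + proj b n v.
Proof.
rewrite /proj -big_split; apply: eq_bigr => i _ /=.
by rewrite innerDr scalerDl.
Qed.

Lemma projZ b n a v : proj b n (a *: v) = a *: proj b n v.
Proof.
rewrite /proj scaler_sumr; apply: eq_bigr => i _ /=.
by rewrite innerZr scalerA.
Qed.

Lemma proj0 b n : proj b n 0 = 0.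
Proof. by rewrite -(scale0r (0:H)) projZ !scale0r. Qed.

Lemma projB b n u v : proj b n (u - v) = proj b n u - proj b n v.
Proof. by rewrite -scaleN1r projD projZ scaleN1r. Qed.

Lemma proj_bessel b n v : onseq b ->
  `|v - proj b n v| ^+ 2 = `|v| ^+ 2 - \sum_(i < n) inner (b i) v ^+ 2.
Proof.
move=> [ob nb]; rewrite /proj.
rewrite (@bessel_eq _ _ _ (index_enum 'I_n) (fun i : 'I_n => b i))//.
  exact: index_enum_uniq.
by move=> i j _ _ ij; apply: ob.
Qed.

Lemma proj_norm_le b n v : onseq b -> `|v - proj b n v| <= `|v|.
Proof.
move=> ob; rewrite -ler_sqr ?nnegrE// proj_bessel// gerBl.
by apply: sumr_ge0 => i _; rewrite sqr_ge0.
Qed.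

Lemma inner_proj b n u v :
  inner (proj b n u) v = \sum_(i < n) inner (b i) u * inner (b i) v.
Proof. by rewrite inner_suml; apply: eq_bigr => i _; rewrite innerZl. Qed.

Lemma proj_id b n i : onseq b -> (i < n)%N -> proj b n (b i) = b i.
Proof.
move=> [ob nb] ni; rewrite /proj (bigD1 (Ordinal ni))//= big1 => [|j ji].
  by rewrite addr0 inner_norm; case: (nb i) => ->; rewrite ?scaler0// expr1n scale1r.
by rewrite ob ?scale0r// ; move: ji; apply: contra_neq => e; apply: val_inj.
Qed.

(** [proj b n] fixes [z], so [v] and [v - z] have the same residue, and taking the residue does not
    increase the norm. *)
Lemma proj_best b n v z : onseq b -> proj b n z = z ->
  `|v - proj b n v| <= `|v - z|.
Proof.
move=> ob pz; have := proj_norm_le n (v - z) ob.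
by rewrite projB pz opprB addrA subrK.
Qed.

Lemma proj_idW b m n v : onseq b -> (m <= n)%N -> proj b n (proj b m v) = proj b m v.
Proof.
move=> ob mn; rewrite {2}/proj (big_morph (proj b n) (id1 := 0) (op1 := +%R) (projD b n)).
  apply: eq_bigr => i _; rewrite projZ proj_id//.
  exact: leq_trans mn.
exact: proj0.
Qed.

Lemma parseval b u v : onseq_total b ->
  \sum_(i < n) inner (b i) u * inner (b i) v @[n --> \oo] --> inner u v.
Proof.
move=> [ob cb]; rewrite innerC.
under eq_fun do rewrite -inner_proj innerC.
exact: (cvg_comp _ _ (cb u) (@continuous_inner _ _ v u)).
Qed.

Lemma parseval_series b v : onseq_total b ->
  (\sum_(n <oo) (inner (b n) v ^+ 2)%:E = (`|v| ^+ 2)%:E)%E.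
Proof.
move=> tb; have := @parseval b v v tb; rewrite inner_norm => pv.
apply/cvg_lim => //; rewrite [X in X @ _ --> _](_ : _ =
    EFin \o (fun n => \sum_(i < n) inner (b i) v * inner (b i) v)); last first.
  by apply/funext => n /=; rewrite big_mkord sumEFin; under eq_bigr do rewrite -expr2.
by apply: cvg_EFin; [exact: nearW|exact: pv].
Qed.

(** Projections onto longer initial segments approximate at least as well ([proj_best]), so one good
    index per tolerance gives convergence. *)
Lemma total_approx b : onseq b ->
  (forall v e, 0 < e -> exists n z, proj b n z = z /\ `|v - z| < e) -> onseq_total b.
Proof.
move=> ob ab; split=> // v; apply/cvgrPdist_lt => e e0.
have [m [z [pz vz]]] := ab v e e0.
near=> n; apply: le_lt_trans vz.
apply: (@proj_best _ _ _ _ ob); rewrite -pz; apply: proj_idW => //.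
by near: n; exists m.
Unshelve. all: by end_near. Qed.

Lemma total_dense b (D : set H) : onseq b -> dense D ->
  (forall v, D v -> proj b n v @[n --> \oo] --> v) -> onseq_total b.
Proof.
move=> ob dD pD; apply: total_approx => // v e e0.
have e2 : 0 < e / 2 by rewrite divr_gt0.
have [w [/= vw Dw]] : ball v (e / 2) `&` D !=set0.
  apply: dD; first by exists v; exact: ballxx.
  exact: ball_open.
have /cvgrPdist_lt/(_ _ e2) [n _ nP] := pD _ Dw.
exists n, (proj b n w); split; first exact: proj_idW.
rewrite -[v](subrK w) -addrA (le_lt_trans (ler_normD _ _))// (splitr e) ltrD//.
  by move: vw; rewrite -ball_normE.
exact: nP (leqnn n).
Qed.

(** The squared distance of two partial sums is a difference of partial sums of the series of
    [a n ^+ 2], so they form a Cauchy sequence. The coefficient on a zero vector must be 0, since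
    its inner product with anything is. *)
Lemma riesz_fischer b (a : nat -> R) : onseq b ->
  (\sum_(n <oo) (a n ^+ 2)%:E < +oo)%E -> (forall n, b n = 0 -> a n = 0) ->
  exists u : H, forall n, inner (b n) u = a n.
Proof.
move=> ob sa a0; have [q1 q2] := ob.
pose s := series (fun n => a n ^+ 2).
pose S n := \sum_(i < n) a i *: b i.
have cs : cvgn s.
  apply: nondecreasing_is_cvgn.
    by apply/nondecreasing_seqP => n; rewrite /s /series /= big_nat_recr//= lerDl sqr_ge0.
  exists (fine (\sum_(n <oo) (a n ^+ 2)%:E)) => _ [n _ <-].
  rewrite -lee_fin fineK.
    rewrite /s /series /= -sumEFin; apply: nneseries_lim_ge => k _ _.
    by rewrite lee_fin sqr_ge0.
  by rewrite ge0_fin_numE// nneseries_ge0// => k _ _; rewrite lee_fin sqr_ge0.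
have dS m n : (m <= n)%N -> `|S n - S m| ^+ 2 = s n - s m.
  move=> /subnKC <-; elim: (n - m)%N => [|k IH]; first by rewrite addn0 !subrr normr0 expr0n.
  have -> : S (m + k.+1)%N - S m = (S (m + k)%N - S m) + a (m + k)%N *: b (m + k)%N.
    by rewrite addnS {1}/S big_ord_recr/= addrAC.
  rewrite normD2 IH innerZr innerBl !inner_suml.
  rewrite big1 => [|i _]; last by rewrite innerZl q1 ?mulr0// ltn_eqF.
  rewrite big1 => [|i _]; last by rewrite innerZl q1 ?mulr0// ltn_eqF// ltn_addr.
  rewrite subrr !mulr0 addr0 addnS /s /series /= big_nat_recr//= normrZ exprMn.
  rewrite real_normK ?num_real//.
  case: (q2 (m + k)%N) => e; last by rewrite e; ring.
  by rewrite e normr0 (a0 _ e); ring.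
have cS : cvgn S.
  apply: cauchy_cvg; apply/cauchy_ballP => e e0.
  have e2 : 0 < e / 2 by rewrite divr_gt0.
  have /cauchy_cvgP/cauchy_ballP/(_ ((e / 2) ^+ 2)) := cs.
  rewrite exprn_gt0// => /(_ isT) [[A1 A2]/= [[N1 _ N1P] [N2 _ N2P]] AP].
  pose N := maxn N1 N2.
  have NP n : (N <= n)%N -> `|S n - S N| < e / 2.
    move=> Nn; rewrite -ltr_sqr ?nnegrE// ?(ltW e2)// dS//.
    apply: le_lt_trans (ler_norm _) _.
    have /= := AP (s n, s N); rewrite -ball_normE /=; apply; split.
      by apply: N1P; rewrite /= (leq_trans _ Nn)// leq_maxl.
    by apply: N2P; rewrite /= leq_maxr.
  exists (S @` [set n | (N <= n)%N], S @` [set n | (N <= n)%N]) => /=.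
    by split; exists N => // n Nn; exists n.
  move=> [_ _] [/= [m Nm <-] [n Nn <-]]; rewrite -ball_normE /=.
  rewrite -(subrKA (S N)) (le_lt_trans (ler_normD _ _))// (splitr e) ltrD ?NP//.
  by rewrite -normrN opprB NP.
exists (lim (S @ \oo)) => n.
have /cvg_lim <- // : inner (b n) (S k) @[k --> \oo] --> a n.
  apply: cvg_near_cst; near=> k; rewrite /S inner_sumr.
  have nk : (n < k)%N by near: k; exists n.+1.
  rewrite (bigD1 (Ordinal nk))//= big1 => [|j ji].
    rewrite innerZr inner_norm addr0.
    by case: (q2 n) => e; rewrite e ?expr1n ?mulr1// normr0 expr0n mulr0 a0.
  rewrite innerZr q1 ?mulr0//; move: ji; apply: contra_neq => e.
  by apply: val_inj.
apply/esym/cvg_lim => //.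
exact: (cvg_comp _ _ cS (@continuous_inner _ _ (b n) _)).
Unshelve. all: by end_near. Qed.

End orthonormal_sequences.

(** * Gram-Schmidt and enumerations of orthonormal bases *)

Section bases.
Context {R : realType} {H : hilbertType R}.
Implicit Types (u v w : H) (b : nat -> H) (E : set H).

(** If [d m] depends on the earlier vectors then [r = 0], and [0^-1 = 0] makes the entry 0. The
    indices of [d] and of the result thus stay aligned, as [proj_gram_schmidt] requires. *)
Fixpoint gram_schmidt_seq (d : nat -> H) n : seq H :=
  if n is m.+1 then
    let s := gram_schmidt_seq d m in
    let r := d m - \sum_(e <- s) inner e (d m) *: e in
    rcons s (`|r|^-1 *: r)
  else [::].

Definition gram_schmidt d n := nth 0 (gram_schmidt_seq d n.+1) n.

Lemma gram_schmidt_seqE d n :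
  gram_schmidt_seq d n = [seq gram_schmidt d i | i <- iota 0 n].
Proof.
have sz k : size (gram_schmidt_seq d k) = k by elim: k => //= k IH; rewrite size_rcons IH.
elim: n => // n IH; rewrite -addn1 iotaD map_cat -IH addn1 /= cats1; congr rcons.
by rewrite /gram_schmidt /= nth_rcons sz ltnn eqxx.
Qed.

Definition gs_residue d n := d n - proj (gram_schmidt d) n (d n).

Lemma gram_schmidtE d n :
  gram_schmidt d n = `|gs_residue d n|^-1 *: gs_residue d n.
Proof.
have sz k : size (gram_schmidt_seq d k) = k by elim: k => //= k IH; rewrite size_rcons IH.
rewrite {1}/gram_schmidt /= nth_rcons sz ltnn eqxx.
suff -> : \sum_(e <- gram_schmidt_seq d n) inner e (d n) *: e =
  proj (gram_schmidt d) n (d n) by [].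
by rewrite gram_schmidt_seqE big_map /proj -{1}[n]subn0 -/(index_iota 0 n) big_mkord.
Qed.

Lemma gram_schmidt_onseq d : onseq (gram_schmidt d).
Proof.
have nb i : gram_schmidt d i = 0 \/ `|gram_schmidt d i| = 1.
  rewrite gram_schmidtE; have [->|r0] := eqVneq (gs_residue d i) 0.
    by left; rewrite scaler0.
  by right; rewrite normrZ normfV normr_id mulVf// normr_eq0.
suff lt n : forall i, (i < n)%N -> inner (gram_schmidt d i) (gram_schmidt d n) = 0.
  split => // i j; rewrite neq_ltn => /orP[ij|ji]; first exact: lt.
  by rewrite innerC; exact: lt.
elim/ltn_ind: n => n IH i ni.
rewrite (gram_schmidtE d n) innerZr {2}/gs_residue innerBr /proj inner_sumr.
rewrite (bigD1 (Ordinal ni))//= big1 => [|j ji].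
  rewrite innerZr inner_norm addr0.
  by case: (nb i) => e; rewrite e ?inner0l ?expr1n ?mulr1 ?subrr ?mulr0// mul0r subr0 mulr0.
rewrite innerZr; have : i != j by rewrite eq_sym; move: ji; apply: contra_neq => e; apply: val_inj.
rewrite neq_ltn => /orP[ij|ij]; first by rewrite IH ?mulr0//.
by rewrite [X in _ * X]innerC IH ?mulr0.
Qed.

Lemma proj_gram_schmidt d n : proj (gram_schmidt d) n.+1 (d n) = d n.
Proof.
have gsn := gram_schmidt_onseq d.
rewrite /proj big_ord_recr/= -/(proj _ n (d n)).
have dE : d n = gs_residue d n + proj (gram_schmidt d) n (d n) by rewrite subrK.
have -> : inner (gram_schmidt d n) (d n) = `|gs_residue d n|.
  rewrite {1}dE innerDr (innerC _ (proj _ _ _)) inner_proj big1 ?addr0 => [|i _].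
    rewrite {1}gram_schmidtE innerZl inner_norm expr2 mulrA.
    have [->|r0] := eqVneq (gs_residue d n) 0; first by rewrite normr0 mulr0.
    by rewrite mulVf ?mul1r// normr_eq0.
  by rewrite gsn.1 ?mulr0// ltn_eqF.
rewrite gram_schmidtE scalerA.
have [r0|r0] := eqVneq (gs_residue d n) 0.
  by rewrite r0 scaler0 addr0 {2}dE r0 add0r.
by rewrite mulfV ?normr_eq0// scale1r addrC -dE.
Qed.

Lemma separable_enum : separable H ->
  exists d : nat -> H, forall v e, 0 < e -> exists n, `|v - d n| < e.
Proof.
move=> [D /countable_injP[f fi] dD].
exists (fun n => xget 0 [set v | D v /\ f v = n]) => v e e0.
have [w [/= vw Dw]] : ball v e `&` D !=set0.
  by apply: dD; [exists v; exact: ballxx|exact: ball_open].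
exists (f w); case: xgetP => [z _ [Dz zw]|/(_ w)]; last by case.
rewrite (fi z w) ?inE//; move: vw; by rewrite -ball_normE.
Qed.

Lemma onseq_total_exists : separable H -> exists b : nat -> H, onseq_total b.
Proof.
move=> /separable_enum[d dP]; exists (gram_schmidt d).
apply: total_approx; first exact: gram_schmidt_onseq.
move=> v e /(dP v)[n vn]; exists n.+1, (d n); split=> //.
exact: proj_gram_schmidt.
Qed.

(** The partial sums behind [orthonormal_basis] are orthogonal projections as well, which lets
    Bessel's inequality act on unconditional sums. *)
Definition fproj E (A : {fset H}) v := partial_sum (on_set E (fun e => inner e v *: e)) A.

Lemma fprojE E A v : fproj E A v = \sum_(e <- A) inner (on_set E id e) v *: on_set E id e.
Proof.
rewrite /fproj /partial_sum -(big_seq_fsetE _ _ xpredT (fun e => on_set E (fun e => inner e v *: e) e)).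
by apply: eq_bigr => e _; rewrite /on_set; case: ifP; rewrite // inner0l scaler0.
Qed.

Lemma fprojB E A u v : fproj E A (u - v) = fproj E A u - fproj E A v.
Proof.
rewrite !fprojE -sumrB; apply: eq_bigr => e _.
by rewrite innerBr scalerBl.
Qed.

Lemma fproj_sum E A I (r : seq I) (a : I -> R) (f : I -> H) :
  fproj E A (\sum_(i <- r) a i *: f i) = \sum_(i <- r) a i *: fproj E A (f i).
Proof.
rewrite fprojE; under [RHS]eq_bigr => i _ do rewrite fprojE scaler_sumr.
rewrite exchange_big /=; apply: eq_bigr => e _.
rewrite inner_sumr scaler_suml; apply: eq_bigr => i _.
by rewrite innerZr scalerA.
Qed.

Lemma fproj_norm E A v : orthonormal_set E -> `|v - fproj E A v| <= `|v|.
Proof.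
move=> oE; rewrite -ler_sqr ?nnegrE// fprojE bessel_eq.
- by rewrite gerBl; apply: sumr_ge0 => i _; rewrite sqr_ge0.
- exact: fset_uniq.
- move=> e f _ _ ef; rewrite /on_set.
  case: ifPn => eE; last by rewrite inner0l.
  case: ifPn => fE; last by rewrite inner0r.
  by rewrite oE ?(negbTE ef)//; exact/set_mem.
- move=> e; rewrite /on_set; case: ifPn => eE; last by left.
  right; apply/eqP; rewrite -(@eqrXn2 _ 2)// expr1n -inner_norm oE ?eqxx//; exact/set_mem.
Qed.

Lemma fproj_id E (A : {fset H}) e : orthonormal_set E -> E e -> e \in A -> fproj E A e = e.
Proof.
move=> oE Ee eA; rewrite fprojE (big_fsetD1 e)//= big_seq big1 ?addr0 => [|f].
  by rewrite /on_set mem_set// oE// eqxx scale1r.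
rewrite in_fsetD1 => /andP[fe _]; rewrite /on_set; case: ifPn => fE; last by rewrite scaler0.
by rewrite oE ?(negbTE fe) ?scale0r//; exact/set_mem.
Qed.

(** Convergence along finite subsets follows from convergence along initial segments: a finite set
    containing the first [n] vectors fixes [proj b n v], so its partial sum is at least as close to
    [v]. *)
Lemma onseq_total_basis b : onseq_total b ->
  orthonormal_basis [set e | e != 0 /\ exists n, e = b n].
Proof.
move=> [ob tb]; set E := [set _ | _].
have oE : orthonormal_set E.
  move=> e f [e0 [n en]] [f0 [m fm]]; rewrite {}en {}fm in e0 f0 *.
  have [->|nm] := eqVneq (b n) (b m).
    rewrite inner_norm; case: (ob.2 m) => h; last by rewrite h expr1n.
    by rewrite h eqxx in f0.
  by rewrite ob.1//; move: nm; apply: contra_neq => ->.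
split=> // v; apply/cvgrPdist_lt => e e0.
have /cvgrPdist_lt/(_ _ e0) [n _ /(_ n (leqnn n)) nP] := tb v.
exists [fset b i | i in iota 0 n]%fset => //= A /fsubsetP bA.
apply: le_lt_trans nP; rewrite -[partial_sum _ _]/(fproj E A v).
have pid : fproj E A (proj b n v) = proj b n v.
  rewrite /proj fproj_sum; apply: eq_bigr => i _.
  have [->|bi0] := eqVneq (b i) 0.
    rewrite (_ : fproj E A 0 = 0)//; last first.
      by rewrite fprojE big1// => j _; rewrite inner0r scale0r.
  rewrite fproj_id//; first by split=> //; exists i.
  apply: bA; apply/imfsetP; exists (i : nat); last by [].
  suff : (i : nat) \in iota 0 n by [].
  by rewrite mem_iota add0n leq0n ltn_ord.
have := fproj_norm A (v - proj b n v) oE.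
by rewrite fprojB pid opprB addrA subrK.
Qed.

Lemma orthonormal_countable E : separable H -> orthonormal_set E -> countable E.
Proof.
move=> /separable_enum[d dP] oE; apply/countable_injP.
have h2 : (0 : R) < 2^-1 by rewrite invr_gt0.
exists (fun e => xget 0%N [set n | `|e - d n| < 2^-1]) => e f /set_mem Ee /set_mem Ef.
case: xgetP => [n _ /= en|/= nn]; last first.
  by have [n en] := dP e _ h2; case: (nn n).
case: xgetP => [m _ /= fm|/= nn]; last first.
  by have [m fm] := dP f _ h2; case: (nn m).
move=> nm; apply/eqP/negPn/negP => ef.
(* Distinct orthonormal vectors are at distance [sqrt 2], so one point of the dense sequence cannot
   be within 1/2 of both. *)
have l1 : `|e - f| < 1.
  rewrite -(subrKA (d n)) (le_lt_trans (ler_normD _ _))// (splitr 1) !div1r ltrD//.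
  by rewrite nm -normrN opprB.
have : `|e - f| ^+ 2 < 1 by rewrite expr_lt1.
by rewrite normB2 -!inner_norm !oE// !eqxx (negbTE ef)/=; lra.
Qed.

(** Entries [b n = 0] pad the sequence, for instance when the basis is finite; this is why the last
    clause asks for [f 0 = 0]. *)
Definition enumerates E b := [/\ onseq_total b,
  (forall n, b n != 0 -> E (b n)),
  (forall e, E e -> exists n, b n = e) &
  (forall f : H -> \bar R, (forall x, 0 <= f x)%E -> f 0%R = 0%E ->
     \esum_(e in E) f e = \sum_(n <oo) f (b n))%E].

Lemma basis_enum E : separable H -> orthonormal_basis E ->
  exists b, enumerates E b.
Proof.
move=> sH [oE bE]; have /countable_injP[f fi] := orthonormal_countable sH oE.
pose b n := xget 0 [set e | E e /\ f e = n].
have bE' n : b n != 0 -> E (b n).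
  by rewrite /b; case: xgetP => [e _ []//|_]; rewrite eqxx.
have bf e : E e -> b (f e) = e.
  move=> Ee; rewrite /b; case: xgetP => [g _ [Eg gf]|/(_ e)]; last by case.
  by apply: fi; rewrite ?inE.
have fb n : b n != 0 -> f (b n) = n.
  by rewrite /b; case: xgetP => [e _ []//|_]; rewrite eqxx.
have n1 e : E e -> `|e| = 1.
  move=> Ee; apply/eqP; rewrite -(@eqrXn2 _ 2)// expr1n -inner_norm oE// eqxx.
  by [].
have ob : onseq b.
  split=> [i j ij|i]; last first.
    by have [->|/bE'/n1] := eqVneq (b i) 0; [left|right].
  have [->|bi] := eqVneq (b i) 0; first by rewrite inner0l.
  have [->|bj] := eqVneq (b j) 0; first by rewrite inner0r.
  rewrite oE; [|exact: bE'|exact: bE'].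
  case: eqP => // bij; exfalso; move: ij.
  by rewrite -(fb _ bi) -(fb _ bj) bij eqxx.
exists b; split=> //.
- apply: total_approx => // v e e0.
  have /cvgrPdist_lt/(_ _ e0) [A _ /(_ A (fsubset_refl A)) /= vA] := bE v.
  (* A crude index exceeding [f e] for each [e] in [A], so that [proj] fixes every vector of the
     finite sum. *)
  exists (\sum_(e <- A) (f e).+1)%N, (fproj E A v); split => //.
  rewrite fprojE (big_morph _ (id1 := 0) (op1 := +%R) (projD b _)).
    apply: eq_big_seq => g gA; rewrite projZ /on_set; case: ifPn => [/set_mem gE|_].
      have fg : (f g < \sum_(g <- A) (f g).+1)%N.
        by rewrite (big_fsetD1 g)//= addSn ltnS leq_addr.
      by have := proj_id ob fg; rewrite bf// => ->.
    by rewrite proj0.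
  exact: proj0.
- by move=> e Ee; exists (f e); exact: bf.
- move=> g g0 g00.
  have bij : set_bij (f @` E) E b.
    split.
    + by move=> _ [e Ee <-] /=; rewrite bf.
    + by move=> _ _ /set_mem[e Ee <-] /set_mem[h Eh <-]; rewrite !bf// => ->.
    + by move=> e Ee; exists (f e); [exists e|exact: bf].
  rewrite (reindex_esum _ _ _ _ bij) esum_mkcond -nneseries_esumT.
    apply: eq_eseriesr => n _; case: ifPn => // /negP nf.
    have [->//|bn] := eqVneq (b n) 0; exfalso; apply: nf; apply/mem_set.
    by exists (b n); [exact: bE'|exact: fb].
  by move=> n; case: ifP.
Qed.

End bases.

Lemma some_onbP (R : realType) (U : hilbertType R) : separable U -> orthonormal_basis (@some_onb R U).
Proof.
move=> /onseq_total_exists[b /onseq_total_basis bb].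
by rewrite /some_onb; case: xgetP => [//|/(_ _ bb)].
Qed.

(** * Coordinates in the interpolation spaces *)

Lemma proj_cvg (R : realType) (H : hilbertType R) (b : nat -> H) v : onseq b ->
  \sum_(i < n) inner (b i) v ^+ 2 @[n --> \oo] --> `|v| ^+ 2 ->
  proj b n v @[n --> \oo] --> v.
Proof.
move=> ob /cvgrPdist_lt bv; apply/cvgrPdist_lt => e e0.
have e2 : 0 < e ^+ 2 by rewrite exprn_gt0.
near=> n; rewrite -ltr_sqr ?nnegrE ?(ltW e0)// proj_bessel//.
apply: le_lt_trans (ler_norm _) _.
by near: n; exact: bv.
Unshelve. all: by end_near. Qed.

(** For negative exponents [Hr r] is only a completion of [H]. Identities between coordinates are
    checked there on the dense image of [H] and carried over by this lemma. *)
Lemma eq_on_dense (R : realType) (E : topologicalType) (D : set E) (f g : E -> R) : dense D ->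
  continuous f -> continuous g -> (forall x, D x -> f x = g x) -> f = g.
Proof.
move=> dD cf cg fg; apply/funext => x; apply/eqP; rewrite -subr_eq0; apply/negPn/negP => fgx.
have oA : open ((fun y => f y - g y) @^-1` [set~ 0]).
  apply: open_comp; last by rewrite openC; exact: closed_eq.
  by move=> y _; apply: cvgB; [exact: cf|exact: cg].
have [|y [/= fy /fg yfg]] := dD _ _ oA; first by exists x => /=; apply/eqP.
by apply: fy; rewrite yfg subrr.
Qed.

Section diagonal_operators.
Context {R : realType} {H : hilbertType R} (bas : set H) (b : nat -> H).
Hypotheses (onb : orthonormal_basis bas) (tb : onseq_total b).
Hypothesis b_bas : forall n, b n != 0 -> bas (b n).
Hypothesis b_surj : forall e, bas e -> exists n, b n = e.
Hypothesis b_sum : forall f : H -> \bar R, (forall x, 0 <= f x)%E ->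
  f 0%R = 0%E -> (\esum_(e in bas) f e = \sum_(n <oo) f (b n))%E.

Lemma inner_inj u v : (forall n, inner (b n) u = inner (b n) v) -> u = v.
Proof.
move=> uv; apply/eqP; rewrite -subr_eq0 -normr_eq0 -sqrf_eq0 -eqe.
rewrite -(parseval_series _ tb); apply/eqP/eseries0 => n _ _.
by rewrite innerBr uv subrr expr0n.
Qed.

Lemma vsum_eq (Q : set H) (f : H -> H) u :
  on_set Q f = on_set bas (fun e => inner e u *: e) -> vsum Q f = u.
Proof.
move=> fu; rewrite /vsum /summability.sum fu.
have [_ /(_ u)] := onb; rewrite /has_vsum => hu.
by apply/cvg_lim; first exact: norm_hausdorff.
Qed.

Lemma diag_domE (m : H -> R) v :
  diag_dom bas m v <-> (\sum_(n <oo) ((m (b n) * inner (b n) v) ^+ 2)%:E < +oo)%E.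
Proof.
rewrite /diag_dom /= b_sum; last 2 first.
- by move=> x; rewrite lee_fin sqr_ge0.
- by rewrite inner0l mulr0 normr0 expr0n.
by under eq_eseriesr do rewrite real_normK ?num_real//.
Qed.

Lemma diag_dom_bounded (m : H -> R) (C : R) v : (forall h, bas h -> `|m h| <= C) ->
  diag_dom bas m v.
Proof.
move=> mC; apply/diag_domE.
apply: (@le_lt_trans _ _ (\sum_(n <oo) (C ^+ 2)%:E * (inner (b n) v ^+ 2)%:E)%E).
  apply: lee_nneseries => n _; first by rewrite lee_fin sqr_ge0.
  have [bn0|bn0] := eqVneq (b n) 0.
    by rewrite bn0 !inner0l mulr0 expr0n mule0.
  rewrite -EFinM lee_fin exprMn ler_wpM2r ?sqr_ge0//.
  rewrite -(@real_normK _ (m (b n))) ?num_real//.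
  have mb := mC _ (b_bas bn0).
  by rewrite ler_sqr ?nnegrE// (le_trans _ mb).
rewrite nneseriesZl => [|n _]; last by rewrite lee_fin sqr_ge0.
by rewrite parseval_series// -EFinM ltry.
Qed.

(** [diag_op] is defined as an unconditional sum. On [diag_dom] Riesz-Fischer provides a vector with
    the required coordinates, and the expansion of that vector in the basis is this very sum. *)
Lemma inner_diag_op (m : H -> R) v n : diag_dom bas m v ->
  inner (b n) (diag_op bas m v) = m (b n) * inner (b n) v.
Proof.
move=> /diag_domE dv.
have a0 k : b k = 0 -> m (b k) * inner (b k) v = 0.
  by move=> ->; rewrite inner0l mulr0.
have [u uP] := @riesz_fischer _ _ b _ tb.1 dv a0.
rewrite /diag_op (@vsum_eq bas _ u)//.
apply/funext => h; rewrite /on_set; case: ifPn => // /set_mem/b_surj[k <-].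
by rewrite uP.
Qed.

Lemma inner_vsum (Q : set H) v n : Q `<=` bas ->
  inner (b n) (vsum Q (fun h => inner h v *: h)) = \1_Q (b n) * inner (b n) v.
Proof.
move=> Qb; rewrite -(@inner_diag_op (\1_Q)); last first.
  by apply: (@diag_dom_bounded _ 1) => h _; rewrite indicE; case: (_ \in _); rewrite ?normr0 ?normr1.
congr (inner _ _); rewrite /diag_op /vsum; congr (summability.sum _).
apply/funext => h; rewrite /on_set indicE; case: ifPn => [/set_mem Qh|nQ].
  by rewrite (mem_set (Qb _ Qh)) mul1r.
by rewrite mul0r scale0r if_same.
Qed.

End diagonal_operators.

Section powR_facts.
Context {R : realType}.
Implicit Types x y r s t : R.

Lemma powR_add x r s : 0 < x -> x `^ (r + s) = x `^ r * x `^ s.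
Proof. by move=> x0; rewrite powRD// (gt_eqF x0) implybT. Qed.

Lemma powR_mulN x r : 0 < x -> x `^ r * x `^ (- r) = 1.
Proof. by move=> x0; rewrite -powR_add// subrr powRr0. Qed.

Lemma powR_invr x r : 0 < x -> (x `^ r)^-1 = x `^ (- r).
Proof.
move=> x0; apply: (mulfI (lt0r_neq0 (powR_gt0 r x0))).
by rewrite mulfV ?powR_mulN// lt0r_neq0// powR_gt0.
Qed.

Lemma powR_invl x r : 0 < x -> x^-1 `^ r = x `^ (- r).
Proof. by move=> x0; rewrite -(powR_inv1 (ltW x0)) -powRrM mulN1r. Qed.

Lemma ler_powR_base x y r : 0 <= r -> 0 <= x -> x <= y -> x `^ r <= y `^ r.
Proof.
move=> r0 x0 xy; apply: ge0_ler_powR => //; rewrite nnegrE//.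
exact: le_trans xy.
Qed.

Lemma powR_le_max x r : 0 <= x -> 0 <= r <= 1 -> x `^ r <= 1 + x.
Proof.
move=> x0 /andP[r0 r1]; have [x1|x1] := leP 1 x.
  by rewrite (le_trans (ler1_powR x1 r1))// lerDr.
rewrite (@le_trans _ _ 1)// ?lerDl//.
have [->|xn0] := eqVneq x 0; first by rewrite /powR eqxx; case: (r == 0); rewrite ?lexx ?ler01.
have xp : 0 < x <= 1 by rewrite lt_def xn0 x0 ltW.
by have := ger_powR xp r0; rewrite powRr0.
Qed.

(** [x^r <= 1 + x <= e^x]; hence [smoothing_bound] carries the constant 1. *)
Lemma powR_expN_le1 x r : 0 <= x -> 0 <= r <= 1 -> x `^ r * expR (- x) <= 1.
Proof.
move=> x0 r01; rewrite expRN ler_pdivrMr ?expR_gt0// mul1r.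
exact: le_trans (powR_le_max x0 r01) (expR_ge1Dx x).
Qed.

Lemma one_sub_expN_le x r : 0 <= x -> 0 <= r <= 1 -> 1 - expR (- x) <= x `^ r.
Proof.
move=> x0 /andP[r0 r1]; have [x1|x1] := leP 1 x.
  have : 1 <= x `^ r by have := ler_powR x1 r0; rewrite powRr0.
  by apply: le_trans; rewrite gerBl expR_ge0.
apply: (@le_trans _ _ x); first by have := expR_ge1Dx (- x); lra.
have [->|xn0] := eqVneq x 0; first exact: powR_ge0.
have xp : 0 < x <= 1 by rewrite lt_def xn0 x0 ltW.
by have := ger_powR xp r1; rewrite powRr1.
Qed.

Lemma smoothing_bound mu t r : 0 < mu -> 0 < t -> 0 <= r <= 1 ->
  mu `^ r * expR (- (t * mu)) <= t `^ (- r).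
Proof.
move=> mu0 t0 r01.
have := @powR_expN_le1 (t * mu) r (mulr_ge0 (ltW t0) (ltW mu0)) r01.
rewrite powRM ?(ltW mu0) ?(ltW t0)// => h; rewrite -powR_invr// -[leRHS]mul1r ler_pdivlMr ?powR_gt0//.
by rewrite mulrC mulrA.
Qed.

End powR_facts.

Section coordinates.
Context {R : realType} {H : hilbertType R} (bas : set H) (lam : H -> R) (b : nat -> H).
Hypotheses (onb : orthonormal_basis bas) (tb : onseq_total b).
Hypothesis b_bas : forall n, b n != 0 -> bas (b n).
Hypothesis b_surj : forall e, bas e -> exists n, b n = e.
Hypothesis b_sum : forall f : H -> \bar R, (forall x, 0 <= f x)%E ->
  f 0%R = 0%E -> (\esum_(e in bas) f e = \sum_(n <oo) f (b n))%E.
Variables (c0 : R) (c0_gt0 : 0 < c0) (lam_lt : forall h, bas h -> c0 <= - lam h).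
Variables (Hr : interpolation_family bas lam) (S : semigroup_action Hr).
Implicit Types (r s : R) (n : nat).

(* The value 1 for the vanishing terms of [b] only serves to keep [mu] positive. *)
Definition mu n : R := if b n == 0 then 1 else - lam (b n).

Lemma mu_ge n : Num.min c0 1 <= mu n.
Proof.
rewrite /mu; case: eqVneq => [_|bn]; first by rewrite ge_min lexx orbT.
by rewrite ge_min lam_lt//; exact: b_bas.
Qed.

Lemma mu_gt0 n : 0 < mu n.
Proof. by apply: lt_le_trans (mu_ge n); rewrite lt_min c0_gt0 ltr01. Qed.

Lemma inner_negA_pow r v n : negA_dom bas lam r v ->
  inner (b n) (negA_pow bas lam r v) = mu n `^ r * inner (b n) v.
Proof.
move=> dv; rewrite /negA_pow inner_diag_op// /mu.
by case: eqVneq => // ->; rewrite inner0l !mulr0.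
Qed.

Lemma negA_dom_basis r n : negA_dom bas lam r (b n).
Proof.
apply/(diag_domE b_sum).
apply: (@le_lt_trans _ _ (\sum_(k <oo) (((- lam (b n)) `^ r) ^+ 2)%:E * (inner (b k) (b n) ^+ 2)%:E)%E).
  apply: lee_nneseries => k _; first by rewrite lee_fin sqr_ge0.
  have [->|kn] := eqVneq k n; first by rewrite exprMn EFinM.
  by rewrite tb.1.1// mulr0 expr0n mule0.
rewrite nneseriesZl => [|k _]; last by rewrite lee_fin sqr_ge0.
by rewrite parseval_series// -EFinM ltry.
Qed.

Lemma negA_pow_basis r n : negA_pow bas lam r (b n) = mu n `^ r *: b n.
Proof.
apply: (inner_inj tb) => k; rewrite inner_negA_pow ?innerZr; last exact: negA_dom_basis.
by have [->//|kn] := eqVneq k n; rewrite tb.1.1// !mulr0.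
Qed.

Lemma negA_dom_neg r v : r <= 0 -> negA_dom bas lam r v.
Proof.
move=> r0; apply: (@diag_dom_bounded _ _ bas b tb b_bas b_sum _ (c0 `^ r)) => h bh.
rewrite ger0_norm ?powR_ge0//.
have lp : 0 < - lam h by apply: lt_le_trans (lam_lt bh).
rewrite -[r]opprK -!(@powR_invr _ _ (- r))// lef_pV2 ?posrE ?powR_gt0//.
by apply: ler_powR_base; rewrite ?oppr_ge0// ?(ltW c0_gt0)// lam_lt.
Qed.

Lemma negA_pow_unit r n : negA_pow bas lam r (mu n `^ (- r) *: b n) = b n.
Proof.
apply: (inner_inj tb) => k.
rewrite inner_negA_pow.
  rewrite innerZr; have [->|kn] := eqVneq k n; last by rewrite tb.1.1// !mulr0.
  by rewrite mulrA powR_mulN ?mul1r// mu_gt0.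
apply/(diag_domE b_sum).
have := negA_dom_basis r n; move/(diag_domE b_sum) => h.
under eq_eseriesr do rewrite innerZr mulrCA exprMn EFinM.
rewrite nneseriesZl => [|j _]; last by rewrite lee_fin sqr_ge0.
by rewrite lte_mul_pinfty// ?lee_fin ?sqr_ge0.
Qed.

(** The normalized vector of [Hr r] along [b n], that is [mu^{-r} b_n]: found through [ires] inside
    [H] when [r >= 0], and as the image of a vector of [H] when [r < 0]. *)
Definition unit_coord r n : Hr r :=
  if 0 <= r then xget 0 [set u : Hr r | ires Hr r u = mu n `^ (- r) *: b n]
  else mu n `^ (- r) *: iemb Hr r (b n).

(** The coefficient along [b n] itself rather than along the normalized vector: in this scaling it
    is unchanged by the inclusions between the spaces ([coord_incl]), and the norm of [Hr r] is the
    l2-norm of [mu^r coord]. *)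
Definition coord r n (v : Hr r) : R := mu n `^ (- r) * inner (unit_coord r n) v.

Arguments coord : clear implicits.

Lemma ires_unit_coord r n : 0 <= r -> ires Hr r (unit_coord r n) = mu n `^ (- r) *: b n.
Proof.
move=> r0; rewrite /unit_coord r0; case: xgetP => [u _//|nu].
have : range (ires Hr r) (b n) by rewrite (ires_range Hr r0); exact: negA_dom_basis.
by move=> [u _ ub]; case: (nu (mu n `^ (- r) *: u)); rewrite /= linearZ/= ub.
Qed.

Lemma inner_unit_coord_res r n (v : Hr r) : 0 <= r ->
  inner (unit_coord r n) v = inner (b n) (negA_pow bas lam r (ires Hr r v)).
Proof.
move=> r0; by rewrite ires_inner// ires_unit_coord// negA_pow_unit.
Qed.

Lemma inner_unit_coord_emb r n (v : H) : r <= 0 ->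
  inner (unit_coord r n) (iemb Hr r v) = mu n `^ r * inner (b n) v.
Proof.
move=> r0; have [rn|rp] := ltP r 0.
  rewrite /unit_coord leNgt rn /= innerZl iemb_inner// negA_pow_basis innerZl mulrA.
  rewrite [X in X * _]mulrC powR_mulN ?mu_gt0// mul1r inner_negA_pow//.
  exact: negA_dom_neg.
have {rp r0} -> : r = 0 by apply/eqP; rewrite eq_le r0.
rewrite inner_unit_coord_res// iemb_res0 inner_negA_pow//.
exact: negA_dom_neg.
Qed.

Lemma onseq_unit_coord r : onseq (unit_coord r).
Proof.
have key n m : inner (unit_coord r n) (unit_coord r m) = inner (b n) (b m).
  have [rn|rp] := ltP r 0.
    rewrite {2}/unit_coord leNgt rn /= innerZr inner_unit_coord_emb ?ltW//.
    have [->|nm] := eqVneq n m; last by rewrite tb.1.1// !mulr0.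
    by rewrite mulrA [X in X * _]mulrC powR_mulN ?mu_gt0// mul1r.
  by rewrite inner_unit_coord_res// ires_unit_coord// negA_pow_unit.
split=> [i j ij|i]; first by rewrite key tb.1.1.
have [h|h] := tb.1.2 i.
  by left; apply/eqP; rewrite -normr_eq0 -sqrf_eq0 -inner_norm key h inner0l.
by right; apply/eqP; rewrite -(@eqrXn2 _ 2)// expr1n -inner_norm key inner_norm h expr1n.
Qed.

Lemma unit_coord0 r n : b n = 0 -> unit_coord r n = 0.
Proof.
move=> bn0; apply/eqP; rewrite -normr_eq0 -sqrf_eq0 -inner_norm.
have [rn|rp] := ltP r 0.
  by rewrite {2}/unit_coord leNgt rn /= bn0 linear0 scaler0 inner0r.
by rewrite inner_unit_coord_res// bn0 inner0l.
Qed.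

(** For [r < 0] Parseval's identity holds on the image of [H], where the norm is that of [(-A)^r v],
    and density does the rest; for [r >= 0] it is Parseval's identity in [H] for [(-A)^r v]. *)
Lemma unit_coord_total r : onseq_total (unit_coord r).
Proof.
have oc := onseq_unit_coord r.
have [rn|rp] := ltP r 0.
  apply: (@total_dense _ _ _ (range (iemb Hr r)) oc) => [|_ [v _ <-]].
    exact: iemb_dense (ltW rn).
  apply: proj_cvg => //; rewrite -inner_norm iemb_inner ?ltW//.
  have e i : inner (unit_coord r i) (iemb Hr r v) = inner (b i) (negA_pow bas lam r v).
    rewrite inner_unit_coord_emb ?ltW// inner_negA_pow//.
    exact: negA_dom_neg (ltW rn).
  under eq_fun do (under eq_bigr do rewrite e expr2).
  exact: parseval.
split=> // v; apply: proj_cvg => //; rewrite -inner_norm ires_inner//.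
under eq_fun => n do (under eq_bigr do rewrite inner_unit_coord_res// expr2).
exact: parseval.
Qed.

Lemma coordE r n v : mu n `^ r * coord r n v = inner (unit_coord r n) v.
Proof. by rewrite /coord mulrA powR_mulN ?mul1r// mu_gt0. Qed.

Lemma coordB r n u v : coord r n (u - v) = coord r n u - coord r n v.
Proof. by rewrite /coord innerBr mulrBr. Qed.

Lemma coord_basis0 r n v : b n = 0 -> coord r n v = 0.
Proof. by move=> bn0; rewrite /coord unit_coord0// inner0l mulr0. Qed.

Lemma continuous_coord r n : continuous (coord r n).
Proof.
move=> v; apply: cvgM; first exact: cvg_cst.
exact: continuous_inner.
Qed.

Lemma coord_parseval r v :
  (\sum_(n <oo) ((mu n `^ r * coord r n v) ^+ 2)%:E = (`|v| ^+ 2)%:E)%E.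
Proof.
under eq_eseriesr do rewrite coordE.
exact: parseval_series (unit_coord_total r).
Qed.

(** The bounds on the truncated semigroup all reduce to a comparison of multipliers through this
    lemma; [u] and [v] may lie in different spaces. *)
Lemma norm_le_coord r s C (u : Hr r) (v : Hr s) : 0 <= C ->
  (forall n, `|mu n `^ r * coord r n u| <= C * `|mu n `^ s * coord s n v|) ->
  `|u| <= C * `|v|.
Proof.
move=> C0 uv; rewrite -ler_sqr ?nnegrE ?mulr_ge0// exprMn -lee_fin [leRHS]EFinM.
rewrite -!coord_parseval -nneseriesZl; last by move=> n _; rewrite lee_fin sqr_ge0.
apply: lee_nneseries => n _; first by rewrite lee_fin sqr_ge0.
rewrite -EFinM lee_fin -(@real_normK _ (_ * coord r _ _)) ?num_real//.
rewrite -(@real_normK _ (_ * coord s _ _)) ?num_real// -exprMn.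
by rewrite ler_sqr ?nnegrE ?mulr_ge0.
Qed.

Lemma coord_inj r (u v : Hr r) : (forall n, coord r n u = coord r n v) -> u = v.
Proof.
move=> uv; apply/eqP; rewrite -subr_eq0 -normr_le0.
have := @norm_le_coord r r 0 (u - v) 0 (lexx _).
rewrite mul0r; apply => n.
by rewrite coordB uv subrr mulr0 normr0 mul0r.
Qed.

Lemma coord_exists r (a : nat -> R) : (forall n, b n = 0 -> a n = 0) ->
  (\sum_(n <oo) ((mu n `^ r * a n) ^+ 2)%:E < +oo)%E ->
  exists v : Hr r, forall n, coord r n v = a n.
Proof.
move=> a0 sa.
have [n|v vP] := riesz_fischer (onseq_unit_coord r) sa.
  move=> un; rewrite a0 ?mulr0//; apply/eqP.
  have [rn|rp] := ltP r 0.
    have := inner_unit_coord_emb n (b n) (ltW rn).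
    rewrite un inner0l => /esym/eqP; rewrite mulf_eq0 gt_eqF ?powR_gt0 ?mu_gt0//=.
    by rewrite inner_norm sqrf_eq0 normr_eq0.
  have := ires_unit_coord n rp; rewrite un linear0 => /esym/eqP.
  by rewrite scaler_eq0 gt_eqF ?powR_gt0 ?mu_gt0.
exists v => n; rewrite /coord vP mulrA [X in X * _]mulrC powR_mulN ?mul1r//.
exact: mu_gt0.
Qed.

Lemma coord_res r n (v : Hr r) : 0 <= r -> coord r n v = inner (b n) (ires Hr r v).
Proof.
move=> r0; rewrite /coord inner_unit_coord_res// inner_negA_pow.
  by rewrite mulrA [X in X * _]mulrC powR_mulN ?mul1r// mu_gt0.
by rewrite -(ires_range Hr r0); exists v.
Qed.

Lemma coord_emb r n (v : H) : r <= 0 -> coord r n (iemb Hr r v) = inner (b n) v.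
Proof.
move=> r0; rewrite /coord inner_unit_coord_emb// mulrA [X in X * _]mulrC.
by rewrite powR_mulN ?mul1r// mu_gt0.
Qed.

(** Three cases by the signs of [s] and [r], following the three axioms on inclusions; only for
    [s <= r < 0] does density come in. *)
Lemma coord_incl r s n (v : Hr r) : s <= r -> coord s n (iincl Hr r s v) = coord r n v.
Proof.
move=> sr; have [s0|s0] := leP 0 s.
  by rewrite !coord_res ?iincl_res// (le_trans s0).
have [r0|r0] := leP 0 r.
  by rewrite iincl_res_emb ?(ltW s0)// coord_emb ?(ltW s0)// coord_res.
suff : (fun v => coord s n (iincl Hr r s v)) = (coord r n)
  by move/(congr1 (fun f => f v)).
refine (@eq_on_dense _ (Hr r) _ _ _ (@iemb_dense _ _ _ _ Hr r (ltW r0)) _ _ _).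
- move=> w; apply: continuous_comp; first exact: iincl_cont.
  exact: continuous_coord.
- exact: continuous_coord.
- by move=> _ [w _ <-]; rewrite iincl_emb ?coord_emb// ltW.
Qed.

Lemma inner_expA t (v : H) n : 0 <= t ->
  inner (b n) (expA bas lam t v) = expR (- (t * mu n)) * inner (b n) v.
Proof.
move=> t0; rewrite /expA inner_diag_op//.
  by rewrite /mu; case: eqVneq => [->|_]; rewrite ?inner0l ?mulr0// mulrN opprK.
apply: (@diag_dom_bounded _ _ bas b tb b_bas b_sum _ 1) => h bh.
rewrite ger0_norm ?expR_ge0// expR_le1 mulr_ge0_le0// -oppr_ge0.
exact: le_trans (ltW c0_gt0) (lam_lt bh).
Qed.

Lemma coord_sg r t n (v : Hr r) : 0 <= t ->
  coord r n (S r t v) = expR (- (t * mu n)) * coord r n v.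
Proof.
move=> t0; have [r0|r0] := leP 0 r.
  by rewrite !coord_res// sg_res// inner_expA.
suff : (fun v => coord r n (S r t v)) = (fun v => expR (- (t * mu n)) * coord r n v)
  by move/(congr1 (fun f => f v)).
refine (@eq_on_dense _ (Hr r) _ _ _ (@iemb_dense _ _ _ _ Hr r (ltW r0)) _ _ _).
- move=> w; apply: continuous_comp; first exact: sg_cont.
  exact: continuous_coord.
- by move=> w; apply: cvgM; [exact: cvg_cst|exact: continuous_coord].
- by move=> _ [w _ <-]; rewrite sg_emb ?coord_emb ?inner_expA// ltW.
Qed.

Lemma coord_trunc m (Q : set H) (PQ : {linear Hr m -> Hr m}) n (v : Hr m) :
  m <= 0 -> Q `<=` bas -> continuous PQ ->
  (forall w : H, PQ (iemb Hr m w) = iemb Hr m (vsum Q (fun h => inner h w *: h))) ->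
  coord m n (PQ v) = \1_Q (b n) * coord m n v.
Proof.
move=> m0 Qb cP PQE.
suff : (fun v => coord m n (PQ v)) = (fun v => \1_Q (b n) * coord m n v)
  by move/(congr1 (fun f => f v)).
refine (@eq_on_dense _ (Hr m) _ _ _ (@iemb_dense _ _ _ _ Hr m m0) _ _ _).
- move=> w; apply: continuous_comp; first exact: cP.
  exact: continuous_coord.
- by move=> w; apply: cvgM; [exact: cvg_cst|exact: continuous_coord].
- move=> _ [w _ <-]; rewrite PQE !coord_emb// (inner_vsum onb)//.
Qed.

(** [ilift] returns 0 outside the range of the inclusion; the vector with the right coordinates in
    [Hr r] excludes this default. *)
Lemma coord_ilift r s n (v : Hr s) : s <= r ->
  (exists u : Hr r, forall k, coord r k u = coord s k v) ->
  coord r n (ilift r v) = coord s n v.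
Proof.
move=> sr [u uP]; rewrite /ilift; case: xgetP => [w _ /= <-|/(_ u) []].
  by rewrite coord_incl.
by apply: coord_inj => k; rewrite coord_incl.
Qed.

End coordinates.

(** * The truncated semigroup *)

Section propagator.
Context {R : realType} {H : hilbertType R} (bas : set H) (lam : H -> R).
Hypotheses (onb : orthonormal_basis bas).
Variables (c0 : R) (c0_gt0 : 0 < c0) (lam_lt : forall h, bas h -> c0 <= - lam h).
Variables (Hr : interpolation_family bas lam) (S : semigroup_action Hr).
Variables (m gam : R) (m0 : m <= 0) (mg : m <= gam).

(** The map [G] of [mild_eq]: the projection acts on the rough space [Hr m], and the smoothed value
    is read in [Hr gam]. *)
Definition propagator (PQ : Hr m -> Hr m) t (v : Hr m) : Hr gam :=
  ilift gam (S m t (PQ v)).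

(* Either t > 0 and y is at most one unit rougher than H_gam, or t = 0 is allowed
   and y is at least as smooth as H_gam. *)
Definition admissible (s t : R) := [/\ m <= s, 0 <= t, gam - s <= 1 & 0 < t \/ gam <= s].

Let mp b k : enumerates bas b -> 0 < mu lam b k.
Proof. by move=> [tb b1 b2 b3]; exact: (mu_gt0 b1 c0_gt0 lam_lt). Qed.

Lemma multiplier_bounded b s t : enumerates bas b -> admissible s t ->
  exists C, forall k, mu lam b k `^ (gam - s) * expR (- (t * mu lam b k)) <= C.
Proof.
move=> eb [ms t0 gs1 ts]; have [tb bb _ _] := eb.
have [gs|gs] := leP gam s; last first.
  have tp : 0 < t by case: ts => //; rewrite leNgt gs.
  exists (t `^ (- (gam - s))) => k; apply: smoothing_bound => //; first exact: mp.
  by rewrite subr_ge0 ltW.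
(* Now [gam - s <= 0], so the power decreases in [mu], which is at least [min c0 1]. *)
exists ((Num.min c0 1) `^ (gam - s)) => k.
rewrite (@le_trans _ _ (mu lam b k `^ (gam - s)))//.
  by rewrite ler_piMr ?powR_ge0// expR_le1 oppr_le0 mulr_ge0// ltW// mp.
rewrite -opprB -!(@powR_invr _ _ (s - gam)) ?mp ?lt_min ?c0_gt0 ?ltr01//.
rewrite lef_pV2 ?posrE ?powR_gt0 ?mp// ?lt_min ?c0_gt0 ?ltr01//.
apply: ler_powR_base; rewrite ?subr_ge0//.
  by rewrite le_min ler01 ltW.
exact: (mu_ge bb lam_lt).
Qed.

Section one_truncation.
Variables (Q : set H) (Qb : Q `<=` bas) (PQ : {linear Hr m -> Hr m}).
Hypotheses (cPQ : continuous PQ)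
  (PQE : forall w : H, PQ (iemb Hr m w) = iemb Hr m (vsum Q (fun h => inner h w *: h))).
Let G := propagator PQ.

Lemma coord_propagator b s t (y : Hr s) n : enumerates bas b -> admissible s t ->
  coord b n (G t (iincl Hr s m y)) =
  \1_Q (b n) * expR (- (t * mu lam b n)) * coord b n y.
Proof.
move=> eb ad; have [C tC] := multiplier_bounded eb ad.
have [ms t0 _ _] := ad; have [tb b1 b2 b3] := eb.
have cm k : coord b k (S m t (PQ (iincl Hr s m y))) =
    \1_Q (b k) * expR (- (t * mu lam b k)) * coord b k y.
  rewrite (coord_sg onb tb b1 b2 b3 c0_gt0 lam_lt)//.
  rewrite (coord_trunc onb tb b1 b2 b3 c0_gt0 lam_lt k _ m0 Qb cPQ PQE)//.
  by rewrite (coord_incl onb tb b1 b2 b3 c0_gt0 lam_lt)// mulrCA mulrA.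
rewrite /G /propagator (coord_ilift onb tb b1 b2 b3 c0_gt0 lam_lt)//.
pose a k := \1_Q (b k) * expR (- (t * mu lam b k)) * coord b k y.
have [k bk0||v vP] := @coord_exists _ _ _ _ _ onb tb b1 b2 b3 _ c0_gt0 lam_lt Hr gam a.
- by rewrite /a (coord_basis0 onb tb b1 b2 b3 c0_gt0 lam_lt)// mulr0.
(* The candidate coordinates are square summable in [Hr gam], so a vector there has them and [ilift]
   does not fall back to 0. *)
- apply: (@le_lt_trans _ _ (\sum_(k <oo) (C ^+ 2)%:E *
      ((mu lam b k `^ s * coord b k y) ^+ 2)%:E)%E).
    apply: lee_nneseries => k _; first by rewrite lee_fin sqr_ge0.
    rewrite -EFinM lee_fin /a.
    have -> : mu lam b k `^ gam = mu lam b k `^ (gam - s) * mu lam b k `^ s.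
      by rewrite -powR_add ?mp// subrK.
    rewrite (_ : _ * (_ * _ * _) = \1_Q (b k) * (mu lam b k `^ (gam - s) *
      expR (- (t * mu lam b k))) * (mu lam b k `^ s * coord b k y)); last by ring.
    rewrite exprMn ler_wpM2r ?sqr_ge0// exprMn.
    have e0 : 0 <= mu lam b k `^ (gam - s) * expR (- (t * mu lam b k)).
      by rewrite mulr_ge0 ?powR_ge0 ?expR_ge0.
    rewrite (@le_trans _ _ (1 * C ^+ 2))// ?mul1r//.
    have i1 : \1_Q (b k) ^+ 2 <= 1 :> R.
      by rewrite indicE; case: (_ \in _); rewrite ?expr1n ?expr0n.
    have C1 : (mu lam b k `^ (gam - s) * expR (- (t * mu lam b k))) ^+ 2 <= C ^+ 2.
      by rewrite ler_sqr ?nnegrE// (le_trans e0).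
    by rewrite -[leRHS]mul1r ler_pM// sqr_ge0.
  rewrite nneseriesZl => [|k _]; last by rewrite lee_fin sqr_ge0.
  by rewrite (coord_parseval onb tb b1 b2 b3 c0_gt0 lam_lt) -EFinM ltry.
- by exists v => k; rewrite vP cm.

Qed.

End one_truncation.

Hypothesis sepH : separable H.
Variables (Q Q' : set H) (Qb : Q `<=` bas) (Q'b : Q' `<=` bas).
Variables (PQ PQ' : {linear Hr m -> Hr m}).
Hypotheses (cPQ : continuous PQ) (cPQ' : continuous PQ').
Hypothesis PQE :
  forall w : H, PQ (iemb Hr m w) = iemb Hr m (vsum Q (fun h => inner h w *: h)).
Hypothesis PQE' :
  forall w : H, PQ' (iemb Hr m w) = iemb Hr m (vsum Q' (fun h => inner h w *: h)).
Let G := propagator PQ.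
Let G' := propagator PQ'.

Lemma propagatorB s t (x y : Hr s) : admissible s t ->
  G t (iincl Hr s m (x - y)) = G t (iincl Hr s m x) - G t (iincl Hr s m y).
Proof.
move=> ad; have [b eb] := basis_enum sepH onb; have [tb b1 b2 b3] := eb.
apply: (coord_inj onb tb b1 b2 b3 c0_gt0 lam_lt) => n.
by rewrite coordB !(coord_propagator Qb cPQ PQE)// coordB mulrBr.
Qed.

Lemma propagator0 s t : admissible s t -> G t (iincl Hr s m 0) = 0.
Proof. by move=> ad; rewrite -{1}(subrr (0 : Hr s)) propagatorB// subrr. Qed.

Let norm_le s C (u : Hr gam) (v : Hr s) b (k : nat -> R) : enumerates bas b -> 0 <= C ->
  (forall n, coord b n u = k n * coord b n v) ->
  (forall n, `|k n| * mu lam b n `^ (gam - s) <= C) ->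
  `|u| <= C * `|v|.
Proof.
move=> eb C0 uv kC; have [tb b1 b2 b3] := eb.
apply: (norm_le_coord onb tb b1 b2 b3 c0_gt0 lam_lt) => // n.
rewrite uv; move: (coord b n v) => c.
rewrite !normrM !(ger0_norm (powR_ge0 _ _)) mulrA [leRHS]mulrA.
rewrite ler_wpM2r// mulrC.
have -> : mu lam b n `^ gam = mu lam b n `^ (gam - s) * mu lam b n `^ s.
  by rewrite -powR_add ?mp// subrK.
by rewrite mulrA ler_wpM2r ?powR_ge0.
Qed.

Let ind_norm (A : set H) x (y : R) : 0 <= y -> `|\1_A x * y| <= y.
Proof.
move=> y0; rewrite indicE; case: (_ \in _); rewrite ?mul1r ?mul0r ?normr0//.
by rewrite ger0_norm.
Qed.

Lemma propagator_smoothing s t (y : Hr s) : m <= s -> 0 < t -> 0 <= gam - s <= 1 ->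
  `|G t (iincl Hr s m y)| <= t `^ (- (gam - s)) * `|y|.
Proof.
move=> ms t0 /andP[gs0 gs1]; have ad : admissible s t by split=> //; [exact: ltW|left].
have [b eb] := basis_enum sepH onb.
apply: (norm_le eb (powR_ge0 _ _) (fun n => coord_propagator Qb cPQ PQE y n eb ad)) => n.
rewrite (le_trans (ler_wpM2r (powR_ge0 _ _) (ind_norm _ _ (expR_ge0 _))))//.
by rewrite mulrC smoothing_bound ?mp// gs0.
Qed.

(** Serves the noise error, whose size is only controlled in [Hr (gam - chi)], at least as rough as
    the space where [B] takes its values. *)
Lemma propagator_smoothing_incl s s' t (y : Hr s) : m <= s' -> s' <= s -> 0 < t ->
  0 <= gam - s' <= 1 ->
  `|G t (iincl Hr s m y)| <= t `^ (- (gam - s')) * `|iincl Hr s s' y|.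
Proof.
move=> ms ss t0 /andP[gs0 gs1].
have ad : admissible s t.
  split; [exact: le_trans ss|exact: ltW| |by left].
  by apply: le_trans gs1; rewrite lerB.
have [b eb] := basis_enum sepH onb; have [tb b1 b2 b3] := eb.
apply: (norm_le (k := fun n => \1_Q (b n) * expR (- (t * mu lam b n))) eb (powR_ge0 _ _)) => n.
  by rewrite (coord_propagator Qb cPQ PQE)// (coord_incl onb tb b1 b2 b3 c0_gt0 lam_lt).
rewrite (le_trans (ler_wpM2r (powR_ge0 _ _) (ind_norm _ _ (expR_ge0 _))))//.
by rewrite mulrC smoothing_bound ?mp// gs0.
Qed.

Lemma propagator_contraction t (x : Hr gam) : 0 <= t -> `|G t (iincl Hr gam m x)| <= `|x|.
Proof.
move=> t0; have ad : admissible gam t by split => //; [rewrite subrr ler01|right].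
have [b eb] := basis_enum sepH onb.
rewrite -[leRHS]mul1r.
apply: (norm_le eb ler01 (fun n => coord_propagator Qb cPQ PQE x n eb ad)) => n.
rewrite subrr powRr0 mulr1 (le_trans (ind_norm _ _ (expR_ge0 _)))//.
by rewrite expR_le1 oppr_le0 mulr_ge0// ltW// mp.
Qed.

Let time_factor b k t t' th : enumerates bas b -> 0 <= t -> t <= t' -> 0 <= th <= 1 ->
  `|expR (- (t' * mu lam b k)) - expR (- (t * mu lam b k))| <=
  expR (- (t * mu lam b k)) * ((t' - t) `^ th * mu lam b k `^ th).
Proof.
move=> eb t0 tt' th1.
have -> : - (t' * mu lam b k) = - (t * mu lam b k) + - ((t' - t) * mu lam b k) by ring.
rewrite expRD -[X in _ - X]mulr1 -mulrBr normrM ger0_norm ?expR_ge0// ler_wpM2l ?expR_ge0//.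
rewrite -normrN opprB ger0_norm.
  rewrite -powRM ?subr_ge0// ?(ltW (mp _ eb))//; apply: one_sub_expN_le => //.
  by rewrite mulr_ge0 ?subr_ge0 ?(ltW (mp _ eb)).
by rewrite subr_ge0 expR_le1 oppr_le0 mulr_ge0 ?subr_ge0 ?(ltW (mp _ eb)).
Qed.

(** A time increment costs [(t' - t)^th mu^th]. The factor [mu^th] is absorbed by smoothing at time
    [t], which raises the singularity from [gam - s] to [gam - s + th]. *)
Lemma propagator_time s t t' th (y : Hr s) : m <= s -> 0 < t -> t <= t' -> 0 <= th ->
  0 <= gam - s -> gam - s + th <= 1 ->
  `|G t' (iincl Hr s m y) - G t (iincl Hr s m y)| <=
  (t' - t) `^ th * t `^ (- (gam - s + th)) * `|y|.
Proof.
move=> ms t0 tt th0 gs0 gs1.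
have gs1' : gam - s <= 1 by apply: le_trans gs1; rewrite lerDl.
have th1 : th <= 1 by apply: le_trans gs1; rewrite lerDr.
have ad : admissible s t by split=> //; [exact: ltW|left].
have ad' : admissible s t'.
  by split=> //; [exact: le_trans (ltW t0) tt|left; exact: lt_le_trans tt].
have [b eb] := basis_enum sepH onb.
apply: (norm_le (k := fun n => \1_Q (b n) *
   (expR (- (t' * mu lam b n)) - expR (- (t * mu lam b n)))) eb) => [|n|n].
- by rewrite mulr_ge0 ?powR_ge0.
- by rewrite coordB !(coord_propagator Qb cPQ PQE)//; ring.
rewrite normrM (@le_trans _ _ (1 * (expR (- (t * mu lam b n)) * ((t' - t) `^ th * mu lam b n `^ th)) * mu lam b n `^ (gam - s)))//.
  rewrite ler_wpM2r ?powR_ge0// ler_pM//.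
    by rewrite indicE; case: (_ \in _); rewrite ?normr1 ?normr0.
  by apply: time_factor => //; [exact: ltW|rewrite th0].
have := @smoothing_bound R (mu lam b n) t (gam - s + th) (mp n eb) t0.
rewrite addr_ge0// gs1 powR_add ?mp// => /(_ isT) h.
rewrite mul1r (_ : _ * _ * _ = (t' - t) `^ th * (mu lam b n `^ (gam - s) * mu lam b n `^ th *
  expR (- (t * mu lam b n)))); last by ring.
by rewrite ler_wpM2l ?powR_ge0.
Qed.

(** Here [mu^th] is absorbed by the additional smoothness of the argument, so there is no
    singularity at [t = 0]. *)
Lemma propagator_time_smooth t t' th (x : Hr gam) (y : Hr (gam + th)) : 0 <= t -> t <= t' ->
  0 <= th <= 1 -> iincl Hr (gam + th) gam y = x ->
  `|G t' (iincl Hr gam m x) - G t (iincl Hr gam m x)| <= (t' - t) `^ th * `|y|.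
Proof.
move=> t0 tt /andP[th0 th1] yx.
have ad : admissible gam t by split => //; [rewrite subrr ler01|right].
have ad' : admissible gam t'.
  by split => //; [exact: le_trans tt|rewrite subrr ler01|right].
have [b eb] := basis_enum sepH onb; have [tb b1 b2 b3] := eb.
apply: (norm_le (k := fun n => \1_Q (b n) *
   (expR (- (t' * mu lam b n)) - expR (- (t * mu lam b n)))) eb) => [|n|n].
- by rewrite powR_ge0.
- rewrite coordB !(coord_propagator Qb cPQ PQE)// -yx.
  by rewrite (coord_incl onb tb b1 b2 b3 c0_gt0 lam_lt) ?lerDl//; ring.
rewrite normrM (@le_trans _ _ (1 * (1 * ((t' - t) `^ th * mu lam b n `^ th)) * mu lam b n `^ (gam - (gam + th))))//.
  rewrite ler_wpM2r ?powR_ge0// ler_pM//.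
    by rewrite indicE; case: (_ \in _); rewrite ?normr1 ?normr0.
  have th01 : 0 <= th <= 1 by rewrite th0.
  apply: le_trans (time_factor _ eb t0 tt th01) _.
  rewrite ler_wpM2r ?mulr_ge0 ?powR_ge0// expR_le1 oppr_le0 mulr_ge0//.
  by rewrite ltW// mp.
rewrite !mul1r -mulrA -powR_add ?mp// (_ : th + _ = 0) ?powRr0 ?mulr1//; ring.
Qed.

Section truncation_error.
Variables (rho : R).
Hypotheses (rho0 : 0 <= rho)
  (QQ' : forall h, bas h -> Q h -> ~ Q' h -> `|lam h|^-1 <= rho) (Q'Q : Q' `<=` Q).

(** The indicators differ only at vectors of [Q] outside [Q'], where [mu^-1 <= rho] and hence
    [1 <= (rho mu)^th]. *)
Let trunc_factor b k th : enumerates bas b -> 0 <= th ->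
  `|\1_Q (b k) - \1_Q' (b k)| <= rho `^ th * mu lam b k `^ th.
Proof.
move=> eb th0; have [tb b1 b2 b3] := eb; rewrite !indicE.
have r0 : 0 <= rho `^ th * mu lam b k `^ th by rewrite mulr_ge0 ?powR_ge0.
have [/set_mem q'|q'] := boolP (b k \in Q').
  by rewrite mem_set ?subrr ?normr0//; exact: Q'Q.
have [/set_mem q|q] := boolP (b k \in Q); last by rewrite subrr normr0.
rewrite subr0 normr1.
have bk : bas (b k) by exact: Qb.
have bk0 : b k != 0.
  apply/eqP => b0; have [+ _] := onb; move=> /(_ _ _ bk bk).
  by rewrite b0 inner0l eqxx => /esym/eqP; rewrite oner_eq0.
have lr : (mu lam b k)^-1 <= rho.
  have := QQ' bk q (fun q'' => negP q' (mem_set q'')).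
  rewrite /mu (negbTE bk0) -normrN ger0_norm// (le_trans _ (lam_lt bk))//.
  exact: ltW.
rewrite -powRM ?(ltW (mp _ eb))//; apply: (@le_trans _ _ (1 `^ th)); first by rewrite powR1.
apply: ler_powR_base => //.
by rewrite -ler_pdivrMr ?mp// div1r.
Qed.

Lemma propagator_trunc s t th (y : Hr s) : m <= s -> 0 < t -> 0 <= th ->
  0 <= gam - s -> gam - s + th <= 1 ->
  `|G t (iincl Hr s m y) - G' t (iincl Hr s m y)| <=
  rho `^ th * t `^ (- (gam - s + th)) * `|y|.
Proof.
move=> ms t0 th0 gs0 gs1.
have gs1' : gam - s <= 1 by apply: le_trans gs1; rewrite lerDl.
have th1 : th <= 1 by apply: le_trans gs1; rewrite lerDr.
have ad : admissible s t by split=> //; [exact: ltW|left].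
have [b eb] := basis_enum sepH onb.
apply: (norm_le (k := fun n => (\1_Q (b n) - \1_Q' (b n)) *
   expR (- (t * mu lam b n))) eb) => [|n|n].
- by rewrite mulr_ge0 ?powR_ge0.
- by rewrite coordB (coord_propagator Qb cPQ PQE)// (coord_propagator Q'b cPQ' PQE')//; ring.
rewrite normrM (ger0_norm (expR_ge0 _)).
rewrite (@le_trans _ _ (rho `^ th * mu lam b n `^ th * expR (- (t * mu lam b n)) * mu lam b n `^ (gam - s)))//.
  rewrite ler_wpM2r ?powR_ge0// ler_wpM2r ?expR_ge0//.
  exact: trunc_factor.
have := @smoothing_bound R (mu lam b n) t (gam - s + th) (mp n eb) t0.
rewrite addr_ge0// gs1 powR_add ?mp// => /(_ isT) h.
rewrite (_ : _ * _ * _ * _ = rho `^ th * (mu lam b n `^ (gam - s) * mu lam b n `^ th *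
  expR (- (t * mu lam b n)))); last by ring.
by rewrite ler_wpM2l ?powR_ge0.
Qed.

Lemma propagator_trunc_smooth t th (x : Hr gam) (y : Hr (gam + th)) : 0 <= t -> 0 <= th ->
  iincl Hr (gam + th) gam y = x ->
  `|G t (iincl Hr gam m x) - G' t (iincl Hr gam m x)| <= rho `^ th * `|y|.
Proof.
move=> t0 th0 yx.
have ad : admissible gam t by split => //; [rewrite subrr ler01|right].
have [b eb] := basis_enum sepH onb; have [tb b1 b2 b3] := eb.
apply: (norm_le (k := fun n => (\1_Q (b n) - \1_Q' (b n)) *
   expR (- (t * mu lam b n))) eb) => [|n|n].
- by rewrite powR_ge0.
- rewrite coordB (coord_propagator Qb cPQ PQE)// (coord_propagator Q'b cPQ' PQE')// -yx.
  by rewrite (coord_incl onb tb b1 b2 b3 c0_gt0 lam_lt) ?lerDl//; ring.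
rewrite normrM (ger0_norm (expR_ge0 _)).
rewrite (@le_trans _ _ (rho `^ th * mu lam b n `^ th * 1 * mu lam b n `^ (gam - (gam + th))))//.
  rewrite ler_wpM2r ?powR_ge0// ler_pM ?expR_ge0//; first exact: trunc_factor.
  by rewrite expR_le1 oppr_le0 mulr_ge0// ltW// mp.
rewrite mulr1 -mulrA -powR_add ?mp// (_ : th + _ = 0) ?powRr0 ?mulr1//; ring.
Qed.

End truncation_error.

End propagator.

(** * Singular kernels and the Gronwall lemma *)

Section integral_facts.
Context {d : measure_display} {T : measurableType d} {R : realType}.
Variable mu : {measure set T -> \bar R}.
Implicit Types (D : set T).

(* No measurability is needed: the integral of a nonnegative function is the
   supremum of the integrals of the simple functions below it. *)
Lemma ge0_le_integral_nomeas D (f g : T -> \bar R) :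
  (forall x, D x -> 0 <= f x)%E -> (forall x, D x -> f x <= g x)%E ->
  (\int[mu]_(x in D) f x <= \int[mu]_(x in D) g x)%E.
Proof.
move=> f0 fg; rewrite !ge0_integralE//; last first.
  by move=> x Dx; exact: le_trans (f0 _ Dx) (fg _ Dx).
apply: ge_ereal_sup => _ [h hf <-]; apply: ereal_sup_ubound; exists h => // x.
apply: le_trans (hf x) _; rewrite /patch; case: ifPn => // /set_mem; exact: fg.
Qed.

(** The graph of [x^q] lies above its tangent at 1; for [q > 1] this is Young's inequality with
    second factor 1. *)
Lemma young_tangent (x q : R) : 0 <= x -> 1 <= q -> q * x <= x `^ q + (q - 1).
Proof.
move=> x0; rewrite le_eqVlt => /predU1P[<-|q1].
  by rewrite powRr1// subrr addr0 mul1r.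
have q0 : 0 < q by exact: lt_trans q1.
have c0 : 0 < (1 - q^-1)^-1 by rewrite invr_gt0 subr_gt0 invf_lt1.
have := @conjugate_powR _ x 1 q (1 - q^-1)^-1 x0 ler01 q0 c0.
rewrite invrK subrKC => /(_ erefl); rewrite mulr1 powR1 mul1r.
rewrite -(ler_pM2l q0) mulrDr mulrCA mulfV ?gt_eqF// mulr1.
by rewrite mulrBr mulr1 mulfV ?gt_eqF.
Qed.

(** Jensen's inequality for the measure with density [k], whose mass is bounded by [K]: integrate
    the tangent line of [x^q] at [m = M / K], where [M] is the integral of [k g]. *)
Lemma jensen_kernel D (k g : T -> R) (q K : R) : measurable D -> 1 <= q -> 0 < K ->
  (forall x, D x -> 0 <= k x) -> (forall x, D x -> 0 <= g x) ->
  measurable_fun D k -> measurable_fun D g ->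
  (\int[mu]_(x in D) (k x)%:E <= K%:E)%E ->
  ((\int[mu]_(x in D) (k x * g x)%:E) `^ q <=
   (K `^ (q - 1))%:E * \int[mu]_(x in D) (k x * g x `^ q)%:E)%E.
Proof.
move=> mD q1 K0 k0 g0 mk mg kK; have q0 : 0 < q by exact: lt_le_trans q1.
have mgq : measurable_fun D (fun x => g x `^ q).
  exact: (measurableT_comp (measurable_powR q)).
set N := (\int[mu]_(x in D) (k x * g x `^ q)%:E)%E.
have N0 : (0 <= N)%E.
  by apply: integral_ge0 => x Dx; rewrite lee_fin mulr_ge0 ?k0 ?powR_ge0.
have [Noo|] := eqVneq N +oo%E.
  by rewrite Noo gt0_muley ?leey// lte_fin powR_gt0.
rewrite -ltey => Nfin.
set M := (\int[mu]_(x in D) (k x * g x)%:E)%E.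
have M0 : (0 <= M)%E.
  by apply: integral_ge0 => x Dx; rewrite lee_fin mulr_ge0 ?k0 ?g0.
have bound (c c' : R) : 0 <= c -> 0 <= c' ->
    (forall x, D x -> c * g x <= g x `^ q + c') -> (c%:E * M <= N + (c' * K)%:E)%E.
  move=> c0 c'0 cg; rewrite /M -ge0_integralZl_EFin//; last 2 first.
  - by move=> x Dx; rewrite lee_fin mulr_ge0 ?k0 ?g0.
  - by apply/measurable_EFinP; exact: measurable_funM.
  apply: (@le_trans _ _ (\int[mu]_(x in D) ((k x * g x `^ q)%:E + c'%:E * (k x)%:E)%E)%E).
    apply: ge0_le_integral_nomeas => x Dx.
      by rewrite -EFinM lee_fin !mulr_ge0 ?k0 ?g0.
    rewrite -!EFinM -EFinD lee_fin mulrCA [leRHS](_ : _ = k x * (g x `^ q + c')); last by ring.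
    by rewrite ler_wpM2l ?k0// cg.
  rewrite ge0_integralD//; last 4 first.
  - by move=> x Dx; rewrite lee_fin mulr_ge0 ?k0 ?powR_ge0.
  - by apply/measurable_EFinP; exact: measurable_funM.
  - by move=> x Dx; rewrite -EFinM lee_fin mulr_ge0 ?k0.
  - by apply/measurable_EFinP; apply: measurable_funM.
  rewrite leeD2l// ge0_integralZl_EFin//; [|exact/measurable_EFinP].
  by rewrite EFinM lee_wpmul2l.
(* [g <= g^q + 1] shows that [M] is finite once the right side is, so that the rest takes place in
   the reals. *)
have Mfin : (M < +oo)%E.
  rewrite -[M]mul1e; apply: le_lt_trans (bound 1 1 ler01 ler01 _) _ => [x Dx|].
    rewrite mul1r; have [g1|g1] := leP 1 (g x).
      by rewrite (le_trans (le1r_powR g1 q1))// lerDl.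
    by rewrite (le_trans (ltW g1))// lerDr powR_ge0.
  by rewrite lte_add_pinfty// ltry.
have Mf : M \is a fin_num by rewrite ge0_fin_numE.
have Nf : N \is a fin_num by rewrite ge0_fin_numE.
move: bound; rewrite -(fineK Mf) -(fineK Nf) poweR_EFin -EFinM lee_fin.
have : 0 <= fine N by rewrite fine_ge0.
have : 0 <= fine M by rewrite fine_ge0.
move: (fine M) (fine N) => x y x0 y0 bound'.
have [->|xn0] := eqVneq x 0.
  by rewrite powR0 ?gt_eqF// mulr_ge0 ?powR_ge0.
have xp : 0 < x by rewrite lt_def xn0.
pose m := x / K; have mp : 0 < m by rewrite divr_gt0.
have m1 := mulr_ge0 (ltW q0) (powR_ge0 m (q - 1)).
have m2 : 0 <= (q - 1) * m `^ q by rewrite mulr_ge0 ?subr_ge0 ?powR_ge0.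
have mq : m `^ q = m * m `^ (q - 1) by rewrite mulr_powRB1 ?ltW.
(* The tangent at [m] reads [q m^{q-1} g <= g^q + (q - 1) m^q]; after integration the multiples [q]
   and [q - 1] of [m^q K] leave exactly one. *)
have h : m `^ q * K <= y.
  have := bound' _ _ m1 m2 _; rewrite (_ : x = m * K); last by rewrite /m divfK ?gt_eqF.
  rewrite -EFinM -EFinD lee_fin mq => {}h; rewrite -(lerD2r ((q - 1) * (m * m `^ (q - 1)) * K)).
  apply: le_trans (h _) => [|z Dz].
    by rewrite le_eqVlt; apply/orP; left; apply/eqP; ring.
  have := @young_tangent (g z / m) q (divr_ge0 (g0 z Dz) (ltW mp)) q1.
  rewrite powRM ?g0// ?invr_ge0 ?(ltW mp)// powR_invl// -(powR_invr _ mp).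
  rewrite -(ler_pM2r (powR_gt0 q mp)) mulrDl mulfVK ?gt_eqF ?powR_gt0// mq.
  apply: le_trans; rewrite le_eqVlt; apply/orP; left; apply/eqP; field.
  by rewrite gt_eqF.
have -> : x `^ q = m `^ q * K `^ q.
  by rewrite -powRM ?ltW// /m divfK ?gt_eqF.
have -> : K `^ q = K * K `^ (q - 1) by rewrite mulr_powRB1 ?ltW.
by rewrite mulrA mulrC ler_wpM2l ?powR_ge0.
Qed.

End integral_facts.

Section singular_kernel.
Context {R : realType}.
Implicit Types (a t kap : R).

Lemma derivable_kernel t r s : s < t ->
  is_derive s 1 (fun x => (t - x) `^ r) (- (r * (t - s) `^ (r - 1))).
Proof.
move=> st.
have h : is_derive s 1 (fun x : R => t - x) (-1).
  have := is_deriveB (is_derive_cst t s 1) (is_derive_id s 1).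
  by rewrite sub0r.
have := @is_derive1_comp _ (fun y => y `^ r) _ s _ _ (is_derive1_powR r _) h.
by rewrite subr_gt0 => /(_ st); rewrite mulrN1.
Qed.

Lemma measurable_kernel t kap (D : set (measurableTypeR R)) : measurable D ->
  measurable_fun D (fun s : measurableTypeR R => (t - s) `^ (- kap)).
Proof.
move=> mD; suff h : measurable_fun (D : set R) (fun s : R => (t - s) `^ (- kap)) by exact h.
apply: (measurableT_comp (measurable_powR (- kap))).
exact: measurable_funB.
Qed.

(** The kernel is continuous on [[a, e i]] for points [e i] increasing to [t]; the fundamental
    theorem of calculus is applied there, and the singular endpoint is reached by monotone
    convergence. *)
Lemma kernel_integral a t kap : kap < 1 -> a <= t ->
  (\int[lebesgue_measure]_(s in `[a, t[) ((t - s) `^ (- kap))%:E <=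
   ((t - a) `^ (1 - kap) / (1 - kap))%:E)%E.
Proof.
move=> k1; have kp : 0 < 1 - kap by rewrite subr_gt0.
rewrite le_eqVlt => /predU1P[->|at_].
  by rewrite set_itvco0// integral_set0 lee_fin divr_ge0 ?powR_ge0// ltW.
have tap : 0 < t - a by rewrite subr_gt0.
pose e i : R := t - (t - a) / i.+2%:R.
have et i : e i < t by rewrite /e ltrBlDr ltrDl divr_gt0.
have ae i : a < e i.
  by rewrite /e ltrBrDr -ltrBrDl ltr_pdivrMr// ltr_pMr// ltr1n.
pose F (i : nat) : set (measurableTypeR R) := `[a, e i]%classic.
have bF : \bigcup_i F i = `[a, t[%classic.
  rewrite eqEsubset; split=> [x [i _]|x]; rewrite /F /= !in_itv /=.
    by move=> /andP[-> xe]; exact: le_lt_trans (et i).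
  move=> /andP[ax xt]; have txp : 0 < t - x by rewrite subr_gt0.
  exists (Num.truncn ((t - a) / (t - x))) => //; rewrite /F /= in_itv /= ax /= /e.
  rewrite lerBrDr -lerBrDl ler_pdivrMr// mulrC -ler_pdivrMr//.
  apply: (@le_trans _ _ (Num.truncn ((t - a) / (t - x))).+1%:R).
    by rewrite ltW// truncnS_gt.
  by rewrite ler_nat.
have mF i : measurable (F i) by exact: measurable_itv.
have ndF : {homo F : n m / (n <= m)%N >-> (n <= m)%O}.
  move=> n m nm; apply/subsetPset => x; rewrite /F /= !in_itv /= => /andP[-> /le_trans].
  apply; rewrite /e lerD2l lerN2 ler_pM2l// lef_pV2 ?posrE//.
  by rewrite ler_nat.
have mk i : measurable_fun (F i) (fun s : measurableTypeR R => ((t - s) `^ (- kap))%:E).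
  by apply/measurable_EFinP; exact: measurable_kernel.
have k0 i x : F i x -> (0 <= ((t - x) `^ (- kap))%:E)%E.
  by move=> _; rewrite lee_fin powR_ge0.
have cF : (\int[lebesgue_measure]_(s in F i) ((t - s) `^ (- kap))%:E)%E @[i --> \oo] -->
    (\int[lebesgue_measure]_(s in \bigcup_i F i) ((t - s) `^ (- kap))%:E)%E.
  exact: ge0_nondecreasing_set_cvg_integral ndF mF mk k0.
rewrite bF in cF; rewrite -(cvg_lim _ cF)//; apply: lime_le; first exact: cvgP cF.
apply: nearW => i.
pose G : R -> R := (- (1 - kap)^-1) \*: (fun s => (t - s) `^ (1 - kap)).
have dG s : s < t -> is_derive s 1 G ((t - s) `^ (- kap)).
  move=> st; apply: is_derive_eq (is_deriveZ _ (derivable_kernel (1 - kap) st)) _.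
  rewrite /GRing.scale /= mulrNN mulrA mulVf ?mul1r ?gt_eqF//.
  by congr (_ `^ _); ring.
rewrite (@continuous_FTC2 _ _ G a (e i))//.
- have GE s : G s = - ((t - s) `^ (1 - kap) / (1 - kap)).
    by rewrite -[LHS]/(- (1 - kap)^-1 * _) mulNr mulrC.
  by rewrite -EFinB lee_fin !GE opprK addrC gerBl divr_ge0 ?powR_ge0// ltW.
- apply: derivable_within_continuous => x; rewrite in_itv /= => /andP[_ xe].
  by have /@ex_derive := derivable_kernel (- kap) (le_lt_trans xe (et i)).
- split.
  + move=> x; rewrite in_itv /= => /andP[_ xe].
    by have /@ex_derive := dG _ (lt_trans xe (et i)).
  + apply: cvg_at_right_filter; apply: differentiable_continuous.
    by apply/derivable1_diffP; have /@ex_derive := dG _ at_.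
  + apply: cvg_at_left_filter; apply: differentiable_continuous.
    by apply/derivable1_diffP; have /@ex_derive := dG _ (et i).
- move=> x; rewrite in_itv /= => /andP[_ xe].
  by rewrite derive1E; have /@derive_val := dG _ (lt_trans xe (et i)).
Qed.

End singular_kernel.

Section gronwall.
Context {R : realType}.

(** The supremum is taken of [exp(-rho t) f t]: as [exp(-rho (t - s)) <= rho^{-th} (t - s)^{-th}], a
    large [rho] gives the integral operator the factor 1/2. The bound [M] makes the supremum finite
    and does not enter [C], which is what allows the use after localization. *)
Lemma singular_gronwall (T kap c : R) : kap < 1 -> 0 <= kap -> 0 <= c -> 0 < T ->
  exists2 C : R, 0 <= C & forall (f : R -> R) (a M : R), 0 <= a ->
    (forall t, 0 <= t <= T -> 0 <= f t <= M) ->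
    (forall t, 0 <= t <= T -> ((f t)%:E <= a%:E +
       c%:E * \int[lebesgue_measure]_(s in `[0%R, t[) ((t - s) `^ (- kap) * f s)%:E)%E) ->
    forall t, 0 <= t <= T -> f t <= C * a.
Proof.
move=> k1 k0 c0 T0.
(* Half of the room below 1: [th] is spent on the decay in [rho], and the kernel with exponent
   [kap + th] is still integrable. *)
pose th := (1 - kap) / 2; have th0 : 0 < th by rewrite divr_gt0// subr_gt0.
have th1 : th <= 1 by rewrite /th ler_pdivrMr//; lra.
have kth : kap + th < 1 by rewrite /th; lra.
pose B := T `^ (1 - (kap + th)) / (1 - (kap + th)).
have B0 : 0 < B by rewrite divr_gt0 ?powR_gt0// subr_gt0.
(* Chosen so that [c B rho^{-th} <= 1/2]. *)
pose rho := (2 * c * B + 1) `^ (th^-1).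
have cB : 0 <= 2 * c * B := mulr_ge0 (mulr_ge0 (ler0n _ 2) c0) (ltW B0).
have rho0 : 0 < rho by rewrite powR_gt0// ltr_wpDl.
have rhoth : c * B * rho `^ (- th) <= 2^-1.
  rewrite -powR_invr// /rho -powRrM mulVf ?gt_eqF// powRr1; last by rewrite addr_ge0.
  by rewrite ler_pdivrMr ?ltr_wpDl//; lra.
clearbody rho.
exists (2 * expR (rho * T)) => [|f a M a0 fM ft]; first by rewrite mulr_ge0 ?expR_ge0.
pose E := [set expR (- (rho * t)) * f t | t in `[0, T]%classic].
have M0 : 0 <= M.
  by have := fM 0; rewrite lexx ltW// => /(_ isT)/andP[]; exact: le_trans.
have ubE : ubound E M.
  move=> y [t /=]; rewrite in_itv /= => tT <-{y}; have /andP[f0 fm] := fM _ tT.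
  have /andP[t0 _] := tT.
  apply: le_trans fm; rewrite ler_piMl// expR_le1 oppr_le0 mulr_ge0// ltW//.
have supE : has_sup E.
  split; last by exists M.
  by exists (expR (- (rho * 0)) * f 0); exists 0 => //; rewrite /= in_itv /= lexx ltW.
pose m := sup E.
have mP t : 0 <= t <= T -> f t <= expR (rho * t) * m.
  move=> tT; rewrite -ler_pdivrMl ?expR_gt0// -expRN.
  by apply: sup_ubound => //; [exact: supE.2|exists t => //=; rewrite in_itv].
have m0 : 0 <= m.
  have := mP 0; rewrite lexx (ltW T0) mulr0 expR0 mul1r => /(_ isT).
  by apply: le_trans; have := fM 0; rewrite lexx ltW// => /(_ isT)/andP[].
have step t : 0 <= t <= T -> f t <= a + expR (rho * t) * m / 2.
  move=> tT; have /andP[t0 tT'] := tT; rewrite -lee_fin; apply: le_trans (ft t tT) _.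
  rewrite EFinD leeD2l//.
  apply: (@le_trans _ _ (c%:E * \int[lebesgue_measure]_(s in `[0%R, t[)
      ((rho `^ (- th) * expR (rho * t) * m)%:E * ((t - s) `^ (- (kap + th)))%:E))%E).
    rewrite lee_wpmul2l ?lee_fin//; apply: ge0_le_integral_nomeas => s /=; rewrite in_itv /= => /andP[s0 st].
      rewrite lee_fin mulr_ge0 ?powR_ge0//.
      by have := fM s; rewrite s0 (ltW (lt_le_trans st tT')) => /(_ isT)/andP[].
    rewrite -EFinM lee_fin.
    have tsp : 0 < t - s by rewrite subr_gt0.
    have sT : 0 <= s <= T by rewrite s0 (ltW (lt_le_trans st tT')).
    apply: (@le_trans _ _ ((t - s) `^ (- kap) * (expR (rho * s) * m))).
      by rewrite ler_wpM2l ?powR_ge0// mP.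
    have -> : rho * s = rho * t + - (rho * (t - s)) by ring.
    rewrite expRD opprD powR_add//.
    have := @powR_expN_le1 _ (rho * (t - s)) th; rewrite mulr_ge0 ?(ltW rho0) ?(ltW tsp)// => /(_ isT).
    rewrite th1 ltW// => /(_ isT); rewrite powRM ?(ltW rho0) ?(ltW tsp)// => h.
    have {}h : expR (- (rho * (t - s))) <= rho `^ (- th) * (t - s) `^ (- th).
      rewrite -!powR_invr// -invfM -[leRHS]mul1r ler_pdivlMr ?mulr_gt0 ?powR_gt0//.
      by rewrite mulrC.
    rewrite [leRHS](_ : _ = (t - s) `^ (- kap) * (expR (rho * t) * (rho `^ (- th) * (t - s) `^ (- th)) * m)); last by ring.
    by rewrite ler_wpM2l ?powR_ge0// ler_wpM2r// ler_wpM2l ?expR_ge0.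
  rewrite ge0_integralZl_EFin//; last 3 first.
  - by move=> s _; rewrite lee_fin powR_ge0.
  - by apply/measurable_EFinP; exact: measurable_kernel.
  - by rewrite !mulr_ge0 ?powR_ge0 ?expR_ge0.
  rewrite muleA -EFinM.
  apply: (@le_trans _ _ ((c * (rho `^ (- th) * expR (rho * t) * m))%:E * B%:E)%E).
    rewrite lee_wpmul2l ?lee_fin ?mulr_ge0 ?powR_ge0 ?expR_ge0//.
    apply: le_trans (kernel_integral kth t0) _; rewrite lee_fin subr0.
    rewrite ler_wpM2r ?invr_ge0 ?subr_ge0 ?(ltW kth)//.
    by apply: ler_powR_base; rewrite ?subr_ge0 ?(ltW kth).
  rewrite -EFinM lee_fin.
  rewrite (_ : _ * B = c * B * rho `^ (- th) * (expR (rho * t) * m)); last by ring.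
  by rewrite [leRHS]mulrC ler_wpM2r ?mulr_ge0 ?expR_ge0.
have m2 : m <= 2 * a.
  suff : m <= a + m / 2 by lra.
  apply: sup_le_ub => [|y [t /=]]; first exact: supE.1.
  rewrite in_itv /= => tT <-{y}; have /andP[t0 _] := tT.
  rewrite expRN mulrC ler_pdivrMr ?expR_gt0//; apply: le_trans (step t tT) _.
  rewrite mulrDl lerD//; last by rewrite -mulrA mulrC.
  by rewrite ler_peMr// -expR0 ler_expR mulr_ge0// ltW.
move=> t tT; apply: le_trans (mP t tT) _; have /andP[t0 tT'] := tT.
rewrite (_ : 2 * _ * a = expR (rho * T) * (2 * a)); last by ring.
by apply: ler_pM; rewrite ?expR_ge0// ler_expR ler_wpM2l// ltW.
Qed.

End gronwall.

(** * Gaussian increments *)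

Section independence.
Context {R : realType} {d d1 d2 : measure_display} {Omega : measurableType d}.
Context {T1 : measurableType d1} {T2 : measurableType d2}.
Variables (P : probability Omega R) (nu : probability T2 R).

(** Independence is given on rectangles; these determine the joint law, which is therefore the
    product measure, and Tonelli's theorem splits the integral. *)
Lemma integral_independent (X : {mfun Omega >-> T1}) (Y : {mfun Omega >-> T2})
    (g : T1 -> \bar R) (f : T2 -> \bar R) :
  (forall A B, measurable A -> measurable B ->
     P (X @^-1` A `&` Y @^-1` B) = (P (X @^-1` A) * nu B)%E) ->
  measurable_fun setT g -> measurable_fun setT f ->
  (forall x, 0 <= g x)%E -> (forall y, 0 <= f y)%E ->
  (\int[P]_w (g (X w) * f (Y w)) = (\int[P]_w g (X w)) * \int[nu]_y f y)%E.
Proof.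
move=> XY mg mf g0 f0.
have mXY : measurable_fun setT (fun w => (X w, Y w)).
  by apply: measurable_fun_pair.
pose Z : {mfun Omega >-> (T1 * T2)%type} :=
  HB.pack (fun w => (X w, Y w)) (isMeasurableFun.Build _ _ _ _ _ mXY).
pose h (z : T1 * T2) := (g z.1 * f z.2)%E.
have mh : measurable_fun setT h.
  by apply: emeasurable_funM; apply: measurableT_comp.
have h0 z : (0 <= h z)%E by rewrite /h mule_ge0.
transitivity (\int[distribution P Z]_z h z)%E.
  by rewrite ge0_integral_distribution.
transitivity (\int[(distribution P X \x nu)%E]_z h z)%E.
  apply: eq_measure_integral => A mA _; apply/esym; apply: product_measure_unique => //.
rewrite fubini_tonelli1// /fubini_F /h /=.
under eq_integral do rewrite ge0_integralZl//.
rewrite ge0_integralZr//; last by apply: integral_ge0.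
by rewrite ge0_integral_distribution.
Qed.

End independence.

Section normal_moments.
Context {R : realType}.
Implicit Types (sigma q : R).
Local Notation Rm := (measurableTypeR R).

Lemma integral_normal_prob sigma (f : Rm -> \bar R) : measurable_fun setT f ->
  (forall x, 0 <= f x)%E ->
  (\int[normal_prob 0 sigma]_x f x =
   \int[lebesgue_measure]_x (f x * (normal_pdf 0 sigma x)%:E))%E.
Proof.
move=> mf f0; have dom := @normal_prob_dominates R 0 sigma.
rewrite -(@Radon_Nikodym_SigmaFinite.change_of_variables _ _ _ _ lebesgue_measure dom)//.
have gi := Radon_Nikodym_SigmaFinite.f_integrable dom.
have mg := measurable_int _ gi.
have mpdf : measurable_fun [set: Rm] (fun x => (normal_pdf 0 sigma x)%:E).
  by apply/measurable_EFinP; exact: measurable_normal_pdf.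
apply: ge0_ae_eq_integral => //.
- by apply: emeasurable_funM.
- by apply: emeasurable_funM.
- by move=> x _; rewrite mule_ge0//; exact: Radon_Nikodym_SigmaFinite.f_ge0.
- by move=> x _; rewrite mule_ge0// lee_fin normal_pdf_ge0.
have : ae_eq lebesgue_measure setT (Radon_Nikodym_SigmaFinite.f (normal_prob 0 sigma) lebesgue_measure)
   (fun x : Rm => (normal_pdf 0 sigma x)%:E).
  apply: integral_ae_eq => // E _ mE.
  by rewrite -Radon_Nikodym_SigmaFinite.f_integral.
by apply: filterS => x /= h xT; rewrite h.
Qed.

Lemma normal_prob_even sigma (f : Rm -> \bar R) : sigma != 0 -> measurable_fun setT f ->
  (forall x, 0 <= f x)%E ->
  (\int[normal_prob 0 sigma]_x f (- x)%R = \int[normal_prob 0 sigma]_x f x)%E.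
Proof.
move=> s0 mf f0.
have mN : measurable_fun [set: Rm] (-%R : Rm -> Rm).
  by apply: (@oppr_measurable R setT).
have mfN : measurable_fun [set: Rm] (fun x : Rm => f (- x)) by exact: (measurableT_comp mf mN).
rewrite !integral_normal_prob//.
pose g (x : Rm) := (f x * (normal_pdf 0 sigma x)%:E)%E.
have mg : measurable_fun [set: Rm] g.
  apply: emeasurable_funM => //.
  by apply/measurable_EFinP; exact: measurable_normal_pdf.
have g0 x : (0 <= g x)%E by rewrite mule_ge0// lee_fin normal_pdf_ge0.
transitivity (\int[lebesgue_measure]_(x in (-%R : Rm -> Rm) @^-1` setT) (g \o -%R) x)%E.
  rewrite preimage_setT; apply: eq_integral => x _; rewrite /g /=; congr (_ * _%:E)%E.
  by rewrite !normal_pdfE// /normal_fun !subr0 sqrrN.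
rewrite -(@ge0_integral_pushforward _ _ Rm Rm R (-%R) mN lebesgue_measure setT g)//.
apply: eq_measure_integral => A mA _.
exact: lebesgue_measureN.
Qed.

Lemma powR_le_expR (r y : R) : 0 < r -> 0 <= y -> y `^ r <= r `^ r * expR y.
Proof.
move=> r0 y0; rewrite mulrC -ler_pdivrMr ?powR_gt0//.
rewrite powR_invr// -powR_invl// -powRM ?invr_ge0// ?(ltW r0)//.
rewrite -[leRHS](_ : expR (y / r) `^ r = _); last by rewrite -expRM divfK ?gt_eqF.
apply: ler_powR_base; rewrite ?(ltW r0) ?divr_ge0 ?(ltW r0)//.
by apply: le_trans (expR_ge1Dx _); rewrite lerDr.
Qed.

Lemma normal_peak_double sigma : 0 < sigma ->
  normal_peak sigma = 2 * normal_peak (2 * sigma) :> R.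
Proof.
move=> s0; rewrite /normal_peak.
rewrite (_ : (2 * sigma) ^+ 2 * pi *+ 2 = 2 ^+ 2 * (sigma ^+ 2 * pi *+ 2)); last by ring.
rewrite sqrtrM ?sqr_ge0// sqrtr_sqr ger0_norm// invfM mulrA mulfV ?mul1r//.
Qed.

Let measurable_normX q : measurable_fun [set: Rm] (fun x : Rm => (`|x| `^ q)%:E).
Proof.
apply/measurable_EFinP; apply: (measurableT_comp (measurable_powR q)).
exact: (@normr_measurable R setT).
Qed.

(** The density of deviation [sigma] is compared with that of [2 sigma]: their quotient is Gaussian
    in [x / sigma] and absorbs [|x|^q]. *)
Lemma normal_moment_le q : 0 < q -> exists2 C : R, 0 <= C & forall sigma, 0 < sigma ->
  (\int[normal_prob 0 sigma]_x (`|x| `^ q)%:E <= (C * sigma `^ q)%:E)%E.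
Proof.
move=> q0; pose r := q / 2; have r0 : 0 < r by rewrite divr_gt0.
pose C := (8 / 3) `^ r * r `^ r * 2.
have C0 : 0 <= C by rewrite !mulr_ge0 ?powR_ge0.
exists C => // sigma s0.
rewrite integral_normal_prob//.
apply: (@le_trans _ _ (\int[lebesgue_measure]_x ((C * sigma `^ q)%:E * (normal_pdf 0 (2 * sigma) x)%:E))%E); last first.
  rewrite ge0_integralZl//; last 3 first.
  - by apply/measurable_EFinP; exact: measurable_normal_pdf.
  - by move=> x _; rewrite lee_fin normal_pdf_ge0.
  - by rewrite lee_fin mulr_ge0 ?powR_ge0.
  by rewrite integral_normal_pdf mule1.
apply: ge0_le_integral_nomeas => x _; first by rewrite -EFinM lee_fin mulr_ge0 ?powR_ge0 ?normal_pdf_ge0.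
have sn0 : sigma != 0 by rewrite gt_eqF.
rewrite -!EFinM lee_fin !normal_pdfE ?mulf_neq0// /normal_fun !subr0.
rewrite (normal_peak_double s0).
(* The difference of the two Gaussian exponents: [3/8 = 1/2 - 1/8]. *)
pose z := 3 / 8 * (x / sigma) ^+ 2.
have z0 : 0 <= z by rewrite mulr_ge0 ?sqr_ge0 ?divr_ge0.
have xz : `|x| `^ q = sigma `^ q * ((8 / 3) `^ r * z `^ r).
  rewrite -powRM ?divr_ge0// (_ : 8 / 3 * z = `|x / sigma| ^+ 2); last first.
    by rewrite real_normK ?num_real// /z; field.
  rewrite -powR_mulrn// -powRrM /r mulrCA mulfV ?mulr1//.
  by rewrite -powRM ?(ltW s0)// normrM normfV (gtr0_norm s0) mulrCA mulfV ?mulr1.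
have h : z `^ r * expR (- z) <= r `^ r.
  by rewrite expRN ler_pdivrMr ?expR_gt0//; exact: powR_le_expR.
have -> : expR (- x ^+ 2 / (sigma ^+ 2 *+ 2)) =
    expR (- z) * expR (- x ^+ 2 / ((2 * sigma) ^+ 2 *+ 2)).
  by rewrite -expRD; congr expR; rewrite /z; field.
rewrite xz [leLHS](_ : _ = sigma `^ q * (8 / 3) `^ r * 2 * normal_peak (2 * sigma) *
   expR (- x ^+ 2 / ((2 * sigma) ^+ 2 *+ 2)) * (z `^ r * expR (- z))); last by ring.
rewrite [leRHS](_ : _ = sigma `^ q * (8 / 3) `^ r * 2 * normal_peak (2 * sigma) *
   expR (- x ^+ 2 / ((2 * sigma) ^+ 2 *+ 2)) * r `^ r); last by rewrite /C; ring.
by rewrite ler_wpM2l// !mulr_ge0 ?powR_ge0 ?expR_ge0 ?normal_peak_ge0.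
Qed.

(** The number 1, carried as a symbolic constant whose finiteness, sign and scaling in [sigma] are
    established below. *)
Definition normal_variance : R := fine (\int[normal_prob 0 (1 : R)]_x (x ^+ 2)%:E)%E.

Let measurable_sqr : measurable_fun [set: Rm] (fun x : Rm => (x ^+ 2)%:E).
Proof. by apply/measurable_EFinP; exact: (@exprn_measurable R setT 2). Qed.

Lemma normal_variance_fin :
  (\int[normal_prob 0 (1 : R)]_x (x ^+ 2)%:E = normal_variance%:E)%E.
Proof.
rewrite /normal_variance fineK// ge0_fin_numE; last first.
  by apply: integral_ge0 => x _; rewrite lee_fin sqr_ge0.
have [C C0 /(_ 1 ltr01) h] := @normal_moment_le 2 (ltr0n _ 2).
apply: le_lt_trans (ltry (C * 1 `^ 2)); apply: le_trans h.
apply: ge0_le_integral_nomeas => x _; first by rewrite lee_fin sqr_ge0.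
by rewrite lee_fin powR_mulrn// real_normK ?num_real.
Qed.

Lemma normal_variance_ge0 : 0 <= normal_variance.
Proof. by rewrite fine_ge0// integral_ge0// => x _; rewrite lee_fin sqr_ge0. Qed.

Lemma normal_variance_scale sigma : 0 < sigma ->
  (\int[normal_prob 0 sigma]_x (x ^+ 2)%:E = (normal_variance * sigma ^+ 2)%:E)%E.
Proof.
move=> s0; have sn0 : sigma != 0 by rewrite gt_eqF.
rewrite mulrC EFinM -normal_variance_fin !integral_normal_prob//; last 2 first.
- by move=> x; rewrite lee_fin sqr_ge0.
- by move=> x; rewrite lee_fin sqr_ge0.
rewrite -ge0_integralZl//; last 3 first.
- apply: emeasurable_funM => //.
  by apply/measurable_EFinP; exact: measurable_normal_pdf.
- by move=> x _; rewrite -EFinM lee_fin mulr_ge0 ?sqr_ge0 ?normal_pdf_ge0.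
- by rewrite lee_fin sqr_ge0.
under eq_integral do rewrite -EFinM.
pose G y := y ^+ 2 * normal_pdf 0 sigma y.
pose F (x : R) := sigma * x.
have dF (x : R) : is_derive x (1 : R) (F : R -> R) sigma.
  by have := is_deriveZ sigma (is_derive_id x (1 : R)); rewrite /GRing.scale /= mulr1.
have F' : F^`()%classic = cst sigma.
  by apply/funext => x; rewrite derive1E (@derive_val _ _ _ _ _ _ _ (dF x)).
have cG : continuous G.
  move=> x; apply: cvgM; first exact: sqr_continuous.
  exact: continuous_normal_pdf.
transitivity (\int[lebesgue_measure]_x (G x)%:E)%E => //.
rewrite (@increasing_ge0_integration_by_substitutionT R F G)//.
- apply: eq_integral => x _; rewrite F' -[LHS]/((G (F x) * sigma)%:E) /G /F.
  rewrite !normal_pdfE ?oner_eq0// /normal_fun !subr0.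
  have -> : normal_peak sigma = normal_peak 1 / sigma.
    rewrite /normal_peak -invfM; congr (_^-1).
    rewrite (_ : sigma ^+ 2 * pi *+ 2 = (1 ^+ 2 * pi *+ 2) * sigma ^+ 2); last by ring.
    rewrite sqrtrM ?sqrtr_sqr ?(gtr0_norm s0)//.
    by rewrite expr1n mul1r mulrn_wge0// pi_ge0.
  rewrite (_ : - (sigma * x) ^+ 2 / (sigma ^+ 2 *+ 2) = - x ^+ 2 / (1 ^+ 2 *+ 2)); last by field.
  by congr EFin; field.
- by move=> x y xy; rewrite /F ltr_pM2l.
- by rewrite F' => x; exact: cst_continuous.
- by rewrite F'; exact: is_cvg_cst.
- by rewrite F'; exact: is_cvg_cst.
- rewrite (_ : F = fun x => x * sigma); last by apply/funext => x; rewrite /F mulrC.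
  exact: gt0_cvgMlNy.
- rewrite (_ : F = fun x => x * sigma); last by apply/funext => x; rewrite /F mulrC.
  exact: gt0_cvgMly.
- by move=> x; rewrite /G mulr_ge0 ?sqr_ge0 ?normal_pdf_ge0.
Qed.

End normal_moments.

Section filtration.
Context {R : realType} {d : measure_display} {Omega : measurableType d}.
Variables (P : probability Omega R) (T : R) (Fil : R -> set (set Omega)).
Hypothesis hFil : normal_filtration P T Fil.

(** Measurability with respect to [Fil s], phrased as ordinary measurability on the type generated
    by [Fil s]: sums, products and powers of adapted variables then follow the usual rules. *)
Definition fil_fun (s : R) (f : Omega -> R) :=
  measurable_fun [set: g_sigma_algebraType (Fil s)] (f : g_sigma_algebraType (Fil s) -> R).

Lemma fil_sigma s : 0 <= s <= T -> sigma_algebra setT (Fil s).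
Proof. by case: hFil => h _ _ _ /h[]. Qed.

Lemma fil_measurable s : 0 <= s <= T -> Fil s `<=` measurable.
Proof. by case: hFil => h _ _ _ /h[]. Qed.

Lemma fil_typeE s (A : set Omega) : 0 <= s <= T ->
  measurable (A : set (g_sigma_algebraType (Fil s))) <-> Fil s A.
Proof. by move=> sT; rewrite measurable_g_measurableTypeE//; exact: fil_sigma. Qed.

Lemma fil_funP s f : 0 <= s <= T ->
  fil_fun s f <-> forall C : set R, measurable C -> Fil s (f @^-1` C).
Proof.
move=> sT; split=> [mf C mC|h _ C mC].
  by apply/(fil_typeE _ sT); have := mf measurableT _ mC; rewrite setTI.
by rewrite setTI; apply/(fil_typeE _ sT); exact: h.
Qed.

Lemma fil_fun_measurable s f : 0 <= s <= T -> fil_fun s f -> measurable_fun setT f.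
Proof.
move=> sT /(fil_funP _ sT) h _ C mC; rewrite setTI; apply: (fil_measurable sT).
exact: h.
Qed.

Lemma fil_fun_mono s t f : 0 <= s -> s <= t -> t <= T -> fil_fun s f -> fil_fun t f.
Proof.
move=> s0 st tT; have sT : 0 <= s <= T by rewrite s0 (le_trans st).
have tT' : 0 <= t <= T by rewrite tT (le_trans s0).
move=> /(fil_funP _ sT) h; apply/(fil_funP _ tT') => C mC.
by case: hFil => _ + _ _; apply; [exact: s0|exact: st|exact: tT|exact: h].
Qed.

Lemma fil_fun_indic s (A : set Omega) : 0 <= s <= T -> Fil s A -> fil_fun s (\1_A).
Proof. by move=> sT FA; apply: measurable_indic; apply/(fil_typeE _ sT). Qed.

End filtration.

Section borel_sets.
Context {R : realType}.

Lemma measurable_borel (C : set R) : measurable C -> borel C.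
Proof.
rewrite /borel => mC.
have : (RGenOInfty.G (R := R)).-sigma.-measurable C by rewrite -RGenOInfty.measurableE.
apply: sub_sigma_algebra2 => _ [x ->] /=.
exact: interval_open.
Qed.

End borel_sets.

Section wiener_increments.
Context {R : realType} {d : measure_display} {Omega : measurableType d}.
Variables (P : probability Omega R) (T : R) (Fil : R -> set (set Omega)).
Hypothesis hFil : normal_filtration P T Fil.
Context {U : hilbertType R} (W : R -> U -> Omega -> R).
Hypothesis hW : cylindrical_wiener P T Fil W.
Local Notation Rm := (measurableTypeR R).
Local Notation fil_fun := (fil_fun Fil).

Definition incr s t u w : R := W t u w - W s u w.

Lemma wiener_fil_fun t u : 0 <= t <= T -> fil_fun t (W t u).
Proof.
move=> tT; apply/(fil_funP hFil) => // C mC.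
by apply: (cw_adapted hW) => //; exact: measurable_borel.
Qed.

Lemma incr_fil_fun s t u : 0 <= s -> s <= t -> t <= T -> fil_fun t (incr s t u).
Proof.
move=> s0 st tT; have tT' : 0 <= t <= T by rewrite tT (le_trans s0).
apply: measurable_funB; first exact: wiener_fil_fun.
apply: (fil_fun_mono hFil s0 st tT); apply: wiener_fil_fun.
by rewrite s0 (le_trans st).
Qed.

Lemma incr_measurable s t u : 0 <= s -> s <= t -> t <= T -> measurable_fun setT (incr s t u).
Proof.
move=> s0 st tT; apply: (fil_fun_measurable hFil (s := t)); last exact: incr_fil_fun.
by rewrite tT (le_trans s0).
Qed.

Lemma incr_linear s t a u v : 0 <= s -> s <= t -> t <= T ->
  {ae P, forall w, incr s t (a *: u + v) w = a * incr s t u w + incr s t v w}.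
Proof.
move=> s0 st tT; have tT' : 0 <= t <= T by rewrite tT (le_trans s0).
have sT' : 0 <= s <= T by rewrite s0 (le_trans st).
have h1 := cw_linear hW a u v tT'; have h2 := cw_linear hW a u v sT'.
by apply: filterS2 h1 h2 => w h1 h2; rewrite /incr h1 h2; ring.
Qed.

(** [cw_normal] speaks of [s < t] and [u != 0]. For [u = 0], linearity at [0 = 1 *: 0 + 0] makes the
    increment equal to its double, hence 0, almost surely. *)
Lemma incr_degenerate s t u : 0 <= s -> s <= t -> t <= T -> u = 0 \/ s = t ->
  {ae P, forall w, incr s t u w = 0}.
Proof.
move=> s0 st tT [->|->]; last by apply: aeW => w; rewrite /incr subrr.
have := incr_linear 1 0 0 s0 st tT; apply: filterS => w.
by rewrite scaler0 addr0 mul1r => /eqP; rewrite -subr_eq0 opprD addrA subrr sub0r oppr_eq0 => /eqP.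
Qed.

Definition incr_sigma s t (u : U) : R := Num.sqrt (t - s) * `|u|.

Lemma incr_sigma_gt0 s t u : s < t -> u != 0 -> 0 < incr_sigma s t u.
Proof. by move=> st u0; rewrite mulr_gt0 ?sqrtr_gt0 ?subr_gt0 ?normr_gt0. Qed.

Lemma integral_incr s t u (g : Omega -> R) (f : Rm -> \bar R) :
  0 <= s -> s < t -> t <= T -> u != 0 -> fil_fun s g -> measurable_fun setT f ->
  (forall w, 0 <= g w) -> (forall y, 0 <= f y)%E ->
  (\int[P]_w ((g w)%:E * f (incr s t u w)) =
   (\int[P]_w (g w)%:E) * \int[normal_prob 0 (incr_sigma s t u)]_y f y)%E.
Proof.
move=> s0 st tT u0 mg mf g0 f0.
have sT : 0 <= s <= T by rewrite s0 (ltW (lt_le_trans st tT)).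
(* The sigma-algebra [Fil s] enters as a random variable: the identity with values in [Omega]
   equipped with [Fil s]. *)
have mid : measurable_fun [set: Omega] (id : Omega -> g_sigma_algebraType (Fil s)).
  move=> _ A mA; rewrite setTI preimage_id; apply: (fil_measurable hFil sT).
  exact/(fil_typeE hFil _ sT).
pose X : {mfun Omega >-> g_sigma_algebraType (Fil s)} :=
  HB.pack (id : Omega -> g_sigma_algebraType (Fil s)) (isMeasurableFun.Build _ _ _ _ _ mid).
have mD : measurable_fun [set: Omega] (incr s t u : Omega -> Rm).
  exact: (incr_measurable u s0 (ltW st) tT).
pose Y : {mfun Omega >-> Rm} :=
  HB.pack (incr s t u : Omega -> Rm) (isMeasurableFun.Build _ _ _ _ _ mD).
apply: (@integral_independent _ _ _ _ _ _ _ P (normal_prob 0 (incr_sigma s t u)) X Y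
  (fun w => (g w)%:E) f) => //.
- move=> A B mA mB.
  have FA : Fil s A by apply/(fil_typeE hFil _ sT).
  have e1 := cw_normal hW s0 st tT u0 mB.
  have e2 := cw_independent hW u s0 st tT FA mB.
  by etransitivity; [exact: e2|congr (_ * _)%E; exact: e1].
exact/measurable_EFinP.
Qed.

Lemma fin_integral_ge0 (d' : measure_display) (T' : measurableType d')
    (m : {measure set T' -> \bar R}) (f : T' -> R) : m.-integrable setT (EFin \o f) ->
  (\int[m]_x (f x)%:E)%E = (\int[m]_x f x)%:E.
Proof. by move=> fi; rewrite /Rintegral fineK// integrable_fin_num. Qed.

Lemma Rintegral_incr_ge0 s t u (g : Omega -> R) (f : Rm -> R) :
  0 <= s -> s < t -> t <= T -> u != 0 -> fil_fun s g ->
  P.-integrable setT (EFin \o g) ->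
  (normal_prob 0 (incr_sigma s t u)).-integrable setT (EFin \o f) ->
  (forall w, 0 <= g w) -> (forall y, 0 <= f y) ->
  P.-integrable setT (EFin \o (fun w => g w * f (incr s t u w))) /\
  \int[P]_w (g w * f (incr s t u w)) =
    \int[P]_w g w * \int[normal_prob 0 (incr_sigma s t u)]_y f y.
Proof.
move=> s0 st tT u0 mg gi fi g0 f0.
have sT : 0 <= s <= T by rewrite s0 (ltW (lt_le_trans st tT)).
have mf : measurable_fun setT f by apply/measurable_EFinP; exact: measurable_int fi.
have mg' : measurable_fun setT g by exact: (fil_fun_measurable hFil sT).
have e : (\int[P]_w (g w * f (incr s t u w))%:E)%E =
    ((\int[P]_w g w) * \int[normal_prob 0 (incr_sigma s t u)]_y f y)%:E.
  under eq_integral do rewrite EFinM.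
  rewrite (integral_incr (f := EFin \o f) s0 st tT u0 mg)//; last exact/measurable_EFinP.
  by rewrite (fin_integral_ge0 gi) (fin_integral_ge0 fi).
split; last by rewrite {1}/Rintegral e.
apply/integrableP; split.
  apply/measurable_EFinP; apply: measurable_funM => //.
  by apply: (measurableT_comp mf); exact: (incr_measurable u s0 (ltW st) tT).
under eq_integral do rewrite /= ger0_norm ?mulr_ge0//.
by rewrite e ltry.
Qed.

Lemma Rintegral_incr s t u (g : Omega -> R) (f : Rm -> R) :
  0 <= s -> s < t -> t <= T -> u != 0 -> fil_fun s g ->
  P.-integrable setT (EFin \o g) ->
  (normal_prob 0 (incr_sigma s t u)).-integrable setT (EFin \o f) ->
  P.-integrable setT (EFin \o (fun w => g w * f (incr s t u w))) /\
  \int[P]_w (g w * f (incr s t u w)) =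
    \int[P]_w g w * \int[normal_prob 0 (incr_sigma s t u)]_y f y.
Proof.
move=> s0 st tT u0 mg gi fi.
have mgp : fil_fun s (fun w => Num.max (g w) 0) by apply: measurable_maxr.
have mgn : fil_fun s (fun w => Num.max (- g w) 0).
  by apply: measurable_maxr => //; exact: measurable_funN.
have gpi : P.-integrable setT (EFin \o (fun w => Num.max (g w) 0)).
  exact: integrable_funrpos.
have gni : P.-integrable setT (EFin \o (fun w => Num.max (- g w) 0)).
  exact: integrable_funrneg.
have fpi : (normal_prob 0 (incr_sigma s t u)).-integrable setT
    (EFin \o (fun y : Rm => Num.max (f y) 0)) by exact: integrable_funrpos.
have fni : (normal_prob 0 (incr_sigma s t u)).-integrable setT
    (EFin \o (fun y : Rm => Num.max (- f y) 0)) by exact: integrable_funrneg.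
have m0 (x : R) : 0 <= Num.max x 0 by rewrite le_max lexx orbT.
have mE (x : R) : x = Num.max x 0 - Num.max (- x) 0.
  case: (lerP 0 x) => x0; last by rewrite [Num.max (- x) 0]max_l ?oppr_ge0 ?(ltW x0)// sub0r opprK.
  by rewrite [Num.max (- x) 0]max_r ?subr0// oppr_le0.
have [i1 e1] := Rintegral_incr_ge0 s0 st tT u0 mgp gpi fpi (fun _ => m0 _) (fun _ => m0 _).
have [i2 e2] := Rintegral_incr_ge0 s0 st tT u0 mgp gpi fni (fun _ => m0 _) (fun _ => m0 _).
have [i3 e3] := Rintegral_incr_ge0 s0 st tT u0 mgn gni fpi (fun _ => m0 _) (fun _ => m0 _).
have [i4 e4] := Rintegral_incr_ge0 s0 st tT u0 mgn gni fni (fun _ => m0 _) (fun _ => m0 _).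
have i12 := integrableB measurableT i1 i2; have i34 := integrableB measurableT i3 i4.
have i := integrableB measurableT i12 i34.
have gE : (fun w => g w * f (incr s t u w)) = (fun w =>
    (Num.max (g w) 0 * Num.max (f (incr s t u w)) 0 -
     Num.max (g w) 0 * Num.max (- f (incr s t u w)) 0) -
    (Num.max (- g w) 0 * Num.max (f (incr s t u w)) 0 -
     Num.max (- g w) 0 * Num.max (- f (incr s t u w)) 0)).
  by apply/funext => w; rewrite {1}[g w]mE {1}[f _]mE; ring.
split; first by rewrite gE.
rewrite gE RintegralB// RintegralB// RintegralB// e1 e2 e3 e4.
rewrite [X in _ = X * _](_ : _ = \int[P]_w Num.max (g w) 0 - \int[P]_w Num.max (- g w) 0).
  rewrite [X in _ = _ * X](_ : _ = \int[normal_prob 0 (incr_sigma s t u)]_y Num.max (f y) 0 -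
    \int[normal_prob 0 (incr_sigma s t u)]_y Num.max (- f y) 0); first by ring.
  by rewrite -RintegralB//; apply: eq_Rintegral => y _; exact: mE.
by rewrite -RintegralB//; apply: eq_Rintegral => y _; exact: mE.
Qed.

Let normal_id_integrable sigma : 0 < sigma ->
  (normal_prob 0 sigma).-integrable setT (EFin \o (id : Rm -> R)).
Proof.
move=> s0; apply/integrableP; split; first by apply/measurable_EFinP; exact: (@measurable_id _ R setT).
have [C C0 /(_ _ s0) h] := @normal_moment_le R 1 ltr01.
apply: le_lt_trans (ltry (C * sigma `^ 1)); apply: le_trans h.
by apply: ge0_le_integral_nomeas => x _ //=; rewrite lee_fin powRr1.
Qed.

Lemma incr_mean0 s t u (g : Omega -> R) :
  0 <= s -> s <= t -> t <= T -> fil_fun s g -> P.-integrable setT (EFin \o g) ->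
  P.-integrable setT (EFin \o (fun w => g w * incr s t u w)) /\
  \int[P]_w (g w * incr s t u w) = 0.
Proof.
move=> s0 st tT mg gi; have sT : 0 <= s <= T by rewrite s0 (le_trans st tT).
have mg' := fil_fun_measurable hFil sT mg.
have [deg|ndeg] := pselect (u = 0 \/ s = t).
  have a0 := incr_degenerate s0 st tT deg.
  have mgD : measurable_fun setT (fun w => g w * incr s t u w).
    by apply: measurable_funM => //; exact: (incr_measurable u s0 st tT).
  have ae0 : ae_eq P setT (fun w => (g w * incr s t u w)%:E) (cst 0%E).
    by apply: filterS a0 => w /= -> _; rewrite mulr0.
  split; last first.
    rewrite /Rintegral (ae_eq_integral (cst 0%E))//; last exact/measurable_EFinP.
    by rewrite integral0.
  apply/integrableP; split; first exact/measurable_EFinP.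
  rewrite (ae_eq_integral (cst 0%E))//.
  - by rewrite integral0 ltry.
  - by apply: measurableT_comp => //; exact/measurable_EFinP.
  - by apply: filterS a0 => w /= -> _; rewrite mulr0 normr0.
have u0 : u != 0 by apply/eqP => u0; apply: ndeg; left.
have {}st : s < t by rewrite lt_neqAle st andbT; apply/eqP => e; apply: ndeg; right.
have sg := incr_sigma_gt0 st u0.
have [i e] := Rintegral_incr s0 st tT u0 mg gi (normal_id_integrable sg).
split=> //; rewrite e [X in _ * X](_ : _ = 0) ?mulr0//.
have fpi := integrable_funrpos measurableT (normal_id_integrable sg).
have fni := integrable_funrneg measurableT (normal_id_integrable sg).
(* The law is even, so the positive and the negative part of [y] have the same integral. *)
transitivity (\int[normal_prob 0 (incr_sigma s t u)]_y (Num.max y 0 - Num.max (- y) 0)).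
  apply: eq_Rintegral => x _.
  have [x0|x0] := leP 0 x; first by rewrite max_r ?subr0// oppr_le0.
  by rewrite max_l ?oppr_ge0 ?(ltW x0)// sub0r opprK.
rewrite RintegralB//.
rewrite [X in X - _](_ : _ = \int[normal_prob 0 (incr_sigma s t u)]_y Num.max (- y) 0) ?subrr//.
rewrite /Rintegral.
have := @normal_prob_even R (incr_sigma s t u) (fun y : Rm => (Num.max y 0)%:E) _ _ _.
move=> <- //; first by rewrite gt_eqF.
  by apply/measurable_EFinP; apply: measurable_maxr => //; exact: (@measurable_id _ R setT).
by move=> x; rewrite lee_fin le_max lexx orbT.
Qed.

Let incr_var s t u (g : Omega -> R) :
  0 <= s -> s <= t -> t <= T -> fil_fun s g -> P.-integrable setT (EFin \o g) ->
  P.-integrable setT (EFin \o (fun w => g w * incr s t u w ^+ 2)) /\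
  \int[P]_w (g w * incr s t u w ^+ 2) = normal_variance * (t - s) * `|u| ^+ 2 * \int[P]_w g w.
Proof.
move=> s0 st tT mg gi; have sT : 0 <= s <= T by rewrite s0 (le_trans st tT).
have mg' := fil_fun_measurable hFil sT mg.
have [deg|ndeg] := pselect (u = 0 \/ s = t).
  have a0 := incr_degenerate s0 st tT deg.
  have mgD : measurable_fun setT (fun w => g w * incr s t u w ^+ 2).
    by apply: measurable_funM => //; apply: measurable_funX; exact: (incr_measurable u s0 st tT).
  have ae0 : ae_eq P setT (fun w => (g w * incr s t u w ^+ 2)%:E) (cst 0%E).
    by apply: filterS a0 => w /= -> _; rewrite expr0n mulr0.
  split; last first.
    rewrite /Rintegral (ae_eq_integral (cst 0%E))//; last exact/measurable_EFinP.
    by rewrite integral0 /=; case: deg => ->; rewrite ?normr0 ?subrr; ring.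
  apply/integrableP; split; first exact/measurable_EFinP.
  rewrite (ae_eq_integral (cst 0%E))//.
  - by rewrite integral0 ltry.
  - by apply: measurableT_comp => //; exact/measurable_EFinP.
  - by apply: filterS a0 => w /= -> _; rewrite expr0n mulr0 normr0.
have u0 : u != 0 by apply/eqP => u0; apply: ndeg; left.
have {}st : s < t by rewrite lt_neqAle st andbT; apply/eqP => e; apply: ndeg; right.
have sg := incr_sigma_gt0 st u0.
have sqi : (normal_prob 0 (incr_sigma s t u)).-integrable setT (EFin \o (fun x : Rm => x ^+ 2)).
  apply/integrableP; split.
    by apply/measurable_EFinP; exact: (@exprn_measurable R setT 2).
  under eq_integral do rewrite /= ger0_norm ?sqr_ge0//.
  by rewrite normal_variance_scale// ltry.
have [i e] := Rintegral_incr s0 st tT u0 mg gi sqi.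
split=> //; rewrite e {2}/Rintegral normal_variance_scale//= /incr_sigma exprMn sqr_sqrtr ?subr_ge0 ?ltW//.
by ring.
Qed.

(** Polarization: by linearity of [W] in its direction, the product of two increments is a quarter
    of the difference of the squared increments along [u + v] and [u - v]. *)
Lemma incr_cov s t u v (g : Omega -> R) :
  0 <= s -> s <= t -> t <= T -> fil_fun s g -> P.-integrable setT (EFin \o g) ->
  P.-integrable setT (EFin \o (fun w => g w * (incr s t u w * incr s t v w))) /\
  \int[P]_w (g w * (incr s t u w * incr s t v w)) =
    normal_variance * (t - s) * inner u v * \int[P]_w g w.
Proof.
move=> s0 st tT mg gi; have sT : 0 <= s <= T by rewrite s0 (le_trans st tT).
have mg' := fil_fun_measurable hFil sT mg.
have mD x := incr_measurable x s0 st tT.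
have [i1 e1] := incr_var (u + v) s0 st tT mg gi.
have [i2 e2] := incr_var (u - v) s0 st tT mg gi.
have ib := integrableZl measurableT 4^-1 (integrableB measurableT i1 i2).
have mp : measurable_fun setT (fun w => g w * (incr s t u w * incr s t v w)).
  by apply: measurable_funM => //; apply: measurable_funM.
have a : {ae P, forall w, g w * (incr s t u w * incr s t v w) =
    4^-1 * (g w * incr s t (u + v) w ^+ 2 - g w * incr s t (u - v) w ^+ 2)}.
  have a1 := incr_linear 1 u v s0 st tT; have a2 := incr_linear (-1) v u s0 st tT.
  apply: filterS2 a1 a2 => w; rewrite scale1r scaleN1r (addrC (- v)) => -> ->.
  by field.
have e : ae_eq P setT (fun w => (g w * (incr s t u w * incr s t v w))%:E)
    (fun w => (4^-1 * (g w * incr s t (u + v) w ^+ 2 - g w * incr s t (u - v) w ^+ 2))%:E).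
  by apply: filterS a => w -> _.
have m2 : measurable_fun setT (fun w => (4^-1 * (g w * incr s t (u + v) w ^+ 2 -
   g w * incr s t (u - v) w ^+ 2))%:E) by exact: measurable_int ib.
split.
  apply/integrableP; split; first exact/measurable_EFinP.
  have /integrableP[_] := ib; apply: le_lt_trans.
  rewrite le_eqVlt; apply/orP; left; apply/eqP; apply: ae_eq_integral => //.
  - by apply: measurableT_comp => //; exact/measurable_EFinP.
  - by apply: measurableT_comp => //.
  - by apply: filterS a => w /= -> _.
transitivity (\int[P]_w (4^-1 * (g w * incr s t (u + v) w ^+ 2 - g w * incr s t (u - v) w ^+ 2))).
  by rewrite /Rintegral (ae_eq_integral _ _ _ _ _ e)//; exact/measurable_EFinP.
rewrite RintegralZl//; last exact: (integrableB measurableT i1 i2).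
by rewrite RintegralB// e1 e2 normD2 normB2; field.
Qed.

Lemma incr_moment q : 0 < q -> exists2 C : R, 0 <= C & forall s t u (g : Omega -> R),
  0 <= s -> s <= t -> t <= T -> fil_fun s g -> (forall w, 0 <= g w) ->
  (\int[P]_w (g w * `|incr s t u w| `^ q)%:E <=
   (C * ((t - s) `^ (q / 2) * `|u| `^ q))%:E * \int[P]_w (g w)%:E)%E.
Proof.
move=> q0; have [C C0 CP] := @normal_moment_le R q q0; exists C => // s t u g s0 st tT mg g0.
have sT : 0 <= s <= T by rewrite s0 (le_trans st tT).
have mg' := fil_fun_measurable hFil sT mg.
have gi0 : (0 <= \int[P]_w (g w)%:E)%E by apply: integral_ge0 => w _; rewrite lee_fin.
have [deg|ndeg] := pselect (u = 0 \/ s = t).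
  have a0 := incr_degenerate s0 st tT deg.
  rewrite (ae_eq_integral (cst 0%E))//.
  - by rewrite integral0 mule_ge0// lee_fin !mulr_ge0 ?powR_ge0.
  - apply/measurable_EFinP; apply: measurable_funM => //.
    apply: (measurableT_comp (measurable_powR q)); apply: measurableT_comp => //.
    exact: incr_measurable.
  - by apply: filterS a0 => w /= -> _; rewrite normr0 powR0 ?mulr0// gt_eqF.
have u0 : u != 0 by apply/eqP => u0; apply: ndeg; left.
have {}st : s < t by rewrite lt_neqAle st andbT; apply/eqP => e; apply: ndeg; right.
have sg := incr_sigma_gt0 st u0.
under eq_integral do rewrite EFinM.
rewrite (integral_incr (f := fun y : Rm => (`|y| `^ q)%:E) s0 st tT u0 mg)//; last first.
  apply/measurable_EFinP; apply: (measurableT_comp (measurable_powR q)).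
  exact: (@normr_measurable R setT).
rewrite muleC lee_wpmul2r//; apply: le_trans (CP _ sg) _.
rewrite lee_fin ler_wpM2l// /incr_sigma powRM ?sqrtr_ge0// -powR12_sqrt ?subr_ge0 ?(ltW st)//.
by rewrite -powRrM (mulrC 2^-1).
Qed.

End wiener_increments.

(** * Moments of discrete martingales *)

Section norm_power_taylor.
Context {R : realType}.

Lemma expR_le_quadratic (x : R) : expR x <= 1 + x + x ^+ 2 * expR `|x|.
Proof.
have h1 (y : R) : expR y - 1 <= y * expR y.
  have := expR_ge1Dx (- y); rewrite -(ler_pM2r (expR_gt0 y)) -expRD addNr expR0.
  by rewrite mulrDl mul1r mulNr; lra.
have h2 : expR x <= 1 + x + x * (expR x - 1) by have := h1 x; lra.
apply: le_trans h2 _; rewrite lerD2l expr2 -mulrA.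
have [x0|x0] := lerP 0 x.
  by rewrite ler_wpM2l// (le_trans (h1 x))// ler_wpM2l// ger0_norm.
rewrite -[leLHS]opprK -mulrN opprB -mulNr -[leRHS]mulrNN ler_wpM2l ?oppr_ge0 ?(ltW x0)//.
have e1 : 1 <= expR `|x| by rewrite -(@expR0 R) ler_expR.
have := expR_ge1Dx x; have : 0 < - x by lra.
move: e1; rewrite ltr0_norm//; nra.
Qed.

Lemma powR_le_quadratic (q : R) : 0 <= q -> exists2 K : R, 0 <= K &
  forall u, -1 < u <= 1 -> (1 + u) `^ q <= 1 + q * u + K * u ^+ 2.
Proof.
move=> q0; exists (q ^+ 2 * expR q); first by rewrite mulr_ge0 ?sqr_ge0 ?expR_ge0.
move=> u /andP[u1 u2]; have u1' : 0 < 1 + u by lra.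
rewrite /powR gt_eqF//.
have h : expR (q * ln (1 + u)) <= expR (q * u).
  by rewrite ler_expR ler_wpM2l//; exact: le_ln1Dx.
apply: le_trans h (le_trans (expR_le_quadratic _) _); rewrite lerD2l exprMn mulrAC ler_wpM2r ?sqr_ge0//.
rewrite ler_wpM2l ?sqr_ge0// ler_expR normrM (ger0_norm q0) ler_piMr// ler_norml; lra.
Qed.

(** The first-order term is kept exact because it will have mean 0. If [|x| <= 4 |y|], every term is
    controlled by [|y|^r]; otherwise [|x + y|^2 = |x|^2 (1 + u)] with [|u| <= 3/4], and
    [(1 + u)^(r/2)] is expanded to second order. *)
Lemma norm_powR_taylor (V : hilbertType R) (r : R) : 2 <= r -> exists2 C : R, 0 <= C &
  forall x y : V, `|x + y| `^ r <= `|x| `^ r + r * `|x| `^ (r - 2) * inner x y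
    + C * (`|x| `^ (r - 2) * `|y| ^+ 2 + `|y| `^ r).
Proof.
move=> r2; have r0 : 0 < r by lra.
have [K K0 HK] := @powR_le_quadratic (r / 2) ltac:(by rewrite divr_ge0// ltW).
(* [C1] serves small [|x|]: [|x + y| <= 5 |y|], and the linear term is at most [r 4^{r-1} |y|^r].
   [C2] serves large [|x|]: [r / 2] comes from the [|y|^2] in [u], and [16 K] covers the [9 K]
   coming from [u^2]. *)
pose C1 := 5 `^ r + r * 4 `^ (r - 1); pose C2 := r / 2 + K * 16.
have C10 : 0 <= C1 by rewrite addr_ge0 ?powR_ge0// mulr_ge0 ?powR_ge0// ltW.
have C20 : 0 <= C2 by rewrite addr_ge0 ?divr_ge0 ?(mulr_ge0 K0) ?(ltW r0).
exists (C1 + C2); first exact: addr_ge0.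
move=> x y; set a := `|x|; set b := `|y|.
have a0 : 0 <= a := normr_ge0 x; have b0 : 0 <= b := normr_ge0 y.
have cs : `|inner x y| <= a * b := cauchy_schwarz x y.
have p0 : 0 <= a `^ (r - 2) := powR_ge0 _ _.
have q0 : 0 <= b `^ r := powR_ge0 _ _.
have s0 : 0 <= a `^ (r - 2) * b ^+ 2 by rewrite mulr_ge0 ?sqr_ge0.
have [ab|ba] := lerP a (4 * b).
  have h1 : `|x + y| `^ r <= 5 `^ r * b `^ r.
    rewrite -powRM//; apply: ge0_ler_powR; rewrite ?nnegrE ?mulr_ge0 ?(ltW r0)//.
    by apply: le_trans (ler_normD _ _) _; rewrite -/a -/b; lra.
  have h2 : - (r * a `^ (r - 2) * inner x y) <= r * 4 `^ (r - 1) * b `^ r.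
    rewrite -mulrN -!mulrA ler_wpM2l ?(ltW r0)//.
    apply: (@le_trans _ _ (a `^ (r - 2) * (a * b))).
      by rewrite ler_wpM2l//; apply: le_trans cs; rewrite -normrN ler_norm.
    rewrite mulrA; apply: (@le_trans _ _ ((4 * b) `^ (r - 1) * b)).
      rewrite ler_wpM2r//; have [->|an0] := eqVneq a 0; first by rewrite mulr0 powR_ge0.
      rewrite -[X in _ * X]powRr1// -powRD ?an0 ?implybT//.
      rewrite (_ : r - 2 + 1 = r - 1); last by ring.
      by apply: ge0_ler_powR; rewrite ?nnegrE ?mulr_ge0//; lra.
    rewrite powRM// -mulrA ler_wpM2l ?powR_ge0//.
    have [->|bn0] := eqVneq b 0; first by rewrite mulr0 powR_ge0.
    by rewrite -[X in _ * X]powRr1// -powRD ?bn0 ?implybT// subrK.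
  have a0' : 0 <= a `^ r := powR_ge0 _ _.
  have t1 : 0 <= C2 * b `^ r by exact: mulr_ge0.
  have t2 : 0 <= (C1 + C2) * (a `^ (r - 2) * b ^+ 2) by rewrite mulr_ge0// addr_ge0.
  have h3 : C1 * b `^ r = 5 `^ r * b `^ r + r * 4 `^ (r - 1) * b `^ r by rewrite /C1 mulrDl.
  rewrite mulrDr [(C1 + C2) * b `^ r]mulrDl h3; lra.
have ap : 0 < a by lra.
pose u := (2 * inner x y + b ^+ 2) / a ^+ 2.
have uE : `|x + y| = a * Num.sqrt (1 + u).
  have e : `|x + y| ^+ 2 = a ^+ 2 * (1 + u).
    by rewrite normD2 /u -/a -/b; field; rewrite gt_eqF.
  by rewrite -[LHS]ger0_norm// -sqrtr_sqr e sqrtrM ?sqr_ge0// sqrtr_sqr ger0_norm.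
have ub : `|u| <= 3 * (b / a).
  rewrite /u normrM normfV (ger0_norm (sqr_ge0 a)) ler_pdivrMr ?exprn_gt0//.
  apply: le_trans (ler_normD _ _) _; rewrite normrM (ger0_norm (sqr_ge0 b)) ger0_norm//.
  rewrite (_ : 3 * _ * _ = 3 * (a * b)); last by field; rewrite gt_eqF.
  by have h : b ^+ 2 <= a * b by [rewrite expr2 ler_wpM2r//; lra]; lra.
have ba4 : b / a <= 4^-1 by rewrite ler_pdivrMr//; lra.
have ba0 : 0 <= b / a by rewrite divr_ge0.
have u1 : -1 < u <= 1 by move: ub; rewrite ler_norml => /andP[]; lra.
have u0 : 0 <= 1 + u by lra.
have u2 : u ^+ 2 <= 9 * (b / a) ^+ 2.
  rewrite -real_normK ?num_real//; apply: (@le_trans _ _ ((3 * (b / a)) ^+ 2)).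
    by rewrite lerXn2r ?nnegrE ?(mulr_ge0 _ ba0).
  by rewrite exprMn; have := sqr_ge0 (b / a); lra.
have e1 : `|x + y| `^ r = a `^ r * (1 + u) `^ (r / 2).
  by rewrite uE powRM ?sqrtr_ge0// -powR12_sqrt// -powRrM (mulrC 2^-1).
have ar : a `^ r = a `^ (r - 2) * a ^+ 2.
  by rewrite -powR_mulrn// -powRD ?gt_eqF ?implybT// subrK.
have h := HK u u1.
have h3 : `|x + y| `^ r <= a `^ (r - 2) * (a ^+ 2 * (1 + r / 2 * u + K * u ^+ 2)).
  by rewrite e1 ar -mulrA ler_wpM2l// ler_wpM2l// sqr_ge0.
have h4 : a ^+ 2 * (1 + r / 2 * u + K * u ^+ 2) <= a ^+ 2 + r * inner x y + C2 * b ^+ 2.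
  have e2 : a ^+ 2 * (r / 2 * u) = r * inner x y + r / 2 * b ^+ 2.
    by rewrite /u; field; rewrite gt_eqF.
  have e3 : a ^+ 2 * u ^+ 2 <= 9 * b ^+ 2.
    apply: le_trans (_ : a ^+ 2 * (9 * (b / a) ^+ 2) <= _); first by rewrite ler_wpM2l ?sqr_ge0.
    by rewrite le_eqVlt; apply/orP; left; apply/eqP; field; rewrite gt_eqF.
  have e4 : a ^+ 2 * (K * u ^+ 2) <= K * (16 * b ^+ 2).
    by rewrite mulrCA ler_wpM2l//; have := sqr_ge0 b; lra.
  by rewrite !mulrDr mulr1 e2 /C2; lra.
have h5 := le_trans h3 (ler_wpM2l p0 h4).
have t1 : 0 <= (C1 + C2) * b `^ r by rewrite mulr_ge0// addr_ge0.
have t2 : 0 <= C1 * (a `^ (r - 2) * b ^+ 2) by exact: mulr_ge0.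
move: h5; rewrite ar !mulrDr [(C1 + C2) * (_ * _)]mulrDl; lra.
Qed.

(* Subtracting [b S^{-b-1} (S - S')] is the gain from the decreasing weight [S^{-b}]. *)
Lemma powR_inv_convex (b S S' : R) : 0 <= b -> 0 < S' -> S' <= S ->
  S `^ (- b) + b * S `^ (- b - 1) * (S - S') <= S' `^ (- b).
Proof.
move=> b0 S'0 SS'; have S0 : 0 < S by lra.
have e : S' `^ (- b) = S `^ (- b) * expR (- b * ln (S' / S)).
  by rewrite -[S' in LHS](mulfVK (lt0r_neq0 S0)) mulrC powRM ?divr_ge0 ?ltW// [(_ / _) `^ _]/powR gt_eqF ?divr_gt0.
rewrite e (powR_add (- b) (- 1) S0) (powR_inv1 (ltW S0)).
have h : 1 + b * (1 - S' / S) <= expR (- b * ln (S' / S)).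
  apply: le_trans (_ : 1 + (- b * ln (S' / S)) <= _); last exact: expR_ge1Dx.
  rewrite lerD2l mulNr -mulrN ler_wpM2l// -[S' / S in leRHS](subrK 1) [_ - 1 + 1]addrC.
  have := @le_ln1Dx R (S' / S - 1); rewrite ltrBrDr [-1 + 1]addrC subrr divr_gt0// => /(_ isT).
  lra.
apply: le_trans (ler_wpM2l (powR_ge0 _ _) h).
rewrite [leRHS]mulrDr mulr1 lerD2l le_eqVlt; apply/orP; left; apply/eqP.
by field; rewrite gt_eqF.
Qed.

(** Absorbs the second-order term of the expansion into the gain of [powR_inv_convex]: if
    [b X^2 > c S] the gain alone exceeds it, and otherwise [X^{2q-2}] is at most
    [(c S / b)^{q-1}]. *)
Lemma drift_young (b c q : R) : 0 < b -> 0 <= c -> 1 <= q -> exists2 C : R, 0 <= C &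
  forall S X : R, 0 < S -> 0 <= X ->
    c * (X `^ (2 * q - 2) * S `^ (- b)) <=
    b * S `^ (- b - 1) * X `^ (2 * q) + C * S `^ (q - 1 - b).
Proof.
move=> b0 c0 q1; exists (c * (c / b) `^ (q - 1)); first by rewrite mulr_ge0 ?powR_ge0.
move=> S X S0 X0; have Sn0 : S != 0 by rewrite gt_eqF.
have cb0 : 0 <= c / b by rewrite divr_ge0// ltW.
have e1 : X `^ (2 * q - 2) = (X ^+ 2) `^ (q - 1).
  by rewrite -powR_mulrn// -powRrM; congr (_ `^ _); ring.
have e2 : X `^ (2 * q) = (X ^+ 2) `^ q by rewrite -powR_mulrn// -powRrM.
have A0 : 0 <= S `^ (q - 1 - b) := powR_ge0 _ _.
have [h|h] := lerP (X ^+ 2) (c / b * S).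
  apply: ler_wpDl; first by rewrite !mulr_ge0 ?powR_ge0 ?ltW.
  rewrite -mulrA ler_wpM2l// e1 (@powRD _ S (q - 1) (- b)) ?Sn0 ?implybT// mulrA ler_wpM2r ?powR_ge0//.
  rewrite -powRM ?(ltW S0)//; apply: ge0_ler_powR; rewrite ?nnegrE ?sqr_ge0 ?subr_ge0//.
  by rewrite mulr_ge0 ?(ltW S0).
apply: ler_wpDr; first by rewrite !mulr_ge0 ?powR_ge0.
have X20 : 0 < X ^+ 2 by apply: le_lt_trans h; rewrite mulr_ge0 ?(ltW S0).
rewrite e1 e2 (powR_add (- b) (- 1) S0) (powR_inv1 (ltW S0)).
have -> : (X ^+ 2) `^ q = (X ^+ 2) `^ (q - 1) * X ^+ 2.
  by rewrite -{3}[X ^+ 2]powRr1 ?(ltW X20)// -powR_add// subrK.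
rewrite [leRHS](_ : _ = (X ^+ 2) `^ (q - 1) * S `^ (- b) * (b * S^-1 * X ^+ 2)); last by ring.
rewrite mulrC ler_wpM2l ?mulr_ge0 ?powR_ge0//.
by rewrite mulrAC ler_pdivlMr// (ltW (_ : c * S < b * X ^+ 2))// -ltr_pdivrMl// mulrA (mulrC b^-1).
Qed.

End norm_power_taylor.

Section power_sums.
Context {R : realType}.

Lemma powR_add_le (r a b : R) : 0 <= r -> 0 <= a -> 0 <= b ->
  (a + b) `^ r <= 2 `^ r * (a `^ r + b `^ r).
Proof.
move=> r0; wlog ab : a b / a <= b.
  by move=> h a0 b0; have [/h|/ltW/h] := lerP a b; [|rewrite addrC [_ `^ _ + _]addrC]; apply.
move=> a0 b0; apply: (@le_trans _ _ ((2 * b) `^ r)).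
  by apply: ge0_ler_powR => //; rewrite ?nnegrE ?addr_ge0 ?mulr_ge0//; lra.
by rewrite powRM// ler_wpM2l ?powR_ge0// lerDr powR_ge0.
Qed.

Lemma powR_sum_le (r : R) (m : nat) : 0 < r -> exists2 C : R, 0 <= C &
  forall a : 'I_m -> R, (forall i, 0 <= a i) -> (\sum_i a i) `^ r <= C * \sum_i a i `^ r.
Proof.
move=> r0; elim: m => [|m [C C0 IH]].
  by exists 0 => // a _; rewrite !big_ord0 mulr0 powR0// gt_eqF.
exists (2 `^ r * (1 + C)); first by rewrite mulr_ge0 ?powR_ge0// addr_ge0.
move=> a a0; rewrite !big_ord_recl; apply: le_trans (powR_add_le (ltW r0) _ _) _ => //.
  by apply: sumr_ge0.
have s0 : 0 <= \sum_(i < m) a (lift ord0 i) `^ r by apply: sumr_ge0 => i _; exact: powR_ge0.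
rewrite -mulrA ler_wpM2l ?powR_ge0// mulrDl mul1r mulrDr.
have := IH (fun i => a (lift ord0 i)) (fun i => a0 _).
have : 0 <= C * a ord0 `^ r by rewrite mulr_ge0 ?powR_ge0.
lra.
Qed.

(** The bookkeeping of [V_step] with its powers named, so that it is linear arithmetic: [a1], [a2],
    [a6] are the powers [-p/2], [-p/2 - 1], [p/2 - 1] of the new bracket, [a5] the power [-p/2] of
    the old one, and [a3], [a4] the powers [r], [r - 2] of the norm. *)
Lemma weighted_drift (h kn b C a1 a2 a3 a4 a5 a6 : R) :
  h * (kn * (a4 * a1)) <= h * (b * a2 * a3 + C * a6) -> (a1 + b * a2 * h) * a3 <= a5 * a3 ->
  a1 * a3 + kn * (a1 * a4 * h) <= a5 * a3 + C * (h * a6).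
Proof. lra. Qed.

End power_sums.

Section linear_combinations.
Context {R : realType} {d : measure_display} {T : measurableType d} {V : hilbertType R}.

Lemma measurable_inner_comb (m : nat) (f : 'I_m -> T -> R) (v : 'I_m -> V) (D : set T)
    (h : T -> V) : (forall i, measurable_fun D (f i)) ->
  (forall i, measurable_fun D (fun x => inner (v i) (h x))) ->
  measurable_fun D (fun x => inner (\sum_i f i x *: v i) (h x)).
Proof.
move=> mf mh; rewrite (_ : (fun x => _) = (fun x => \sum_i f i x * inner (v i) (h x))).
  by apply: measurable_sum => i; exact: measurable_funM.
by apply/funext => x; rewrite inner_suml; apply: eq_bigr => i _; rewrite innerZl.
Qed.

Lemma measurable_norm_comb (m : nat) (f : 'I_m -> T -> R) (v : 'I_m -> V) (D : set T) :
  (forall i, measurable_fun D (f i)) -> measurable_fun D (fun x => `|\sum_i f i x *: v i|).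
Proof.
move=> mf; rewrite (_ : (fun x => _) =
   (@powR R)^~ 2^-1 \o (fun x => inner (\sum_i f i x *: v i) (\sum_i f i x *: v i))).
  apply: (measurableT_comp (measurable_powR 2^-1)).
  apply: measurable_inner_comb => // i.
  under eq_fun do rewrite innerC.
  by apply: measurable_inner_comb => // j; exact: measurable_cst.
by apply/funext => x /=; rewrite inner_norm powR12_sqrt ?sqr_ge0// sqrtr_sqr normr_id.
Qed.

End linear_combinations.

Section filtration_closure.
Context {R : realType} {d : measure_display} {Omega : measurableType d}.
Variables (Fil : R -> set (set Omega)) (s : R).
Local Notation fil := (fil_fun Fil s).
Local Notation Om := (g_sigma_algebraType (Fil s)).
Implicit Types f h : Omega -> R.

Lemma fil_cst (a : R) : fil (fun=> a).
Proof. exact: (@measurable_cst _ _ Om R setT a). Qed.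

Lemma fil_add f h : fil f -> fil h -> fil (fun w => f w + h w).
Proof. exact: (@measurable_funD _ Om R setT f h). Qed.

Lemma fil_mul f h : fil f -> fil h -> fil (fun w => f w * h w).
Proof. exact: (@measurable_funM _ Om R setT f h). Qed.

Lemma fil_powR (q : R) f : fil f -> fil (fun w => f w `^ q).
Proof. by move=> mf; exact: (measurableT_comp (measurable_powR q) mf). Qed.

Lemma fil_sum (I : Type) (l : seq I) (f : I -> Omega -> R) :
  (forall i, fil (f i)) -> fil (fun w => \sum_(i <- l) f i w).
Proof. exact: (@measurable_sum _ Om R setT I l f). Qed.

Lemma fil_norm_comb (V : hilbertType R) (m : nat) (f : 'I_m -> Omega -> R) (v : 'I_m -> V) :
  (forall i, fil (f i)) -> fil (fun w => `|\sum_i f i w *: v i|).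
Proof. exact: (@measurable_norm_comb _ _ Om V m f v setT). Qed.

Lemma fil_inner_comb (V : hilbertType R) (m : nat) (f : 'I_m -> Omega -> R) (v : 'I_m -> V) y :
  (forall i, fil (f i)) -> fil (fun w => inner (\sum_i f i w *: v i) y).
Proof.
move=> mf; exact: (@measurable_inner_comb _ _ Om V m f v setT (fun=> y)).
Qed.

End filtration_closure.

Section integrable_facts.
Context {R : realType} {d : measure_display} {Omega : measurableType d}.
Variable P : probability Omega R.

Lemma dominated_integrable (f h : Omega -> R) : measurable_fun setT f ->
  P.-integrable setT (EFin \o h) -> (forall w, `|f w| <= h w) ->
  P.-integrable setT (EFin \o f).
Proof.
move=> mf hi fh; apply: le_integrable hi => //; first exact/measurable_EFinP.
by move=> w _ /=; rewrite lee_fin (le_trans (fh w))// ler_norm.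
Qed.

Lemma bounded_integrable (f : Omega -> R) (C : R) : measurable_fun setT f ->
  (forall w, `|f w| <= C) -> P.-integrable setT (EFin \o f).
Proof.
move=> mf fC; apply: (@dominated_integrable _ (cst C)) => //.
exact: finite_measure_integrable_cst.
Qed.

Lemma bounded_mul_integrable (f h : Omega -> R) (C : R) : measurable_fun setT f ->
  P.-integrable setT (EFin \o h) -> (forall w, `|f w| <= C) ->
  P.-integrable setT (EFin \o (fun w => f w * h w)).
Proof.
move=> mf hi fC; have mh : measurable_fun setT h by apply/measurable_EFinP; exact: measurable_int hi.
have i1 : P.-integrable setT (EFin \o (fun w => C * `|h w|)).
  apply: (integrableZl measurableT C (f := EFin \o (fun w => `|h w|))).
  exact: integrable_norm.
apply: (dominated_integrable _ i1); first exact: measurable_funM.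
by move=> w; rewrite normrM ler_wpM2r.
Qed.

End integrable_facts.

Section increment_combinations.
Context {R : realType} {d : measure_display} {Omega : measurableType d}.
Variables (P : probability Omega R) (T : R) (Fil : R -> set (set Omega)).
Hypothesis hFil : normal_filtration P T Fil.
Context {U V : hilbertType R} (W : R -> U -> Omega -> R).
Hypothesis hW : cylindrical_wiener P T Fil W.
Variables (m : nat) (u : 'I_m -> U) (v : 'I_m -> V) (r : R).
Hypothesis r0 : 0 < r.

Definition incr_comb (c : 'I_m -> Omega -> R) s t w : V :=
  \sum_i (c i w * incr W s t (u i) w) *: v i.

(** [C] may depend on the vectors [u i] and [v i], but not on the coefficients or the interval. It
    will multiply a sum of powers of the mesh, so its size is harmless. *)
Definition incr_comb_bound (C : R) := forall s t (c : 'I_m -> Omega -> R) (w0 : Omega -> R) G,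
  0 <= s -> s <= t -> t <= T -> (forall i, measurable_fun setT (c i)) ->
  (forall i w, `|c i w| <= 1) -> fil_fun Fil s w0 -> (forall w, 0 <= w0 w <= G) ->
  P.-integrable setT (EFin \o (fun w => w0 w * `|incr_comb c s t w| `^ r)) /\
  \int[P]_w (w0 w * `|incr_comb c s t w| `^ r) <= C * (t - s) `^ (r / 2) * G.

Lemma incr_comb_measurable c s t : 0 <= s -> s <= t -> t <= T ->
  (forall i, measurable_fun setT (c i)) ->
  measurable_fun setT (fun w => `|incr_comb c s t w|).
Proof.
move=> s0 st tT mc; apply: measurable_norm_comb => i; apply: measurable_funM; first exact: mc.
exact: (incr_measurable hFil hW).
Qed.

Lemma incr_comb_moment : exists2 C : R, 0 <= C & incr_comb_bound C.
Proof.
have [C1 C10 HC1] := @powR_sum_le R r m r0.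
have [C2 C20 HC2] := incr_moment hFil hW r0.
exists (C1 * \sum_i (`|v i| `^ r * (C2 * `|u i| `^ r))).
  by rewrite mulr_ge0// sumr_ge0// => i _; rewrite !mulr_ge0 ?powR_ge0.
move=> s t c w0 G s0 st tT mc c1 mw w0G; have G0 : 0 <= G by have /andP[h1 h2] := w0G point; exact: le_trans h1 h2.
have w00 w : 0 <= w0 w by case/andP: (w0G w).
have sT : 0 <= s <= T by rewrite s0 (le_trans st).
have mw' := fil_fun_measurable hFil sT mw.
have mi i : measurable_fun setT (fun w => `|incr W s t (u i) w| `^ r).
  apply: (measurableT_comp (measurable_powR r)); apply: measurableT_comp => //.
  exact: (incr_measurable hFil hW).
have mm : measurable_fun setT (fun w => w0 w * `|incr_comb c s t w| `^ r).
  by apply: measurable_funM => //; exact: (measurableT_comp (measurable_powR r) (incr_comb_measurable s0 st tT mc)).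
have key : (\int[P]_w (w0 w * `|incr_comb c s t w| `^ r)%:E <=
    (C1 * (\sum_i (`|v i| `^ r * (C2 * `|u i| `^ r))) * (t - s) `^ (r / 2) * G)%:E)%E.
  apply: (@le_trans _ _ (\int[P]_w \sum_(i < m)
      ((C1 * `|v i| `^ r)%:E * (w0 w * `|incr W s t (u i) w| `^ r)%:E))%E).
    apply: ge0_le_integral_nomeas => w _ //=; first by rewrite lee_fin mulr_ge0 ?powR_ge0.
    under eq_bigr do rewrite -EFinM.
    rewrite sumEFin lee_fin.
    apply: (@le_trans _ _ (w0 w * (C1 * \sum_i (`|incr W s t (u i) w| * `|v i|) `^ r))).
      rewrite ler_wpM2l//; apply: le_trans (HC1 _ _) => [|i]; last by rewrite mulr_ge0.
      apply: ge0_ler_powR; rewrite ?nnegrE ?(ltW r0)//.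
        by apply: sumr_ge0 => i _; exact: mulr_ge0.
      apply: le_trans (ler_norm_sum _ _ _) _; apply: ler_sum => i _.
      by rewrite normrZ ler_wpM2r// normrM ler_piMl.
    rewrite mulrCA mulr_sumr mulr_sumr; apply: ler_sum => i _.
    by rewrite powRM// le_eqVlt; apply/orP; left; apply/eqP; ring.
  rewrite ge0_integral_sum//; last 2 first.
  - move=> i; apply: measurable_funeM; apply/measurable_EFinP; exact: measurable_funM.
  - by move=> i w _; rewrite mule_ge0// lee_fin mulr_ge0 ?powR_ge0.
  rewrite -mulrA -mulrA mulr_suml mulr_sumr -sumEFin; apply: lee_sum => i _.
  rewrite ge0_integralZl//; last 3 first.
  - by apply/measurable_EFinP; exact: measurable_funM.
  - by move=> w _; rewrite lee_fin mulr_ge0 ?powR_ge0.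
  - by rewrite lee_fin mulr_ge0 ?powR_ge0.
  apply: le_trans (lee_wpmul2l _ (HC2 _ _ _ _ s0 st tT mw w00)) _.
    by rewrite lee_fin mulr_ge0 ?powR_ge0.
  have wG : (\int[P]_w (w0 w)%:E <= G%:E)%E.
    apply: (@le_trans _ _ (\int[P]_w (cst G%:E w))%E).
      by apply: ge0_le_integral_nomeas => w _ //=; rewrite lee_fin; case/andP: (w0G w).
    by rewrite integral_cst//= [X in (_ * X)%E](@probability_setT _ _ _ P) mule1.
  apply: le_trans (lee_wpmul2l _ (lee_wpmul2l _ wG)) _; rewrite ?lee_fin ?mulr_ge0 ?powR_ge0//.
  by rewrite le_eqVlt; apply/orP; left; apply/eqP; ring.
have i1 : P.-integrable setT (EFin \o (fun w => w0 w * `|incr_comb c s t w| `^ r)).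
  apply/integrableP; split; first exact/measurable_EFinP.
  under eq_integral do rewrite /= ger0_norm ?mulr_ge0 ?powR_ge0//.
  exact: le_lt_trans key (ltry _).
by split=> //; rewrite -lee_fin -(fin_integral_ge0 i1).
Qed.

End increment_combinations.

Section discrete_martingale.
Context {R : realType} {d : measure_display} {Omega : measurableType d}.
Variables (P : probability Omega R) (T : R) (Fil : R -> set (set Omega)).
Hypothesis hFil : normal_filtration P T Fil.
Context {U V : hilbertType R} (W : R -> U -> Omega -> R).
Hypothesis hW : cylindrical_wiener P T Fil W.
Variables (m : nat) (u : 'I_m -> U) (v : 'I_m -> V) (g : nat -> R).
Hypothesis g0 : forall k, 0 <= g k.
Hypothesis gT : forall k, g k <= T.
Hypothesis gS : forall k, g k <= g k.+1.
Variable c : nat -> 'I_m -> Omega -> R.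
Hypothesis mc : forall k i, fil_fun Fil (g k) (c k i).
Hypothesis c1 : forall k i w, `|c k i w| <= 1.

Definition mart_diff k w : V := incr_comb W u v (c k) (g k) (g k.+1) w.
Definition mart k w : V := \sum_(j < k) mart_diff j w.
(** The squared Hilbert-Schmidt norm of [sum_i c_i <u_i, .> v_i] on cell [k], written with Gram
    matrices; see [hs_sqr_comb]. *)
Definition bracket k w : R :=
  \sum_i \sum_j c k i w * c k j w * (inner (u i) (u j) * inner (v i) (v j)).
Definition mesh k : R := g k.+1 - g k.
Hypothesis bracket_ge0 : forall k w, 0 <= bracket k w.

Let gg k : 0 <= g k <= T. Proof. by rewrite g0 gT. Qed.

Let mesh_ge0 k : 0 <= mesh k. Proof. by rewrite subr_ge0. Qed.

Let fil_g j k f : (j <= k)%N -> fil_fun Fil (g j) f -> fil_fun Fil (g k) f.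
Proof.
move=> jk; apply: (fil_fun_mono hFil (g0 j) _ (gT k)).
have /nondecreasing_seqP : forall n, g n <= g n.+1 by [].
exact.
Qed.

Let coeff k i w : R := \sum_(j < k) c j i w * incr W (g j) (g j.+1) (u i) w.

Let martE k w : mart k w = \sum_i coeff k i w *: v i.
Proof.
rewrite /mart /mart_diff /incr_comb exchange_big /=; apply: eq_bigr => i _.
by rewrite scaler_suml.
Qed.

Let coeff_fil k i : fil_fun Fil (g k) (coeff k i).
Proof.
apply: fil_sum => j; apply: (@fil_g j.+1) => //.
apply: fil_mul.
  exact: (fil_g (leqnSn j) (@mc j i)).
exact: (incr_fil_fun hFil hW).
Qed.

Let norm_fil k : fil_fun Fil (g k) (fun w => `|mart k w|).
Proof.
by under eq_fun do rewrite martE; exact: (fil_norm_comb v (@coeff_fil k)).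
Qed.

Let inner_fil k y : fil_fun Fil (g k) (fun w => inner (mart k w) y).
Proof.
by under eq_fun do rewrite martE; exact: (fil_inner_comb v y (@coeff_fil k)).
Qed.

Lemma bracket_fil k : fil_fun Fil (g k) (bracket k).
Proof.
apply: fil_sum => i; apply: fil_sum => j.
by apply: fil_mul; [exact: fil_mul|exact: fil_cst].
Qed.

Definition total_bracket n w : R := \sum_(k < n) mesh k * bracket k w.

(** The bracket is predictable: the sum including cell [k] is already known at its left end. The
    weight used in step [k] may therefore contain the new term. *)
Lemma total_bracket_fil k : fil_fun Fil (g k) (total_bracket k.+1).
Proof.
apply: fil_sum => j; apply: (@fil_g j k); first by rewrite -ltnS.
by apply: fil_mul; [exact: fil_cst|exact: bracket_fil].
Qed.

Let Bmax : R := \sum_i \sum_j `|inner (u i) (u j) * inner (v i) (v j)|.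

Let bracket_max k w : bracket k w <= Bmax.
Proof.
apply: ler_sum => i _; apply: ler_sum => j _; apply: le_trans (ler_norm _) _.
rewrite normrM ler_piMl// normrM -[leRHS]mulr1.
by apply: ler_pM.
Qed.

Let meas k f : fil_fun Fil (g k) f -> measurable_fun [set: Omega] f.
Proof. exact: (fil_fun_measurable hFil (gg k)). Qed.

Variables r Cd : R.
Hypothesis r2 : 2 <= r.
Hypothesis HCd : incr_comb_bound P T Fil W u v r Cd.

Let r0 : 0 < r. Proof. by apply: lt_le_trans r2. Qed.

Let diff_moment k w0 G : fil_fun Fil (g k) w0 -> (forall w, 0 <= w0 w <= G) ->
  P.-integrable setT (EFin \o (fun w => w0 w * `|mart_diff k w| `^ r)) /\
  \int[P]_w (w0 w * `|mart_diff k w| `^ r) <= Cd * mesh k `^ (r / 2) * G.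
Proof. by move=> mw w0G; apply: HCd => // i; exact: (@meas k _ (@mc k i)). Qed.

Let mart_int k : P.-integrable setT (EFin \o (fun w => `|mart k w| `^ r)).
Proof.
elim: k => [|k IH].
  apply: (@bounded_integrable _ _ _ _ _ 0); first exact: (@meas 0%N _ (fil_powR r (@norm_fil 0%N))).
  by move=> w; rewrite /mart big_ord0 normr0 powR0 ?gt_eqF// normr0.
have [w|i1 _] := @diff_moment k (cst 1) 1 (@fil_cst _ _ _ _ _ 1); first by rewrite /= ler01 lexx.
have i2 := integrableZl measurableT (2 `^ r) (integrableD measurableT IH i1).
apply: (dominated_integrable _ i2); first exact: (@meas k.+1 _ (fil_powR r (@norm_fil k.+1))).
move=> w; rewrite mul1r ger0_norm ?powR_ge0// /mart big_ord_recr /=.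
apply: le_trans (powR_add_le (ltW r0) (normr_ge0 _) (normr_ge0 _)).
by apply: ge0_ler_powR; rewrite ?nnegrE ?(ltW r0)// ?addr_ge0// ler_normD.
Qed.

Let mart_int_le k s : 0 <= s <= r -> P.-integrable setT (EFin \o (fun w => `|mart k w| `^ s)).
Proof.
move=> /andP[s0 sr].
have i2 := integrableD measurableT (@finite_measure_integrable_cst _ _ _ P setT 1 measurableT) (mart_int k).
apply: (dominated_integrable _ i2); first exact: (@meas k _ (fil_powR s (@norm_fil k))).
move=> w; rewrite ger0_norm ?powR_ge0//=.
have [h|h] := lerP `|mart k w| 1.
  apply: ler_wpDr; first exact: powR_ge0.
  have -> : (1 : R) = 1 `^ s by rewrite powR1.
  by apply: ge0_ler_powR; rewrite ?nnegrE.
by apply: ler_wpDl => //; apply: ler_powR => //; exact: ltW.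
Qed.

Variable K : R.
Hypothesis K0 : 0 <= K.
Hypothesis taylor : forall x y : V, `|x + y| `^ r <= `|x| `^ r + r * `|x| `^ (r - 2) * inner x y
    + K * (`|x| `^ (r - 2) * `|y| ^+ 2 + `|y| `^ r).

Let RE f := Rintegral P setT f.
Let Pint (f : Omega -> R) := P.-integrable setT (EFin \o f).

Let sum_int (I : Type) (l : seq I) (f : I -> Omega -> R) : (forall i, Pint (f i)) ->
  Pint (fun w => \sum_(i <- l) f i w) /\
  RE (fun w => \sum_(i <- l) f i w) = \sum_(i <- l) RE (f i).
Proof.
move=> fi; elim: l => [|i l [IH1 IH2]].
  have e : (fun w : Omega => \sum_(i <- [::]) f i w) = cst 0 by apply/funext => w; rewrite big_nil.
  rewrite e big_nil; split; first exact: finite_measure_integrable_cst.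
  by rewrite /RE Rintegral_cst// mul0r.
have e : (fun w : Omega => \sum_(i <- i :: l) f i w) = (fun w => f i w + \sum_(i <- l) f i w).
  by apply/funext => w; rewrite big_cons.
rewrite e big_cons -IH2; split; first exact: (integrableD measurableT (fi i) IH1).
by rewrite /RE (RintegralD measurableT (fi i) IH1).
Qed.

(** The weight is known at the left end of the cell, so the linear term of the expansion has mean 0
    and the quadratic one produces the bracket; the remainder is of order [mesh^{r/2}]. *)
Lemma mart_step k w0 G :
  fil_fun Fil (g k) w0 -> (forall w, 0 <= w0 w <= G) ->
  Pint (fun w => w0 w * `|mart k.+1 w| `^ r) /\
  RE (fun w => w0 w * `|mart k.+1 w| `^ r) <= RE (fun w => w0 w * `|mart k w| `^ r)
    + K * normal_variance * RE (fun w => w0 w * `|mart k w| `^ (r - 2) * (mesh k * bracket k w))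
    + K * Cd * mesh k `^ (r / 2) * G.
Proof.
move=> mw w0G; have w00 w : 0 <= w0 w by case/andP: (w0G w).
have w0n w : `|w0 w| <= G by rewrite ger0_norm//; case/andP: (w0G w).
have mw' := @meas k _ mw.
have [id hd] := diff_moment mw w0G.
have fM q : fil_fun Fil (g k) (fun w => `|mart k w| `^ q) by exact: (fil_powR q (@norm_fil k)).
have ia : Pint (fun w => w0 w * `|mart k w| `^ r) by exact: (bounded_mul_integrable mw' (mart_int k) w0n).
have ia' : Pint (fun w => w0 w * `|mart k.+1 w| `^ r).
  exact: (bounded_mul_integrable mw' (mart_int k.+1) w0n).
have r1 : 0 <= r - 1 <= r by apply/andP; have := r2; split; lra.
have r22 : 0 <= r - 2 <= r by apply/andP; have := r2; split; lra.
pose bc i w := w0 w * `|mart k w| `^ (r - 2) * inner (mart k w) (v i) * c k i w.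
have fb i : fil_fun Fil (g k) (bc i).
  by apply: fil_mul => //; apply: fil_mul; [exact: fil_mul|exact: inner_fil].
have bi i : Pint (bc i).
  have i1 := integrableZl measurableT (G * `|v i|) (mart_int_le k r1).
  apply: (dominated_integrable _ i1); first exact: (@meas k _ (fb i)).
  move=> w; rewrite /bc /= -mulrA normrM normrM -mulrA -mulrA; apply: ler_pM => //.
  rewrite [leRHS]mulrC (_ : r - 1 = (r - 2) + 1); last by ring.
  apply: (@le_trans _ _ (`|mart k w| `^ (r - 2) * (`|mart k w| * `|v i|))).
    rewrite ger0_norm ?powR_ge0// ler_wpM2l ?powR_ge0// normrM -[leRHS]mulr1.
    by apply: ler_pM => //; exact: cauchy_schwarz.
  rewrite mulrA ler_wpM2r//; have [->|x0] := eqVneq `|mart k w| 0; first by rewrite mulr0 powR_ge0.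
  have xp : 0 < `|mart k w| by rewrite lt_neqAle eq_sym x0 normr_ge0.
  by rewrite (powR_add (r - 2) 1 xp) (powRr1 (ltW xp)).
have ibi i := incr_mean0 hFil hW (u i) (g0 k) (gS k) (gT k.+1) (fb i) (bi i).
have [ib eb] := sum_int (index_enum 'I_m) (fun i => (ibi i).1).
have {}eb : RE (fun w => \sum_i bc i w * incr W (g k) (g k.+1) (u i) w) = 0.
  by rewrite eb big1// => i _; exact: (ibi i).2.
pose dc i j w := w0 w * `|mart k w| `^ (r - 2) * (c k i w * c k j w).
have fd i j : fil_fun Fil (g k) (dc i j) by apply: fil_mul; exact: fil_mul.
have di i j : Pint (dc i j).
  have i1 := integrableZl measurableT G (mart_int_le k r22).
  apply: (dominated_integrable _ i1); first exact: (@meas k _ (fd i j)).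
  move=> w; rewrite /dc /= normrM -[leRHS]mulr1; apply: ler_pM => //.
    by rewrite normrM ler_pM// ger0_norm ?powR_ge0.
  by rewrite normrM -[leRHS]mulr1; exact: ler_pM.
have icv i j := incr_cov hFil hW (u i) (u j) (g0 k) (gS k) (gT k.+1) (fd i j) (di i j).
have icv' i j : Pint (fun w => inner (v i) (v j) * (dc i j w *
    (incr W (g k) (g k.+1) (u i) w * incr W (g k) (g k.+1) (u j) w))).
  exact: (integrableZl measurableT _ (icv i j).1).
have ic1 i := sum_int (index_enum 'I_m) (icv' i).
have [ic ec] := sum_int (index_enum 'I_m) (fun i => (ic1 i).1).
have ib1 i j : Pint (fun w => inner (v i) (v j) * (mesh k * inner (u i) (u j)) * dc i j w).
  exact: (integrableZl measurableT _ (di i j)).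
have ib2 i := sum_int (index_enum 'I_m) (ib1 i).
have [ib3 eb3] := sum_int (index_enum 'I_m) (fun i => (ib2 i).1).
have brE : (fun w => w0 w * `|mart k w| `^ (r - 2) * (mesh k * bracket k w)) =
    (fun w => \sum_i \sum_j inner (v i) (v j) * (mesh k * inner (u i) (u j)) * dc i j w).
  apply/funext => w; rewrite /bracket !mulr_sumr; apply: eq_bigr => i _.
  by rewrite !mulr_sumr; apply: eq_bigr => j _; rewrite /dc; ring.
have {}ec : RE (fun w => \sum_i \sum_j inner (v i) (v j) * (dc i j w *
    (incr W (g k) (g k.+1) (u i) w * incr W (g k) (g k.+1) (u j) w))) =
    normal_variance * RE (fun w => w0 w * `|mart k w| `^ (r - 2) * (mesh k * bracket k w)).
  rewrite brE eb3 ec mulr_sumr; apply: eq_bigr => i _.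
  rewrite (ic1 i).2 (ib2 i).2 mulr_sumr; apply: eq_bigr => j _.
  rewrite /RE RintegralZl//; last exact: (icv i j).1.
  by rewrite (icv i j).2 RintegralZl//; [rewrite /mesh; ring|exact: di].
have DE w : mart k.+1 w = mart k w + mart_diff k w by rewrite /mart big_ord_recr.
have bE w : w0 w * `|mart k w| `^ (r - 2) * inner (mart k w) (mart_diff k w) =
    \sum_i bc i w * incr W (g k) (g k.+1) (u i) w.
  rewrite /mart_diff /incr_comb inner_sumr mulr_sumr; apply: eq_bigr => i _.
  by rewrite innerZr /bc; ring.
have cE w : w0 w * `|mart k w| `^ (r - 2) * `|mart_diff k w| ^+ 2 =
    \sum_i \sum_j inner (v i) (v j) * (dc i j w *
    (incr W (g k) (g k.+1) (u i) w * incr W (g k) (g k.+1) (u j) w)).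
  rewrite -inner_norm {1}/mart_diff /incr_comb inner_suml mulr_sumr; apply: eq_bigr => i _.
  rewrite innerZl /mart_diff /incr_comb inner_sumr !mulr_sumr; apply: eq_bigr => j _.
  by rewrite innerZr /dc; ring.
split; first exact: ia'.
have irb := integrableZl measurableT r ib.
have ikc := integrableZl measurableT K ic.
have ikd := integrableZl measurableT K id.
have i12 := integrableD measurableT ia irb.
have i123 := integrableD measurableT i12 ikc.
have i1234 := integrableD measurableT i123 ikd.
apply: (@le_trans _ _ (RE (fun w => w0 w * `|mart k w| `^ r +
    r * (\sum_i bc i w * incr W (g k) (g k.+1) (u i) w) +
    K * (\sum_i \sum_j inner (v i) (v j) * (dc i j w *
    (incr W (g k) (g k.+1) (u i) w * incr W (g k) (g k.+1) (u j) w))) +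
    K * (w0 w * `|mart_diff k w| `^ r)))).
  apply: le_Rintegral => // w _; rewrite -bE -cE DE.
  apply: le_trans (ler_wpM2l (w00 w) (taylor _ _)) _.
  by rewrite le_eqVlt; apply/orP; left; apply/eqP; ring.
rewrite /RE RintegralD// RintegralD// RintegralD// !RintegralZl//.
rewrite -!/(RE _) eb ec mulr0 addr0 -!addrA lerD2l -mulrA lerD2l -!mulrA ler_wpM2l//.
by rewrite mulrA.
Qed.

Variables (p eta C2 : R).
Hypothesis rp : r = 2 * p.
Hypothesis p2 : 2 <= p.
Hypothesis eta0 : 0 < eta.
Hypothesis C20 : 0 <= C2.
Hypothesis young : forall S X : R, 0 < S -> 0 <= X ->
  K * normal_variance * (X `^ (r - 2) * S `^ (- (p / 2))) <=
  p / 2 * S `^ (- (p / 2) - 1) * X `^ r + C2 * S `^ (p / 2 - 1).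

Let h k w : R := mesh k * bracket k w.
(** [eta] keeps the negative powers of the bracket bounded; in [one_step] it is the tolerance
    [c]. *)
Let SS k w : R := eta + total_bracket k w.

Let h_ge0 k w : 0 <= h k w. Proof. exact: mulr_ge0. Qed.

Let h_fil k : fil_fun Fil (g k) (h k).
Proof. by apply: fil_mul; [exact: fil_cst|exact: bracket_fil]. Qed.

Let SS_fil k : fil_fun Fil (g k) (SS k.+1).
Proof. by apply: fil_add; [exact: fil_cst|exact: total_bracket_fil]. Qed.

Let SS_eta k w : eta <= SS k w.
Proof. by rewrite lerDl; apply: sumr_ge0 => j _; exact: h_ge0. Qed.

Let SS_gt0 k w : 0 < SS k w. Proof. exact: lt_le_trans (SS_eta k w). Qed.

Let SS_S k w : SS k.+1 w = SS k w + h k w.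
Proof. by rewrite /SS /total_bracket big_ord_recr addrA. Qed.

Let SS_mono k n w : (k <= n)%N -> SS k w <= SS n w.
Proof.
have /nondecreasing_seqP h1 : forall n, SS n w <= SS n.+1 w by move=> l; rewrite SS_S lerDl.
exact: h1.
Qed.

Let SS_max k w : SS k w <= eta + k%:R * (T * Bmax).
Proof.
rewrite lerD2l -[k in X in _ <= X]card_ord -sum1_card natr_sum mulr_suml.
apply: ler_sum => j _; rewrite mul1r /h; apply: ler_pM => //.
by rewrite (le_trans _ (gT j.+1))// gerBl.
Qed.

Let SS_powN k b w : 0 <= b -> SS k w `^ (- b) <= eta `^ (- b).
Proof.
move=> b0; rewrite !powRN lef_pV2 ?posrE ?powR_gt0//.
by apply: ge0_ler_powR; rewrite ?nnegrE ?(ltW eta0)// ltW.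
Qed.

Let p0 : 0 < p. Proof. exact: lt_le_trans p2. Qed.

Let SS_meas k : measurable_fun setT (SS k).
Proof.
case: k => [|k]; last exact: (@meas k _ (@SS_fil k)).
rewrite (_ : SS 0 = cst eta); first exact: measurable_cst.
by apply/funext => w; rewrite /SS /total_bracket big_ord0 addr0.
Qed.

Let SS_int k q : 0 <= q -> Pint (fun w => SS k w `^ q).
Proof.
move=> q0; apply: (@bounded_integrable _ _ _ _ _ ((eta + k%:R * (T * Bmax)) `^ q)).
  exact: (measurableT_comp (measurable_powR q) (SS_meas k)).
move=> w; rewrite ger0_norm ?powR_ge0//; apply: ge0_ler_powR => //.
- by rewrite nnegrE ltW.
- by rewrite nnegrE (le_trans (ltW (SS_gt0 k point)) (SS_max k point)).
Qed.

Let h_int k q : 0 <= q -> Pint (fun w => h k w * SS k.+1 w `^ q).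
Proof.
move=> q0; apply: (@bounded_mul_integrable _ _ _ _ _ _ (T * Bmax)).
- exact: (@meas k _ (@h_fil k)).
- exact: SS_int.
move=> w; rewrite ger0_norm// /h; apply: ler_pM => //.
by rewrite (le_trans _ (gT k.+1))// gerBl.
Qed.

Let V_int k : Pint (fun w => SS k w `^ (- (p / 2)) * `|mart k w| `^ r).
Proof.
apply: (@bounded_mul_integrable _ _ _ _ _ _ (eta `^ (- (p / 2)))).
- exact: (measurableT_comp (measurable_powR _) (SS_meas k)).
- exact: mart_int.
by move=> w; rewrite ger0_norm ?powR_ge0// SS_powN// divr_ge0 ?(ltW p0).
Qed.

(** [mart_step] is used with the weight of [SS k.+1] at both times. Passing back to the weight of
    [SS k] yields the gain that pays for the second-order term. *)
Let V_step k : RE (fun w => SS k.+1 w `^ (- (p / 2)) * `|mart k.+1 w| `^ r) <=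
  RE (fun w => SS k w `^ (- (p / 2)) * `|mart k w| `^ r) +
  C2 * RE (fun w => h k w * SS k.+1 w `^ (p / 2 - 1)) +
  K * Cd * mesh k `^ p * eta `^ (- (p / 2)).
Proof.
have ph : 0 <= p / 2 by rewrite divr_ge0 ?(ltW p0).
have ph1 : 0 <= p / 2 - 1 by rewrite subr_ge0 ler_pdivlMr// mul1r.
have fw : fil_fun Fil (g k) (fun w => SS k.+1 w `^ (- (p / 2))) by exact: fil_powR (@SS_fil k).
have wb w : 0 <= SS k.+1 w `^ (- (p / 2)) <= eta `^ (- (p / 2)) by rewrite powR_ge0 SS_powN.
have [_] := mart_step fw wb.
rewrite (_ : r / 2 = p); last by rewrite rp; field.
move=> /le_trans; apply; rewrite lerD2r.
have wn w : `|SS k.+1 w `^ (- (p / 2))| <= eta `^ (- (p / 2)).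
  by rewrite ger0_norm ?powR_ge0// SS_powN.
have i1 := bounded_mul_integrable (@meas k _ fw) (mart_int k) wn.
have r22 : 0 <= r - 2 <= r by apply/andP; have := r2; split; lra.
have hb w : `|h k w| <= T * Bmax.
  rewrite ger0_norm// /h; apply: ler_pM => //.
  by rewrite (le_trans _ (gT k.+1))// gerBl.
have i2' := bounded_mul_integrable (@meas k _ fw) (mart_int_le k r22) wn.
have i2 : Pint (fun w => SS k.+1 w `^ (- (p / 2)) * `|mart k w| `^ (r - 2) * h k w).
  under eq_fun do rewrite mulrC.
  exact: (bounded_mul_integrable (@meas k _ (@h_fil k)) i2' hb).
have i3 := integrableZl measurableT (K * normal_variance) i2.
have i4 := integrableZl measurableT C2 (h_int k ph1).
rewrite -(RintegralZl (C2) measurableT (h_int k ph1)).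
rewrite -(RintegralZl (K * normal_variance) measurableT i2).
rewrite -(RintegralD measurableT i1 i3) -(RintegralD measurableT (V_int k) i4).
apply: le_Rintegral => //.
- exact: (integrableD measurableT i1 i3).
- exact: (integrableD measurableT (V_int k) i4).
move=> w _; set S := SS k.+1 w; set X := `|mart k w|.
have S'0 := SS_gt0 k w; have SS' : SS k w <= S by rewrite /S SS_S lerDl.
have e : S - SS k w = h k w by rewrite /S SS_S addrC addKr.
have := ler_wpM2r (powR_ge0 X r) (powR_inv_convex ph S'0 SS').
have := ler_wpM2l (h_ge0 k w) (young (SS_gt0 k.+1 w) (normr_ge0 (mart k w))).
rewrite -/S -/X e.
exact: weighted_drift.
Qed.

(* The weight [S^{-p/2}] with [S] the bracket replaces Doob's maximal inequality: it bounds
   [E |M|^{2p} S^{-p/2}] by [E S^{p/2}], and [|M|^p <= |M|^{2p} S^{-p/2} + S^{p/2}]. *)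
Lemma mart_moment n :
  Pint (fun w => `|mart n w| `^ p) /\
  RE (fun w => `|mart n w| `^ p) <=
    (C2 + 1) * RE (fun w => (eta + total_bracket n w) `^ (p / 2)) +
    K * Cd * eta `^ (- (p / 2)) * \sum_(k < n) mesh k `^ p.
Proof.
have ph : 0 <= p / 2 by rewrite divr_ge0 ?(ltW p0).
have ph1 : 0 <= p / 2 - 1 by rewrite subr_ge0 ler_pdivlMr// mul1r.
have pr : 0 <= p <= r by rewrite rp; have := p0; lra.
have ip := mart_int_le n pr.
have [isum esum] := sum_int (index_enum 'I_n) (fun k : 'I_n => h_int k ph1).
have ib := SS_int n ph.
split; first exact: ip.
have V_n : RE (fun w => SS n w `^ (- (p / 2)) * `|mart n w| `^ r) <=
    C2 * (\sum_(k < n) RE (fun w => h k w * SS k.+1 w `^ (p / 2 - 1))) +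
    K * Cd * eta `^ (- (p / 2)) * \sum_(k < n) mesh k `^ p.
  elim: n {ip isum esum ib} => [|n IH].
    rewrite !big_ord0 !mulr0 addr0 le_eqVlt; apply/orP; left; apply/eqP.
    rewrite /RE -[RHS](mul0r (fine (P setT))) -Rintegral_cst//; apply: eq_Rintegral => w _.
    by rewrite /mart big_ord0 normr0 powR0 ?mulr0// gt_eqF.
  by rewrite !big_ord_recr /=; apply: le_trans (V_step n) _; move: IH; lra.
(* [SS] increases and [p / 2 - 1 >= 0], so each power is at most the last one, while the [h k] add
   up to less than [SS n]. *)
have sum_le : \sum_(k < n) RE (fun w => h k w * SS k.+1 w `^ (p / 2 - 1)) <=
    RE (fun w => SS n w `^ (p / 2)).
  rewrite -esum; apply: le_Rintegral => // w _.
  have Sn : SS n w `^ (p / 2) = SS n w * SS n w `^ (p / 2 - 1).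
    rewrite -{2}(powRr1 (ltW (SS_gt0 n w))) -(powR_add _ _ (SS_gt0 n w)).
    by congr (_ `^ _); ring.
  rewrite Sn; apply: (@le_trans _ _ (\sum_(k < n) h k w * SS n w `^ (p / 2 - 1))).
    apply: ler_sum => k _; rewrite ler_wpM2l//; apply: ge0_ler_powR => //.
    - by rewrite nnegrE ltW.
    - by rewrite nnegrE ltW.
    - exact: SS_mono.
  by rewrite -mulr_suml ler_wpM2r ?powR_ge0// lerDr ltW.
(* With [x = X^p] and [s = S^{p/2}] this is [x <= x^2 / s + s]. *)
have V_p : RE (fun w => `|mart n w| `^ p) <=
    RE (fun w => SS n w `^ (- (p / 2)) * `|mart n w| `^ r) + RE (fun w => SS n w `^ (p / 2)).
  rewrite -RintegralD//; last exact: V_int.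
  apply: le_Rintegral => //; first exact: (integrableD measurableT (V_int n) ib).
  move=> w _; set X := `|mart n w|; set S := SS n w.
  have S0 : 0 < S `^ (p / 2) by apply: powR_gt0; exact: SS_gt0.
  have -> : X `^ r = (X `^ p) ^+ 2 by rewrite -powR_mulrn ?powR_ge0// -powRrM rp mulrC.
  rewrite powRN; move: (S `^ (p / 2)) (X `^ p) S0 (powR_ge0 X p) => s x s0 x0.
  have [xs|sx] := lerP x s; first by rewrite (le_trans xs)// lerDr mulr_ge0 ?sqr_ge0 ?invr_ge0 ?(ltW s0).
  apply: ler_wpDr; first exact: ltW.
  by rewrite mulrC ler_pdivlMr// expr2 ler_wpM2l// ltW.
have := ler_wpM2l C20 sum_le; rewrite -!/(SS _ _) mulrDl mul1r; move: V_n V_p; lra.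
Qed.

End discrete_martingale.

(** * Moments of Ito integrals *)

Section hs_norms.
Context {R : realType} {U V : hilbertType R}.
Variable b : nat -> U.
Hypothesis tb : onseq_total b.
Hypothesis hb : forall L : U -> V, L 0 = 0 ->
  (hs_norm L `^ 2 = \sum_(n <oo) (`|L (b n)| ^+ 2)%:E)%E.

Lemma hs_sqr_comb (m : nat) (c : 'I_m -> R) (u : 'I_m -> U) (v : 'I_m -> V) :
  (hs_norm (fun x => \sum_i (c i * inner (u i) x) *: v i)%R `^ 2 =
   (\sum_i \sum_j c i * c j * (inner (u i) (u j) * inner (v i) (v j)))%:E)%E.
Proof.
rewrite hb; last by rewrite big1// => i _; rewrite inner0r mulr0 scale0r.
have e n : \sum_(k < n) `|\sum_i (c i * inner (u i) (b k)) *: v i| ^+ 2 =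
    \sum_i \sum_j c i * c j * inner (v i) (v j) *
      (\sum_(k < n) inner (b k) (u i) * inner (b k) (u j)).
  transitivity (\sum_(k < n) \sum_i \sum_j c i * c j * inner (v i) (v j) *
      (inner (b k) (u i) * inner (b k) (u j))).
    apply: eq_bigr => k _; rewrite -inner_norm inner_suml; apply: eq_bigr => i _.
    rewrite innerZl inner_sumr mulr_sumr; apply: eq_bigr => j _.
    by rewrite innerZr !(innerC (b k)); ring.
  rewrite exchange_big; apply: eq_bigr => i _; rewrite exchange_big; apply: eq_bigr => j _.
  by rewrite mulr_sumr.
apply/cvg_lim => //; rewrite [X in X @ _ --> _](_ : _ = EFin \o (fun n =>
    \sum_i \sum_j c i * c j * inner (v i) (v j) *
      (\sum_(k < n) inner (b k) (u i) * inner (b k) (u j)))); last first.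
  by apply/funext => n /=; rewrite big_mkord sumEFin e.
apply: cvg_EFin; first by apply: nearW => n.
rewrite [X in _ --> X](_ : _ = \sum_i \sum_j c i * c j * inner (v i) (v j) *
      inner (u i) (u j)); last first.
  by apply: eq_bigr => i _; apply: eq_bigr => j _; ring.
apply: cvg_big => [|i _]; first exact: add_continuous.
apply: cvg_big => [|j _]; first exact: add_continuous.
by apply: cvgM; [exact: cvg_cst|exact: parseval].
Qed.

Lemma hs_sqr_add_le (L1 L2 : U -> V) : L1 0 = 0 -> L2 0 = 0 ->
  (hs_norm (fun x => L1 x + L2 x)%R `^ 2 <= 2%:E * hs_norm L1 `^ 2 + 2%:E * hs_norm L2 `^ 2)%E.
Proof.
move=> z1 z2; rewrite !hb//; last by rewrite z1 z2 addr0.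
rewrite -!nneseriesZl; try by move=> i _; rewrite lee_fin sqr_ge0.
rewrite -nneseriesD; try by move=> i _ _; rewrite -EFinM lee_fin mulr_ge0 ?sqr_ge0.
apply: lee_nneseries => [i _ _|n _]; first by rewrite lee_fin sqr_ge0.
rewrite -!EFinM -EFinD lee_fin normD2.
have := sqr_ge0 `|L1 (b n) - L2 (b n)|; rewrite normB2; lra.
Qed.

Lemma hs_sqr_opp (L : U -> V) : hs_norm (fun x => - L x) = hs_norm L.
Proof. by rewrite /hs_norm; under eq_esum do rewrite normrN. Qed.

End hs_norms.

Section grid.
Context {R : realType}.

(** No point of [l] lies inside a cell, so an elementary process with endpoints in [l] does not jump
    there. Being constant from index [n] on, the grid can be a function on [nat]. *)
Lemma grid_exists (l : seq R) (t : R) (M : nat) : 0 <= t ->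
  exists n (g : nat -> R), [/\ g 0%N = 0, forall k, (n <= k)%N -> g k = t,
    {homo g : j k / (j <= k)%N >-> j <= k},
    forall x k, x \in l -> x <= g k \/ g k.+1 <= x &
    forall k, g k.+1 - g k <= t / M.+1%:R].
Proof.
move=> t0; pose y j : R := t * j%:R / M.+1%:R.
pose s := sort <=%R ([:: 0; t] ++ [seq x <- l | 0 <= x <= t] ++ [seq y j | j <- iota 0 M.+2]).
have ss : sorted <=%R s by exact: sort_le_sorted.
have s0 : 0 \in s by rewrite mem_sort !inE eqxx.
have st : t \in s by rewrite mem_sort !inE eqxx orbT.
have sz : (0 < size s)%N by case: (s) s0.
have y0 : y 0%N = 0 by rewrite /y mulr0 mul0r.
have sb x : x \in s -> 0 <= x <= t.
  rewrite mem_sort !inE mem_cat mem_filter => /orP[/eqP->|/orP[/eqP->|/orP[/andP[]//|]]].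
  - by rewrite lexx.
  - by rewrite lexx t0.
  case/mapP => j; rewrite mem_iota add0n => /andP[_ jM] ->.
  rewrite /y divr_ge0 ?mulr_ge0//= ler_pdivrMr// ler_wpM2l// ler_nat -ltnS//.
pose g := nth t s.
have gb k : 0 <= g k <= t.
  have [ks|sk] := ltnP k (size s); first by apply: sb; exact: mem_nth.
  by rewrite /g nth_default// lexx t0.
have gm : {homo g : j k / (j <= k)%N >-> j <= k}.
  move=> j k jk; have [ks|sk] := ltnP k (size s); last first.
    by rewrite {2}/g nth_default//; case/andP: (gb j).
  apply: (sorted_leq_nth le_trans lexx t ss) => //; rewrite inE//.
  exact: leq_ltn_trans ks.
have gin x k : x \in s -> x <= g k \/ g k.+1 <= x.
  move=> xs; rewrite -(nth_index t xs) -/(g _).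
  by have [h|h] := leqP (index x s) k; [left|right]; apply: gm.
exists (size s).-1, g; split=> //.
- apply/eqP; rewrite eq_le; case/andP: (gb 0%N) => -> _; rewrite andbT.
  by rewrite -(nth_index t s0); apply: gm.
- move=> k nk; apply/eqP; rewrite eq_le; case/andP: (gb k) => _ -> /=.
  rewrite -{1}(nth_index t st); apply: gm; apply: leq_trans nk.
  by rewrite -ltnS prednK// index_mem.
- move=> x k xl; have [x0|x0] := ltP x 0; first by left; case/andP: (gb k) => ? _; lra.
  have [xt|xt] := leP x t; last by right; case/andP: (gb k.+1) => _ ?; lra.
  by apply: gin; rewrite mem_sort !mem_cat mem_filter x0 xt xl orbT.
(* If a cell were longer than the step of the equidistant points [y j], none of them could pass
   beyond [g k]; but the last one is [t]. *)
- move=> k; rewrite leNgt; apply/negP => h.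
  have yS j : y j.+1 = y j + t / M.+1%:R by rewrite /y -natr1; ring.
  have yg j : (j <= M.+1)%N -> y j <= g k.
    elim: j => [_|j IH jM]; first by rewrite y0; case/andP: (gb k).
    have /gin : y j.+1 \in s.
      rewrite mem_sort !mem_cat; apply/orP; right; apply/orP; right.
      by apply/mapP; exists j.+1 => //; rewrite mem_iota add0n /= ltnS.
    case/(_ k) => //; rewrite yS; have := IH (ltnW jM).
    by move: (t / M.+1%:R) h => dt; lra.
  have := yg M.+1 (leqnn _); rewrite /y mulfK ?pnatr_eq0//.
  have : 0 <= t / M.+1%:R by rewrite divr_ge0.
  by move: (t / M.+1%:R) h => dt h; case/andP: (gb k.+1); lra.
Qed.

End grid.

Section cut_moment.
Context {R : realType} {d : measure_display} {Omega : measurableType d}.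
Variables (P : probability Omega R) (T : R) (Fil : R -> set (set Omega)).
Hypothesis hFil : normal_filtration P T Fil.
Context {U V : hilbertType R} (W : R -> U -> Omega -> R).
Hypothesis hW : cylindrical_wiener P T Fil W.
Variable b : nat -> U.
Hypothesis tb : onseq_total b.
Hypothesis hb : forall L : U -> V, L 0 = 0 ->
  (hs_norm L `^ 2 = \sum_(n <oo) (`|L (b n)| ^+ 2)%:E)%E.
Local Notation elt := (elementary T Fil U V).

Let comb_ge0 (m : nat) (c : 'I_m -> R) (u : 'I_m -> U) (v : 'I_m -> V) :
  0 <= \sum_i \sum_j c i * c j * (inner (u i) (u j) * inner (v i) (v j)).
Proof. by rewrite -lee_fin -(hs_sqr_comb tb hb) poweR_ge0. Qed.

Section fixed_grid.
Variables (Z : elt) (t : R) (D : R -> set Omega) (K : R) (n : nat) (g : nat -> R).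
Hypothesis tT : 0 <= t <= T.
Hypothesis FD : forall s, 0 <= s <= T -> Fil s (D s).
Hypothesis DD : forall s s', 0 <= s -> s <= s' -> s' <= T -> D s' `<=` D s.
Hypothesis K0 : 0 <= K.
Hypothesis g0 : g 0%N = 0.
Hypothesis gt : forall k, (n <= k)%N -> g k = t.
Hypothesis gm : {homo g : j k / (j <= k)%N >-> j <= k}.
Hypothesis ga : forall (i : 'I_(el_size Z)) k, el_a i <= g k \/ g k.+1 <= el_a i.
Hypothesis gb : forall (i : 'I_(el_size Z)) k, el_b i <= g k \/ g k.+1 <= el_b i.

Let gg0 k : 0 <= g k. Proof. by rewrite -g0 gm. Qed.
Let ggt k : g k <= t.
Proof. by have [/gt->//|/ltnW kn] := leqP n k; rewrite -(gt (leqnn n)) gm. Qed.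
Let ggT k : g k <= T. Proof. by case/andP: tT => _; exact: le_trans. Qed.
Let ggS k : g k <= g k.+1. Proof. exact: gm. Qed.

Definition el_active k (i : 'I_(el_size Z)) := (el_a i <= g k) && (g k.+1 <= el_b i).
(** The indicator of [D] is taken at the left end of the cell, which keeps the coefficient adapted.
    As [D] decreases in time, all these indicators equal 1 on [D t]. *)
Definition el_coeff k (i : 'I_(el_size Z)) w : R := (el_active k i)%:R * \1_(el_A i) w * \1_(D (g k)) w.
Let br0 := bracket (el_u (e:=Z)) (el_v (e:=Z)) el_coeff.
Let Q := total_bracket (el_u (e:=Z)) (el_v (e:=Z)) g el_coeff.
(** Switched off as soon as the bracket including the present cell exceeds [K]. That bracket is
    known at [g k], so the coefficient stays adapted, and the bracket of the cut process never
    exceeds [K]. *)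
Definition el_coeff_cut k (i : 'I_(el_size Z)) w : R := el_coeff k i w * \1_[set w | Q k.+1 w <= K] w.

Let gg k : 0 <= g k <= T. Proof. by rewrite gg0 ggT. Qed.

Let coeff_fil k (i : 'I_(el_size Z)) : fil_fun Fil (g k) (el_coeff k i).
Proof.
apply: fil_mul; last exact: (fil_fun_indic hFil (gg k) (FD (gg k))).
rewrite /el_active; case: (boolP (_ && _)) => [/andP[ak kb]|_]; last first.
  by under eq_fun do rewrite mul0r; exact: fil_cst.
apply: fil_mul; first exact: fil_cst.
apply: (fil_fun_indic hFil (gg k)).
have [a0 ab bT] := el_ab i.
by case: hFil => _ + _ _; apply; [exact: a0|exact: ak|exact: ggT|exact: el_meas].
Qed.

Let Q_fil k : fil_fun Fil (g k) (Q k.+1).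
Proof. exact: (total_bracket_fil hFil (el_u (e:=Z)) (el_v (e:=Z)) gg0 ggT ggS
  (fun k i => @coeff_fil k i) (k := k)). Qed.

Let cut_fil k (i : 'I_(el_size Z)) : fil_fun Fil (g k) (el_coeff_cut k i).
Proof.
apply: fil_mul; first exact: coeff_fil.
apply: (fil_fun_indic hFil (gg k)).
have /(fil_funP hFil (Q k.+1) (gg k)) h := @Q_fil k.
have := h `]-oo, K]%classic; rewrite /preimage /= => {}h.
rewrite (_ : [set w | _] = [set w | Q k.+1 w \in `]-oo, K]]); first by apply: h.
by apply/seteqP; split => w; rewrite /= in_itv.
Qed.

Let coeff_le k (i : 'I_(el_size Z)) w : `|el_coeff k i w| <= 1.
Proof.
rewrite /el_coeff !indicE.
by case: (el_active k i); case: (w \in el_A i); case: (w \in D (g k));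
  rewrite ?(mulr0, mul0r, mulr1, normr0, normr1).
Qed.

Let cut_le k (i : 'I_(el_size Z)) w : `|el_coeff_cut k i w| <= 1.
Proof.
rewrite normrM -[leRHS]mulr1; apply: ler_pM => //.
by rewrite indicE; case: (w \in _); rewrite ?normr0 ?normr1.
Qed.

Let br0_ge0 k w : 0 <= br0 k w. Proof. exact: comb_ge0. Qed.

Let Q_S k w : Q k.+1 w = Q k w + (g k.+1 - g k) * br0 k w.
Proof. by rewrite /Q /total_bracket big_ord_recr. Qed.

Let mesh_br k w : 0 <= (g k.+1 - g k) * br0 k w.
Proof. by rewrite mulr_ge0// subr_ge0. Qed.

Let Q_mono j k w : (j <= k)%N -> Q j w <= Q k w.
Proof.
have /nondecreasing_seqP h1 : forall l, Q l w <= Q l.+1 w by move=> l; rewrite Q_S lerDl.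
exact: h1.
Qed.

Let Q_ge0 k w : 0 <= Q k w.
Proof. by apply: le_trans (Q_mono w (leq0n k)); rewrite /Q /total_bracket big_ord0. Qed.

Let Qc := total_bracket (el_u (e:=Z)) (el_v (e:=Z)) g el_coeff_cut.

Let bracket_cut k w : bracket (el_u (e:=Z)) (el_v (e:=Z)) el_coeff_cut k w =
  \1_[set w | Q k.+1 w <= K] w * br0 k w.
Proof.
rewrite /br0 /bracket mulr_sumr; apply: eq_bigr => i _.
rewrite mulr_sumr; apply: eq_bigr => j _; rewrite /el_coeff_cut indicE.
by case: (w \in _); rewrite ?mulr1 ?mul1r// !(mulr0, mul0r).
Qed.

Let Qc_S k w : Qc k.+1 w = Qc k w + (g k.+1 - g k) * (\1_[set w | Q k.+1 w <= K] w * br0 k w).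
Proof. by rewrite /Qc /total_bracket big_ord_recr /= bracket_cut. Qed.

Let Qc_le k w : Qc k w <= Num.min (Q k w) K.
Proof.
elim: k => [|k IH].
  by rewrite /Qc /Q /total_bracket !big_ord0 le_min lexx.
have h1 : Qc k.+1 w <= Q k.+1 w.
  rewrite Qc_S Q_S; apply: lerD; first by move: IH; rewrite le_min => /andP[].
  rewrite ler_wpM2l ?subr_ge0 ?ggS// ler_piMl ?br0_ge0//.
rewrite le_min h1 /=; have [QK|QK] := lerP (Q k.+1 w) K; first exact: le_trans QK.
rewrite Qc_S indicE memNset ?mul0r ?mulr0 ?addr0//=; last by apply/negP; rewrite -ltNge.
by move: IH; rewrite le_min => /andP[].
Qed.

Let Qc_ge0 k w : 0 <= Qc k w.
Proof.
apply: sumr_ge0 => j _; rewrite mulr_ge0 ?subr_ge0//.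
exact: comb_ge0.
Qed.

Let active_dichotomy k (i : 'I_(el_size Z)) : el_active k i = false -> el_b i <= g k \/ g k.+1 <= el_a i.
Proof.
rewrite /el_active; have [h|h] := ga i k; last by right.
by rewrite h /=; have [h'|->//] := gb i k; left.
Qed.

(** As a function of time, a term of the elementary integral grows on a cell by the increment of [W]
    if it is active there and is unchanged otherwise; summed over the cells, this telescopes. *)
Let active_incr k (i : 'I_(el_size Z)) w (x := el_u i) :
  (el_active k i)%:R * incr W (g k) (g k.+1) x w =
  (W (Num.min (el_b i) (g k.+1)) x w - W (Num.min (el_a i) (g k.+1)) x w) -
  (W (Num.min (el_b i) (g k)) x w - W (Num.min (el_a i) (g k)) x w).
Proof.
have [a0 ab bT] := el_ab i; have gk := ggS k; rewrite /incr.
case: (boolP (el_active k i)) => [/andP[ak kb]|/negbTE /active_dichotomy[h|h]].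
- rewrite mul1r (min_idPr kb) (min_idPr (le_trans gk kb)) (min_idPl ak).
  by rewrite (min_idPl (le_trans ak gk)); ring.
- rewrite mul0r (min_idPl h) (min_idPl (le_trans h gk)).
  rewrite (min_idPl (le_trans ab h)) (min_idPl (le_trans ab (le_trans h gk))); ring.
- rewrite mul0r (min_idPr h) (min_idPr (le_trans h ab)).
  by rewrite (min_idPr (le_trans gk h)) (min_idPr (le_trans gk (le_trans h ab))); ring.
Qed.

Let mart_el w : D t w -> Q n w <= K ->
  mart W (el_u (e:=Z)) (el_v (e:=Z)) g el_coeff_cut n w = el_integral W Z t w.
Proof.
move=> Dw QK; rewrite /mart /mart_diff /incr_comb exchange_big /= /el_integral.
apply: eq_bigr => i _; rewrite -scaler_suml; congr (_ *: _).
transitivity (\sum_(k < n) \1_(el_A i) w *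
    ((el_active k i)%:R * incr W (g k) (g k.+1) (el_u i) w)).
  apply: eq_bigr => k _; rewrite /el_coeff_cut /el_coeff.
  rewrite [\1_(D _) w]indicE mem_set; last first.
    by apply: (DD (gg0 k) (ggt k) _ Dw); case/andP: tT.
  rewrite [\1_[set w0 | _] w]indicE mem_set /=; last by apply: le_trans QK; exact: Q_mono.
  by ring.
rewrite -mulr_sumr; congr (_ * _).
under eq_bigr do rewrite active_incr.
rewrite -(big_mkord xpredT (fun k => (W (Num.min (el_b i) (g k.+1)) (el_u i) w -
    W (Num.min (el_a i) (g k.+1)) (el_u i) w) -
  (W (Num.min (el_b i) (g k)) (el_u i) w - W (Num.min (el_a i) (g k)) (el_u i) w))).
rewrite (telescope_sumr (fun k => W (Num.min (el_b i) (g k)) (el_u i) w -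
    W (Num.min (el_a i) (g k)) (el_u i) w))//.
have [a0 ab bT] := el_ab i.
by rewrite (gt (leqnn n)) g0 (min_idPr a0) (min_idPr (le_trans a0 ab)) subrr subr0.
Qed.

Let cell_bracket k s w : g k < s < g k.+1 ->
  ((br0 k w)%:E = (\1_(D (g k)) w)%:E * hs_norm (el_val Z s w) `^ 2)%E.
Proof.
move=> /andP[gs sg]; rewrite /el_val (hs_sqr_comb tb hb) -EFinM; congr (_%:E).
rewrite /br0 /bracket mulr_sumr; apply: eq_bigr => i _.
rewrite mulr_sumr; apply: eq_bigr => j _.
have e l : \1_(`]el_a l, el_b l]) s = (el_active k l)%:R :> R.
  rewrite indicE; congr (nat_of_bool _)%:R; rewrite mem_setE /= in_itv /=.
  case: (boolP (el_active k l)) => [/andP[ak kb]|/negbTE /active_dichotomy[h|h]].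
  - by rewrite (le_lt_trans ak gs) (le_trans (ltW sg) kb).
  - by rewrite [X in _ && X]leNgt (le_lt_trans h gs) andbF.
  - by rewrite ltNge (le_trans (ltW sg) h).
rewrite !e /el_coeff [\1_(D _) w]indicE.
by case: (w \in D (g k)); rewrite ?mulr1 ?mul1r// !(mulr0, mul0r).
Qed.

Variable h : R.
Hypothesis gh : forall k, g k.+1 - g k <= h.

(** On the cell of [s] the coefficient carries [D (g k)] rather than [D s], and the mesh only gives
    [g k >= s - h]. This is the origin of the time lag, removed later by the left continuity of
    [D]. *)
Let Q_integral w : ((Q n w)%:E <= \int[lebesgue_measure]_(s in `[0%R, t[)
   ((\1_(D (Num.max 0 (s - h))) w)%:E * hs_norm (el_val Z s w) `^ 2))%E.
Proof.
have e : ((Q n w)%:E = \int[lebesgue_measure]_(s in `[0%R, t[)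
    (\sum_(k < n) (br0 k w)%:E * (\1_(`]g k, g k.+1[) s)%:E))%E.
  rewrite ge0_integral_sum//; last 2 first.
  - by move=> k; apply: measurable_funeM; apply/measurable_EFinP; exact: measurable_indic.
  - by move=> k s _; rewrite -EFinM lee_fin mulr_ge0.
  rewrite /Q /total_bracket -sumEFin; apply: eq_bigr => k _.
  rewrite ge0_integralZl ?lee_fin//; last by apply/measurable_EFinP; exact: measurable_indic.
  rewrite integral_indic// (_ : _ `&` _ = `]g k, g k.+1[%classic); last first.
    apply/seteqP; split => s /=; rewrite !in_itv /=; first by case.
    move=> /andP[h1 h2]; split; first by rewrite h1 h2.
    by rewrite (le_trans (gg0 k) (ltW h1)) (lt_le_trans h2 (ggt k.+1)).
  have mu : lebesgue_measure (`]g k, g k.+1[%classic : set R) = (g k.+1 - g k)%:E.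
    rewrite lebesgue_measure_itv /= lte_fin; case: ltP => [_|h1]; first by rewrite EFinB.
    by rewrite (_ : g k.+1 - g k = 0)//; apply/eqP; rewrite subr_eq0 eq_le h1 ggS.
  transitivity ((br0 k w)%:E * (g k.+1 - g k)%:E)%E; first by rewrite -EFinM mulrC.
  by congr (_ * _)%E; exact: esym mu.
rewrite e; apply: ge0_le_integral_nomeas => s /=; rewrite in_itv /= => /andP[s0 st].
  by apply: sume_ge0 => k _; rewrite -EFinM lee_fin mulr_ge0.
have r0 : (0 <= (\1_(D (Num.max 0 (s - h))) w)%:E * hs_norm (el_val Z s w) `^ 2)%E.
  by rewrite mule_ge0 ?lee_fin ?poweR_ge0.
have [[k /andP[gs sg]]|no] := pselect (exists k : 'I_n, g k < s < g k.+1); last first.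
  rewrite big1// => k _; rewrite indicE memNset ?mule0//= in_itv /= => gsg.
  by apply: no; exists k.
rewrite (bigD1 k)//= big1 ?adde0; last first.
  move=> j jk; rewrite indicE memNset ?mule0//= in_itv /= => /andP[js sj].
  have [jk'|kj|/val_inj e'] := ltngtP j k; last by rewrite e' eqxx in jk.
  - by have := gm jk'; rewrite leNgt (lt_trans gs sj).
  - by have := gm kj; rewrite leNgt (lt_trans js sg).
rewrite indicE mem_set ?mule1//=; last by rewrite in_itv /= gs sg.
rewrite (@cell_bracket k s w) ?gs ?sg// lee_wpmul2r ?poweR_ge0// lee_fin.
rewrite !indicE; case: (boolP (w \in D (g k))) => [/set_mem Dw|_]; last exact: ler0n.
rewrite mem_set//; apply: (DD _ _ (ggT k) Dw); first by rewrite le_max lexx.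
by rewrite ge_max gg0 /=; have := gh k; lra.
Qed.

Lemma grid_moment (p Kt C2 Cd eta : R) : 2 <= p -> 0 < eta -> 0 <= Kt -> 0 <= C2 ->
  (forall x y : V, `|x + y| `^ (2 * p) <= `|x| `^ (2 * p) + 2 * p * `|x| `^ (2 * p - 2) * inner x y
    + Kt * (`|x| `^ (2 * p - 2) * `|y| ^+ 2 + `|y| `^ (2 * p))) ->
  (forall S X : R, 0 < S -> 0 <= X ->
    Kt * normal_variance * (X `^ (2 * p - 2) * S `^ (- (p / 2))) <=
    p / 2 * S `^ (- (p / 2) - 1) * X `^ (2 * p) + C2 * S `^ (p / 2 - 1)) ->
  incr_comb_bound P T Fil W (el_u (e:=Z)) (el_v (e:=Z)) (2 * p) Cd ->
  exists Q : Omega -> R, [/\ measurable_fun setT Q, forall w, 0 <= Q w,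
    forall w, ((Q w)%:E <= \int[lebesgue_measure]_(s in `[0%R, t[)
      ((\1_(D (Num.max 0 (s - h))) w)%:E * hs_norm (el_val Z s w) `^ 2))%E &
    (\int[P]_(w in D t `&` [set w | (Q w <= K)%R]) (`|el_integral W Z t w| `^ p)%:E <=
      ((C2 + 1) * \int[P]_w ((eta + Num.min (Q w) K) `^ (p / 2)) +
       Kt * Cd * eta `^ (- (p / 2)) * \sum_(k < n) (g k.+1 - g k) `^ p)%:E)%E].
Proof.
move=> p2 eta0 Kt0 C20 taylor young HCd; exists (Q n).
have mQ : measurable_fun setT (Q n).
  case: n => [|k]; last exact: (fil_fun_measurable hFil (gg k) (@Q_fil k)).
  rewrite (_ : Q 0 = cst 0); first exact: measurable_cst.
  by apply/funext => w; rewrite /Q /total_bracket big_ord0.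
split=> //.
have ph : 0 <= p / 2 by rewrite divr_ge0// (le_trans _ p2).
have r2 : 2 <= 2 * p by lra.
have [i1 h1] := mart_moment hFil hW gg0 ggT ggS (fun k i => @cut_fil k i) cut_le
  (fun k w => comb_ge0 _ _ _) r2 HCd Kt0 taylor erefl p2 eta0 C20 young n.
apply: (@le_trans _ _ (\int[P]_w (`|mart W (el_u (e:=Z)) (el_v (e:=Z)) g el_coeff_cut n w| `^ p)%:E)%E).
  rewrite integral_mkcond; apply: ge0_le_integral_nomeas => w _; rewrite patchE.
    by case: ifPn => _; rewrite ?lee_fin ?powR_ge0.
  case: ifPn => [/set_mem[Dw /= Qw]|_]; last by rewrite lee_fin powR_ge0.
  by rewrite mart_el.
rewrite (fin_integral_ge0 i1) lee_fin; apply: le_trans h1 _.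
rewrite lerD2r ler_wpM2l ?addr_ge0//.
have b1 w : 0 <= eta + Qc n w by rewrite addr_ge0// ltW.
have b2 w : 0 <= eta + Num.min (Q n w) K.
  by rewrite addr_ge0 ?(ltW eta0)// le_min Q_ge0.
have b3 w : eta + Qc n w <= eta + K.
  by rewrite lerD2l; have := Qc_le n w; rewrite le_min => /andP[].
have b4 w : eta + Num.min (Q n w) K <= eta + K by rewrite lerD2l ge_min lexx orbT.
have eK : 0 <= eta + K by rewrite addr_ge0// ltW.
have mQc : measurable_fun setT (Qc n).
  case: n => [|k].
    rewrite (_ : Qc 0 = cst 0); first exact: measurable_cst.
    by apply/funext => w; rewrite /Qc /total_bracket big_ord0.
  exact: (fil_fun_measurable hFil (gg k) (total_bracket_fil hFil (el_u (e:=Z)) (el_v (e:=Z)) gg0 ggT ggS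
    (fun k i => @cut_fil k i) (k := k))).
apply: le_Rintegral => //.
- apply: (@bounded_integrable _ _ _ _ _ ((eta + K) `^ (p / 2))).
    apply: (measurableT_comp (measurable_powR _)); exact: measurable_funD.
  by move=> w; rewrite ger0_norm ?powR_ge0//; apply: ge0_ler_powR; rewrite ?nnegrE ?b1 ?b2 ?b3 ?b4.
- apply: (@bounded_integrable _ _ _ _ _ ((eta + K) `^ (p / 2))).
    apply: (measurableT_comp (measurable_powR _)); apply: measurable_funD => //.
    exact: measurable_minr.
  by move=> w; rewrite ger0_norm ?powR_ge0//; apply: ge0_ler_powR; rewrite ?nnegrE ?b1 ?b2 ?b3 ?b4.
by move=> w _; apply: ge0_ler_powR; rewrite ?nnegrE// lerD2l Qc_le.
Qed.

End fixed_grid.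

(** [C] is independent of the elementary process. The constant [Cd] that does depend on it
    multiplies only the sum of [mesh^p], and this product is brought below [e] by refining the
    grid. *)
Lemma cut_moment (p : R) : 2 <= p -> exists2 C : R, 0 <= C &
  forall (Z : elt) (t : R) (D : R -> set Omega) (K eta h e : R), 0 <= t <= T ->
  (forall s, 0 <= s <= T -> Fil s (D s)) ->
  (forall s s', 0 <= s -> s <= s' -> s' <= T -> D s' `<=` D s) ->
  0 <= K -> 0 < eta -> 0 < h -> 0 < e ->
  exists Q : Omega -> R, [/\ measurable_fun setT Q, forall w, 0 <= Q w,
    forall w, ((Q w)%:E <= \int[lebesgue_measure]_(s in `[0%R, t[)
      ((\1_(D (Num.max 0 (s - h))) w)%:E * hs_norm (el_val Z s w) `^ 2))%E &
    (\int[P]_(w in D t `&` [set w | (Q w <= K)%R]) (`|el_integral W Z t w| `^ p)%:E <=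
      (C * \int[P]_w ((eta + Num.min (Q w) K) `^ (p / 2)) + e)%:E)%E].
Proof.
move=> p2; have p0 : 0 < p by lra.
have [Kt Kt0 taylor] := @norm_powR_taylor R V (2 * p) ltac:(lra).
have c0 : 0 <= Kt * normal_variance by rewrite mulr_ge0 ?normal_variance_ge0.
have [C2 C20 young] := @drift_young R (p / 2) _ p ltac:(lra) c0 ltac:(lra).
exists (C2 + 1); first exact: addr_ge0.
move=> Z t D K eta h e tT FD DD K0 eta0 h0 e0.
have t0 : 0 <= t by case/andP: tT.
have [Cd Cd0 HCd] := incr_comb_moment hFil hW (el_u (e:=Z)) (el_v (e:=Z)) (r := 2 * p) ltac:(lra).
pose a := Kt * Cd * eta `^ (- (p / 2)).
have a0 : 0 <= a by rewrite mulr_ge0 ?powR_ge0// mulr_ge0.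
(* The three summands make the mesh at most [h], at most 1, and so small that [a] times mesh times
   [t] is at most [e]. *)
pose x := t / h + t + a * t * t / e.
have th0 : 0 <= t / h by rewrite divr_ge0// ltW.
have ate0 : 0 <= a * t * t / e by rewrite divr_ge0 ?(ltW e0)// mulr_ge0// mulr_ge0.
have x0 : 0 <= x by rewrite addr_ge0// addr_ge0.
have := archi_boundP x0; set M := Num.bound x => xM.
have M1 : x < M.+1%:R by apply: lt_le_trans xM _; rewrite ler_nat.
have Mp : 0 < M.+1%:R :> R by [].
have d1 : t / M.+1%:R <= h.
  rewrite ler_pdivrMr// mulrC -ler_pdivrMr//; move: M1; rewrite /x; lra.
have d2 : t / M.+1%:R <= 1 by rewrite ler_pdivrMr// mul1r; move: M1; rewrite /x; lra.
have d3 : a * (t / M.+1%:R * t) <= e.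
  rewrite (_ : a * _ = a * t * t / M.+1%:R); last by ring.
  by rewrite ler_pdivrMr// [leRHS]mulrC -ler_pdivrMr//; move: M1; rewrite /x; lra.
have [n [g [g0 gt gm gl gM]]] := grid_exists ([seq el_a i | i <- enum 'I_(el_size Z)] ++
  [seq el_b i | i <- enum 'I_(el_size Z)]) M t0.
have ga (i : 'I_(el_size Z)) k : el_a i <= g k \/ g k.+1 <= el_a i.
  by apply: gl; rewrite mem_cat map_f// mem_enum.
have gb (i : 'I_(el_size Z)) k : el_b i <= g k \/ g k.+1 <= el_b i.
  by apply: gl; rewrite mem_cat (map_f (fun i => el_b i)) ?orbT// mem_enum.
have gh k : g k.+1 - g k <= h by apply: le_trans (gM k) d1.
have young' S X : 0 < S -> 0 <= X ->
    Kt * normal_variance * (X `^ (2 * p - 2) * S `^ (- (p / 2))) <=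
    p / 2 * S `^ (- (p / 2) - 1) * X `^ (2 * p) + C2 * S `^ (p / 2 - 1).
  move=> S0 X0; apply: le_trans (young S X S0 X0) _.
  by rewrite (_ : p - 1 - p / 2 = p / 2 - 1)//; field.
have [Q [mQ Q0 Qi QM]] := grid_moment tT FD DD K0 g0 gt gm ga gb gh p2 eta0 Kt0 C20 taylor young' HCd.
exists Q; split=> //; apply: le_trans QM _; rewrite lee_fin lerD2l -/a.
apply: le_trans d3; rewrite ler_wpM2l//.
apply: (@le_trans _ _ (\sum_(k < n) t / M.+1%:R * (g k.+1 - g k))).
  apply: ler_sum => k _.
  have dk0 : 0 <= g k.+1 - g k by rewrite subr_ge0 gm.
  apply: (@le_trans _ _ ((g k.+1 - g k) * (g k.+1 - g k))); last by rewrite ler_wpM2r.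
  have [->|dk] := eqVneq (g k.+1 - g k) 0; first by rewrite powR0 ?mulr0// gt_eqF.
  rewrite -expr2 -powR_mulrn//; apply: ger_powR => //.
  by rewrite lt_neqAle eq_sym dk dk0 (le_trans (gM k)).
rewrite -mulr_sumr -(big_mkord xpredT (fun k => g k.+1 - g k)) telescope_sumr//.
by rewrite (gt _ (leqnn n)) g0 subr0.
Qed.

End cut_moment.

Section measurability.
Context {R : realType}.
Local Notation Rm := (measurableTypeR R).

Lemma continuous_preimage_borel (E : topologicalType) (f : E -> R) (C : set R) :
  continuous f -> measurable C -> borel (f @^-1` C).
Proof.
move=> cf mC; have := measurable_borel mC; rewrite /borel.
have sa : sigma_algebra setT [set A : set R | borel (f @^-1` A)].
  have [s1 s2 s3] := smallest_sigma_algebra (setT : set E) [set O | open O].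
  split.
  - by rewrite /= preimage_set0.
  - by move=> A /= /s2; rewrite !setTD preimage_setC.
  - by move=> A /= bA; rewrite preimage_bigcup; exact: s3.
move=> bC; apply: (@smallest_sub _ _ _ _ sa _ C bC) => O oO /=.
apply: sub_sigma_algebra => /=; by apply: open_comp => // x _; exact: cf.
Qed.

Context {d : measure_display} {T : measurableType d} {V : hilbertType R}.

Lemma measurable_lt_set (f g : T -> R) : measurable_fun setT f -> measurable_fun setT g ->
  measurable [set x | f x < g x].
Proof.
move=> /measurable_EFinP mf /measurable_EFinP mg.
have := measurable_lte measurableT mf mg; rewrite setTI.
by congr measurable; apply/seteqP; split => x /=; rewrite lte_fin.
Qed.

Variable e : nat -> V.
Hypothesis te : onseq_total e.

(** Parseval's identity writes the squared norm as a series of squared coordinates. *)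
Lemma measurable_norm_coord (D : set T) (f : T -> V) : measurable D ->
  (forall i, measurable_fun D (fun x => inner (e i) (f x))) ->
  measurable_fun D (fun x => `|f x|).
Proof.
move=> mD mf.
have h : measurable_fun D (fun x => (`|f x| ^+ 2)%:E).
  under eq_fun do rewrite -(parseval_series _ te).
  apply: ge0_emeasurable_sum => [k x _ _|k _]; first by rewrite lee_fin sqr_ge0.
  by apply/measurable_EFinP; exact: measurable_funX.
have -> : (fun x => `|f x|) = (fun x => (`|f x| ^+ 2) `^ 2^-1).
  by apply/funext => x; rewrite powR12_sqrt ?sqr_ge0// sqrtr_sqr normr_id.
apply: (measurableT_comp (measurable_powR 2^-1)).
exact/measurable_EFinP.
Qed.

End measurability.

Section section_integrals.
Context {R : realType} {d : measure_display} {Omega : measurableType d}.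
Local Notation Rm := (measurableTypeR R).
Variable t : R.
Local Notation I := (`[0%R, t[%classic : set Rm).

Lemma measurable_strip : measurable (I `*` [set: Omega]).
Proof. by apply: measurableX. Qed.

Lemma measurable_section_integral (G : Rm * Omega -> \bar R) :
  measurable_fun (I `*` [set: Omega]) G -> (forall z, 0 <= G z)%E ->
  measurable_fun setT (fun w => \int[lebesgue_measure]_(s in I) G (s, w))%E.
Proof.
move=> mG G0; pose f := G \_ (I `*` [set: Omega]).
have mf : measurable_fun setT f.
  by apply/(measurable_restrictT G measurable_strip).
have f0 z : (0 <= f z)%E by rewrite /f patchE; case: ifP.
have := @measurable_fun_fubini_tonelli_G _ _ Rm Omega R lebesgue_measure f mf f0.
rewrite (_ : fubini_G _ _ = (fun w => \int[lebesgue_measure]_(s in I) G (s, w))%E)//.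
apply/funext => w; rewrite /fubini_G [RHS]integral_mkcond; apply: eq_integral => s _.
by rewrite /f !patchE in_setX /= in_setT andbT.
Qed.

Lemma measurable_section (G : Rm * Omega -> \bar R) w :
  measurable_fun (I `*` [set: Omega]) G -> measurable_fun I (fun s => G (s, w)).
Proof.
move=> mG; apply/(measurable_restrictT _ _) => //=.
have mf : measurable_fun setT (G \_ (I `*` [set: Omega])).
  by apply/(measurable_restrictT G measurable_strip).
have := @measurable_fun_pair1 _ _ _ Rm Omega _ _ w mf.
congr (measurable_fun _ _); apply/funext => s.
by rewrite !patchE in_setX /= in_setT andbT.
Qed.

End section_integrals.

Section ge0_integrals.
Context {R : realType} {d : measure_display} {T : measurableType d}.
Variable mu : {measure set T -> \bar R}.
Implicit Types f g : T -> \bar R.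

Lemma integralD_ge0 f g : measurable_fun setT f -> measurable_fun setT g ->
  (forall x, 0 <= f x)%E -> (forall x, 0 <= g x)%E ->
  (\int[mu]_x (f x + g x) = \int[mu]_x f x + \int[mu]_x g x)%E.
Proof. by move=> mf mg f0 g0; rewrite ge0_integralD. Qed.

Lemma integralZ_ge0 (k : R) f : 0 <= k -> measurable_fun setT f -> (forall x, 0 <= f x)%E ->
  (\int[mu]_x (k%:E * f x) = k%:E * \int[mu]_x f x)%E.
Proof. by move=> k0 mf f0; rewrite ge0_integralZl. Qed.

End ge0_integrals.

Section ito_limit.
Context {R : realType} {d : measure_display} {Omega : measurableType d}.
Variables (P : probability Omega R) (T : R) (Fil : R -> set (set Omega)).
Hypothesis hFil : normal_filtration P T Fil.
Hypothesis T0 : 0 <= T.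
Context {U V : hilbertType R} (W : R -> U -> Omega -> R).
Hypothesis hW : cylindrical_wiener P T Fil W.
Variables (b : nat -> U) (e : nat -> V).
Hypothesis tb : onseq_total b.
Hypothesis te : onseq_total e.
Hypothesis hb : forall L : U -> V, L 0 = 0 ->
  (hs_norm L `^ 2 = \sum_(n <oo) (`|L (b n)| ^+ 2)%:E)%E.
Local Notation Rm := (measurableTypeR R).
Local Notation elt := (elementary T Fil U V).
Local Notation strip t := ((`[0%R, t[%classic : set Rm) `*` [set: Omega]).

(* Measurability is only asked coordinatewise, which makes the notion stable under
   subtraction without discussing the Borel sets of [V * V]. *)
Definition ito_approx (t : R) (Phi : R -> Omega -> U -> V) (J : Omega -> V) : Prop :=
  [/\ forall u i, measurable_fun (strip t) (fun z => inner (e i) (Phi z.1 z.2 u)),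
      forall i, measurable_fun setT (fun w => inner (e i) (J w)),
      forall s w, 0 <= s < t -> Phi s w 0 = 0
    & exists Z : nat -> elt,
      (forall c : R, 0 < c ->
        P [set w | (c%:E < \int[lebesgue_measure]_(s in `[0%R, t[)
             (hs_norm (fun u => Phi s w u - el_val (Z n) s w u)%R) `^ 2)%E]
        @[n --> \oo] --> 0%E) /\
      (forall c : R, 0 < c ->
        P [set w | c < `|el_integral W (Z n) t w - J w|] @[n --> \oo] --> 0%E)].

Lemma predictable_measurable (D : set (R * Omega)) : predictable T Fil D ->
  measurable (D : set (Rm * Omega)).
Proof.
have mT : measurable (`[0, T]%classic `*` [set: Omega] : set (Rm * Omega)).
  by apply: measurableX.
have sa : sigma_algebra (`[0, T] `*` [set: Omega]) [set A : set (Rm * Omega) | measurable A].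
  split => [|A mA|A mA]; [exact: measurable0|exact: measurableD|].
  exact: (@bigcupT_measurable _ _ A mA).
apply: smallest_sub => // A [[a [c [B [a0 ab bT FB ->]]]]|[B FB ->]].
- apply: measurableX => //; apply: (fil_measurable hFil _ FB).
  by rewrite a0 (le_trans ab bT).
- apply: measurableX; first exact: measurable_set1.
  by apply: (fil_measurable hFil _ FB); rewrite lexx.
Qed.

Lemma ito_integral_approx t Phi J : (forall s w, 0 <= s < t -> Phi s w 0 = 0) ->
  is_ito_integral P T Fil W t Phi J -> ito_approx t Phi J.
Proof.
move=> Phi0 [mPhi mJ [Z hZ]]; split=> //.
- move=> u i _ C mC; apply: predictable_measurable.
  exact: (mPhi u _ (continuous_preimage_borel (@continuous_inner _ _ (e i)) mC)).
- move=> i _ C mC; rewrite setTI.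
  exact: (mJ _ (continuous_preimage_borel (@continuous_inner _ _ (e i)) mC)).
- by exists Z.
Qed.

Lemma el_val0 (Z : elt) s w : el_val Z s w 0 = 0.
Proof. by rewrite /el_val big1// => i _; rewrite inner0r mulr0 scale0r. Qed.

Let m_ind (A : set Omega) D : measurable A -> measurable_fun D (fun z : Rm * Omega => \1_A z.2 : R).
Proof.
move=> mA; apply: (measurableT_comp (measurable_indic mA)).
exact: measurable_funTS measurable_snd.
Qed.

Let m_ind1 (A : set Rm) D : measurable A -> measurable_fun D (fun z : Rm * Omega => \1_A z.1 : R).
Proof.
move=> mA; apply: (measurableT_comp (measurable_indic mA)).
exact: measurable_funTS measurable_fst.
Qed.

Lemma el_set_measurable (Z : elt) i : measurable (el_A (e:=Z) i).
Proof.
have [a0 ab bT] := el_ab (e:=Z) i; apply: (fil_measurable hFil _ (el_meas i)).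
by rewrite a0 (le_trans ab bT).
Qed.

Lemma el_val_measurable (Z : elt) D u i :
  measurable_fun D (fun z : Rm * Omega => inner (e i) (el_val Z z.1 z.2 u)).
Proof.
under eq_fun do rewrite innerC; apply: measurable_inner_comb => j.
  apply: measurable_funM; last exact: measurable_cst.
  by apply: measurable_funM; [exact: m_ind1|apply: m_ind; exact: el_set_measurable].
exact: measurable_cst.
Qed.

Lemma el_integral_measurable (Z : elt) t i : 0 <= t <= T ->
  measurable_fun setT (fun w => inner (e i) (el_integral W Z t w)).
Proof.
move=> /andP[t0 tT]; under eq_fun do rewrite innerC; apply: measurable_inner_comb => j.
  have [a0 ab bT] := el_ab (e:=Z) j.
  apply: measurable_funM; first by apply: measurable_indic; exact: el_set_measurable.
  have mW s : 0 <= s <= T -> measurable_fun setT (W s (el_u j)).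
    by move=> sT; apply: (fil_fun_measurable hFil sT); exact: (wiener_fil_fun hFil hW).
  apply: measurable_funB; apply: mW; rewrite le_min t0 ge_min tT orbT andbT ?a0//.
  by rewrite (le_trans a0 ab).
exact: measurable_cst.
Qed.

Lemma hs_sqr_measurable (D : set (Rm * Omega)) (Phi : R -> Omega -> U -> V) :
  measurable D -> (forall z, D z -> Phi z.1 z.2 0 = 0) ->
  (forall u i, measurable_fun D (fun z => inner (e i) (Phi z.1 z.2 u))) ->
  measurable_fun D (fun z => hs_norm (Phi z.1 z.2) `^ 2)%E.
Proof.
move=> mD Phi0 mPhi.
apply: (eq_measurable_fun (fun z => \sum_(n <oo) (`|Phi z.1 z.2 (b n)| ^+ 2)%:E)%E).
  by move=> z /set_mem Dz; rewrite hb// Phi0.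
apply: ge0_emeasurable_sum => [k z _ _|k _]; first by rewrite lee_fin sqr_ge0.
apply/measurable_EFinP; apply: measurable_funX.
by apply: (measurable_norm_coord te mD) => i.
Qed.

Lemma ito_error_measurable t Phi (Z : elt) :
  (forall u i, measurable_fun (strip t) (fun z => inner (e i) (Phi z.1 z.2 u))) ->
  (forall s w, 0 <= s < t -> Phi s w 0 = 0) ->
  measurable_fun (strip t) (fun z : Rm * Omega =>
    (hs_norm (fun u => Phi z.1 z.2 u - el_val Z z.1 z.2 u)%R `^ 2)%E).
Proof.
move=> mPhi Phi0; apply: (@hs_sqr_measurable _ (fun s w u => Phi s w u - el_val Z s w u)).
- exact: measurable_strip.
- by case=> s w [/=]; rewrite in_itv /= => h1 _; rewrite Phi0// el_val0 subrr.
- move=> u i; rewrite (_ : (fun z => _) = (fun z => inner (e i) (Phi z.1 z.2 u) -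
    inner (e i) (el_val Z z.1 z.2 u))); last by apply/funext => z; rewrite innerBr.
  by apply: measurable_funB; [exact: mPhi|exact: el_val_measurable].
Qed.

Lemma ito_error_set t Phi (Z : elt) (c : \bar R) :
  (forall u i, measurable_fun (strip t) (fun z => inner (e i) (Phi z.1 z.2 u))) ->
  (forall s w, 0 <= s < t -> Phi s w 0 = 0) ->
  measurable [set w | (c < \int[lebesgue_measure]_(s in `[0%R, t[)
     (hs_norm (fun u => Phi s w u - el_val Z s w u)%R) `^ 2)%E].
Proof.
move=> mPhi Phi0; rewrite -[X in measurable X]setTI; apply: emeasurable_fun_o_infty => //.
apply: (@measurable_section_integral R d Omega t (fun z : Rm * Omega =>
  (hs_norm (fun u => Phi z.1 z.2 u - el_val Z z.1 z.2 u)%R `^ 2)%E)) => [|z].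
  exact: ito_error_measurable.
exact: poweR_ge0.
Qed.

Lemma ito_distance_set t J (Z : elt) (c : R) : 0 <= t <= T ->
  (forall i, measurable_fun setT (fun w => inner (e i) (J w))) ->
  measurable [set w | c < `|el_integral W Z t w - J w|].
Proof.
move=> tT mJ; apply: measurable_lt_set; first exact: measurable_cst.
apply: (measurable_norm_coord te measurableT) => i; under eq_fun do rewrite innerBr.
by apply: measurable_funB; [exact: el_integral_measurable|exact: mJ].
Qed.

Section one_integral.
Variables (p C : R).
Hypothesis p2 : 2 <= p.
Hypothesis C0 : 0 < C.
Variables (t : R) (Phi : R -> Omega -> U -> V) (J : Omega -> V) (D : R -> set Omega)
  (phi : Rm * Omega -> R).
Hypothesis HC : forall (Z : elt) (K eta h c : R), 0 <= K -> 0 < eta -> 0 < h -> 0 < c ->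
  exists Q : Omega -> R, [/\ measurable_fun setT Q, forall w, 0 <= Q w,
    forall w, ((Q w)%:E <= \int[lebesgue_measure]_(s in `[0%R, t[)
      ((\1_(D (Num.max 0 (s - h))) w)%:E * hs_norm (el_val Z s w) `^ 2))%E &
    (\int[P]_(w in D t `&` [set w | (Q w <= K)%R]) (`|el_integral W Z t w| `^ p)%:E <=
      (C * \int[P]_w ((eta + Num.min (Q w) K) `^ (p / 2)) + c)%:E)%E].
Hypothesis tT : 0 <= t <= T.
Hypothesis FD : forall s, 0 <= s <= T -> Fil s (D s).
Hypothesis DD : forall s s', 0 <= s -> s <= s' -> D s' `<=` D s.
Hypothesis Dleft : forall s w, 0 < s -> (forall s', 0 <= s' < s -> D s' w) -> D s w.
Hypothesis mD : measurable [set z : Rm * Omega | D z.1 z.2].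
Hypothesis mphi : measurable_fun setT phi.
Hypothesis phi0 : forall z, 0 <= phi z.
Hypothesis phi_fin : forall w, (\int[lebesgue_measure]_(s in `[0%R, t[) (phi (s, w))%:E < +oo)%E.
Hypothesis Phi_phi : forall s w, 0 <= s < t -> (hs_norm (Phi s w) `^ 2 <= (phi (s, w))%:E)%E.
Hypothesis HJ : ito_approx t Phi J.

Let G (s h : R) w : R := \1_(D (Num.max 0 (s - h))) w * phi (s, w).
Let AE h w : \bar R := (\int[lebesgue_measure]_(s in `[0%R, t[) (G s h w)%:E)%E.

Let G0 s h w : 0 <= G s h w. Proof. by rewrite mulr_ge0. Qed.

Let mDh h : measurable [set z : Rm * Omega | D (Num.max 0 (z.1 - h)) z.2].
Proof.
have mf : measurable_fun setT (fun z : Rm * Omega => (Num.max 0 (z.1 - h), z.2) : Rm * Omega).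
  apply: measurable_fun_pair; last exact: measurable_snd.
  apply: measurable_maxr; first exact: measurable_cst.
  by apply: measurable_funB; [exact: measurable_fst|exact: measurable_cst].
by have := mf measurableT _ mD; rewrite setTI.
Qed.

Let mG h : measurable_fun setT (fun z : Rm * Omega => G z.1 h z.2).
Proof.
apply: measurable_funM => //.
  rewrite (_ : (fun z : Rm * Omega => _) = \1_[set z : Rm * Omega | D (Num.max 0 (z.1 - h)) z.2]).
    by apply: measurable_indic; exact: mDh.
  apply/funext => z; rewrite !indicE; congr (nat_of_bool _)%:R.
by rewrite (_ : (fun z : Rm * Omega => _) = phi)//; apply/funext => -[].
Qed.

Let AE_ge0 h w : (0 <= AE h w)%E.
Proof. by apply: integral_ge0 => s _; rewrite lee_fin. Qed.

Let AE_fin h w : AE h w \is a fin_num.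
Proof.
rewrite ge0_fin_numE//; apply: le_lt_trans (phi_fin w).
apply: ge0_le_integral_nomeas => s _; rewrite lee_fin// /G ler_piMl// indicE.
Qed.

Let a h w : R := fine (AE h w).

Let a_ge0 h w : 0 <= a h w. Proof. exact: fine_ge0. Qed.

Let aE h w : (a h w)%:E = AE h w. Proof. by rewrite fineK ?AE_fin. Qed.

Let ma h : measurable_fun setT (a h).
Proof.
apply: measurableT_comp => //.
apply: (@measurable_section_integral R d Omega t (fun z => (G z.1 h z.2)%:E)) => [|z].
  by apply: measurable_funTS; apply/measurable_EFinP; exact: mG.
by rewrite lee_fin.
Qed.

Let a_mono h h' w : h <= h' -> a h w <= a h' w.
Proof.
move=> hh; rewrite -lee_fin !aE; apply: ge0_le_integral_nomeas => s _; rewrite lee_fin//.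
rewrite ler_wpM2r// !indicE; case: (boolP (w \in D (Num.max 0 (s - h)))) => [/set_mem Dw|_]; last exact: ler0n.
rewrite mem_set//; apply: (DD _ _ Dw); first by rewrite le_max lexx.
by rewrite ge_max !le_max lexx /= lerD2l lerN2 hh orbT.
Qed.

Let h_ n : R := n.+1%:R^-1.

Let h_gt0 n : 0 < h_ n. Proof. by rewrite invr_gt0. Qed.

(** The lag disappears in the limit: where [D s] fails, left continuity makes [D] fail already at
    some [s' < s], hence at [s - h_ n] for large [n]. Dominated convergence concludes. *)
Let a_cvg w : a (h_ n) w @[n --> \oo] --> a 0 w.
Proof.
apply: fine_cvg; rewrite fineK//.
have mGw h : measurable_fun (`[0%R, t[%classic : set Rm) (fun s => (G s h w)%:E).
  apply: (@measurable_section R d Omega t (fun z => (G z.1 h z.2)%:E)).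
  by apply: measurable_funTS; apply/measurable_EFinP; exact: mG.
have mpw : measurable_fun (`[0%R, t[%classic : set Rm) (fun s => (phi (s, w))%:E).
  apply: (@measurable_section R d Omega t (fun z => (phi z)%:E)).
  by apply: measurable_funTS; exact/measurable_EFinP.
have pw : \forall s \ae (lebesgue_measure : measure Rm R), `[0%R, t[%classic s ->
    (G s (h_ n) w)%:E @[n --> \oo] --> (G s 0 w)%:E.
  apply: aeW => s /=; rewrite in_itv /= => /andP[s0 st].
  apply: cvg_EFin; first exact: nearW.
  apply: cvgM; last exact: cvg_cst.
  apply: cvg_near_cst; rewrite subr0 (max_idPr s0).
  have [->|sn0] := eqVneq s 0.
    apply: nearW => n; apply/eqP; rewrite max_l// sub0r oppr_le0 invr_ge0//.
  have sp : 0 < s by rewrite lt_neqAle eq_sym sn0.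
  have [Dw|nDw] := pselect (D s w).
    apply: nearW => n; rewrite !indicE !mem_set//; apply: (DD _ _ Dw).
      by rewrite le_max lexx.
    by rewrite ge_max s0 gerBl ltW.
  have [s' /andP[s'0 s's] nD] : exists2 s', 0 <= s' < s & ~ D s' w.
    apply: contrapT => no; apply: nDw; apply: Dleft => // s' hs'.
    by apply: contrapT => nD; apply: no; exists s'.
  have ds : 0 < s - s' by rewrite subr_gt0.
  near=> n; rewrite !indicE !memNset// => Dh; apply: nD.
  apply: (DD s'0 _ Dh); rewrite le_max lerBrDr -lerBrDl; apply/orP; right.
  by near: n; have := near_infty_natSinv_lt (PosNum ds); apply: filterS => n /ltW.
have ip : (lebesgue_measure : measure Rm R).-integrable `[0%R, t[%classic (fun s => (phi (s, w))%:E).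
  apply/integrableP; split=> //; apply: le_lt_trans (phi_fin w).
  by apply: ge0_le_integral_nomeas => s _ //=; rewrite ger0_norm.
have dom : \forall s \ae (lebesgue_measure : measure Rm R), forall n, `[0%R, t[%classic s ->
    (`|(G s (h_ n) w)%:E| <= (phi (s, w))%:E)%E.
  by apply: aeW => s n _; rewrite /= ger0_norm// lee_fin /G ler_piMl// indicE.
by have [] := @dominated_convergence _ Rm R lebesgue_measure `[0%R, t[%classic (measurable_itv _)
  _ _ _ (fun n => mGw (h_ n)) (mGw 0) pw ip dom.
Unshelve. all: by end_near. Qed.

Let a_exceed_cvg (c : R) : 0 < c -> P [set w | a 0 w + c < a (h_ n) w] @[n --> \oo] --> 0%E.
Proof.
move=> c0; pose F n := [set w | a 0 w + c < a (h_ n) w].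
have mF n : measurable (F n).
  apply: measurable_lt_set; last exact: ma.
  by apply: measurable_funD => //; exact: ma.
have F0 : \bigcap_n F n = set0.
  apply/seteqP; split => // w Fw.
  have := @a_cvg w; move/cvgrPdist_lt => /(_ c c0)[N _ /(_ N (leqnn N))] /=.
  have := Fw N I; rewrite /F /= => h1; rewrite ltNge => /negP; apply.
  by rewrite distrC (le_trans _ (ler_norm _))// lerBrDr addrC ltW.
have := @nonincreasing_cvg_mu _ _ _ P F; rewrite F0 measure0; apply=> //.
- by rewrite (le_lt_trans (probability_le1 P (mF 0%N)))// ltry.
- move=> i j ij; apply/subsetPset => w; rewrite /F /= => /lt_le_trans; apply.
  by apply: a_mono; rewrite lef_pV2 ?posrE// ler_nat ltnS.
Qed.

Let t0 : 0 <= t. Proof. by case/andP: tT. Qed.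

Let r (Z : elt) s w := (hs_norm (fun u => Phi s w u - el_val Z s w u)%R `^ 2)%E.

Let mr Z : measurable_fun (strip t) (fun z : Rm * Omega => r Z z.1 z.2).
Proof. by have [mPhi _ Phi0 _] := HJ; exact: ito_error_measurable. Qed.

Let el_val_integral (Z : elt) h w :
  ((\int[lebesgue_measure]_(s in `[0%R, t[)
     ((\1_(D (Num.max 0 (s - h))) w)%:E * hs_norm (el_val Z s w) `^ 2)) <=
   2%:E * AE h w + 2%:E * \int[lebesgue_measure]_(s in `[0%R, t[) r Z s w)%E.
Proof.
have [mPhi _ Phi0 _] := HJ.
have mGw : measurable_fun (`[0%R, t[%classic : set Rm) (fun s => (G s h w)%:E).
  apply: (@measurable_section R d Omega t (fun z => (G z.1 h z.2)%:E)).
  by apply: measurable_funTS; apply/measurable_EFinP; exact: mG.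
have mrw : measurable_fun (`[0%R, t[%classic : set Rm) (fun s => r Z s w).
  exact: (@measurable_section R d Omega t (fun z => r Z z.1 z.2) w (@mr Z)).
have r0 s : (0 <= r Z s w)%E by exact: poweR_ge0.
rewrite -ge0_integralZl//; last by move=> s _; rewrite lee_fin.
rewrite -ge0_integralZl// -ge0_integralD//; last 4 first.
- by move=> s _; rewrite -EFinM lee_fin mulr_ge0.
- exact: measurable_funeM.
- by move=> s _; rewrite mule_ge0.
- exact: measurable_funeM.
apply: ge0_le_integral_nomeas => s /=; rewrite in_itv /= => hs.
  by rewrite mule_ge0 ?lee_fin ?poweR_ge0.
have h1 : (hs_norm (el_val Z s w) `^ 2 <= 2%:E * (phi (s, w))%:E + 2%:E * r Z s w)%E.
  have := hs_sqr_add_le hb (L1 := Phi s w) (L2 := fun u => - (Phi s w u - el_val Z s w u)).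
  rewrite Phi0// el_val0 subrr oppr0 => /(_ erefl erefl).
  rewrite hs_sqr_opp (_ : (fun x => _) = el_val Z s w); last first.
    by apply/funext => x; rewrite opprB addrC subrK.
  by move=> /le_trans; apply; rewrite leeD2r// lee_wpmul2l// Phi_phi.
rewrite /G indicE; case: (w \in _); rewrite ?mul1e ?mul1r//.
by rewrite mul0e mul0r mule0 add0e mule_ge0.
Qed.

(** Off [bad n] the approximant, its integral and the lag are accurate up to [c], and the condition
    [a 0 w <= m] keeps the cut at [K] out of sight. On [bad n] the truncation at [m] and the cut
    bound everything, and the probability is small. *)
Let one_step (Z : nat -> elt) (m : nat) (c : R) : 0 < c <= 1 ->
  (forall c' : R, 0 < c' -> P [set w | (c'%:E < \int[lebesgue_measure]_(s in `[0%R, t[)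
     (hs_norm (fun u => Phi s w u - el_val (Z n) s w u)%R) `^ 2)%E] @[n --> \oo] --> 0%E) ->
  (forall c' : R, 0 < c' ->
     P [set w | c' < `|el_integral W (Z n) t w - J w|] @[n --> \oo] --> 0%E) ->
  (\int[P]_(w in D t `&` [set w | (a 0 w <= m%:R)%R]) (Num.min (`|J w| `^ p) m%:R)%:E <=
   (2 `^ p * C * 2 `^ p)%:E * \int[P]_w (a 0 w `^ (p / 2))%:E +
   ((2 `^ p * (C * (2 `^ (p / 2) * 5 `^ (p / 2)) + 2) + 1) * c)%:E)%E.
Proof.
move=> /andP[c0 c1] cv1 cv2; have [mPhi mJ Phi0 _] := HJ.
(* Off [bad n] one gets [Q <= 2 a + 4 c]: the 2 comes from [|x + y|^2 <= 2 |x|^2 + 2 |y|^2], the 4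
   from doubling the two errors of size [c]. With [a <= m] the level [K] is not passed. *)
pose K : R := 2 * m%:R + 4 * c.
have K0 : 0 <= K by rewrite addr_ge0 ?mulr_ge0// ltW.
pose Rn n w := (\int[lebesgue_measure]_(s in `[0%R, t[) r (Z n) s w)%E.
have mI' n : measurable_fun setT (fun w => `|el_integral W (Z n) t w|).
  by apply: (measurable_norm_coord te measurableT) => i; exact: el_integral_measurable.
pose bad n := [set w | (c%:E < Rn n w)%E] `|` [set w | c < `|el_integral W (Z n) t w - J w|]
  `|` [set w | a 0 w + c < a (h_ n) w].
have mb1 n : measurable [set w | (c%:E < Rn n w)%E].
  exact: ito_error_set.
have mb2 n : measurable [set w | c < `|el_integral W (Z n) t w - J w|].
  exact: ito_distance_set.
have mb3 n : measurable [set w | a 0 w + c < a (h_ n) w].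
  apply: measurable_lt_set; last exact: ma.
  by apply: measurable_funD => //; exact: ma.
have mbad n : measurable (bad n) by apply: measurableU => //; exact: measurableU.
have bad_cvg : P (bad n) @[n --> \oo] --> 0%E.
  have s0 := cvgeD _ (cvgeD _ (cv1 c c0) (cv2 c c0)) (a_exceed_cvg c0).
  have {}s0 := s0 _ ltac:(by rewrite adde0) _ isT; rewrite !adde0 in s0.
  have {}s0 := s0 eventually_filter eventually_filter.
  apply: (squeeze_cvge _ (cvg_cst 0%E) s0); apply: nearW => n; rewrite measure_ge0 /=.
  apply: le_trans (measureU2 P _ (mb3 n)) _; first exact: measurableU.
  by rewrite leeD2r//; exact: measureU2.
(* The total factor with which [P (bad n)] enters the final bound. *)
pose kap : R := m%:R + 2 `^ p * C * (c + K) `^ (p / 2).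
have kap0 : 0 <= kap by rewrite addr_ge0// mulr_ge0 ?powR_ge0// mulr_ge0 ?powR_ge0// ltW.
have [n Pn] : exists n, kap * fine (P (bad n)) <= c.
  have : (kap%:E * P (bad n) @[n --> \oo] --> 0)%E.
    by rewrite -(mule0 kap%:E); apply: cvgeZl.
  move/fine_cvgP => [_ /cvgrPdist_le /(_ c c0)[N _ /(_ N (leqnn N))]] /=.
  rewrite sub0r normrN => h1; exists N.
  by rewrite fineM ?fin_num_measure// in h1; exact: le_trans (ler_norm _) h1.
have [Q [mQ Q0 Qi QM]] := HC (Z n) K0 c0 (h_gt0 n) c0.
have p2' : 2 <= p by exact: p2.
have p0 : 0 < p by lra.
have ph : 0 <= p / 2 by rewrite divr_ge0// ltW.
have good w : ~ bad n w ->
    [/\ `|el_integral W (Z n) t w - J w| <= c & Q w <= 2 * a 0 w + 4 * c].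
  move=> /not_orP[/not_orP[/= h1 h2] h3]; split; first by rewrite leNgt; exact/negP.
  rewrite -lee_fin; apply: le_trans (Qi w) (le_trans (el_val_integral _ _ _) _).
  apply: (@le_trans _ _ (2%:E * (a (h_ n) w)%:E + 2%:E * c%:E)%E).
    by rewrite aE leeD2l// lee_wpmul2l// leNgt; exact/negP.
  rewrite -!EFinM -EFinD lee_fin.
  have : a (h_ n) w <= a 0 w + c by rewrite leNgt; exact/negP.
  lra.
have mDt : measurable (D t) by exact: (fil_measurable hFil tT (FD tT)).
have mQK : measurable [set w | Q w <= K].
  rewrite (_ : [set w | _] = ~` [set w | K < Q w]).
    by apply: measurableC; apply: measurable_lt_set => //; exact: measurable_cst.
  by apply/seteqP; split => w /=; [move=> h1; apply/negP; rewrite -leNgt|move/negP; rewrite -leNgt].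
have mIp : measurable_fun setT (fun w => `|el_integral W (Z n) t w| `^ p).
  exact: (measurableT_comp (measurable_powR p) (mI' n)).
have mGI : measurable_fun setT (fun w => \1_(D t `&` [set w | Q w <= K]) w * `|el_integral W (Z n) t w| `^ p).
  by apply: measurable_funM => //; apply: measurable_indic; exact: measurableI.
have mP := fin_num_measure P _ (mbad n).
pose f w := m%:R * \1_(bad n) w +
  2 `^ p * (\1_(D t `&` [set w | Q w <= K]) w * `|el_integral W (Z n) t w| `^ p + c).
have f1 w : 0 <= \1_(D t `&` [set w | Q w <= K]) w * `|el_integral W (Z n) t w| `^ p + c.
  by rewrite addr_ge0 ?(ltW c0)// mulr_ge0 ?powR_ge0.
have step1 : (\int[P]_(w in D t `&` [set w | (a 0 w <= m%:R)%R]) (Num.min (`|J w| `^ p) m%:R)%:E <=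
    (m%:R * fine (P (bad n)))%:E + (2 `^ p)%:E * (\int[P]_(w in D t `&` [set w | (Q w <= K)%R])
      (`|el_integral W (Z n) t w| `^ p)%:E + c%:E))%E.
  apply: (@le_trans _ _ (\int[P]_w (m%:R%:E * (\1_(bad n) w)%:E + (2 `^ p)%:E *
      ((\1_(D t `&` [set w | Q w <= K]) w * `|el_integral W (Z n) t w| `^ p)%:E + (cst c%:E w))))%E).
    rewrite integral_mkcond; apply: ge0_le_integral_nomeas => w _; rewrite patchE.
      by case: ifPn => _ //; rewrite lee_fin le_min powR_ge0 ler0n.
    rewrite -[leRHS]/((f w)%:E).
    case: ifPn => [/set_mem[Dw /= am]|_]; last by rewrite lee_fin addr_ge0 ?mulr_ge0 ?powR_ge0.
    rewrite lee_fin /f.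
    have [bw|/good[g1 g2]] := pselect (bad n w).
      rewrite [\1_(bad n) w]indicE mem_set// mulr1; apply: ler_wpDr; last by rewrite ge_min lexx orbT.
      by rewrite mulr_ge0 ?powR_ge0.
    apply: ler_wpDl; first by rewrite mulr_ge0.
    rewrite indicE mem_set ?mul1r; last first.
      by split=> //=; apply: le_trans g2 _; rewrite /K; lra.
    rewrite ge_min; apply/orP; left.
    apply: (@le_trans _ _ ((`|el_integral W (Z n) t w| + c) `^ p)).
      apply: ge0_ler_powR; rewrite ?nnegrE ?(ltW p0)//; first by rewrite addr_ge0// ltW.
      have := ler_normB (el_integral W (Z n) t w) (el_integral W (Z n) t w - J w).
      by rewrite opprB addrC subrK; lra.
    apply: le_trans (powR_add_le (ltW p0) (normr_ge0 _) (ltW c0)) _.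
    rewrite ler_wpM2l ?powR_ge0// lerD2l -[leRHS]powRr1 ?(ltW c0)//.
    by apply: ger_powR; rewrite ?c0 ?c1//; lra.
  have i1 : measurable_fun setT (fun w => (\1_(bad n) w)%:E : \bar R).
    by apply/measurable_EFinP; exact: measurable_indic.
  have i2 : measurable_fun setT (fun w =>
      (\1_(D t `&` [set w | Q w <= K]) w * `|el_integral W (Z n) t w| `^ p)%:E).
    exact/measurable_EFinP.
  have i3 : measurable_fun setT (cst c%:E : Omega -> \bar R) by exact: measurable_cst.
  have i4 := emeasurable_funD i2 i3.
  have z1 w : (0 <= (\1_(bad n) w)%:E :> \bar R)%E by rewrite lee_fin.
  have z2 w : (0 <= (\1_(D t `&` [set w | Q w <= K]) w * `|el_integral W (Z n) t w| `^ p)%:E)%E.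
    by rewrite lee_fin mulr_ge0 ?powR_ge0.
  have z3 (w : Omega) : (0 <= cst c%:E w)%E by rewrite lee_fin ltW.
  have z4 w := adde_ge0 (z2 w) (z3 w).
  have pk : 0 <= 2 `^ p :> R := powR_ge0 _ _.
  rewrite (integralD_ge0 P (measurable_funeM _ i1) (measurable_funeM _ i4)); last 2 first.
  - by move=> w; rewrite mule_ge0// lee_fin.
  - by move=> w; rewrite mule_ge0.
  rewrite (integralZ_ge0 P (ler0n _ m) i1 z1) (integralZ_ge0 P pk i4 z4).
  rewrite integral_indic// setIT EFinM fineK// leeD2l// lee_wpmul2l//.
  rewrite (integralD_ge0 P i2 i3 z2 z3).
  rewrite integral_cst//= [X in (_ + _ * X)%E](@probability_setT _ _ _ P) mule1 leeD2r//.
  rewrite [leRHS]integral_mkcond le_eqVlt; apply/orP; left; apply/eqP.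
  apply: eq_integral => w _; rewrite patchE indicE.
  by case: ifP => _; rewrite ?mul1r ?mul0r.
have step2 : ((\int[P]_w ((c + Num.min (Q w) K) `^ (p / 2)))%:E <=
    ((c + K) `^ (p / 2) * fine (P (bad n)))%:E + (2 `^ p)%:E * \int[P]_w (a 0 w `^ (p / 2))%:E +
    (2 `^ (p / 2) * 5 `^ (p / 2) * c)%:E)%E.
  have cQ w : 0 <= c + Num.min (Q w) K by rewrite addr_ge0 ?(ltW c0)// le_min Q0.
  have cQK w : c + Num.min (Q w) K <= c + K by rewrite lerD2l ge_min lexx orbT.
  have cK : 0 <= c + K by rewrite addr_ge0// ltW.
  rewrite -fin_integral_ge0; last first.
    apply: (@bounded_integrable _ _ _ _ _ ((c + K) `^ (p / 2))).
      apply: (measurableT_comp (measurable_powR _)); apply: measurable_funD => //.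
      exact: measurable_minr.
    by move=> w; rewrite ger0_norm ?powR_ge0//; apply: ge0_ler_powR; rewrite ?nnegrE ?cQ ?cQK.
  apply: (@le_trans _ _ (\int[P]_w (((c + K) `^ (p / 2))%:E * (\1_(bad n) w)%:E +
      ((2 `^ p)%:E * (a 0 w `^ (p / 2))%:E + cst (2 `^ (p / 2) * 5 `^ (p / 2) * c)%:E w)))%E).
    apply: ge0_le_integral_nomeas => w _; first by rewrite lee_fin powR_ge0.
    rewrite -[leRHS]/(((c + K) `^ (p / 2) * \1_(bad n) w +
      (2 `^ p * a 0 w `^ (p / 2) + 2 `^ (p / 2) * 5 `^ (p / 2) * c))%:E) lee_fin.
    have [bw|/good[g1 g2]] := pselect (bad n w).
      rewrite indicE mem_set// mulr1; apply: ler_wpDr.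
        by rewrite addr_ge0 ?mulr_ge0 ?powR_ge0// ltW.
      by apply: ge0_ler_powR; rewrite ?nnegrE ?cQ ?cQK.
    apply: ler_wpDl; first by rewrite mulr_ge0 ?powR_ge0.
    apply: (@le_trans _ _ ((2 * a 0 w + 5 * c) `^ (p / 2))).
      have mQ' : Num.min (Q w) K <= Q w by rewrite ge_min lexx.
      have aw := a_ge0 0 w; have y0 : 0 <= 2 * a 0 w + 5 * c by lra.
      by apply: ge0_ler_powR; rewrite ?nnegrE ?cQ//; move: g2 mQ'; lra.
    apply: le_trans (powR_add_le ph _ _) _; rewrite ?mulr_ge0 ?(ltW c0) ?a_ge0//.
    rewrite !powRM ?(ltW c0) ?a_ge0// mulrDr mulrA -powR_add// -splitr lerD2l.
    rewrite -mulrA ler_wpM2l ?powR_ge0// ler_wpM2l ?powR_ge0// -[leRHS]powRr1 ?(ltW c0)//.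
    by apply: ger_powR; rewrite ?c0 ?c1//; lra.
  have map : measurable_fun setT (fun w => (a 0 w `^ (p / 2))%:E).
    by apply/measurable_EFinP; apply: (measurableT_comp (measurable_powR _)); exact: ma.
  have i1 : measurable_fun setT (fun w => (\1_(bad n) w)%:E : \bar R).
    by apply/measurable_EFinP; exact: measurable_indic.
  have i3 : measurable_fun setT (cst (2 `^ (p / 2) * 5 `^ (p / 2) * c)%:E : Omega -> \bar R).
    exact: measurable_cst.
  have z1 w : (0 <= (\1_(bad n) w)%:E :> \bar R)%E by rewrite lee_fin.
  have z2 w : (0 <= (a 0 w `^ (p / 2))%:E)%E by rewrite lee_fin powR_ge0.
  have z3 (w : Omega) : (0 <= cst (2 `^ (p / 2) * 5 `^ (p / 2) * c)%:E w)%E.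
    by rewrite lee_fin mulr_ge0 ?(ltW c0)// mulr_ge0 ?powR_ge0.
  have pk : 0 <= 2 `^ p :> R := powR_ge0 _ _.
  have z2' w : (0 <= (2 `^ p)%:E * (a 0 w `^ (p / 2))%:E)%E by rewrite mule_ge0.
  have i23 := emeasurable_funD (measurable_funeM (2 `^ p)%:E map) i3.
  rewrite (integralD_ge0 P (measurable_funeM _ i1) i23); last 2 first.
  - by move=> w; rewrite mule_ge0// lee_fin powR_ge0.
  - by move=> w; rewrite adde_ge0.
  rewrite (integralZ_ge0 P (powR_ge0 _ _) i1 z1) integral_indic// setIT
    [((c + K) `^ (p / 2) * fine _)%:E]EFinM fineK// -addeA leeD2l//.
  rewrite (integralD_ge0 P (measurable_funeM _ map) i3 z2' z3) (integralZ_ge0 P pk map z2).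
  by rewrite integral_cst//= [X in (_ + _ * X)%E](@probability_setT _ _ _ P) mule1.
have pp : 0 < 2 `^ p :> R by rewrite powR_gt0.
have aint0 : (0 <= \int[P]_w (a 0 w `^ (p / 2))%:E)%E.
  by apply: integral_ge0 => w _; rewrite lee_fin powR_ge0.
(* If the moment of the bracket is infinite there is nothing to prove. *)
move: step2 aint0; case: (\int[P]_w (a 0 w `^ (p / 2))%:E)%E => [B||//] step2 _; last first.
  by rewrite gt0_muley ?addye ?leey// lte_fin mulr_gt0// mulr_gt0.
apply: le_trans step1 _.
have := le_trans (leeD2r c%:E QM) (lexx _).
move=> /(lee_wpmul2l (ltW pp : (0 <= (2 `^ p)%:E)%E)) h1.
apply: le_trans (leeD2l _ h1) _.
move: step2; set IQ := (\int[P]_w (c + Num.min (Q w) K) `^ (p / 2)) => step2.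
have {}step2 : IQ <= (c + K) `^ (p / 2) * fine (P (bad n)) + 2 `^ p * B +
  2 `^ (p / 2) * 5 `^ (p / 2) * c by rewrite -lee_fin.
rewrite -[leLHS]/((m%:R * fine (P (bad n)) + 2 `^ p * (C * IQ + c + c))%:E).
rewrite -[leRHS]/((2 `^ p * C * 2 `^ p * B +
  (2 `^ p * (C * (2 `^ (p / 2) * 5 `^ (p / 2)) + 2) + 1) * c)%:E) lee_fin.
have := ler_wpM2l (ltW pp) (ler_wpM2l (ltW C0) step2); move: Pn; rewrite /kap.
lra.
Qed.

(** The tolerance [c] tends to 0 with [m] fixed; then both truncations by [m] are removed by
    monotone convergence. *)
Lemma ito_moment_one :
  (\int[P]_(w in D t) (`|J w| `^ p)%:E <= (2 `^ p * C * 2 `^ p)%:E *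
     \int[P]_w (\int[lebesgue_measure]_(s in `[0%R, t[) (\1_(D s) w * phi (s, w))%:E) `^ (p / 2))%E.
Proof.
have [mPhi mJ Phi0 [Z [cv1 cv2]]] := HJ.
rewrite (_ : (\int[P]_w (_ `^ (p / 2)) = \int[P]_w (a 0 w `^ (p / 2))%:E)%E); last first.
  apply: eq_integral => w _; rewrite -poweR_EFin aE; congr (_ `^ _)%E.
  apply: eq_integral => s /set_mem; rewrite /= in_itv /= => /andP[s0 _].
  by rewrite /G subr0 (max_idPr s0).
set Y := ((2 `^ p * C * 2 `^ p)%:E * _)%E.
have mDt : measurable (D t) by exact: (fil_measurable hFil tT (FD tT)).
have mJn : measurable_fun setT (fun w => `|J w|) by apply: (measurable_norm_coord te measurableT).
pose k : R := 2 `^ p * (C * (2 `^ (p / 2) * 5 `^ (p / 2)) + 2) + 1.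
have k0 : 0 < k.
  rewrite ltr_wpDl// mulr_ge0 ?powR_ge0// addr_ge0// mulr_ge0 ?(ltW C0)// mulr_ge0 ?powR_ge0//.
pose g (m : nat) w : \bar R :=
  (\1_(D t `&` [set w | a 0 w <= m%:R]) w * Num.min (`|J w| `^ p) m%:R)%:E.
have gY m : (\int[P]_w g m w <= Y)%E.
  apply/lee_addgt0Pr => eps eps0; pose c := Num.min 1 (eps / k).
  have c01 : 0 < c <= 1 by rewrite lt_min ltr01 divr_gt0//= ge_min lexx.
  have ck : k * c <= eps by rewrite mulrC -ler_pdivlMr// ge_min lexx orbT.
  have := one_step m c01 cv1 cv2; rewrite -/Y -/k => h1.
  apply: (@le_trans _ _ (Y + (k * c)%:E)%E); last by rewrite leeD2l// lee_fin.
  apply: le_trans h1; rewrite [leRHS]integral_mkcond le_eqVlt; apply/orP; left; apply/eqP.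
  apply: eq_integral => w _; rewrite patchE /g indicE.
  by case: ifP => _; rewrite ?mul1r ?mul0r.
have Jp w : 0 <= `|J w| `^ p := powR_ge0 _ _.
have cv w : g m w @[m --> \oo] --> (\1_(D t) w * `|J w| `^ p)%:E.
  apply: cvg_near_cst; near=> m; rewrite /g; congr EFin.
  have am : a 0 w <= m%:R by near: m; exact: nbhs_infty_ger.
  have Jm : `|J w| `^ p <= m%:R by near: m; exact: nbhs_infty_ger.
  rewrite (min_idPl Jm) !indicE; congr (_%:R * _); congr nat_of_bool.
  by apply/idP/idP => /set_mem => [[Dw _]|Dw]; apply/mem_set.
have mg m : measurable_fun setT (g m).
  apply/measurable_EFinP; apply: measurable_funM.
    apply: measurable_indic; apply: measurableI => //.
    rewrite (_ : [set w | _] = ~` [set w | m%:R < a 0 w]).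
      apply: measurableC; apply: measurable_lt_set; last exact: ma.
      exact: measurable_cst.
    by apply/seteqP; split => w /=; [move=> h1; apply/negP; rewrite -leNgt|move/negP; rewrite -leNgt].
  apply: measurable_minr; last exact: measurable_cst.
  exact: (measurableT_comp (measurable_powR p) mJn).
have g0 m w : setT w -> (0 <= g m w)%E by rewrite lee_fin mulr_ge0// le_min Jp ler0n.
have gm w : setT w -> {homo g^~ w : m n / (m <= n)%N >-> (m <= n)%E}.
  move=> _ m n mn; rewrite lee_fin; have mn' : m%:R <= n%:R :> R by rewrite ler_nat.
  apply: ler_pM; rewrite ?le_min ?Jp ?ler0n//.
    rewrite !indicE ler_nat; case: (boolP (w \in D t `&` [set w | a 0 w <= m%:R])) => // /set_mem[Dw am].
    by rewrite mem_set//; split=> //=; exact: le_trans am mn'.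
  by rewrite !ge_min lexx mn' orbT.
have h1 := @cvg_monotone_convergence _ _ _ P _ measurableT _ mg g0 gm.
rewrite integral_mkcond (_ : (\int[P]_w _)%E = (\int[P]_w limn (g^~ w))%E); last first.
  apply: eq_integral => w _; rewrite (cvg_lim _ (cv w))// patchE indicE.
  by case: ifP => _; rewrite ?mul1r ?mul0r.
rewrite -(cvg_lim _ h1)//; apply: lime_le; first by apply/cvg_ex; eexists; exact: h1.
exact: nearW.
Unshelve. all: by end_near. Qed.

End one_integral.

Lemma ito_moment (p : R) : 2 <= p -> exists2 C : R, 0 <= C &
  forall t Phi J (D : R -> set Omega) (phi : Rm * Omega -> R), 0 <= t <= T ->
  (forall s, 0 <= s <= T -> Fil s (D s)) ->
  (forall s s', 0 <= s -> s <= s' -> D s' `<=` D s) ->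
  (forall s w, 0 < s -> (forall s', 0 <= s' < s -> D s' w) -> D s w) ->
  measurable [set z : Rm * Omega | D z.1 z.2] ->
  measurable_fun setT phi -> (forall z, 0 <= phi z) ->
  (forall w, (\int[lebesgue_measure]_(s in `[0%R, t[) (phi (s, w))%:E < +oo)%E) ->
  (forall s w, 0 <= s < t -> (hs_norm (Phi s w) `^ 2 <= (phi (s, w))%:E)%E) ->
  ito_approx t Phi J ->
  (\int[P]_(w in D t) (`|J w| `^ p)%:E <= C%:E *
     \int[P]_w (\int[lebesgue_measure]_(s in `[0%R, t[) (\1_(D s) w * phi (s, w))%:E) `^ (p / 2))%E.
Proof.
move=> p2; have [C C0 HC] := cut_moment hFil hW tb hb p2.
exists (2 `^ p * (C + 1) * 2 `^ p); first by rewrite mulr_ge0 ?powR_ge0// mulr_ge0 ?powR_ge0// addr_ge0.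
move=> t Phi J D phi tT FD DD Dl mD mphi phi0 phif Phiphi HJ.
(* A positive constant makes the right side infinite whenever the moment of the bracket is. *)
have C1 : 0 < C + 1 by rewrite ltr_wpDl.
apply: (@ito_moment_one p _ p2 C1 t Phi J D phi _ tT FD DD Dl mD mphi phi0 phif Phiphi HJ).
move=> Z K eta h c K0 eta0 h0 c0.
have [Q [mQ Q0 Qi QM]] := HC Z t D K eta h c tT FD (fun s s' s0 ss _ => DD s s' s0 ss) K0 eta0 h0 c0.
exists Q; split=> //; apply: le_trans QM _; rewrite lee_fin lerD2r ler_wpM2r ?lerDl//.
apply: Rintegral_ge0 => w _; exact: powR_ge0.
Qed.

End ito_limit.

Lemma squeeze_sum_cvg0 (R : realType) (f g h : nat -> \bar R) :
  (forall n, 0 <= f n)%E -> (forall n, f n <= g n + h n)%E ->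
  g n @[n --> \oo] --> 0%E -> h n @[n --> \oo] --> 0%E -> f n @[n --> \oo] --> 0%E.
Proof.
move=> f0 fgh cg ch.
have s0 : (g n + h n)%E @[n --> \oo] --> (0 + 0 : \bar R)%E by exact: cvgeD.
rewrite adde0 in s0; apply: (squeeze_cvge _ (cvg_cst 0%E) s0).
by apply: nearW => n; rewrite f0 fgh.
Qed.

Lemma subrBB (V : zmodType) (x y z t : V) : x - y - (z - t) = x - z - (y - t).
Proof. by rewrite !opprD !opprK addrACA. Qed.

Definition on_split {A : Type} (m n : nat) (f : 'I_m -> A) (g : 'I_n -> A) (i : 'I_(m + n)) : A :=
  match fintype.split i with inl j => f j | inr k => g k end.

Lemma on_split_sum (W : zmodType) (A : Type) (m n : nat) (h : A -> W) (f : 'I_m -> A) (g : 'I_n -> A) :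
  \sum_i h (on_split f g i) = \sum_i h (f i) + \sum_i h (g i).
Proof.
rewrite big_split_ord /on_split; congr (_ + _); apply: eq_bigr => i _.
  by rewrite (unsplitK (inl i)).
by rewrite (unsplitK (inr i)).
Qed.

(** * Differences of Ito integrals over different time intervals *)

Section elementary_difference.
Context {R : realType} {d : measure_display} {Omega : measurableType d}.
Variables (P : probability Omega R) (T : R) (Fil : R -> set (set Omega)).
Hypothesis hFil : normal_filtration P T Fil.
Context {U V : hilbertType R} (W : R -> U -> Omega -> R).
Local Notation elt := (elementary T Fil U V).

Section stop.
Variables (Z : elt) (t : R).
Hypothesis tT : 0 <= t <= T.

(** A term starting after [t] is moved to start at [t], where its event may not be known yet; as the
    term vanishes up to [t], the event is replaced by [set0]. *)
Definition stop_set (i : 'I_(el_size Z)) : set Omega :=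
  if el_a i <= t then el_A i else set0.

Let stop_ab (i : 'I_(el_size Z)) :
  [/\ 0 <= Num.min (el_a i) t, Num.min (el_a i) t <= Num.min (el_b i) t & Num.min (el_b i) t <= T].
Proof.
have [a0 ab bT] := el_ab i; have /andP[t0 tT'] := tT; split.
- by rewrite le_min a0.
- by rewrite le_min !ge_min ab lexx orbT.
- by rewrite ge_min bT.
Qed.

Let stop_meas (i : 'I_(el_size Z)) : Fil (Num.min (el_a i) t) (stop_set i).
Proof.
rewrite /stop_set; have [a0 ab bT] := el_ab i; have /andP[t0 tT'] := tT.
case: lerP => _; first exact: el_meas.
by have [] := fil_sigma hFil (s := t) tT.
Qed.

Definition el_stop : elt := @Elementary _ _ _ T Fil U V (el_size Z)
  (fun i => Num.min (el_a i) t) (fun i => Num.min (el_b i) t) stop_set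
  (fun i => el_u i) (fun i => el_v i) stop_ab stop_meas.

Lemma el_stop_val s w u : el_val el_stop s w u = if s <= t then el_val Z s w u else 0.
Proof.
rewrite /el_val /el_stop /=; case: ifPn => st; last first.
  rewrite big1// => i _; rewrite indicE memNset ?mul0r ?scale0r//= in_itv /= => /andP[_].
  by rewrite le_min => /andP[_ h]; rewrite h in st.
apply: eq_bigr => i _; congr (_ *: _); congr (_ * _).
rewrite /stop_set; have [at_|ta] := lerP (el_a i) t.
  congr (_ * _); rewrite !indicE; congr (nat_of_bool _)%:R.
  by rewrite !mem_setE /= !in_itv /= le_min st andbT.
rewrite indic0 mulr0 indicE memNset ?mul0r//= in_itv /= => /andP[h _].
by move: (lt_trans ta h); rewrite ltNge st.
Qed.

Lemma el_stop_integral t' w : t <= t' -> el_integral W el_stop t' w = el_integral W Z t w.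
Proof.
move=> tt'; rewrite /el_integral /el_stop /=; apply: eq_bigr => i _; congr (_ *: _).
have h x : Num.min (Num.min x t) t' = Num.min x t by apply/min_idPl; rewrite ge_min tt' orbT.
rewrite !h /stop_set; have [at_|ta] := lerP (el_a i) t; first by [].
have [_ ab _] := el_ab i.
by rewrite (min_idPr (ltW (lt_le_trans ta ab))) subrr !mulr0.
Qed.

End stop.

Section sub.
Variables Z1 Z2 : elt.

Record el_term := ElTerm { et_a : R; et_b : R; et_A : set Omega; et_u : U; et_v : V;
  et_ab : [/\ 0 <= et_a, et_a <= et_b & et_b <= T]; et_meas : Fil et_a et_A }.

Definition el_term_of (Z : elt) (i : 'I_(el_size Z)) : el_term :=
  @ElTerm (el_a i) (el_b i) (el_A i) (el_u i) (el_v i) (el_ab i) (el_meas i).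

Definition el_term_opp (x : el_term) : el_term :=
  @ElTerm (et_a x) (et_b x) (et_A x) (et_u x) (- et_v x) (et_ab x) (et_meas x).

Let term := on_split (@el_term_of Z1) (fun i => el_term_opp (@el_term_of Z2 i)).

Definition el_sub : elt := @Elementary _ _ _ T Fil U V (el_size Z1 + el_size Z2)
  (fun i => et_a (term i)) (fun i => et_b (term i)) (fun i => et_A (term i))
  (fun i => et_u (term i)) (fun i => et_v (term i))
  (fun i => et_ab (term i)) (fun i => et_meas (term i)).

Lemma el_sub_val s w u : el_val el_sub s w u = el_val Z1 s w u - el_val Z2 s w u.
Proof.
rewrite /el_val /el_sub /=.
rewrite (on_split_sum (fun x => (\1_`]et_a x, et_b x] s * \1_(et_A x) w * inner (et_u x) u) *: et_v x)).
congr (_ + _); rewrite -sumrN; apply: eq_bigr => i _ /=.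
by rewrite scalerN.
Qed.

Lemma el_sub_integral t w :
  el_integral W el_sub t w = el_integral W Z1 t w - el_integral W Z2 t w.
Proof.
rewrite /el_integral /el_sub /=.
rewrite (on_split_sum (fun x => (\1_(et_A x) w * (W (Num.min (et_b x) t) (et_u x) w -
  W (Num.min (et_a x) t) (et_u x) w)) *: et_v x)).
congr (_ + _); rewrite -sumrN; apply: eq_bigr => i _ /=.
by rewrite scalerN.
Qed.

End sub.

End elementary_difference.

Section ito_difference.
Context {R : realType} {d : measure_display} {Omega : measurableType d}.
Variables (P : probability Omega R) (T : R) (Fil : R -> set (set Omega)).
Hypothesis hFil : normal_filtration P T Fil.
Hypothesis T0 : 0 <= T.
Context {U V : hilbertType R} (W : R -> U -> Omega -> R).
Hypothesis hW : cylindrical_wiener P T Fil W.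
Variables (b : nat -> U) (e : nat -> V).
Hypothesis tb : onseq_total b.
Hypothesis te : onseq_total e.
Hypothesis hb : forall L : U -> V, L 0 = 0 ->
  (hs_norm L `^ 2 = \sum_(n <oo) (`|L (b n)| ^+ 2)%:E)%E.
Local Notation Rm := (measurableTypeR R).
Local Notation elt := (elementary T Fil U V).
Local Notation strip t := ((`[0%R, t[%classic : set Rm) `*` [set: Omega]).
Local Notation approx := (ito_approx P T Fil W e).

Definition stopped (t : R) (Phi : R -> Omega -> U -> V) s w u : V :=
  if s < t then Phi s w u else 0.

(** The approximants of the second integral are stopped at [t2], which leaves their integrals
    unchanged and puts both families on [[0, t1[], where they can be subtracted. *)
Lemma ito_approx_sub t1 t2 Phi1 Phi2 J1 J2 : 0 <= t2 -> t2 <= t1 -> t1 <= T ->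
  approx t1 Phi1 J1 -> approx t2 Phi2 J2 ->
  approx t1 (fun s w u => Phi1 s w u - stopped t2 Phi2 s w u) (fun w => J1 w - J2 w).
Proof.
move=> t20 t21 t1T [mP1 mJ1 P10 [Z1 [c11 c12]]] [mP2 mJ2 P20 [Z2 [c21 c22]]].
have t2T : 0 <= t2 <= T by rewrite t20 (le_trans t21).
have t1T' : 0 <= t1 <= T by rewrite t1T (le_trans t20).
have mdiff u i : measurable_fun (strip t1)
    (fun z => inner (e i) (Phi1 z.1 z.2 u - stopped t2 Phi2 z.1 z.2 u)).
  rewrite (_ : (fun z => _) = (fun z => inner (e i) (Phi1 z.1 z.2 u) -
    inner (e i) (stopped t2 Phi2 z.1 z.2 u))); last by apply/funext => z; rewrite innerBr.
  apply: measurable_funB; first exact: mP1.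
  have e1 : (fun z : Rm * Omega => inner (e i) (stopped t2 Phi2 z.1 z.2 u)) \_ (strip t1) =
      (fun z => inner (e i) (Phi2 z.1 z.2 u)) \_ (strip t2).
    apply/funext => z; rewrite !patchE /stopped !in_setX !in_setT !andbT !mem_setE /= !in_itv /=.
    have [z0|//] := lerP 0 z.1; have [h2|h2] /= := ltP z.1 t2; last by case: ifP; rewrite ?inner0r.
    by rewrite (lt_le_trans h2 t21).
  apply/(measurable_restrictT _ (measurable_strip t1)); rewrite e1.
  by apply/(measurable_restrictT _ (measurable_strip t2)); exact: mP2.
have mJ i : measurable_fun setT (fun w => inner (e i) (J1 w - J2 w)).
  under eq_fun do rewrite innerBr.
  by apply: measurable_funB; [exact: mJ1|exact: mJ2].
have d0 s w : 0 <= s < t1 -> Phi1 s w 0 - stopped t2 Phi2 s w 0 = 0.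
  move=> hs; rewrite P10// /stopped; case: ifP => st; last by rewrite subrr.
  by rewrite P20 ?subrr//; move: hs => /andP[->].
split=> //; exists (fun n => el_sub (Z1 n) (el_stop hFil (Z2 n) t2T)).
split=> c c0; last first.
  have c20 : 0 < c / 2 by rewrite divr_gt0.
  apply: (squeeze_sum_cvg0 _ _ (c12 _ c20) (c22 _ c20)) => n; first exact: measure_ge0.
  have m1 := ito_distance_set hFil hW te (Z1 n) (c / 2) t1T' mJ1.
  have m2 := ito_distance_set hFil hW te (Z2 n) (c / 2) t2T mJ2.
  apply: le_trans (measureU2 P m1 m2).
  apply: le_measure; rewrite ?inE.
  - exact: (ito_distance_set hFil hW te _ c t1T' mJ).
  - exact: measurableU.
  move=> w /=; rewrite el_sub_integral el_stop_integral// => h.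
  have [h1|h1] := ltP (c / 2) `|el_integral W (Z1 n) t1 w - J1 w|; first by left.
  right; have := ler_normB (el_integral W (Z1 n) t1 w - J1 w) (el_integral W (Z2 n) t2 w - J2 w).
  rewrite subrBB => h2; apply: contrapT => /negP; rewrite -leNgt => h3.
  by move: h; rewrite ltNge => /negP; apply; apply: le_trans h2 _; lra.
have c40 : 0 < c / 4 by rewrite divr_gt0.
apply: (squeeze_sum_cvg0 _ _ (c11 _ c40) (c21 _ c40)) => n; first exact: measure_ge0.
have m1 := ito_error_set hFil te hb (Z1 n) (c / 4)%:E mP1 P10.
have m2 := ito_error_set hFil te hb (Z2 n) (c / 4)%:E mP2 P20.
apply: le_trans (measureU2 P m1 m2).
apply: le_measure; rewrite ?inE.
- exact: (ito_error_set hFil te hb _ _ mdiff d0).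
- exact: measurableU.
move=> w /= h; apply: contrapT => /not_orP[/negP h1 /negP h2].
rewrite -leNgt in h1; rewrite -leNgt in h2.
move: h; rewrite ltNge => /negP; apply.
pose r1 s := (hs_norm (fun u => Phi1 s w u - el_val (Z1 n) s w u)%R `^ 2)%E.
pose r2 s := (hs_norm (fun u => Phi2 s w u - el_val (Z2 n) s w u)%R `^ 2)%E.
have r10 s : (0 <= r1 s)%E by exact: poweR_ge0.
have r20 s : (0 <= r2 s)%E by exact: poweR_ge0.
have mr1 : measurable_fun (`[0, t1[%classic : set Rm) r1.
  exact: (measurable_section w (ito_error_measurable hFil te hb (Z1 n) mP1 P10)).
have mr2 : measurable_fun (`[0, t2[%classic : set Rm) r2.
  exact: (measurable_section w (ito_error_measurable hFil te hb (Z2 n) mP2 P20)).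
pose I1 := `[0, t1[%classic : set Rm; pose I2 := `[0, t2[%classic : set Rm.
(* At [s = t2] the stopped approximant is still active while [Phi2] is already cut off. The value
   [+oo] at this single point dominates the integrand without changing the integral. *)
pose top : Rm -> \bar R := cst +oo%E.
have m1' : measurable_fun setT (r1 \_ I1) by apply/(measurable_restrictT _ (measurable_itv _)).
have m2' : measurable_fun setT (r2 \_ I2) by apply/(measurable_restrictT _ (measurable_itv _)).
have m3' : measurable_fun setT (top \_ [set t2]).
  by apply/(measurable_restrictT _ (measurable_set1 _)); exact: measurable_cst.
have p1 s : (0 <= (r1 \_ I1) s)%E by rewrite patchE; case: ifP.
have p2 s : (0 <= (r2 \_ I2) s)%E by rewrite patchE; case: ifP.
have p3 s : (0 <= (top \_ [set t2]) s)%E.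
  by rewrite patchE; case: ifP => // _; exact: leey.
have two0 : 0 <= 2 :> R by [].
have q1 s : (0 <= 2%:E * (r1 \_ I1) s)%E by rewrite mule_ge0.
have q2 s : (0 <= 2%:E * (r2 \_ I2) s)%E by rewrite mule_ge0.
apply: (@le_trans _ _ (\int[lebesgue_measure]_s
    (2%:E * (r1 \_ I1) s + 2%:E * (r2 \_ I2) s + (top \_ [set t2]) s))%E); last first.
  rewrite (integralD_ge0 lebesgue_measure (emeasurable_funD (measurable_funeM _ m1') (measurable_funeM _ m2')) m3')//; last first.
    by move=> s; rewrite adde_ge0.
  rewrite (integralD_ge0 lebesgue_measure (measurable_funeM _ m1') (measurable_funeM _ m2') q1 q2).
  rewrite (integralZ_ge0 lebesgue_measure two0 m1' p1) (integralZ_ge0 lebesgue_measure two0 m2' p2).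
  rewrite -!integral_mkcond integral_set1 adde0.
  apply: (@le_trans _ _ (2%:E * (c / 4)%:E + 2%:E * (c / 4)%:E)%E).
    by apply: leeD; rewrite lee_wpmul2l.
  by rewrite -!EFinM -EFinD lee_fin; lra.
rewrite integral_mkcond; apply: ge0_le_integral_nomeas => s _; rewrite patchE.
  by case: ifP => // _; exact: poweR_ge0.
case: ifPn => [/set_mem|_]; last by rewrite !adde_ge0.
rewrite /= in_itv /= => /andP[s0' s1].
have [->|st2] := eqVneq s t2.
  rewrite [(top \_ _) t2]patchE mem_set//= addey ?leey// gt_eqF//.
  by rewrite (lt_le_trans ltNy0)// adde_ge0.
rewrite [(top \_ _) s]patchE memNset ?adde0; last by move=> /= /eqP; rewrite (negbTE st2).
rewrite [(r1 \_ _) s]patchE mem_set; last by rewrite /I1 /= in_itv /= s0' s1.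
have [s2|s2] := ltP s t2.
  rewrite [(r2 \_ _) s]patchE mem_set; last by rewrite /I2 /= in_itv /= s0' s2.
  have := hs_sqr_add_le hb (L1 := fun u => Phi1 s w u - el_val (Z1 n) s w u)
    (L2 := fun u => - (Phi2 s w u - el_val (Z2 n) s w u)).
  rewrite P10 ?s0' ?s1// P20 ?s0' ?s2// !el_val0 !subrr oppr0 => /(_ erefl erefl).
  rewrite hs_sqr_opp; apply: le_trans; rewrite le_eqVlt; apply/orP; left; apply/eqP.
  congr (hs_norm _ `^ 2)%E; apply/funext => u; rewrite el_sub_val el_stop_val (ltW s2) /stopped s2.
  by rewrite subrBB.
apply: (@le_trans _ _ (2%:E * r1 s)%E); last by rewrite leeDl.
apply: (@le_trans _ _ (r1 s)); last by rewrite -[leLHS]mul1e lee_wpmul2r// lee_fin; lra.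
rewrite le_eqVlt; apply/orP; left; apply/eqP.
congr (hs_norm _ `^ 2)%E; apply/funext => u; rewrite el_sub_val el_stop_val /stopped ltNge s2 /=.
by rewrite leNgt lt_neqAle eq_sym st2 s2 /= !subr0.
Qed.

End ito_difference.

(** * Bochner integrals *)

Section bochner.
Context {R : realType} {V : hilbertType R}.
Local Notation Rm := (measurableTypeR R).
Local Notation mu := (lebesgue_measure : {measure set Rm -> \bar R}).

Let mI t : measurable (`[0, t[%classic : set Rm). Proof. exact: measurable_itv. Qed.

Lemma vs_val_measurable (g : vsimple V) (y : V) :
  measurable_fun [set: Rm] (fun s => inner (vs_val g s) y).
Proof.
apply: measurable_inner_comb => i; last exact: measurable_cst.
exact: measurable_indic (vs_meas i).
Qed.

Lemma vs_norm_measurable (g : vsimple V) : measurable_fun [set: Rm] (fun s => `|vs_val g s|).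
Proof. by apply: measurable_norm_comb => i; exact: measurable_indic (vs_meas i). Qed.

Let itv_fin t : (lebesgue_measure (`[0%R, t[%classic : set R) < +oo)%E.
Proof. by rewrite lebesgue_measure_itv /=; case: ifP; rewrite ?ltry// -EFinB ltry. Qed.

Let mu_fin (A : set Rm) t : measurable A -> (mu (A `&` `[0%R, t[) < +oo)%E.
Proof.
move=> mA; apply: (@le_lt_trans _ _ (mu (`[0%R, t[%classic : set Rm))); last exact: itv_fin.
by apply: le_measure; rewrite ?inE//; exact: measurableI.
Qed.

Let indic_integrable (A : set Rm) t : measurable A ->
  mu.-integrable (`[0, t[%classic : set Rm) (EFin \o \1_A).
Proof.
move=> mA; apply/integrableP; split.
  by apply/measurable_EFinP; exact: measurable_indic.
under eq_integral do rewrite /= ger0_norm//.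
by rewrite integral_indic// mu_fin.
Qed.

Lemma vs_integral_inner (g : vsimple V) t y :
  mu.-integrable (`[0, t[%classic : set Rm) (EFin \o (fun s => inner (vs_val g s) y)) /\
  inner (vs_integral g t) y = \int[mu]_(s in `[0, t[) inner (vs_val g s) y.
Proof.
have e : (fun s : Rm => inner (vs_val g s) y) =
    (fun s => \sum_i inner (vs_v g i) y * \1_(vs_A g i) s).
  by apply/funext => s; rewrite inner_suml; apply: eq_bigr => i _; rewrite innerZl mulrC.
have ia (i : 'I_(vs_size g)) := @indic_integrable (vs_A g i) t (@vs_meas _ _ g i).
have ii (i : 'I_(vs_size g)) : mu.-integrable (`[0, t[%classic : set Rm)
    (EFin \o (fun s => inner (vs_v g i) y * \1_(vs_A g i) s)).
  exact: (integrableZl (mI t) _ (ia i)).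
rewrite e /vs_integral inner_suml.
elim: (index_enum _) => [|i l [IH1 IH2]].
  have -> : (fun s : Rm => \sum_(i <- [::]) inner (vs_v g i) y * \1_(vs_A g i) s) = cst 0.
    by apply/funext => s; rewrite big_nil.
  by split; [exact: integrable0|rewrite big_nil Rintegral_cst// mul0r].
split.
  have -> : (fun s : Rm => \sum_(i <- i :: l) inner (vs_v g i) y * \1_(vs_A g i) s) =
      (fun s => inner (vs_v g i) y * \1_(vs_A g i) s + \sum_(i <- l) inner (vs_v g i) y * \1_(vs_A g i) s).
    by apply/funext => s; rewrite big_cons.
  exact: (integrableD (mI t) (ii i) IH1).
rewrite big_cons IH2; under [RHS]eq_Rintegral => s _ do rewrite big_cons.
rewrite (RintegralD (mI t) (ii i) IH1); congr (_ + _).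
rewrite RintegralZl//.
by rewrite innerZl mulrC /Rintegral integral_indic//; exact: vs_meas.
Qed.

(** Test against the integral [v] itself: [|v|^2] is the integral of [<g(s), v>], hence at most
    [|v|] times the integral of [|g(s)|]. *)
Lemma vs_integral_norm_le (g : vsimple V) t :
  (`|vs_integral g t|%:E <= \int[mu]_(s in `[0%R, t[) `|vs_val g s|%:E)%E.
Proof.
set v := vs_integral g t.
have [->|v0] := eqVneq v 0; first by rewrite normr0; apply: integral_ge0 => s _; rewrite lee_fin.
have nv : 0 < `|v| by rewrite normr_gt0.
have [ii ie] := vs_integral_inner g t v.
have h : ((`|v| ^+ 2)%:E <= \int[mu]_(s in `[0%R, t[) (`|v|%:E * `|vs_val g s|%:E))%E.
  rewrite -inner_norm {1}/v ie /Rintegral fineK; last exact: integrable_fin_num.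
  apply: (@le_trans _ _ (\int[mu]_(s in `[0%R, t[) `|(inner (vs_val g s) v)%:E|)%E).
    apply: le_trans (lee_abs _) _; apply: le_abse_integral => //.
    by apply/measurable_EFinP; apply: measurable_funTS; exact: vs_val_measurable.
  apply: ge0_le_integral_nomeas => s _ //=.
  by rewrite lee_fin mulrC cauchy_schwarz.
rewrite ge0_integralZl//= in h; last first.
  by apply/measurable_EFinP; apply: measurable_funTS; exact: vs_norm_measurable.
by rewrite -(@lee_pmul2l _ `|v|%:E)// -EFinM -expr2.
Qed.

Record vs_term := VsTerm { vt_A : set Rm; vt_v : V; vt_meas : measurable vt_A }.

Let mAI (A : set Rm) t : measurable A -> measurable (A `&` `[0, t[%classic : set Rm).
Proof. by move=> mA; exact: measurableI. Qed.

Section difference.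
Variables (g1 g2 : vsimple V) (t1 t2 : R).

Let term := on_split
  (fun i => @VsTerm (vs_A g1 i) (vs_v g1 i) (@vs_meas _ _ g1 i))
  (fun i => @VsTerm (vs_A g2 i `&` `[0, t2[%classic) (- vs_v g2 i) (mAI t2 (@vs_meas _ _ g2 i))).

Definition vs_sub : vsimple V := @VSimple R V (vs_size g1 + vs_size g2)
  (fun i => vt_A (term i)) (fun i => vt_v (term i)) (fun i => vt_meas (term i)).

Lemma vs_sub_val s : 0 <= s ->
  vs_val vs_sub s = vs_val g1 s - (if s < t2 then vs_val g2 s else 0).
Proof.
move=> s0; rewrite /vs_val /vs_sub /= (on_split_sum (fun x => \1_(vt_A x) s *: vt_v x)) /=.
congr (_ + _); case: ifPn => st; last first.
  rewrite oppr0 big1// => i _; rewrite indicE memNset ?scale0r//= in_itv /= (negbTE st) andbF.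
  by case.
rewrite -sumrN; apply: eq_bigr => i _; rewrite scalerN; congr (- (_ *: _)); rewrite !indicE; congr (nat_of_bool _)%:R.
by rewrite in_setI (_ : (s \in `[0, t2[%classic) = true) ?andbT// mem_set//= in_itv /= s0 st.

Qed.

Lemma vs_sub_integral : t2 <= t1 -> vs_integral vs_sub t1 = vs_integral g1 t1 - vs_integral g2 t2.
Proof.
move=> t21; rewrite /vs_integral /vs_sub /= (on_split_sum (fun x => fine (mu (vt_A x `&` `[0, t1[)) *: vt_v x)) /=.
congr (_ + _); rewrite -sumrN; apply: eq_bigr => i _; rewrite scalerN; congr (- (fine (mu _) *: _)).
rewrite -setIA; congr (_ `&` _); apply/seteqP; split => x /=; first by case.
by move=> h; split=> //; move: h; rewrite /= !in_itv /= => /andP[-> /lt_le_trans->].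
Qed.

End difference.

Variable e : nat -> V.
Hypothesis te : onseq_total e.

Lemma bochner_error_measurable t (f : R -> V) (g : vsimple V) :
  (forall C, borel C -> measurable (`[0, t[ `&` f @^-1` C : set Rm)) ->
  measurable_fun (`[0, t[%classic : set Rm) (fun s => `|f s - vs_val g s|%:E).
Proof.
move=> mf; apply/measurable_EFinP; apply: (measurable_norm_coord te) => // i.
rewrite (_ : (fun s => _) = (fun s => inner (e i) (f s) - inner (vs_val g s) (e i))); last first.
  by apply/funext => s; rewrite innerBr [X in _ - X]innerC.
apply: measurable_funB; last exact: measurable_funTS (vs_val_measurable _ _).
  move=> _ C mC; apply: (mf (inner (e i) @^-1` C)).
  exact: (continuous_preimage_borel (@continuous_inner _ _ (e i))).

Qed.

(** Different endpoints serve time increments, equal ones the truncation error. The comparison is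
    made between simple functions ([vs_sub]), whose L1 errors vanish in the limit. *)
Lemma bochner_sub_le t1 t2 (f1 f2 : R -> V) (I1 I2 : V) (h : Rm -> \bar R) :
  0 <= t2 -> t2 <= t1 -> is_bochner_integral t1 f1 I1 -> is_bochner_integral t2 f2 I2 ->
  measurable_fun (`[0, t1[%classic : set Rm) h ->
  (forall s, 0 <= s < t1 -> (`|f1 s - (if s < t2 then f2 s else 0)|%:E <= h s)%E) ->
  (`|I1 - I2|%:E <= \int[mu]_(s in `[0%R, t1[) h s)%E.
Proof.
move=> t20 t21 [mf1 [g1 [c1 d1]]] [mf2 [g2 [c2 d2]]] mh fh.
have h0 s : `[0, t1[%classic s -> (0 <= h s)%E.
  by rewrite /= in_itv /= => /fh; apply: le_trans; rewrite lee_fin.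
pose e1 n := (\int[mu]_(s in `[0%R, t1[) `|f1 s - vs_val (g1 n) s|%:E)%E.
pose e2 n := (\int[mu]_(s in `[0%R, t2[) `|f2 s - vs_val (g2 n) s|%:E)%E.
have c : `|vs_integral (g1 n) t1 - vs_integral (g2 n) t2|%:E @[n --> \oo] --> `|I1 - I2|%:E.
  by apply: cvg_EFin; [exact: nearW|apply: cvg_norm; exact: cvgB].
have c' : (\int[mu]_(s in `[0%R, t1[) h s + (e1 n + e2 n))%E @[n --> \oo] -->
    (\int[mu]_(s in `[0%R, t1[) h s + (0 + 0 : \bar R))%E.
  by apply: cvgeD; [rewrite adde0 fin_num_adde_defl|exact: cvg_cst|exact: cvgeD].
rewrite !adde0 in c'; apply: (lee_cvg_to c c'); apply: nearW => n.
rewrite -(vs_sub_integral _ _ t21); apply: le_trans (vs_integral_norm_le _ _) _.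
have e2E : e2 n = (\int[mu]_(s in `[0%R, t1[)
    ((fun s => `|f2 s - vs_val (g2 n) s|%:E) \_ (`[0%R, t2[%classic : set Rm)) s)%E.
  rewrite /e2 integral_mkcond [RHS]integral_mkcond; apply: eq_integral => s _.
  rewrite !patchE; case: ifPn => [/set_mem|] //; last by case: ifP.
  by rewrite /= in_itv /= => /andP[h1 h2]; rewrite mem_set//= in_itv /= h1 (lt_le_trans h2).
have m2 : measurable_fun (`[0%R, t1[%classic : set Rm)
    ((fun s => `|f2 s - vs_val (g2 n) s|%:E) \_ (`[0%R, t2[%classic : set Rm))%E.
  apply: measurable_funTS; apply/(measurable_restrictT _ (mI t2)).
  exact: bochner_error_measurable.
have m1 : measurable_fun (`[0%R, t1[%classic : set Rm) (fun s => `|f1 s - vs_val (g1 n) s|%:E).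
  exact: bochner_error_measurable.
have p2 s : (0 <= ((fun s => `|f2 s - vs_val (g2 n) s|%:E) \_ (`[0%R, t2[%classic : set Rm)) s)%E.
  by rewrite patchE; case: ifP; rewrite // lee_fin.
have p1 s : (0 <= `|f1 s - vs_val (g1 n) s|%:E)%E by rewrite lee_fin.
rewrite e2E /e1 -(@ge0_integralD _ _ _ mu _ (mI t1) _ _ (fun s _ => p1 s) m1 (fun s _ => p2 s) m2).
rewrite -(@ge0_integralD _ _ _ mu _ (mI t1) _ _ h0 mh (fun s _ => adde_ge0 (p1 s) (p2 s))
  (emeasurable_funD m1 m2)).
apply: ge0_le_integral_nomeas => s /= hs; first by rewrite lee_fin.
move: hs; rewrite in_itv /= => hs; have /andP[s0 s1] := hs.
rewrite vs_sub_val//; apply: le_trans (leeD2r _ (fh s hs)); rewrite patchE.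
case: ifPn => st; last first.
  rewrite subr0 memNset; last by rewrite /= in_itv /= (negbTE st) andbF.
  rewrite subr0 adde0 -EFinD lee_fin -{1}[vs_val (g1 n) s](subrK (f1 s)) addrC.
  by apply: le_trans (ler_normD _ _) _; rewrite [X in _ + X]distrC.
rewrite mem_set/= ?in_itv /= ?s0 ?st// -!EFinD lee_fin.
rewrite (_ : vs_val (g1 n) s - vs_val (g2 n) s =
    f1 s - f2 s + (- (f1 s - vs_val (g1 n) s) + (f2 s - vs_val (g2 n) s))).
  apply: le_trans (ler_normD _ _) _; rewrite lerD2l.
  by apply: le_trans (ler_normD _ _) _; rewrite normrN.
by rewrite opprB addrA [f1 s - f2 s + _]addrC !subrKA.
Qed.

End bochner.

(** * Continuous adapted processes *)

Section continuous_adapted.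
Context {R : realType} {d : measure_display} {Omega : measurableType d}.
Local Notation Rm := (measurableTypeR R).

(* A Caratheodory function is the limit of its restrictions to the grids of mesh [1/n]. *)
Lemma measurable_caratheodory (f : Rm * Omega -> R) :
  (forall s, measurable_fun setT (fun w => f (s, w))) ->
  (forall w, continuous (fun s : R => f (s, w))) -> measurable_fun setT f.
Proof.
move=> mf cf.
pose a (n : nat) (s : Rm) : R := (Num.floor (s * n.+1%:R))%:~R / n.+1%:R.
pose fn n (z : Rm * Omega) := f (a n z.1, z.2).
have mfn n : measurable_fun setT (fn n).
  move=> _ C mC; rewrite setTI.
  have -> : fn n @^-1` C = \bigcup_(k in [set: int])
      ([set s : Rm | Num.floor (s * n.+1%:R) = k] `*` [set w | C (f (k%:~R / n.+1%:R, w))]).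
    apply/seteqP; split => [[s w] /= h|[s w] [k _] [/= h1 h2]]; last by rewrite /fn /a /= h1.
    by exists (Num.floor (s * n.+1%:R)).
  apply: countable_bigcupT_measurable; first exact: countableP.
  move=> k; apply: measurableX; last by rewrite -[X in measurable X]setTI; exact: (mf _).
  rewrite (_ : [set s | _] = `[k%:~R / n.+1%:R, (k + 1)%:~R / n.+1%:R[%classic); first exact: measurable_itv.
  apply/seteqP; split => s /=; rewrite in_itv /= ler_pdivrMr// ltr_pdivlMr//.
    by move=> <-; rewrite floor_le lt_succ_floor.
  by move=> h; apply: floor_def.
apply: (measurable_fun_cvg mfn) => -[s w] _.
apply: (@cvg_comp _ _ _ (fun n => a n s) (fun x => f (x, w)) \oo (nbhs (s : R)) (nbhs (f (s, w)))); last exact: cf.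
have : (fun n : nat => n.+1%:R^-1 : R) @ \oo --> (0 : R) by exact: cvg_harmonic.
move=> h; have h2 : (fun n : nat => s - n.+1%:R^-1 : R) @ \oo --> (s - 0 : R).
  by apply: cvgB => //; exact: cvg_cst.
rewrite subr0 in h2; apply: (squeeze_cvgr _ h2 (cvg_cst _)).
apply: nearW => n; rewrite /a; apply/andP; split.
  rewrite lerBlDr -[X in _ + X]mul1r -mulrDl.
  by rewrite ler_pdivlMr// ltW// -[1]/(1%:~R) -intrD lt_succ_floor.
by rewrite ler_pdivrMr// floor_le.
Qed.

Variables (P : probability Omega R) (T : R) (Fil : R -> set (set Omega)).
Hypothesis hFil : normal_filtration P T Fil.
Hypothesis T0 : 0 <= T.
Context {V : hilbertType R} (e : nat -> V).
Hypothesis te : onseq_total e.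

(** Freezes a process outside [[0, T]], so that its paths are continuous on the whole line and joint
    measurability holds on all of [Rm * Omega]. *)
Definition clamp (s : R) : R := Num.max 0 (Num.min s T).

Lemma clamp_itv s : 0 <= clamp s <= T.
Proof. by rewrite /clamp le_max lexx ge_max T0 ge_min lexx orbT. Qed.

Lemma clamp_id s : 0 <= s <= T -> clamp s = s.
Proof. by move=> /andP[s0 sT]; rewrite /clamp (min_idPl sT) (max_idPr s0). Qed.

Let continuous_minr (y : R) : continuous (fun x : R => Num.min x y).
Proof. by move=> s; apply: (@continuous_min R R id (cst y)); [exact: cvg_id|exact: cvg_cst]. Qed.

Lemma continuous_clamp : continuous clamp.
Proof.
move=> s; apply: (@continuous_max R R (cst 0) (fun x => Num.min x T)); first exact: cvg_cst.
exact: continuous_minr.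
Qed.

Variable X : R -> Omega -> V.
Hypothesis adX : adapted T Fil X.
Hypothesis contX : forall w, {within `[0, T], continuous (fun t => X t w)}.

Lemma continuous_clamp_path w : continuous (fun s => X (clamp s) w).
Proof.
move=> s; have /subspace_continuousP h : {within `[0, T], continuous (fun t => X t w)} := @contX w.
have := h (clamp s); rewrite /= in_itv /= clamp_itv => /(_ isT) hs.
apply: (@cvg_comp _ _ _ clamp (fun t => X t w) _ (within `[0, T] (nbhs (clamp s)))); last exact: hs.
move=> A wA; have wA' : nbhs (clamp s) [set x | `[0, T]%classic x -> A x] := wA.
have c : nbhs s (clamp @^-1` [set x | `[0, T]%classic x -> A x]) := continuous_clamp wA'.
by apply: filterS c => x /= hx; apply: hx; rewrite in_itv /= clamp_itv.
Qed.

Lemma path_bounded w : exists M, forall s, `|X (clamp s) w| <= M.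
Proof.
have [|c cI hc] := @EVT_max R (fun s => `|X (clamp s) w|) 0 T T0.
  apply: continuous_subspaceT => s; apply: continuous_comp; last exact: norm_continuous.
  exact: continuous_clamp_path.
exists `|X (clamp c) w| => s; have := hc (clamp s); rewrite in_itv /= clamp_itv => /(_ isT).
by rewrite clamp_id// clamp_itv.
Qed.

Lemma adapted_norm s C : 0 <= s <= T -> measurable C -> Fil s [set w | C `|X s w|].
Proof.
move=> sT mC; apply: (adX sT (C := [set x : V | C `|x|])).
exact: (continuous_preimage_borel (@norm_continuous _ V)).
Qed.

Lemma adapted_coord_measurable s i : 0 <= s <= T ->
  measurable_fun setT (fun w => inner (e i) (X s w)).
Proof.
move=> sT _ C mC; rewrite setTI; apply: (fil_measurable hFil sT).
apply: (adX sT (C := inner (e i) @^-1` C)).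
exact: (continuous_preimage_borel (@continuous_inner _ _ (e i))).
Qed.

Lemma path_coord_measurable i :
  measurable_fun setT (fun z : Rm * Omega => inner (e i) (X (clamp z.1) z.2)).
Proof.
apply: measurable_caratheodory => [s|w] /=; first exact: adapted_coord_measurable (clamp_itv _).
move=> s; apply: continuous_comp; first exact: continuous_clamp_path.
exact: continuous_inner.
Qed.

Lemma path_norm_measurable : measurable_fun setT (fun z : Rm * Omega => `|X (clamp z.1) z.2|).
Proof. by apply: (measurable_norm_coord te) => // i; exact: path_coord_measurable. Qed.

(** The localizing events of the moment estimates. They bound the running maximum of the clamped
    path; continuity of the path makes them measurable through rational times and left continuous in
    [s]. *)
Definition path_below (K s : R) : set Omega := [set w | forall r, r <= s -> `|X (clamp r) w| <= K].

Lemma path_below_rat K s w :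
  path_below K s w <-> forall q : rat, `|X (clamp (Num.min (ratr q) s)) w| <= K.
Proof.
split=> [h q|h r rs]; first by apply: h; rewrite ge_min lexx orbT.
rewrite leNgt; apply/negP => Kr.
pose f (x : R) := `|X (clamp (Num.min x s)) w|.
have cf : continuous f.
  move=> x; apply: continuous_comp; last exact: norm_continuous.
  apply: (@continuous_comp _ _ _ (fun x : R => Num.min x s) (fun x => X (clamp x) w)).
    exact: continuous_minr.
  exact: continuous_clamp_path.
have [] := @dense_rat R (f @^-1` `]K, +oo[%classic).
- by exists r; rewrite /f /= in_itv /= andbT (min_idPl rs).
- apply: open_comp => [x _|]; [exact: cf|exact: interval_open].
by move=> x [hx [q _ qx]]; move: hx; rewrite -qx /= in_itv /= andbT /f ltNge h.
Qed.

Lemma path_below_decr K s s' : s <= s' -> path_below K s' `<=` path_below K s.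
Proof. by move=> ss' w h r rs; apply: h; exact: le_trans rs ss'. Qed.

Lemma path_below_fil K s : 0 <= s <= T -> Fil s (path_below K s).
Proof.
move=> sT; have /andP[s0 sT'] := sT; apply/(fil_typeE hFil _ sT).
rewrite (_ : path_below K s = \bigcap_(q : rat)
   [set w | `|X (clamp (Num.min (ratr q) s)) w| <= K]); last first.
  by apply/seteqP; split => w; rewrite /= path_below_rat => h q; [move=> _; exact: h|exact: (h q)].
rewrite -[X in measurable X]setCK; apply: measurableC; rewrite setC_bigcap.
apply: countable_bigcupT_measurable => [|q]; first exact: countableP.
apply: measurableC; apply/(fil_typeE hFil _ sT).
have [_ hmono _ _] := hFil; set c := clamp _.
have cs : c <= s by rewrite /c /clamp ge_max s0 !ge_min lexx orbT.
have /andP[c0 cT] := clamp_itv (Num.min (ratr q) s).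
apply: (hmono c s c0 cs sT'); apply: (@adapted_norm c `]-oo, K]%classic); first by rewrite c0.
exact: measurable_itv.
Qed.

Lemma path_below_left K s w : (forall s', s' < s -> path_below K s' w) -> path_below K s w.
Proof.
move=> h r; rewrite le_eqVlt => /predU1P[->|rs]; last exact: (h r rs).
have c : `|X (clamp x) w| @[x --> s^'-] --> `|X (clamp s) w|.
  apply: cvg_at_left_filter; apply: cvg_norm; exact: continuous_clamp_path.
apply: (cvgr_to_le c); near=> x; apply: (h x) => //.
Unshelve. all: by end_near. Qed.

Lemma path_below_measurable K : measurable [set z : Rm * Omega | path_below K z.1 z.2].
Proof.
rewrite (_ : [set z | _] = \bigcap_(q : rat)
   [set z : Rm * Omega | `|X (clamp (Num.min (ratr q) z.1)) z.2| <= K]); last first.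
  by apply/seteqP; split => z; rewrite /= path_below_rat => h q; [move=> _; exact: h|exact: (h q)].
rewrite -[X in measurable X]setCK; apply: measurableC; rewrite setC_bigcap.
apply: countable_bigcupT_measurable => [|q]; first exact: countableP.
apply: measurableC.
have m : measurable_fun setT (fun z : Rm * Omega => `|X (clamp (Num.min (ratr q) z.1)) z.2|).
  apply: (measurable_norm_coord te) => // i; apply: measurable_caratheodory => [s|w] /=.
    exact: adapted_coord_measurable (clamp_itv _).
  move=> s; apply: continuous_comp; last exact: continuous_inner.
  apply: (@continuous_comp _ _ _ (fun x : R => Num.min (ratr q) x) (fun x => X (clamp x) w)).
    by apply: (@continuous_min R R (cst (ratr q)) id); [exact: cvg_cst|exact: cvg_id].
  exact: continuous_clamp_path.
by rewrite -[X in measurable X]setTI; apply: (m measurableT `]-oo, K]%classic); exact: measurable_itv.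
Qed.

End continuous_adapted.

(** * Mild solutions *)

Section singular_weights.
Context {R : realType}.
Local Notation Rm := (measurableTypeR R).
Implicit Types s t kap : R.

(** Brings every milder singularity to the common exponent [kap], which is where the factors [1 + T]
    in the constants come from. *)
Lemma powRN_le (x T a kap : R) : 0 < x -> x <= T -> 0 <= a -> a <= kap -> kap <= 1 ->
  x `^ (- a) <= (1 + T) * x `^ (- kap).
Proof.
move=> x0 xT a0 ak k1; rewrite (_ : - a = (kap - a) + - kap); last by ring.
rewrite powR_add// ler_wpM2r ?powR_ge0//; apply: le_trans (lerD (lexx _) xT).
by apply: powR_le_max; [exact: ltW|apply/andP; split; lra].
Qed.

(* The singular weight of an increment: both semigroups are close before [t2], and only
   the first one acts after. *)
Definition incr_kernel kap t1 t2 (s : R) : R :=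
  if s < t2 then (t2 - s) `^ (- kap) else (t1 - s) `^ (- kap).

Lemma incr_kernel_ge0 kap t1 t2 s : 0 <= incr_kernel kap t1 t2 s.
Proof. by rewrite /incr_kernel; case: ifP => _; exact: powR_ge0. Qed.

Lemma incr_kernel_measurable kap t1 t2 :
  measurable_fun setT (incr_kernel kap t1 t2 : Rm -> R).
Proof.
apply: measurable_fun_ifT; try exact: measurable_kernel.
by apply: measurable_fun_ltr.
Qed.

Lemma kernel_integral_le T kap t : kap < 1 -> 0 <= kap -> 0 <= t -> t <= T ->
  (\int[lebesgue_measure]_(s in `[0%R, t[) ((t - s) `^ (- kap))%:E <= ((1 + T) / (1 - kap))%:E)%E.
Proof.
move=> k1 k0 t0 tT; apply: le_trans (kernel_integral k1 t0) _.
rewrite lee_fin ler_wpM2r ?invr_ge0 ?subr_ge0 ?(ltW k1)// subr0.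
apply: le_trans (powR_le_max t0 _) _; [apply/andP; split; lra|by rewrite lerD2l].
Qed.

Lemma incr_kernel_integral_le T kap t1 t2 : kap < 1 -> 0 <= kap -> 0 <= t2 -> t2 <= t1 -> t1 <= T ->
  (\int[lebesgue_measure]_(s in `[0%R, t1[) (incr_kernel kap t1 t2 s)%:E <=
   (2 * ((1 + T) / (1 - kap)))%:E)%E.
Proof.
move=> k1 k0 t20 t21 tT.
have e : (`[0%R, t1[%classic : set R) = `[0%R, t2[%classic `|` `[t2, t1[%classic.
  apply/seteqP; split => s /=; rewrite !in_itv /=.
    by move=> /andP[s0 s1]; rewrite s0 s1; case: (ltP s t2) => _; [left|right].
  by move=> [/andP[-> /lt_le_trans->]//|/andP[/(le_trans t20)-> ->]].
rewrite e ge0_integral_setU//=; last 3 first.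
- by apply/measurable_EFinP; apply: measurable_funTS; exact: incr_kernel_measurable.
- by move=> s _; rewrite lee_fin incr_kernel_ge0.
- apply/disj_setPS => s /= []; rewrite !in_itv /= => /andP[_ h] /andP[h' _].
  by move: h; rewrite ltNge h'.
rewrite mulrDl mul1r EFinD; apply: leeD.
  rewrite (eq_integral (fun s : Rm => ((t2 - s) `^ (- kap))%:E)); last first.
    by move=> s; rewrite inE /= in_itv /= /incr_kernel => /andP[_ ->].
  by apply: kernel_integral_le => //; exact: le_trans tT.
rewrite (eq_integral (fun s : Rm => ((t1 - s) `^ (- kap))%:E)); last first.
  by move=> s; rewrite inE /= in_itv /= /incr_kernel => /andP[h _]; rewrite ltNge h.
apply: le_trans (kernel_integral k1 t21) _.
rewrite lee_fin ler_wpM2r ?invr_ge0 ?subr_ge0 ?(ltW k1)//.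
have h0 : 0 <= t1 - t2 by rewrite subr_ge0.
by apply: le_trans (powR_le_max h0 _) _; [apply/andP; split; lra|lra].
Qed.

End singular_weights.

Lemma measurable_powR_comp (R : realType) (d : measure_display) (T : measurableType d)
    (D : set T) (f : T -> R) (q : R) :
  measurable_fun D f -> measurable_fun D (fun x => f x `^ q).
Proof.
move=> mf; apply: (@measurableT_comp _ _ _ _ _ _ (fun x : measurableTypeR R => x `^ q)) => //.
Qed.

Section mild_moment.
Context {R : realType} {d : measure_display} {Omega : measurableType d}.
Variables (P : probability Omega R) (T : R) (Fil : R -> set (set Omega)).
Hypothesis hFil : normal_filtration P T Fil.
Hypothesis T0 : 0 <= T.
Context {U V : hilbertType R} (W : R -> U -> Omega -> R).
Hypothesis hW : cylindrical_wiener P T Fil W.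
Variables (b : nat -> U) (e : nat -> V).
Hypothesis tb : onseq_total b.
Hypothesis te : onseq_total e.
Hypothesis hb : forall L : U -> V, L 0 = 0 ->
  (hs_norm L `^ 2 = \sum_(n <oo) (`|L (b n)| ^+ 2)%:E)%E.
Local Notation Rm := (measurableTypeR R).
Local Notation strip t := ((`[0%R, t[%classic : set Rm) `*` [set: Omega]).
Local Notation approx := (ito_approx P T Fil W e).

(* Both integrals of a mild solution are estimated by Jensen's inequality for the
   finite measure [k(s) ds]. *)
Lemma mild_moment (p kap : R) : 2 <= p -> 0 < kap -> exists2 C : R, 0 <= C &
  forall t Phi J (D : R -> set Omega) (k : Rm -> R) (g : Rm * Omega -> R)
    (Y y0 : Omega -> R), 0 <= t <= T ->
  (forall s, 0 <= s <= T -> Fil s (D s)) ->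
  (forall s s', 0 <= s -> s <= s' -> D s' `<=` D s) ->
  (forall s w, 0 < s -> (forall s', 0 <= s' < s -> D s' w) -> D s w) ->
  measurable [set z : Rm * Omega | D z.1 z.2] ->
  measurable_fun setT k -> (forall s, 0 <= k s) ->
  (\int[lebesgue_measure]_(s in `[0%R, t[) (k s)%:E <= kap%:E)%E ->
  measurable_fun setT g -> (forall z, 0 <= g z) ->
  (forall w, exists M, forall s, g (s, w) <= M) ->
  (forall s w, 0 <= s < t -> (hs_norm (Phi s w) `^ 2 <= (k s * g (s, w) ^+ 2)%:E)%E) ->
  approx t Phi J ->
  measurable_fun setT Y -> measurable_fun setT y0 ->
  (forall w, 0 <= Y w) -> (forall w, 0 <= y0 w) ->
  {ae P, forall w, ((Y w)%:E <= (y0 w)%:E +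
    \int[lebesgue_measure]_(s in `[0%R, t[) (k s * g (s, w))%:E + `|J w|%:E)%E} ->
  (\int[P]_w (\1_(D t) w * Y w `^ p)%:E <= C%:E * (\int[P]_w (y0 w `^ p)%:E +
     \int[lebesgue_measure]_(s in `[0%R, t[)
       ((k s)%:E * \int[P]_w (\1_(D s) w * g (s, w) `^ p)%:E)))%E.
Proof.
move=> p2 kap0; have [Ci Ci0 HI] := ito_moment hFil hW tb te hb p2.
pose A := 2 `^ p * 2 `^ p.
exists (A * (1 + kap `^ (p - 1) + Ci * kap `^ (p / 2 - 1))).
  by rewrite mulr_ge0 ?mulr_ge0 ?addr_ge0 ?mulr_ge0 ?powR_ge0.
move=> t Phi J D k g Y y0 tT FD DD Dl mD mk k0 ik mg g0 gM hsP HJ mY my0 Y0 y00 aeY.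
pose mu := (lebesgue_measure : {measure set Rm -> \bar R}).
pose I := `[0%R, t[%classic : set Rm.
have mI : measurable I by exact: measurable_itv.
have p0 : 0 < p by lra.
have mDt : measurable (D t) by exact: (fil_measurable hFil tT (FD t tT)).
pose u s w : R := \1_(D s) w * g (s, w).
have u0 s w : 0 <= u s w by rewrite mulr_ge0.
have ug s w : u s w <= g (s, w) by rewrite ler_piMl// indicE; case: (w \in _).
have mu_ : measurable_fun setT (fun z : Rm * Omega => u z.1 z.2).
  apply: measurable_funM; last by apply: (eq_measurable_fun g) => // -[].
  rewrite (_ : (fun z : Rm * Omega => _) = \1_[set z : Rm * Omega | D z.1 z.2]); first exact: measurable_indic.
  by apply/funext => z; rewrite !indicE; congr (nat_of_bool _)%:R; rewrite !mem_setE.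
have mk2 : measurable_fun setT (fun z : Rm * Omega => k z.1).
  by apply: measurableT_comp mk _; exact: measurable_fst.
have mku q : measurable_fun (I `*` [set: Omega]) (fun z : Rm * Omega => (k z.1 * u z.1 z.2 `^ q)%:E).
  apply/measurable_EFinP; apply: measurable_funTS; apply: measurable_funM => //.
  exact: measurable_powR_comp.
have ku0 q s w : 0 <= k s * u s w `^ q by rewrite mulr_ge0// powR_ge0.
have u1 s w : u s w `^ 1 = u s w by rewrite powRr1.
have usec w : measurable_fun I (fun s => u s w).
  by apply: measurable_funTS; exact: (measurableT_comp mu_ (measurable_pair2 w)).
have ksec : measurable_fun I k by exact: measurable_funTS.
pose Kq q w := (\int[mu]_(s in I) (k s * u s w `^ q)%:E)%E.
have Kq0 q w : (0 <= Kq q w)%E by apply: integral_ge0 => s _; rewrite lee_fin.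
have mKq q : measurable_fun setT (Kq q).
  exact: (measurable_section_integral (mku q) (fun z => ku0 q z.1 z.2)).
have jens q q' : 1 <= q -> 0 < q' ->
    forall w, (Kq q' w `^ q <= (kap `^ (q - 1))%:E * Kq (q' * q)%R w)%E.
  move=> q1 q'0 w; have := @jensen_kernel _ _ R mu I k (fun s => u s w `^ q') q kap mI q1 kap0.
  move=> /(_ (fun s _ => k0 s) (fun s _ => powR_ge0 _ _) ksec).
  have m' : measurable_fun I (fun s => u s w `^ q') by exact: measurable_powR_comp.
  move=> /(_ m' ik); rewrite /Kq; under [X in (_ <= _ * X)%E]eq_integral do rewrite -powRrM.
  by [].
have fub q : (\int[P]_w Kq q w = \int[mu]_(s in I) ((k s)%:E * \int[P]_w (u s w `^ q)%:E))%E.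
  pose f (z : Rm * Omega) : \bar R := ((fun z : Rm * Omega => (k z.1 * u z.1 z.2 `^ q)%:E) \_ (I `*` [set: Omega])) z.
  have mf : measurable_fun setT f by apply/(measurable_restrictT _ (measurable_strip t)).
  have f0 z : (0 <= f z)%E by rewrite /f patchE; case: ifP; rewrite // lee_fin.
  have fE s w : f (s, w) = ((fun s => (k s * u s w `^ q)%:E) \_ I) s.
    by rewrite /f !patchE in_setX in_setT andbT.
  transitivity (\int[P]_w \int[mu]_s f (s, w))%E.
    apply: eq_integral => w _; rewrite /Kq integral_mkcond.
    by apply: eq_integral => s _; rewrite fE.
  rewrite -(fubini_tonelli (m1 := lebesgue_measure) (m2 := P) f mf f0) [RHS]integral_mkcond.
  apply: eq_integral => s _; rewrite patchE; case: ifPn => sI.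
    rewrite -(integralZ_ge0 P (k0 s)).
    - by apply: eq_integral => w _; rewrite fE patchE sI EFinM.
    - apply/measurable_EFinP; apply: measurable_powR_comp.
      exact: (measurableT_comp mu_ (measurable_pair1 s)).
    - by move=> w; rewrite lee_fin powR_ge0.
  by apply: integral0_eq => w _; rewrite fE patchE (negbTE sI).
have Kfin q : 0 <= q -> forall w, Kq q w \is a fin_num.
  move=> q0 w; rewrite ge0_fin_numE//; have [M gM'] := gM w.
  apply: (@le_lt_trans _ _ (\int[mu]_(s in I) ((Num.max 0 M `^ q)%:E * (k s)%:E))%E).
    apply: ge0_le_integral_nomeas => s _; first by rewrite lee_fin.
    rewrite -EFinM lee_fin mulrC ler_wpM2r//; apply: ler_powR_base => //.
    by apply: le_trans (ug s w) _; rewrite le_max gM' orbT.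
  rewrite ge0_integralZl//=; last 3 first.
  - by apply/measurable_EFinP.
  - by move=> s _; rewrite lee_fin.
  - by rewrite lee_fin powR_ge0.
  by apply: lte_mul_pinfty => //; [rewrite lee_fin powR_ge0|exact: le_lt_trans ik (ltry _)].
pose a q w := fine (Kq q w).
have aE q w : 0 <= q -> (a q w)%:E = Kq q w by move=> q0; rewrite /a fineK// Kfin.
have a0 q w : 0 <= a q w by exact: fine_ge0.
have ma q : measurable_fun setT (a q) by exact: measurableT_comp (mKq q).
have [_ mJ _ _] := HJ.
have mnJ : measurable_fun setT (fun w => `|J w|) by exact: (measurable_norm_coord te).
have mpow f : measurable_fun [set: Omega] f -> measurable_fun setT (fun w => f w `^ p).
  exact: measurable_powR_comp.
have mind : measurable_fun setT (\1_(D t) : Omega -> R) by exact: measurable_indic.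
have mF : measurable_fun setT (fun w => y0 w `^ p + (a 1 w `^ p + \1_(D t) w * `|J w| `^ p)).
  by do !apply: measurable_funD => //; try exact: mpow; apply: measurable_funM => //; exact: mpow.
have A1 : 1 <= 2 `^ p :> R by rewrite -[X in X <= _](powRr0 2); apply: ler_powR; lra.
have F0 w : 0 <= y0 w `^ p + (a 1 w `^ p + \1_(D t) w * `|J w| `^ p).
  by rewrite !addr_ge0 ?powR_ge0// mulr_ge0// powR_ge0.
have step1 : (\int[P]_w (\1_(D t) w * Y w `^ p)%:E <=
    \int[P]_w (A%:E * (y0 w `^ p + (a 1 w `^ p + \1_(D t) w * `|J w| `^ p))%:E))%E.
  apply: ae_ge0_le_integral => //.
  - by move=> w _; rewrite lee_fin mulr_ge0// powR_ge0.
  - by apply/measurable_EFinP; apply: measurable_funM => //; exact: mpow.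
  - by move=> w _; rewrite -EFinM lee_fin mulr_ge0// mulr_ge0// powR_ge0.
  - by apply: measurable_funeM; apply/measurable_EFinP.
  apply: filterS aeY => w hw _.
  have [wD|wD] := pselect (D t w); last first.
    by rewrite indicE memNset// mul0r mul0r addr0 -EFinM lee_fin mulr_ge0 ?addr_ge0 ?mulr_ge0 ?powR_ge0.
  rewrite !indicE mem_set// !mul1r -EFinM lee_fin.
  (* On [D t] all earlier events hold as well, so the indicator may be inserted under the time
     integral. *)
  have eK : (\int[lebesgue_measure]_(s in `[0%R, t[) (k s * g (s, w))%:E = Kq 1%R w)%E.
    apply: eq_integral => s; rewrite inE /I /= in_itv /= => /andP[s0 st].
    by rewrite u1 /u indicE mem_set ?mul1r//; exact: (DD s t s0 (ltW st)).
  move: hw; rewrite eK -(aE _ _ ler01) -!EFinD lee_fin => hw.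
  have hA x y : 0 <= x -> 0 <= y -> (x + y) `^ p <= 2 `^ p * (x `^ p + y `^ p).
    by move=> x0 y0'; apply: powR_add_le => //; exact: ltW.
  apply: (@le_trans _ _ ((y0 w + (a 1 w + `|J w|)) `^ p)).
    by apply: ler_powR_base; rewrite ?(ltW p0)// addrA.
  apply: le_trans (hA _ _ (y00 w) (addr_ge0 (a0 _ _) (normr_ge0 _))) _.
  rewrite /A -mulrA ler_wpM2l ?powR_ge0// mulrDr; apply: lerD; last exact: hA.
  by rewrite ler_peMl// powR_ge0.
have step2 : (\int[P]_w (\1_(D t) w * `|J w| `^ p)%:E <= Ci%:E * \int[P]_w (Kq 2%R w `^ (p / 2)%R))%E.
  have := HI t Phi J D (fun z => k z.1 * g z ^+ 2) tT FD DD Dl mD.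
  have mphi : measurable_fun setT (fun z : Rm * Omega => k z.1 * g z ^+ 2).
    by apply: measurable_funM => //; exact: measurable_funX.
  have phi0 z : 0 <= k z.1 * g z ^+ 2 by rewrite mulr_ge0// sqr_ge0.
  have phifin w : (\int[lebesgue_measure]_(s in `[0%R, t[) (k s * g (s, w) ^+ 2)%:E < +oo)%E.
    have [M gM'] := gM w.
    apply: (@le_lt_trans _ _ (\int[mu]_(s in I) ((M ^+ 2)%:E * (k s)%:E))%E).
      apply: ge0_le_integral_nomeas => s _; first by rewrite lee_fin mulr_ge0// sqr_ge0.
      by rewrite -EFinM lee_fin mulrC ler_wpM2r// lerXn2r// nnegrE// (le_trans (g0 (s, w))).
    rewrite ge0_integralZl//=; last 3 first.
    - by apply/measurable_EFinP.
    - by move=> s _; rewrite lee_fin.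
    - by rewrite lee_fin sqr_ge0.
    by apply: lte_mul_pinfty => //; [rewrite lee_fin sqr_ge0|exact: le_lt_trans ik (ltry _)].
  move=> /(_ mphi phi0 phifin hsP HJ); rewrite integral_mkcond.
  rewrite (eq_integral (fun w => (\1_(D t) w * `|J w| `^ p)%:E)); last first.
    by move=> w _; rewrite patchE indicE; case: ifP => _; rewrite ?mul1r ?mul0r.
  move=> h; apply: le_trans h _; rewrite lee_wpmul2l//; apply: ge0_le_integral_nomeas => w _.
    exact: poweR_ge0.
  rewrite le_eqVlt; apply/orP; left; apply/eqP; congr (_ `^ _)%E.
  apply: eq_integral => s _; rewrite (powR_mulrn 2 (u0 s w)) /u exprMn indicE /=.
  by case: (w \in _); rewrite ?mul0r ?expr0n/= ?mul0r ?mulr0// expr1n !mul1r.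
have pe : 2 * (p / 2) = p by field.
(* The bracket is the integral of [k u^2]; Jensen with exponent [p / 2 >= 1] leads to the integral
   of [k u^p], the same one that the drift yields in [step4] with exponent [p]. *)
have step3 : (\int[P]_w (Kq 2%R w `^ (p / 2)%R) <= (kap `^ (p / 2 - 1))%:E * \int[P]_w Kq p w)%E.
  rewrite -(integralZ_ge0 P (powR_ge0 _ _) (mKq p) (Kq0 p)).
  apply: ge0_le_integral_nomeas => w _; first exact: poweR_ge0.
  by have := jens (p / 2) 2 _ _ w; rewrite pe; apply; lra.
have step4 : (\int[P]_w (a 1 w `^ p)%:E <= (kap `^ (p - 1))%:E * \int[P]_w Kq p w)%E.
  rewrite -(integralZ_ge0 P (powR_ge0 _ _) (mKq p) (Kq0 p)).
  apply: ge0_le_integral_nomeas => w _; first by rewrite lee_fin powR_ge0.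
  have := jens p 1 _ _ w; rewrite mul1r -(aE _ _ ler01) poweR_EFin; apply; lra.
pose S := (\int[P]_w Kq p w)%E.
have S0 : (0 <= S)%E by apply: integral_ge0 => w _.
have SE : S = (\int[lebesgue_measure]_(s in `[0%R, t[)
       ((k s)%:E * \int[P]_w (\1_(D s) w * g (s, w) `^ p)%:E))%E.
  rewrite /S fub; apply: eq_integral => s _; congr (_ * _)%E; apply: eq_integral => w _.
  by rewrite /u powRM// !indicE; case: (w \in _); rewrite ?powR1 ?powR0 ?gt_eqF.
apply: le_trans step1 _; rewrite -SE.
have A0 : 0 <= A by rewrite mulr_ge0// powR_ge0.
have mFE : measurable_fun setT (fun w => (y0 w `^ p + (a 1 w `^ p + \1_(D t) w * `|J w| `^ p))%:E).
  exact/measurable_EFinP.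
rewrite (integralZ_ge0 P A0 mFE (fun w => F0 w)) [in X in (_ <= X)%E]EFinM -[X in (_ <= X)%E]muleA.
rewrite lee_wpmul2l ?lee_fin//.
have m1 : measurable_fun setT (fun w => (y0 w `^ p)%:E) by apply/measurable_EFinP; exact: mpow.
have m2 : measurable_fun setT (fun w => (a 1 w `^ p)%:E) by apply/measurable_EFinP; exact: mpow.
have m3 : measurable_fun setT (fun w => (\1_(D t) w * `|J w| `^ p)%:E).
  by apply/measurable_EFinP; apply: measurable_funM => //; exact: mpow.
have q1 w : (0 <= (y0 w `^ p)%:E)%E by rewrite lee_fin powR_ge0.
have q2 w : (0 <= (a 1 w `^ p)%:E)%E by rewrite lee_fin powR_ge0.
have q3 w : (0 <= (\1_(D t) w * `|J w| `^ p)%:E)%E by rewrite lee_fin mulr_ge0// powR_ge0.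
rewrite (integralD_ge0 P m1 (emeasurable_funD m2 m3) q1 (fun w => adde_ge0 (q2 w) (q3 w))).
rewrite (integralD_ge0 P m2 m3 q2 q3).
have Y00 : (0 <= \int[P]_w (y0 w `^ p)%:E)%E by exact: integral_ge0.
have k10 : 0 <= kap `^ (p - 1) by exact: powR_ge0.
have k20 : 0 <= kap `^ (p / 2 - 1) by exact: powR_ge0.
rewrite !EFinD !ge0_muleDl ?lee_fin ?mulr_ge0 ?addr_ge0//.
rewrite mul1e -[X in (_ <= X)%E]addeA; apply: leeD; first by apply: leeDl.
apply: leeD.
  by apply: le_trans step4 _; rewrite lee_wpmul2l ?lee_fin// leeDr.
apply: le_trans step2 _; rewrite EFinM -muleA lee_wpmul2l ?lee_fin//.
by apply: le_trans step3 _; rewrite lee_wpmul2l ?lee_fin// leeDr.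
Qed.

End mild_moment.

Section bochner_bound.
Context {R : realType} {V : hilbertType R} (e : nat -> V).
Hypothesis te : onseq_total e.
Local Notation Rm := (measurableTypeR R).

Lemma is_bochner_integral0 : is_bochner_integral (0 : R) (fun=> 0 : V) 0.
Proof.
have e0 : (`[0%R, 0%R[%classic : set Rm) = set0.
  by apply/seteqP; split => // s; rewrite /= in_itv /= => /andP[/le_lt_trans h /h]; rewrite ltxx.
split; first by move=> C _; rewrite e0 set0I.
have n0 (i : 'I_0) : False by case: i.
exists (fun=> @VSimple R V 0 (fun=> set0) (fun=> 0) (fun i => match n0 i with end)); split.
  by rewrite e0; under eq_fun do rewrite integral_set0; exact: cvg_cst.
by rewrite /vs_integral /=; under eq_fun do rewrite big_ord0; exact: cvg_cst.
Qed.

Lemma bochner_le t (f : R -> V) (I : V) (h : Rm -> \bar R) : 0 <= t ->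
  is_bochner_integral t f I -> measurable_fun (`[0, t[%classic : set Rm) h ->
  (forall s, 0 <= s < t -> (`|f s|%:E <= h s)%E) ->
  (`|I|%:E <= \int[lebesgue_measure]_(s in `[0%R, t[) h s)%E.
Proof.
move=> t0 fI mh fh; rewrite -[I]subr0.
apply: (bochner_sub_le te (lexx 0) t0 fI is_bochner_integral0 mh) => s st.
by rewrite (fun_if (fun x => f s - x)) subr0 if_same fh.
Qed.

End bochner_bound.

(** * Abstract mild problems: moments, time regularity and truncation error *)

Section mild_problem.
Context {R : realType} {d : measure_display} {Omega : measurableType d}.
Variables (P : probability Omega R) (T : R) (Fil : R -> set (set Omega)).
Hypothesis hFil : normal_filtration P T Fil.
Hypothesis T_gt0 : 0 < T.
Context {U V : hilbertType R} (W : R -> U -> Omega -> R).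
Hypothesis hW : cylindrical_wiener P T Fil W.
Variables (b : nat -> U) (e : nat -> V).
Hypothesis tb : onseq_total b.
Hypothesis te : onseq_total e.
Hypothesis hb : forall L : U -> V, L 0 = 0 ->
  (hs_norm L `^ 2 = \sum_(n <oo) (`|L (b n)| ^+ 2)%:E)%E.
Local Notation Rm := (measurableTypeR R).
Local Notation approx := (ito_approx P T Fil W e).

Variables (th p kap c : R).
Hypotheses (th_gt0 : 0 < th) (th_le1 : th <= 1) (p_ge2 : 2 <= p) (kap01 : 0 <= kap < 1) (c_ge0 : 0 <= c).
Variables (X y : nat -> R -> Omega -> V) (xi : Omega -> R) (rho : nat -> R) (Mx : R).
Hypothesis adX : forall N, adapted T Fil (X N).
Hypothesis contX : forall N w, {within `[0, T], continuous (fun t => X N t w)}.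
Hypothesis mxi : measurable_fun setT xi.
Hypothesis xi0 : forall w, 0 <= xi w.
Hypothesis momxi : (\int[P]_w ((1 + xi w) `^ p)%:E <= Mx%:E)%E.
Hypothesis rho0 : forall N, 0 <= rho N.
Variables (GF : nat -> R -> V -> V) (GB : nat -> R -> V -> U -> V).
Hypothesis eqX : forall N t, 0 <= t <= T -> exists2 J : Omega -> V,
  approx t (fun s w u => GB N (t - s) (X N s w) u) J &
  {ae P, forall w, exists2 I : V,
     is_bochner_integral t (fun s => GF N (t - s) (X N s w)) I &
     X N t w = y N t w + I + J w}.
Hypothesis y_le : forall N t w, 0 <= t <= T -> `|y N t w| <= xi w.
Hypothesis y_time : forall N t1 t2 w, 0 <= t2 -> t2 <= t1 -> t1 <= T ->
  `|y N t1 w - y N t2 w| <= (t1 - t2) `^ th * xi w.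
Hypothesis y_trunc : forall N t w, (0 < N)%N -> 0 <= t <= T ->
  `|y 0%N t w - y N t w| <= rho N `^ th * xi w.
Hypothesis F_le : forall N r x, 0 < r <= T ->
  `|GF N r x| <= r `^ (- kap) * (r `^ th * (c * (1 + `|x|))).
Hypothesis F_time : forall N r r' x, 0 < r -> r <= r' -> r' <= T ->
  `|GF N r' x - GF N r x| <= r `^ (- kap) * ((r' - r) `^ th * (c * (1 + `|x|))).
Hypothesis F_trunc : forall N r x x', (0 < N)%N -> 0 < r <= T ->
  `|GF 0%N r x - GF N r x'| <=
    r `^ (- kap) * (c * (`|x - x'| + rho N `^ th * (2 + `|x| + `|x'|))).
Hypothesis B_le : forall N r x, 0 < r <= T ->
  (hs_norm (GB N r x) `^ 2 <= (r `^ (- kap) * (r `^ th * (c * (1 + `|x|))) ^+ 2)%:E)%E.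
Hypothesis B_time : forall N r r' x, 0 < r -> r <= r' -> r' <= T ->
  (hs_norm (fun u => GB N r' x u - GB N r x u)%R `^ 2 <=
   (r `^ (- kap) * ((r' - r) `^ th * (c * (1 + `|x|))) ^+ 2)%:E)%E.
Hypothesis B_trunc : forall N r x x', (0 < N)%N -> 0 < r <= T ->
  (hs_norm (fun u => GB 0%N r x u - GB N r x' u)%R `^ 2 <=
   (r `^ (- kap) * (c * (`|x - x'| + rho N `^ th * (2 + `|x| + `|x'|))) ^+ 2)%:E)%E.

Let T0 : 0 <= T. Proof. exact: ltW. Qed.
Let p0 : 0 < p. Proof. by have := p_ge2; lra. Qed.
Let k0 : 0 <= kap. Proof. by case/andP: kap01. Qed.
Let k1 : kap < 1. Proof. by case/andP: kap01. Qed.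
Let kint : R := 2 * ((1 + T) / (1 - kap)).
Let kint_gt0 : 0 < kint.
Proof. by rewrite mulr_gt0// divr_gt0//; [have := T0; lra|rewrite subr_gt0]. Qed.

Let Xc N s w := X N (clamp T s) w.
Let XcE N s w : 0 <= s <= T -> Xc N s w = X N s w.
Proof. by move=> sT; rewrite /Xc clamp_id. Qed.

Let mXc N i : measurable_fun setT (fun z : Rm * Omega => inner (e i) (Xc N z.1 z.2)).
Proof. exact: (path_coord_measurable hFil T0 e (@adX N) (@contX N)). Qed.

Let mnXc N : measurable_fun setT (fun z : Rm * Omega => `|Xc N z.1 z.2|).
Proof. exact: (path_norm_measurable hFil T0 te (@adX N) (@contX N)). Qed.

Let mdXc N1 N2 : measurable_fun setT (fun z : Rm * Omega => `|Xc N1 z.1 z.2 - Xc N2 z.1 z.2|).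
Proof.
apply: (measurable_norm_coord te) => // i; under eq_fun do rewrite innerBr.
by apply: measurable_funB; exact: mXc.
Qed.

Let mX N t i : 0 <= t <= T -> measurable_fun setT (fun w => inner (e i) (X N t w)).
Proof. by move=> tT; exact: (adapted_coord_measurable hFil e (@adX N) i tT). Qed.

Let mnX N t : 0 <= t <= T -> measurable_fun setT (fun w => `|X N t w|).
Proof. by move=> tT; apply: (measurable_norm_coord te) => // i; exact: mX. Qed.

Let mdX N1 t1 N2 t2 : 0 <= t1 <= T -> 0 <= t2 <= T ->
  measurable_fun setT (fun w => `|X N1 t1 w - X N2 t2 w|).
Proof.
move=> t1T t2T; apply: (measurable_norm_coord te) => // i; under eq_fun do rewrite innerBr.
by apply: measurable_funB; exact: mX.
Qed.

Let Xc_bounded N w : exists M, forall s, `|Xc N s w| <= M.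
Proof. exact: (path_bounded T0 (@contX N)). Qed.

Let ker_measurable t : measurable_fun setT (fun s : Rm => (t - s) `^ (- kap)).
Proof. exact: measurable_kernel. Qed.

Let ker_le t : 0 <= t <= T ->
  (\int[lebesgue_measure]_(s in `[0%R, t[) ((t - s) `^ (- kap))%:E <= kint%:E)%E.
Proof.
move=> /andP[t0 tT]; apply: le_trans (kernel_integral_le k1 k0 t0 tT) _.
by rewrite lee_fin /kint ler_peMl// ?ler1n// divr_ge0 ?subr_ge0 ?(ltW k1)// addr_ge0.
Qed.

Let r_le r : 0 < r <= T -> r `^ th <= 1 + T.
Proof.
move=> /andP[r0 rT]; apply: le_trans (powR_le_max (ltW r0) _) _; last by rewrite lerD2l.
by rewrite (ltW th_gt0) th_le1.
Qed.

Let cc := (1 + T) * c.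
Let cc0 : 0 <= cc. Proof. by rewrite mulr_ge0 ?addr_ge0. Qed.

Let r_grow r (x : V) : 0 < r <= T -> r `^ th * (c * (1 + `|x|)) <= cc * (1 + `|x|).
Proof. by move=> rT; rewrite mulrA /cc ler_wpM2r ?addr_ge0// ler_wpM2r// r_le. Qed.

Let mg (f : Rm * Omega -> R) a : measurable_fun setT f -> measurable_fun setT (fun z => a * f z).
Proof. by move=> mf; apply: measurable_funM. Qed.

Let integral_powRM (a : R) (f : Omega -> R) (A : set Omega) : 0 <= a -> (forall w, 0 <= f w) ->
  measurable A -> measurable_fun setT f ->
  (\int[P]_w (\1_A w * (a * f w) `^ p)%:E = (a `^ p)%:E * \int[P]_w (\1_A w * f w `^ p)%:E)%E.
Proof.
move=> a0 f0 mA mf; rewrite -(integralZ_ge0 P (powR_ge0 _ _)).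
- by apply: eq_integral => w _; rewrite -EFinM powRM// mulrCA.
- by apply/measurable_EFinP; apply: measurable_funM => //; exact: measurable_powR_comp.
- by move=> w; rewrite lee_fin mulr_ge0// powR_ge0.
Qed.

(* Gronwall needs finite moments beforehand: the process is localized on the events
   that its path stays below [K], and [K] tends to infinity. *)
Lemma mild_problem_moment : exists2 M : R, 0 <= M & forall N t, 0 <= t <= T ->
  (\int[P]_w ((1 + `|X N t w|) `^ p)%:E <= M%:E)%E.
Proof.
have [C C0 HC] := mild_moment hFil hW tb te hb p_ge2 kint_gt0.
have [Cg Cg0 HG] := singular_gronwall k1 k0 (mulr_ge0 C0 (powR_ge0 cc p)) T_gt0.
have Mx0 : 0 <= Mx.
  by rewrite -lee_fin; apply: le_trans momxi; apply: integral_ge0 => w _; rewrite lee_fin powR_ge0.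
exists (Cg * (C * Mx)); first by rewrite !mulr_ge0.
move=> N t tT.
pose D (K : nat) s := path_below T (X N) K%:R s.
have FD K s : 0 <= s <= T -> Fil s (D K s) by exact: (path_below_fil hFil T0 (@adX N) (@contX N)).
have mDs K s : 0 <= s <= T -> measurable (D K s) by move=> sT; exact: (fil_measurable hFil sT (FD K s sT)).
have mD K : measurable [set z : Rm * Omega | D K z.1 z.2].
  exact: (path_below_measurable hFil T0 te (@adX N) (@contX N)).
pose f K s : \bar R := (\int[P]_w (\1_(D K s) w * (1 + `|Xc N s w|) `^ p)%:E)%E.
have f0 K s : (0 <= f K s)%E.
  by apply: integral_ge0 => w _; rewrite lee_fin mulr_ge0// powR_ge0.
have mf K : measurable_fun setT (f K : Rm -> \bar R).
  apply: (measurable_fun_fubini_tonelli_F (m2 := P)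
    (fun z : Rm * Omega => (\1_(D K z.1) z.2 * (1 + `|Xc N z.1 z.2|) `^ p)%:E)).
    apply/measurable_EFinP; apply: measurable_funM.
      rewrite (_ : (fun z : Rm * Omega => _) = \1_[set z : Rm * Omega | D K z.1 z.2]); first exact: measurable_indic.
      by apply/funext => z; rewrite !indicE; congr (nat_of_bool _)%:R; rewrite !mem_setE.
    by apply: measurable_powR_comp; exact: measurable_funD.
  by move=> z; rewrite lee_fin mulr_ge0// powR_ge0.
(* The a priori bound required by the Gronwall lemma; it grows with [K], but [Cg] does not depend on
   it. *)
have fK K s : (f K s <= ((1 + K%:R) `^ p)%:E)%E.
  apply: (@le_trans _ _ (\int[P]_w ((1 + K%:R) `^ p)%:E)%E).
    apply: ge0_le_integral_nomeas => w _; first by rewrite lee_fin mulr_ge0// powR_ge0.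
    rewrite lee_fin; have [wD|wD] := pselect (D K s w); last first.
      by rewrite indicE memNset// mul0r powR_ge0.
    rewrite indicE mem_set// mul1r; apply: ler_powR_base; rewrite ?(ltW p0)// ?lerD2l//.
    exact: wD s (lexx s).
  by rewrite integral_cst// -[leRHS]mule1 lee_wpmul2l ?lee_fin ?powR_ge0// probability_le1.
have ffin K s : f K s \is a fin_num.
  by rewrite ge0_fin_numE//; apply: le_lt_trans (fK K s) (ltry _).
have fE K s : 0 <= s <= T -> f K s = (\int[P]_w (\1_(D K s) w * (1 + `|X N s w|) `^ p)%:E)%E.
  by move=> sT; apply: eq_integral => w _; rewrite XcE.
have key K s : 0 <= s <= T -> (f K s <= (C * Mx)%:E + (C * cc `^ p)%:E *
    \int[lebesgue_measure]_(r in `[0%R, s[) ((s - r) `^ (- kap) * fine (f K r))%:E)%E.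
  move=> sT; have /andP[s0 sT'] := sT; have [J HJ aeI] := eqX N sT.
  pose g (z : Rm * Omega) : R := cc * (1 + `|Xc N z.1 z.2|).
  have g0 z : 0 <= g z by rewrite mulr_ge0// addr_ge0.
  have mgg : measurable_fun setT g by apply: mg; exact: measurable_funD.
  have rs r : 0 <= r < s -> 0 < s - r <= T /\ 0 <= r <= T.
    by move=> /andP[r0 rs]; split; apply/andP; split; lra.
  have := HC s _ J (D K) (fun r => (s - r) `^ (- kap)) g (fun w => 1 + `|X N s w|)
    (fun w => 1 + xi w) sT (FD K) _ _ (mD K)
    (ker_measurable s) (fun r => powR_ge0 _ _) (ker_le sT) mgg g0 _ _ HJ.
  have h1 u v : 0 <= u -> u <= v -> D K v `<=` D K u by move=> _; exact: path_below_decr.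
  have h2 u w : 0 < u -> (forall v, 0 <= v < u -> D K v w) -> D K u w.
    move=> u0 h; apply: (path_below_left T0 (@contX N)) => v vu.
    have [v0|v0] := leP 0 v; first by apply: h; rewrite v0.
    by apply: (path_below_decr (ltW v0)); apply: h; rewrite lexx.
  have h3 w : exists M, forall r, g (r, w) <= M.
    by have [M hM] := Xc_bounded N w; exists (cc * (1 + M)) => r; rewrite ler_wpM2l// lerD2l.
  have h4 r w : 0 <= r < s -> (hs_norm (GB N (s - r) (X N r w)) `^ 2 <=
      ((s - r) `^ (- kap) * g (r, w) ^+ 2)%:E)%E.
    move=> /rs[r1 r2]; apply: le_trans (B_le N (X N r w) r1) _.
    rewrite lee_fin ler_wpM2l ?powR_ge0// lerXn2r// ?nnegrE ?mulr_ge0 ?powR_ge0 ?addr_ge0//.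
    by rewrite /g /= XcE// r_grow.
  move=> /(_ h1 h2 h3 h4 (measurable_funD (measurable_cst _) (mnX N sT)) (measurable_funD (measurable_cst _) mxi)).
  move=> /(_ (fun w => addr_ge0 ler01 (normr_ge0 _)) (fun w => addr_ge0 ler01 (xi0 w))).
  have ae : {ae P, forall w, ((1 + `|X N s w|)%:E <= (1 + xi w)%:E +
      \int[lebesgue_measure]_(r in `[0%R, s[) ((s - r) `^ (- kap) * g (r, w))%:E + `|J w|%:E)%E}.
    apply: filterS aeI => w [I hI ->].
    have hI' : (`|I|%:E <= \int[lebesgue_measure]_(r in `[0%R, s[) ((s - r) `^ (- kap) * g (r, w))%:E)%E.
      apply: (bochner_le te s0 hI).
        apply/measurable_EFinP; apply: measurable_funM; first exact: measurable_funTS.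
        by apply: measurable_funTS; exact: (measurableT_comp mgg (measurable_pair2 w)).
      move=> r /rs[r1 r2]; rewrite lee_fin; apply: le_trans (F_le N (X N r w) r1) _.
      by rewrite ler_wpM2l ?powR_ge0// /g /= XcE// r_grow.
    apply: le_trans (leeD2r _ (leeD2l _ hI')); rewrite -!EFinD lee_fin -!addrA lerD2l.
    apply: le_trans (ler_normD _ _) _; apply: lerD; first exact: y_le.
    exact: ler_normD.
  move=> /(_ ae) h; rewrite (fE _ _ sT); apply: le_trans h _.
  rewrite ge0_muleDr; last 2 first.
  - by apply: integral_ge0 => w _; rewrite lee_fin powR_ge0.
  - apply: integral_ge0 => r _; rewrite mule_ge0 ?lee_fin ?powR_ge0//.
    by apply: integral_ge0 => w _; rewrite lee_fin mulr_ge0// powR_ge0.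
  apply: leeD; first by rewrite EFinM lee_wpmul2l ?lee_fin.
  rewrite EFinM -muleA lee_wpmul2l ?lee_fin//.
  rewrite -ge0_integralZl//=; last 3 first.
  - apply/measurable_EFinP; apply: measurable_funM; apply: measurable_funTS; first exact: ker_measurable.
    exact: measurableT_comp (mf K).
  - by move=> r _; rewrite lee_fin mulr_ge0 ?powR_ge0// fine_ge0.
  - by rewrite lee_fin powR_ge0.
  apply: ge0_le_integral_nomeas => r /=; rewrite in_itv /= => /rs[r1 r2].
    rewrite mule_ge0 ?lee_fin ?powR_ge0//.
    by apply: integral_ge0 => w _; rewrite lee_fin mulr_ge0// powR_ge0.
  have e1 : (\int[P]_w (\1_(D K r) w * g (r, w) `^ p)%:E = (cc `^ p)%:E * f K r)%E.
    rewrite (fE _ _ r2) -(@integral_powRM cc (fun w => 1 + `|X N r w|))//.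
    - by apply: eq_integral => w _; rewrite /g /= XcE.
    - exact: mDs.
    - by apply: measurable_funD => //; exact: mnX.
  by rewrite e1 [X in (_ * X <= _)%E]muleC muleA -{1}(fineK (ffin K r)) -!EFinM lee_fin mulrC mulrA.
have bound K : (f K t <= (Cg * (C * Mx))%:E)%E.
  rewrite -(fineK (ffin K t)) lee_fin.
  apply: (HG (fun s => fine (f K s)) (C * Mx) ((1 + K%:R) `^ p) (mulr_ge0 C0 Mx0)) => // s sT.
    rewrite fine_ge0//=; by have := fK K s; rewrite -{1}(fineK (ffin K s)) lee_fin.
  by rewrite fineK//; exact: key.
have mY : measurable_fun setT (fun w => (1 + `|X N t w|) `^ p).
  by apply: measurable_powR_comp; apply: measurable_funD => //; exact: mnX.
(* Removal of the localization: every path is bounded, so the events [D K t] increase to the whole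
   space with [K]. *)
pose h K w : \bar R := (\1_(D K t) w * (1 + `|X N t w|) `^ p)%:E.
have lim1 w : limn (h ^~ w) = ((1 + `|X N t w|) `^ p)%:E.
  apply/cvg_lim => //; apply: cvg_EFin; first exact: nearW.
  apply: cvg_near_cst; have [M hM] := Xc_bounded N w.
  near=> K; rewrite /= indicE mem_set ?mul1r// => r rt.
  by apply: le_trans (hM r) _; near: K; exact: nbhs_infty_ger.
have mh K : measurable_fun setT (h K).
  by apply/measurable_EFinP; apply: measurable_funM => //; exact: measurable_indic (mDs K t tT).
have h0 K w : setT w -> (0 <= h K w)%E by move=> _; rewrite lee_fin mulr_ge0// powR_ge0.
have hmono w : setT w -> {homo h ^~ w : m n / (m <= n)%N >-> (m <= n)%E}.
  move=> _ K1 K2 K12; rewrite lee_fin ler_wpM2r ?powR_ge0//.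
  have [wD|wD] := pselect (D K1 t w); last by rewrite indicE memNset.
  rewrite !indicE !mem_set// => r rt; apply: le_trans (wD r rt) _.
  by rewrite ler_nat.
have := @cvg_monotone_convergence _ _ _ P setT measurableT h mh h0 hmono.
rewrite (eq_integral (fun w => ((1 + `|X N t w|) `^ p)%:E)); last by move=> w _; exact: lim1.
move=> hc; apply: (cvge_to_le hc); apply: nearW => K.
by have := bound K; rewrite fE.
Unshelve. all: by end_near. Qed.

(** Time increments ([N1 = N2]) and truncation errors ([t1 = t2]) are both instances, distinguished
    by the kernel [k] and the size [g] of the integrands. The localizing events are all [setT]. *)
Lemma mild_problem_diff : exists2 C : R, 0 <= C &
  forall N1 N2 t1 t2 (k : Rm -> R) (g : Rm * Omega -> R) (y0 : Omega -> R),
  0 <= t2 -> t2 <= t1 -> t1 <= T ->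
  measurable_fun setT k -> (forall s, 0 <= k s) ->
  (\int[lebesgue_measure]_(s in `[0%R, t1[) (k s)%:E <= kint%:E)%E ->
  measurable_fun setT g -> (forall z, 0 <= g z) ->
  (forall w, exists M, forall s, g (s, w) <= M) ->
  measurable_fun setT y0 -> (forall w, 0 <= y0 w) ->
  (forall w, `|y N1 t1 w - y N2 t2 w| <= y0 w) ->
  (forall s w, 0 <= s < t1 -> `|GF N1 (t1 - s) (X N1 s w) -
     (if s < t2 then GF N2 (t2 - s) (X N2 s w) else 0)| <= k s * g (s, w)) ->
  (forall s w, 0 <= s < t1 -> (hs_norm (fun u => GB N1 (t1 - s) (X N1 s w) u -
     (if s < t2 then GB N2 (t2 - s) (X N2 s w) u else 0))%R `^ 2 <= (k s * g (s, w) ^+ 2)%:E)%E) ->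
  (\int[P]_w (`|X N1 t1 w - X N2 t2 w| `^ p)%:E <= C%:E * (\int[P]_w (y0 w `^ p)%:E +
     \int[lebesgue_measure]_(s in `[0%R, t1[) ((k s)%:E * \int[P]_w (g (s, w) `^ p)%:E)))%E.
Proof.
have [C C0 HC] := mild_moment hFil hW tb te hb p_ge2 kint_gt0.
exists C => // N1 N2 t1 t2 k g y0 t20 t21 t1T mk k_ge0 ik mgg g0 gM my0 y00 hy hF hB.
have t1T' : 0 <= t1 <= T by rewrite t1T (le_trans t20).
have t2T' : 0 <= t2 <= T by rewrite t20 (le_trans t21).
have [J1 HJ1 ae1] := eqX N1 t1T'; have [J2 HJ2 ae2] := eqX N2 t2T'.
have HJ := ito_approx_sub hFil hW te hb t20 t21 t1T HJ1 HJ2.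
have FT s : 0 <= s <= T -> Fil s setT.
  by move=> sT; have [_ + _] := fil_sigma hFil sT => /(_ set0); rewrite setD0; apply; case: (fil_sigma hFil sT).
have ae : {ae P, forall w, (`|X N1 t1 w - X N2 t2 w|%:E <= (y0 w)%:E +
    \int[lebesgue_measure]_(s in `[0%R, t1[) (k s * g (s, w))%:E + `|J1 w - J2 w|%:E)%E}.
  apply: filterS2 ae1 ae2 => w [I1 hI1 ->] [I2 hI2 ->].
  have hI : (`|I1 - I2|%:E <= \int[lebesgue_measure]_(s in `[0%R, t1[) (k s * g (s, w))%:E)%E.
    apply: (bochner_sub_le te t20 t21 hI1 hI2).
      apply/measurable_EFinP; apply: measurable_funM; first exact: measurable_funTS.
      by apply: measurable_funTS; exact: (measurableT_comp mgg (measurable_pair2 w)).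
    by move=> s st; rewrite lee_fin hF.
  apply: le_trans (leeD2r _ (leeD2l _ hI)); rewrite -!EFinD lee_fin.
  rewrite opprD addrACA; apply: le_trans (ler_normD _ _) _; rewrite lerD2r.
  rewrite opprD addrACA; apply: le_trans (ler_normD _ _) _; rewrite lerD2r.
  exact: hy.
have := HC t1 _ _ (fun=> setT) k g (fun w => `|X N1 t1 w - X N2 t2 w|) y0 t1T' FT
  (fun s s' _ _ => @subset_refl _ _) (fun s w _ _ => I) _ mk k_ge0 ik mgg g0 gM hB HJ
  (mdX N1 N2 t1T' t2T') my0 (fun w => normr_ge0 _) y00 ae.
rewrite (_ : [set z : Rm * Omega | _] = setT); last by apply/seteqP; split.
move=> /(_ measurableT); rewrite (eq_integral (fun w => (`|X N1 t1 w - X N2 t2 w| `^ p)%:E)); last first.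
  by move=> w _; rewrite indicT mul1r.
move=> h; apply: le_trans h _; rewrite lee_wpmul2l ?lee_fin//; apply: leeD => //.
apply: ge0_le_integral_nomeas => s _.
  by rewrite mule_ge0 ?lee_fin//; apply: integral_ge0 => w _; rewrite lee_fin mulr_ge0// powR_ge0.
rewrite lee_wpmul2l ?lee_fin//; apply: ge0_le_integral_nomeas => w _.
  by rewrite lee_fin mulr_ge0// powR_ge0.
by rewrite indicT mul1r.
Qed.

Let Mx0 : 0 <= Mx.
Proof.
by rewrite -lee_fin; apply: le_trans momxi; apply: integral_ge0 => w _; rewrite lee_fin powR_ge0.
Qed.

Let integral_powRM_le (a M : R) (f : Omega -> R) : 0 <= a -> (forall w, 0 <= f w) ->
  measurable_fun setT f -> (\int[P]_w ((1 + f w) `^ p)%:E <= M%:E)%E ->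
  (\int[P]_w ((a * (1 + f w)) `^ p)%:E <= (a `^ p * M)%:E)%E.
Proof.
move=> a0 f0 mf hM; rewrite EFinM; apply: le_trans (lee_wpmul2l _ hM); last by rewrite lee_fin powR_ge0.
rewrite -(integralZ_ge0 P (powR_ge0 _ _)); last 2 first.
- by apply/measurable_EFinP; apply: measurable_powR_comp; exact: measurable_funD.
- by move=> w; rewrite lee_fin powR_ge0.
apply: ge0_le_integral_nomeas => w _; first by rewrite lee_fin powR_ge0.
by rewrite -EFinM powRM ?addr_ge0.
Qed.

Let integral_xi_le (a : R) : 0 <= a -> (\int[P]_w ((a * xi w) `^ p)%:E <= (a `^ p * Mx)%:E)%E.
Proof.
move=> a0; apply: le_trans (integral_powRM_le a0 xi0 mxi momxi).
apply: ge0_le_integral_nomeas => w _; rewrite lee_fin ?powR_ge0//.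
by apply: ler_powR_base; rewrite ?(ltW p0) ?mulr_ge0// ler_wpM2l// lerDr.
Qed.

Let integral_ker_le (k : Rm -> R) t (a : R) : measurable_fun setT k -> (forall s, 0 <= k s) ->
  (\int[lebesgue_measure]_(s in `[0%R, t[) (k s)%:E <= kint%:E)%E -> 0 <= a ->
  (\int[lebesgue_measure]_(s in `[0%R, t[) ((k s)%:E * a%:E) <= (kint * a)%:E)%E.
Proof.
move=> mk k_ge0 ik a0; under eq_integral do rewrite muleC.
rewrite ge0_integralZl//=; last 2 first.
- by apply/measurable_EFinP; exact: measurable_funTS.
- by move=> s _; rewrite lee_fin.
by rewrite mulrC EFinM lee_wpmul2l// lee_fin.
Qed.

(** The integrands involve only [1 + |X|], whose moments are already bounded, so the estimate is
    direct. Between [t2] and [t1] the factor [r^th] of [F_le] and [B_le] is at most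
    [(t1 - t2)^th]. *)
Lemma mild_problem_incr : exists2 C : R, 0 <= C & forall N t1 t2, 0 <= t2 -> t2 <= t1 -> t1 <= T ->
  (\int[P]_w (`|X N t1 w - X N t2 w| `^ p)%:E <= (C * (t1 - t2) `^ (th * p))%:E)%E.
Proof.
have [C C0 HC] := mild_problem_diff; have [M M0 HM] := mild_problem_moment.
exists (C * (Mx + kint * (c `^ p * M))).
  by rewrite mulr_ge0// addr_ge0// mulr_ge0 ?(ltW kint_gt0)// mulr_ge0// powR_ge0.
move=> N t1 t2 t20 t21 t1T; set h := t1 - t2.
have h0 : 0 <= h by rewrite subr_ge0.
have hth0 : 0 <= h `^ th by exact: powR_ge0.
pose g (z : Rm * Omega) : R := h `^ th * c * (1 + `|Xc N z.1 z.2|).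
have mgg : measurable_fun setT g by apply: mg; exact: measurable_funD.
have g0 z : 0 <= g z by rewrite !mulr_ge0// addr_ge0.
have gM w : exists A, forall r, g (r, w) <= A.
  have [A hA] := Xc_bounded N w; exists (h `^ th * c * (1 + A)) => r.
  by rewrite ler_wpM2l ?mulr_ge0// lerD2l.
have sT s : 0 <= s < t1 -> 0 <= s <= T by move=> /andP[s0 s1]; rewrite s0 ltW// (lt_le_trans s1).
have := HC N N t1 t2 (incr_kernel kap t1 t2) g (fun w => h `^ th * xi w) t20 t21 t1T
  (incr_kernel_measurable kap t1 t2) (incr_kernel_ge0 kap t1 t2)
  (incr_kernel_integral_le k1 k0 t20 t21 t1T) mgg g0 gM.
move=> /(_ (measurable_funM (measurable_cst _) mxi) (fun w => mulr_ge0 hth0 (xi0 w))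
  (fun w => y_time N w t20 t21 t1T)) H.
have h_le s : s < t1 -> t2 <= s -> (t1 - s) `^ th <= h `^ th.
  by move=> s1 s2; apply: ler_powR_base; rewrite ?(ltW th_gt0)// /h; lra.
apply: le_trans (H _ _) _.
- move=> s w st; have /andP[s0 s1] := st; rewrite /incr_kernel /g /= XcE ?sT// -mulrA.
  case: ifPn => [s2|].
    have -> : h = t1 - s - (t2 - s) by rewrite /h; ring.
    by apply: F_time; lra.
  rewrite -leNgt => s2; rewrite subr0; apply: le_trans (F_le N _ _) _; first by apply/andP; split; lra.
  by rewrite ler_wpM2l ?powR_ge0// ler_wpM2r ?mulr_ge0 ?addr_ge0// h_le.
- move=> s w st; have /andP[s0 s1] := st; rewrite /incr_kernel /g /= XcE ?sT// -mulrA.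
  case: ifPn => [s2|].
    have -> : h = t1 - s - (t2 - s) by rewrite /h; ring.
    by apply: B_time; lra.
  rewrite -leNgt => s2; under [X in hs_norm X]eq_fun do rewrite subr0.
  apply: le_trans (B_le N _ _) _; first by apply/andP; split; lra.
  rewrite lee_fin ler_wpM2l ?powR_ge0// lerXn2r ?nnegrE ?mulr_ge0 ?powR_ge0 ?addr_ge0//.
  by rewrite ler_wpM2r ?mulr_ge0 ?addr_ge0// h_le.
have hp : h `^ (th * p) = (h `^ th) `^ p by rewrite powRrM.
rewrite -mulrA EFinM lee_wpmul2l ?lee_fin// mulrDl EFinD; apply: leeD.
  by rewrite hp mulrC; exact: integral_xi_le.
apply: (@le_trans _ _ (\int[lebesgue_measure]_(s in `[0%R, t1[)
   ((incr_kernel kap t1 t2 s)%:E * ((h `^ th * c) `^ p * M)%:E))%E).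
  apply: ge0_le_integral_nomeas => s /=; rewrite in_itv /= => st.
    by rewrite mule_ge0 ?lee_fin ?incr_kernel_ge0//; apply: integral_ge0 => w _; rewrite lee_fin powR_ge0.
  rewrite lee_wpmul2l ?lee_fin ?incr_kernel_ge0// /g.
  apply: integral_powRM_le => //; first by rewrite mulr_ge0.
    exact: (measurableT_comp (mnXc N) (measurable_pair1 s)).
  by under eq_integral do rewrite XcE ?sT//; exact: HM (sT s st).
apply: le_trans (integral_ker_le (incr_kernel_measurable kap t1 t2) (incr_kernel_ge0 kap t1 t2)
  (incr_kernel_integral_le k1 k0 t20 t21 t1T) _) _; first by rewrite mulr_ge0 ?powR_ge0.
by rewrite lee_fin powRM// hp le_eqVlt; apply/orP; left; apply/eqP; ring.
Qed.

(** The error reappears under the integral next to a source of size [rho^(th p)]. Its moments are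
    bounded a priori by those of the two processes, so the singular Gronwall lemma applies without
    localization. *)
Lemma mild_problem_trunc : exists2 C : R, 0 <= C & forall N t, (0 < N)%N -> 0 <= t <= T ->
  (\int[P]_w (`|X 0%N t w - X N t w| `^ p)%:E <= (C * rho N `^ (th * p))%:E)%E.
Proof.
have [C C0 HC] := mild_problem_diff; have [M M0 HM] := mild_problem_moment.
(* From [(x + y)^p <= 2^p (x^p + y^p)], applied to the two summands that [c] multiplies in the
   truncation hypotheses. *)
pose c1 := c `^ p * 2 `^ p.
have c10 : 0 <= c1 by rewrite mulr_ge0// powR_ge0.
have [Cg Cg0 HG] := singular_gronwall k1 k0 (mulr_ge0 C0 c10) T_gt0.
pose A := C * (Mx + kint * (c1 * (2 `^ p * (M + M)))).
have A0 : 0 <= A.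
  rewrite /A mulr_ge0// addr_ge0// mulr_ge0 ?(ltW kint_gt0)// mulr_ge0// mulr_ge0 ?powR_ge0//.
  exact: addr_ge0.
exists (Cg * A); first by rewrite mulr_ge0.
move=> N t N0 tT; set q := rho N `^ th.
have q0 : 0 <= q by exact: powR_ge0.
have qp : rho N `^ (th * p) = q `^ p by rewrite powRrM.
pose f s : \bar R := (\int[P]_w (`|Xc 0%N s w - Xc N s w| `^ p)%:E)%E.
have f0 s : (0 <= f s)%E by apply: integral_ge0 => w _; rewrite lee_fin powR_ge0.
have mf : measurable_fun setT (f : Rm -> \bar R).
  apply: (measurable_fun_fubini_tonelli_F (m2 := P)
    (fun z : Rm * Omega => (`|Xc 0%N z.1 z.2 - Xc N z.1 z.2| `^ p)%:E)).
    by apply/measurable_EFinP; apply: measurable_powR_comp.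
  by move=> z; rewrite lee_fin powR_ge0.
have msec n s : measurable_fun setT (fun w => `|Xc n s w|).
  exact: (measurableT_comp (mnXc n) (measurable_pair1 s)).
have HMc n s : (\int[P]_w ((1 + `|Xc n s w|) `^ p)%:E <= M%:E)%E.
  exact: (HM n (clamp T s) (clamp_itv T0 s)).
pose b2 s w : R := 2 `^ p * ((1 + `|Xc 0%N s w|) `^ p + (1 + `|Xc N s w|) `^ p).
have b2_int s : (\int[P]_w (b2 s w)%:E <= (2 `^ p * (M + M))%:E)%E.
  have mp n : measurable_fun setT (fun w => ((1 + `|Xc n s w|) `^ p)%:E).
    by apply/measurable_EFinP; apply: measurable_powR_comp; exact: measurable_funD.
  have pp n w : (0 <= ((1 + `|Xc n s w|) `^ p)%:E)%E by rewrite lee_fin powR_ge0.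
  under eq_integral do rewrite EFinM EFinD.
  rewrite (integralZ_ge0 P (powR_ge0 _ _) (emeasurable_funD (mp 0%N) (mp N)) (fun w => adde_ge0 (pp _ w) (pp _ w))).
  rewrite (integralD_ge0 P (mp 0%N) (mp N) (pp 0%N) (pp N)) EFinM EFinD lee_wpmul2l ?lee_fin ?powR_ge0//.
  by apply: leeD; exact: HMc.
have b2_le s w : (2 + `|Xc 0%N s w| + `|Xc N s w|) `^ p <= b2 s w.
  rewrite (_ : 2 + _ + _ = (1 + `|Xc 0%N s w|) + (1 + `|Xc N s w|)); last by ring.
  by apply: powR_add_le; rewrite ?(ltW p0) ?addr_ge0.
have fb s : (f s <= (2 `^ p * (M + M))%:E)%E.
  apply: le_trans (b2_int s); apply: ge0_le_integral_nomeas => w _; rewrite lee_fin ?powR_ge0//.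
  apply: le_trans (b2_le s w); apply: ler_powR_base; rewrite ?(ltW p0)//.
  by apply: le_trans (ler_normB _ _) _; lra.
have ffin s : f s \is a fin_num.
  by rewrite ge0_fin_numE//; apply: le_lt_trans (fb s) (ltry _).
pose g (z : Rm * Omega) : R := c * (`|Xc 0%N z.1 z.2 - Xc N z.1 z.2| +
  q * (2 + `|Xc 0%N z.1 z.2| + `|Xc N z.1 z.2|)).
have g0 z : 0 <= g z by rewrite mulr_ge0// addr_ge0// mulr_ge0// !addr_ge0.
have mgg : measurable_fun setT g.
  apply: mg; apply: measurable_funD => //; apply: mg.
  by apply: measurable_funD => //; exact: measurable_funD.
have gM w : exists A', forall r, g (r, w) <= A'.
  have [A1 hA1] := Xc_bounded 0%N w; have [A2 hA2] := Xc_bounded N w.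
  exists (c * (A1 + A2 + q * (2 + A1 + A2))) => r; rewrite ler_wpM2l//; apply: lerD.
    by apply: le_trans (ler_normB _ _) _; exact: lerD.
  by rewrite ler_wpM2l//; apply: lerD => //; rewrite lerD2l.
have g_int s : (\int[P]_w (g (s, w) `^ p)%:E <= c1%:E * (f s + (q `^ p * (2 `^ p * (M + M)))%:E))%E.
  have mb2 : measurable_fun setT (fun w => (b2 s w)%:E).
    apply/measurable_EFinP; apply: measurable_funM => //.
    by apply: measurable_funD; apply: measurable_powR_comp; exact: measurable_funD.
  have b20 w : (0 <= (b2 s w)%:E)%E by rewrite lee_fin mulr_ge0 ?addr_ge0 ?powR_ge0.
  have md : measurable_fun setT (fun w => (`|Xc 0%N s w - Xc N s w| `^ p)%:E).
    apply/measurable_EFinP; apply: measurable_powR_comp.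
    exact: (measurableT_comp (mdXc 0%N N) (measurable_pair1 s)).
  have d0 w : (0 <= (`|Xc 0%N s w - Xc N s w| `^ p)%:E)%E by rewrite lee_fin powR_ge0.
  have qb0 w : (0 <= (q `^ p)%:E * (b2 s w)%:E)%E by rewrite mule_ge0// lee_fin powR_ge0.
  apply: (@le_trans _ _ (\int[P]_w (c1%:E * ((`|Xc 0%N s w - Xc N s w| `^ p)%:E + (q `^ p)%:E * (b2 s w)%:E)))%E).
    apply: ge0_le_integral_nomeas => w _; first by rewrite lee_fin powR_ge0.
    rewrite -[leRHS]/((c1 * (`|Xc 0%N s w - Xc N s w| `^ p + q `^ p * b2 s w))%:E) lee_fin /g powRM ?addr_ge0 ?mulr_ge0 ?addr_ge0// /c1 -mulrA.
    rewrite ler_wpM2l ?powR_ge0//; apply: le_trans (powR_add_le _ _ _) _; rewrite ?(ltW p0) ?mulr_ge0 ?addr_ge0//.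
    rewrite ler_wpM2l ?powR_ge0// lerD2l powRM ?addr_ge0// ler_wpM2l ?powR_ge0//.
  rewrite (integralZ_ge0 P c10 (emeasurable_funD md (measurable_funeM _ mb2)) (fun w => adde_ge0 (d0 w) (qb0 w))).
  rewrite (integralD_ge0 P md (measurable_funeM _ mb2) d0 qb0).
  rewrite (integralZ_ge0 P (powR_ge0 _ _) mb2 b20).
  rewrite lee_wpmul2l ?lee_fin//; apply: leeD => //.
  by rewrite EFinM lee_wpmul2l ?lee_fin ?powR_ge0.
have fE s : 0 <= s <= T -> f s = (\int[P]_w (`|X 0%N s w - X N s w| `^ p)%:E)%E.
  by move=> sT; apply: eq_integral => w _; rewrite !XcE.
have key s : 0 <= s <= T -> (f s <= (A * q `^ p)%:E + (C * c1)%:E *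
    \int[lebesgue_measure]_(r in `[0%R, s[) ((s - r) `^ (- kap) * fine (f r))%:E)%E.
  move=> sT; have /andP[s0 sT'] := sT; rewrite fE//.
  have rs r : 0 <= r < s -> 0 < s - r <= T /\ 0 <= r <= T.
    by move=> /andP[r0 rs]; split; apply/andP; split; lra.
  have := HC 0%N N s s (fun r => (s - r) `^ (- kap)) g (fun w => q * xi w) s0 (lexx s) sT'
    (ker_measurable s) (fun r => powR_ge0 _ _) (ker_le sT) mgg g0 gM
    (measurable_funM (measurable_cst _) mxi) (fun w => mulr_ge0 q0 (xi0 w)) (fun w => y_trunc w N0 sT).
  move=> H; apply: le_trans (H _ _) _.
  - move=> r w rr; have [r1 r2] := rs r rr; have /andP[_ ->] := rr; rewrite /g /= !XcE//.
    exact: F_trunc.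
  - move=> r w rr; have [r1 r2] := rs r rr; have /andP[_ ->] := rr; rewrite /g /= !XcE//.
    exact: B_trunc.
  have mff : measurable_fun (`[0%R, s[%classic : set Rm) (fun r => ((s - r) `^ (- kap) * fine (f r))%:E).
    apply/measurable_EFinP; apply: measurable_funM; apply: measurable_funTS; first exact: ker_measurable.
    exact: measurableT_comp mf.
  have ff0 r : (0 <= ((s - r) `^ (- kap) * fine (f r))%:E)%E by rewrite lee_fin mulr_ge0 ?powR_ge0// fine_ge0.
  have mkr : measurable_fun (`[0%R, s[%classic : set Rm) (fun r => ((s - r) `^ (- kap))%:E).
    by apply/measurable_EFinP; apply: measurable_funTS; exact: ker_measurable.
  set a := q `^ p * (2 `^ p * (M + M)).
  have a0 : 0 <= a by rewrite !mulr_ge0 ?powR_ge0 ?addr_ge0.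
  apply: (@le_trans _ _ (C%:E * ((q `^ p * Mx)%:E + (c1%:E * \int[lebesgue_measure]_(r in `[0%R, s[) ((s - r) `^ (- kap) * fine (f r))%:E
     + (kint * (c1 * a))%:E)))%E).
    rewrite lee_wpmul2l ?lee_fin//; apply: leeD; first exact: integral_xi_le.
    rewrite -ge0_integralZl//= ?lee_fin//.
    apply: le_trans (leeD2l _ (integral_ker_le (ker_measurable s) (fun r => powR_ge0 _ _) (ker_le sT) (mulr_ge0 c10 a0))).
    rewrite -ge0_integralD//=; last 4 first.
    - by move=> r _; rewrite mule_ge0// lee_fin.
    - exact: measurable_funeM.
    - by move=> r _; rewrite -EFinM lee_fin mulr_ge0 ?powR_ge0// mulr_ge0.
    - by apply: emeasurable_funM.
    apply: ge0_le_integral_nomeas => r _.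
      by rewrite mule_ge0 ?lee_fin ?powR_ge0//; apply: integral_ge0 => w _; rewrite lee_fin powR_ge0.
    apply: (@le_trans _ _ (((s - r) `^ (- kap))%:E * (c1%:E * (f r + a%:E)))%E).
      by rewrite lee_wpmul2l ?lee_fin ?powR_ge0// g_int.
    rewrite -(fineK (ffin r)) -!(EFinD, EFinM) lee_fin le_eqVlt; apply/orP; left; apply/eqP.
    by rewrite fineK//; ring.
  rewrite addeA addeAC -EFinD ge0_muleDr; last 2 first.
  - rewrite lee_fin addr_ge0// mulr_ge0 ?powR_ge0 ?(ltW kint_gt0)//.
    exact: mulr_ge0.
  - by rewrite mule_ge0 ?lee_fin//; apply: integral_ge0.
  rewrite muleA -!EFinM leeD2r// lee_fin /A /a le_eqVlt; apply/orP; left; apply/eqP; ring.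
have := HG (fun s => fine (f s)) (A * q `^ p) (2 `^ p * (M + M)) (mulr_ge0 A0 (powR_ge0 _ _)).
move=> H; rewrite -fE// -(fineK (ffin t)) lee_fin qp -mulrA; apply: H => // s sT.
  by rewrite fine_ge0//=; have := fb s; rewrite -{1}(fineK (ffin s)) lee_fin.
by rewrite fineK//; exact: key.
Qed.

End mild_problem.

(** * The Kolmogorov-Chentsov theorem *)

Lemma geometric_series_le (R : realType) (a q : R) : 0 <= a -> 0 <= q -> q < 1 ->
  (\sum_(n <oo) (a * q ^+ n)%:E <= (a / (1 - q))%:E)%E.
Proof.
move=> a0 q0 q1; have q1' : 0 < 1 - q by rewrite subr_gt0.
have ge0 n : (0 <= (a * q ^+ n)%:E)%E by rewrite lee_fin mulr_ge0// exprn_ge0.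
apply: (lime_le (is_cvg_nneseries (fun n _ _ => ge0 n))); apply: nearW => n.
rewrite sumEFin lee_fin -mulr_sumr ler_wpM2l// -[X in _ <= X]mul1r ler_pdivlMr//.
suff -> : (\sum_(0 <= i < n) q ^+ i) * (1 - q) = 1 - q ^+ n by rewrite lerBlDr lerDl exprn_ge0.
elim: n => [|n IH]; first by rewrite big_geq// mul0r expr0 subrr.
by rewrite big_nat_recr//= mulrDl IH exprS; ring.
Qed.

Lemma powR_half_lt1 (R : realType) (r : R) : 0 < r -> 2^-1 `^ r < 1.
Proof.
move=> r0; have h : (2^-1 : R) < 1 by rewrite invf_lt1 ?ltr1n.
by have := gt0_ltr_powR r0 _ _ h; rewrite powR1 !nnegrE; apply; rewrite ?invr_ge0.
Qed.

Lemma powR_exprn (R : realType) (x r : R) n : 0 <= x -> (x `^ r) ^+ n = (x ^+ n) `^ r.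
Proof.
move=> x0; elim: n => [|n IH]; first by rewrite !expr0 powR1.
by rewrite !exprS IH powRM// exprn_ge0.
Qed.

Section dyadic.
Context {R : realType}.
Variable T : R.
Hypothesis T0 : 0 < T.
Implicit Types s t : R.

Definition dyadic n k : R := T * k%:R / 2 ^+ n.
Definition dyadic_index n s : nat := Num.truncn (s * 2 ^+ n / T).

Let e2 n : 0 < 2 ^+ n :> R. Proof. by rewrite exprn_gt0. Qed.

Lemma dyadic_indexP n s : 0 <= s ->
  (dyadic_index n s)%:R <= s * 2 ^+ n / T < (dyadic_index n s).+1%:R.
Proof. by move=> s0; apply: truncn_itv; rewrite divr_ge0 ?mulr_ge0 ?(ltW T0) ?(ltW (e2 n)). Qed.

Lemma dyadic_index_le n s : 0 <= s -> s <= T -> (dyadic_index n s <= 2 ^ n)%N.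
Proof.
move=> s0 sT; have /andP[h _] := dyadic_indexP n s0.
rewrite -(ler_nat R) natrX; apply: le_trans h _.
by rewrite ler_pdivrMr// mulrC ler_wpM2l ?(ltW (e2 n)).
Qed.

Lemma dyadic_itv n k : (k <= 2 ^ n)%N -> 0 <= dyadic n k <= T.
Proof.
move=> kn; rewrite /dyadic; apply/andP; split; first by rewrite divr_ge0 ?mulr_ge0 ?(ltW T0) ?(ltW (e2 n)).
by rewrite ler_pdivrMr// ler_wpM2l ?(ltW T0)// -natrX ler_nat.
Qed.

Lemma dyadic_index_succ n s : 0 <= s ->
  dyadic_index n.+1 s = (dyadic_index n s).*2 \/ dyadic_index n.+1 s = (dyadic_index n s).*2.+1.
Proof.
move=> s0; have /andP[h1 h2] := dyadic_indexP n s0; have /andP[h3 h4] := dyadic_indexP n.+1 s0.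
set k := dyadic_index n s in h1 h2 *; set j := dyadic_index n.+1 s in h3 h4 *.
have e : s * 2 ^+ n.+1 / T = 2 * (s * 2 ^+ n / T) by rewrite exprS; ring.
rewrite e in h3 h4; set x := s * 2 ^+ n / T in h1 h2 h3 h4.
have l1 : (k.*2 < j.+1)%N by rewrite -(ltr_nat R) -muln2 natrM; lra.
have l2 : (j < k.*2.+2)%N.
  by rewrite -(ltr_nat R) -[k.*2.+2]/(k.+1.*2) -muln2 natrM; lra.
by move: l1 l2; rewrite !ltnS leq_eqVlt => /predU1P[->|h] l2; [left|right; apply/eqP; rewrite eqn_leq l2 h].
Qed.

Lemma dyadic_double n k : dyadic n.+1 k.*2 = dyadic n k.
Proof. by rewrite /dyadic exprS -muln2 natrM; field; rewrite gt_eqF ?e2. Qed.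

Lemma dyadic_index_near n s t : 0 <= s -> s <= t -> t - s <= T / 2 ^+ n ->
  dyadic_index n t = dyadic_index n s \/ dyadic_index n t = (dyadic_index n s).+1.
Proof.
move=> s0 st h; have /andP[h1 h2] := dyadic_indexP n s0.
have /andP[h3 h4] := dyadic_indexP n (le_trans s0 st).
have le1 : s * 2 ^+ n / T <= t * 2 ^+ n / T by rewrite ler_pM2r ?invr_gt0// ler_pM2r.
have le2 : t * 2 ^+ n / T <= s * 2 ^+ n / T + 1.
  rewrite -lerBlDl -mulrBl -mulrBl ler_pdivrMr// mul1r -ler_pdivlMr//.
set k := dyadic_index n s in h1 h2 *; set j := dyadic_index n t in h3 h4 *.
have l1 : (k < j.+1)%N by rewrite -(ltr_nat R); lra.
have l2 : (j < k.+2)%N by rewrite -(ltr_nat R) -[k.+2%:R]natr1; lra.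
by move: l1 l2; rewrite !ltnS leq_eqVlt => /predU1P[->|l1] l2; [left|right; apply/eqP; rewrite eqn_leq l2 l1].
Qed.

Lemma dyadic_cvg s : 0 <= s -> dyadic n (dyadic_index n s) @[n --> \oo] --> s.
Proof.
move=> s0.
have c : (s - T * (2^-1) ^+ n) @[n --> \oo] --> (s - T * 0 : R).
  apply: cvgB; first exact: cvg_cst.
  apply: cvgMr; apply: cvg_expr; rewrite ger0_norm ?invr_ge0//; lra.
rewrite mulr0 subr0 in c; apply: (squeeze_cvgr _ c (cvg_cst s)).
apply: nearW => n; have /andP[h1 h2] := dyadic_indexP n s0.
rewrite /dyadic; set k := dyadic_index n s in h1 h2 *; apply/andP; split; last first.
  by rewrite ler_pdivrMr// mulrC -ler_pdivlMr.
rewrite lerBlDr exprVn -mulrDl -[X in _ + X]mulr1 -mulrDr ler_pdivlMr//.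
by rewrite natr1 [leRHS]mulrC -ler_pdivrMr// ltW.
Qed.

Lemma dyadic_scale s t : s < t -> t - s <= T ->
  exists m, T / 2 ^+ m.+1 < t - s /\ t - s <= T / 2 ^+ m.
Proof.
move=> st tsT; have ts0 : 0 < t - s by rewrite subr_gt0.
have ex : exists m, T / 2 ^+ m < t - s.
  exists (Num.truncn (T / (t - s))).+1.
  rewrite ltr_pdivrMr// mulrC -ltr_pdivrMr//.
  have x0 : 0 <= T / (t - s) by rewrite divr_ge0// ltW.
  have /andP[_ h] := truncn_itv x0; apply: lt_trans h _.
  by rewrite -natrX ltr_nat ltn_expl.
(* The least exponent satisfying the strict inequality is not 0, since [t - s <= T]; minimality
   gives the other inequality at its predecessor. *)
pose m := ex_minn ex; have := ex_minnP ex; case => -[|m'] hm hmin.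
  by rewrite expr0 divr1 in hm; move: (lt_le_trans hm tsT); rewrite ltxx.
exists m'; split=> //; rewrite leNgt; apply/negP => h.
by have := hmin _ h; rewrite ltnn.
Qed.

End dyadic.

Section kolmogorov.
Context {R : realType} {V : normedModType R}.
Variables (T : R) (del sig : R).
Hypotheses (T0 : 0 < T) (del0 : 0 <= del) (ds : del <= sig) (sig0 : 0 < sig).
Variable f : R -> V.
Hypothesis cf : {within `[0, T], continuous f}.

Let a : R := 2^-1 `^ sig.
Let a0 : 0 < a. Proof. by rewrite powR_gt0 ?invr_gt0. Qed.
Let a1 : a < 1.
Proof.
exact: powR_half_lt1.
Qed.

(** At the scale [T / 2^m] of [t - s] the dyadic floors of [s] and [t] coincide or are neighbours,
    which gives the 1; each of the two tails of finer floors sums to [a / (1 - a)], which gives the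
    2. The factor [(2 / T)^del] converts [2^-m] into [t - s]. *)
Lemma dyadic_chaining (r : R) : 0 <= r ->
  (forall n k, (k < 2 ^ n)%N -> `|f (dyadic T n k.+1) - f (dyadic T n k)| <= r * a ^+ n) ->
  forall s t, 0 <= s -> s < t -> t <= T ->
  `|f t - f s| <= r * ((1 + 2 * (a / (1 - a))) * (2 / T) `^ del) * (t - s) `^ del.
Proof.
move=> r0 hr s t s0 st tT; pose L := a / (1 - a).
have L0 : 0 <= L by rewrite divr_ge0 ?(ltW a0)// subr_ge0 ltW.
pose D n x := dyadic T n (dyadic_index T n x).
have step n x : 0 <= x -> x <= T -> `|f (D n.+1 x) - f (D n x)| <= r * a ^+ n.+1.
  move=> x0 xT; rewrite /D -[dyadic T n _]dyadic_double.
  have := dyadic_index_le T0 n.+1 x0 xT.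
  have [->|->] := dyadic_index_succ T0 n x0 => h.
    by rewrite subrr normr0 mulr_ge0// exprn_ge0// ltW.
  exact: hr.
have chain m j x : 0 <= x -> x <= T ->
    `|f (D (m + j)%N x) - f (D m x)| <= r * L * (a ^+ m - a ^+ (m + j)%N).
  move=> x0 xT; elim: j => [|j IH]; first by rewrite addn0 !subrr normr0 mulr0.
  rewrite addnS -(subrKA (f (D (m + j)%N x))).
  apply: le_trans (ler_normD _ _) _; apply: le_trans (lerD (step _ _ x0 xT) IH) _.
  rewrite le_eqVlt; apply/orP; left; apply/eqP; rewrite /L exprS; field.
  by rewrite gt_eqF// subr_gt0.
have lim m x : 0 <= x -> x <= T -> `|f x - f (D m x)| <= r * L * a ^+ m.
  move=> x0 xT.
  have c1 : D n x @[n --> \oo] --> x by exact: dyadic_cvg.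
  have c2 : f (D n x) @[n --> \oo] --> f x.
    have /subspace_continuousP h : {within `[0, T], continuous f} := cf.
    have := h x; rewrite /= in_itv /= x0 xT => /(_ isT) hx.
    apply: (@cvg_comp _ _ _ (fun n => D n x) f _ (within `[0, T] (nbhs x))); last exact: hx.
    move=> A wA; have wA' : nbhs x [set x | `[0, T]%classic x -> A x] := wA.
    have c1' : \forall n \near \oo, `[0, T]%classic (D n x) -> A (D n x) := c1 _ wA'.
    apply: filterS c1' => n hn; apply: hn; rewrite /= in_itv /=.
    exact: (dyadic_itv T0 (dyadic_index_le T0 n x0 xT)).
  have c3 : `|f (D n x) - f (D m x)| @[n --> \oo] --> `|f x - f (D m x)|.
    by apply: cvg_norm; apply: cvgB => //; exact: cvg_cst.
  apply: (cvgr_to_le c3); near=> n.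
  have mn : (m <= n)%N by near: n; exact: nbhs_infty_ge.
  rewrite -(subnKC mn); apply: le_trans (chain m _ x x0 xT) _.
  by apply: ler_wpM2l; [exact: mulr_ge0|rewrite lerBlDr lerDl exprn_ge0// ltW].
have [|m [m1 m2]] := dyadic_scale T0 st; first by lra.
have t0 : 0 <= t by lra.
have sT : s <= T by lra.
have mid : `|f (D m t) - f (D m s)| <= r * a ^+ m.
  rewrite /D; have := dyadic_index_le T0 m t0 tT.
  have [->|->] := dyadic_index_near T0 s0 (ltW st) m2 => h.
    by rewrite subrr normr0 mulr_ge0// exprn_ge0// ltW.
  exact: hr.
have tot : `|f t - f s| <= r * (1 + 2 * L) * a ^+ m.
  rewrite -(subrKA (f (D m t))) -(subrKA (f (D m s)) (f (D m t))).
  apply: le_trans (ler_normD _ _) _.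
  apply: le_trans (lerD (lim m t t0 tT) (ler_normD _ _)) _.
  have h3 : `|f (D m s) - f s| <= r * L * a ^+ m by rewrite distrC; exact: lim.
  apply: le_trans (lerD (lexx _) (lerD mid h3)) _.
  by rewrite le_eqVlt; apply/orP; left; apply/eqP; ring.
apply: le_trans tot _; rewrite -!(mulrA r) ler_wpM2l// -[X in _ <= X]mulrA.
apply: ler_wpM2l; first by rewrite addr_ge0// mulr_ge0.
have z0 : 0 < (2^-1 : R) ^+ m by rewrite exprn_gt0// invr_gt0.
have z1 : (2^-1 : R) ^+ m <= 1 by rewrite exprn_ile1 ?invr_ge0//; lra.
have -> : a ^+ m = ((2^-1 : R) ^+ m) `^ sig.
  by rewrite /a powR_exprn ?invr_ge0.
apply: (@le_trans _ _ (((2^-1 : R) ^+ m) `^ del)).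
  by apply: ger_powR => //; rewrite z0 z1.
rewrite -powRM ?divr_ge0 ?subr_ge0 ?(ltW T0) ?(ltW st)//.
apply: ler_powR_base => //.
move: m1; rewrite exprS invfM -exprVn mulrAC ler_pdivlMr//; move: (2^-1 ^+ m) => x.
by rewrite mulrCA; move: (T * x) (mulrC x T) => Tx ->; lra.
Unshelve. all: by end_near. Qed.

Lemma chaining_holder_norm (r : R) : 0 <= r ->
  (forall n k, (k < 2 ^ n)%N -> `|f (dyadic T n k.+1) - f (dyadic T n k)| <= r * a ^+ n) ->
  (holder_norm `[0%R, T] enorm del f <=
   (`|f 0| + r * ((1 + 2 * (a / (1 - a))) * (2 / T) `^ del) * (T `^ del + 1))%:E)%E.
Proof.
move=> r0 hr; set c := (1 + _) * _.
have c0 : 0 <= c.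
  by rewrite mulr_ge0 ?powR_ge0// addr_ge0// mulr_ge0// divr_ge0 ?(ltW a0)// subr_ge0 ltW.
have rc0 : 0 <= r * c by exact: mulr_ge0.
have H s t : 0 <= s <= T -> 0 <= t <= T -> `|f t - f s| <= r * c * `|t - s| `^ del.
  move=> /andP[s0 sT] /andP[t0 tT]; have [st|ts|->] := ltgtP s t.
  - by rewrite gtr0_norm ?subr_gt0//; exact: dyadic_chaining.
  - by rewrite distrC [X in X `^ _]distrC gtr0_norm ?subr_gt0//; exact: dyadic_chaining.
  - by rewrite !subrr normr0 mulr_ge0// powR_ge0.
rewrite mulrDr mulr1 addrA EFinD; apply: leeD.
  apply: ge_ereal_sup => _ [[s /= + <-]|->]; last by rewrite lee_fin addr_ge0// mulr_ge0// powR_ge0.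
  rewrite in_itv /= => /andP[s0 sT]; rewrite /enorm lee_fin.
  have h : `|f s| <= `|f 0| + `|f s - f 0| by rewrite -{1}(subrKC (f 0) (f s)) ler_normD.
  apply: le_trans h _; rewrite lerD2l; apply: le_trans (H 0 s _ _) _; rewrite ?lexx ?s0 ?(ltW T0)//.
  apply: ler_wpM2l => //; rewrite subr0 ger0_norm//.
  exact: ler_powR_base.
apply: ge_ereal_sup => _ [[[s t] /= [+ + st] <-]|->]; last by rewrite lee_fin mulr_ge0.
rewrite !in_itv /= => sT tT; rewrite /enorm -EFinM lee_fin ler_pdivrMr; first exact: H.
by rewrite powR_gt0// normr_gt0 subr_eq0.
Qed.

End kolmogorov.

Section kolmogorov_moment.
Context {R : realType} {d : measure_display} {Omega : measurableType d} {V : normedModType R}.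
Variable P : probability Omega R.

(* The weighted sum of all dyadic increments dominates each of them. *)
Lemma kolmogorov_chentsov (T p th del : R) : 0 < T -> 1 <= p -> 0 <= del -> del + p^-1 < th ->
  exists2 C : R, 0 <= C & forall (Y : R -> Omega -> V) (A : R), 0 <= A ->
  (forall w, {within `[0, T], continuous (fun t => Y t w)}) ->
  (forall s t, 0 <= s <= T -> 0 <= t <= T -> measurable_fun setT (fun w => `|Y s w - Y t w|)) ->
  measurable_fun setT (fun w => `|Y 0 w|) ->
  (forall s t, 0 <= s -> s <= t -> t <= T ->
    (\int[P]_w (`|Y t w - Y s w| `^ p)%:E <= (A * (t - s) `^ (th * p))%:E)%E) ->
  (\int[P]_w (`|Y 0 w| `^ p)%:E <= A%:E)%E ->
  (\int[P]_w (holder_norm `[0%R, T] enorm del (fun t => Y t w)) `^ p <= (C * A)%:E)%E.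
Proof.
move=> T0 p1 del0 dth; have p0 : 0 < p by lra.
(* Half of the slack: one half raises [del] to the exponent [sig] of the chaining, the other makes
   the series of moments geometric with ratio [q < 1]. *)
pose eta := (th - p^-1 - del) / 2.
have eta0 : 0 < eta by rewrite divr_gt0//; lra.
pose sig := del + eta.
have sig0 : 0 < sig by rewrite ltr_wpDl.
have ds : del <= sig by rewrite lerDl ltW.
pose a : R := 2^-1 `^ sig.
have a0 : 0 < a by rewrite powR_gt0 ?invr_gt0.
have ap0 : 0 < a `^ p by exact: powR_gt0.
pose q : R := 2^-1 `^ (p * eta).
have q0 : 0 < q by rewrite powR_gt0 ?invr_gt0.
have q1 : q < 1.
  by apply: powR_half_lt1; rewrite mulr_gt0.
pose c0 := (1 + 2 * (a / (1 - a))) * (2 / T) `^ del * (T `^ del + 1).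
pose C1 := T `^ (th * p) / (1 - q).
have C10 : 0 <= C1 by rewrite divr_ge0 ?powR_ge0// subr_ge0 ltW.
exists (2 `^ p * (1 + c0 `^ p * C1)).
  by rewrite mulr_ge0 ?powR_ge0// addr_ge0// mulr_ge0 ?powR_ge0.
move=> Y A A0 cY mY mY0 hY hY0.
pose D n k w := `|Y (dyadic T n k.+1) w - Y (dyadic T n k) w|.
have Tk n k : (k < 2 ^ n)%N -> 0 <= dyadic T n k /\ dyadic T n k.+1 <= T /\ dyadic T n k.+1 - dyadic T n k = T / 2 ^+ n.
  move=> kn; have /andP[h1 _] := dyadic_itv T0 (ltnW kn); have /andP[_ h2] := dyadic_itv T0 kn.
  by do !split=> //; rewrite /dyadic -natr1; ring.
have mD n k : (k < 2 ^ n)%N -> measurable_fun setT (D n k).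
  by move=> kn; apply: mY; apply: (dyadic_itv T0) => //; exact: ltnW.
(* The weight [a^{-pn}] is chosen so that, if the whole series equals [r^p], each increment of level
   [n] is at most [r a^n]. *)
pose term n w : \bar R := ((a `^ p) ^- n * \sum_(k < 2 ^ n) D n k w `^ p)%:E.
have w0 n : 0 <= (a `^ p) ^- n by rewrite invr_ge0 exprn_ge0// ltW.
have term0 n w : (0 <= term n w)%E.
  by rewrite lee_fin mulr_ge0// sumr_ge0// => k _; exact: powR_ge0.
have mterm n : measurable_fun setT (term n).
  apply/measurable_EFinP; apply: measurable_funM => //; apply: measurable_sum => k.
  by apply: measurable_powR_comp; apply: mD.
pose Rw w : \bar R := (\sum_(n <oo) term n w)%E.
have Rw0 w : (0 <= Rw w)%E by apply: nneseries_ge0 => n _ _.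
have mRw : measurable_fun setT Rw by apply: ge0_emeasurable_sum => // n w _ _.
have termI n : (\int[P]_w term n w <= (A * T `^ (th * p) * q ^+ n)%:E)%E.
  have mS : measurable_fun setT (fun w => (\sum_(k < 2 ^ n) D n k w `^ p)%:E).
    by apply/measurable_EFinP; apply: measurable_sum => k; apply: measurable_powR_comp; apply: mD.
  have S0 w : (0 <= (\sum_(k < 2 ^ n) D n k w `^ p)%:E)%E.
    by rewrite lee_fin sumr_ge0// => k _; exact: powR_ge0.
  rewrite /term; under eq_integral do rewrite EFinM.
  rewrite (integralZ_ge0 P (w0 n) mS S0).
  apply: (@le_trans _ _ (((a `^ p) ^- n)%:E * \sum_(k < 2 ^ n) (A * (T / 2 ^+ n) `^ (th * p))%:E)%E).
    rewrite lee_wpmul2l ?lee_fin//; under eq_integral do rewrite -sumEFin.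
    rewrite ge0_integral_sum//; last 2 first.
    - by move=> k; apply/measurable_EFinP; apply: measurable_powR_comp; apply: mD.
    - by move=> k w _; rewrite lee_fin powR_ge0.
    apply: lee_sum => k _; have [h1 [h2 h3]] := Tk n k (ltn_ord k).
    rewrite -h3; apply: hY => //.
    by rewrite -subr_ge0 h3 divr_ge0 ?exprn_ge0// ltW.
  rewrite sumEFin -EFinM lee_fin sumr_const card_ord -[_ *+ (2 ^ n)%N]mulr_natl natrX le_eqVlt; apply/orP; left; apply/eqP.
  have -> : (T / 2 ^+ n) `^ (th * p) = T `^ (th * p) * ((2^-1 : R) `^ (th * p)) ^+ n.
    rewrite powRM ?invr_ge0 ?exprn_ge0 ?(ltW T0)//; congr (_ * _).
    by rewrite -exprVn powR_exprn ?invr_ge0.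
  (* Count of exponents of 2: [p sig + 1 - th p = - p eta], where the 1 stands for the [2^n]
     increments of level [n]. *)
  have e2 : (a `^ p)^-1 * 2 * (2^-1 `^ (th * p)) = q.
    have h0 : 0 < (2^-1 : R) by rewrite invr_gt0.
    have e3 : (2 : R) = 2^-1 `^ (- 1) by rewrite powR_inv1 ?invrK ?invr_ge0.
    rewrite /a -powRrM powR_invr// [X in _ * X * _]e3 -!powR_add// /q; congr (_ `^ _).
    by rewrite /sig /eta; field; rewrite gt_eqF.
  by rewrite -e2 !exprMn exprVn; ring.
have RwI : (\int[P]_w Rw w <= (C1 * A)%:E)%E.
  rewrite /Rw integral_nneseries//.
  apply: (@le_trans _ _ (\sum_(n <oo) (A * T `^ (th * p) * q ^+ n)%:E)%E).
    apply: lee_nneseries => [n _ _|n _]; last exact: termI.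
    by apply: integral_ge0 => w _.
  apply: le_trans (geometric_series_le _ (ltW q0) q1) _; first by rewrite mulr_ge0 ?powR_ge0.
  by rewrite lee_fin /C1 le_eqVlt; apply/orP; left; apply/eqP; ring.
have c00 : 0 < c0.
  rewrite /c0 !mulr_gt0 ?powR_gt0 ?divr_gt0//; last by rewrite ltr_wpDl ?powR_ge0.
  by rewrite ltr_wpDr// mulr_ge0// divr_ge0 ?(ltW a0)// subr_ge0 ltW// powR_half_lt1.
have point w : (holder_norm `[0%R, T] enorm del (fun t => Y t w) `^ p <=
    (2 `^ p)%:E * ((`|Y 0 w| `^ p)%:E + (c0 `^ p)%:E * Rw w))%E.
  have [Rfin|] := ltP (Rw w) +oo%E; last first.
    rewrite leye_eq => /eqP ->; rewrite gt0_muley ?lte_fin ?powR_gt0// addey// gt0_muley ?leey//.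
  have [x xE] : exists x, Rw w = x%:E by exists (fine (Rw w)); rewrite fineK// ge0_fin_numE.
  have x0 : 0 <= x by rewrite -lee_fin -xE.
  pose r := x `^ p^-1.
  have rp : r `^ p = x by rewrite -powRrM mulVf ?gt_eqF// powRr1.
  have r0 : 0 <= r by exact: powR_ge0.
  have inc n k : (k < 2 ^ n)%N -> D n k w <= r * a ^+ n.
    move=> kn; rewrite leNgt; apply/negP => h.
    have h0 : 0 <= r * a ^+ n by rewrite mulr_ge0// exprn_ge0// ltW.
    have := gt0_ltr_powR p0 _ _ h; rewrite !nnegrE h0 normr_ge0 => /(_ isT isT).
    apply/negP; rewrite -leNgt powRM// ?exprn_ge0 ?(ltW a0)// rp.
    have -> : (a ^+ n) `^ p = (a `^ p) ^+ n.
      by rewrite powR_exprn ?(ltW a0).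
    rewrite -ler_pdivrMr ?exprn_gt0// mulrC.
    apply: (@le_trans _ _ ((a `^ p) ^- n * \sum_(k < 2 ^ n) D n k w `^ p)).
      rewrite ler_wpM2l// (bigD1 (Ordinal kn))//= lerDl sumr_ge0// => i _; exact: powR_ge0.
    rewrite -lee_fin -xE -[leLHS]/(term n w) /Rw.
    apply: le_trans (@nneseries_lim_ge _ (term ^~ w) xpredT 0 n.+1 (fun k _ _ => term0 k w)).
    by rewrite big_nat_recr//= leeDr// sume_ge0.
  have := chaining_holder_norm T0 del0 ds sig0 (cY w) r0 inc.
  rewrite -mulrA -/c0 => h.
  apply: (@le_trans _ _ ((`|Y 0 w| + r * c0)%:E `^ p)%E).
    apply: gt0_ler_poweR => //; first exact: ltW.
    - by rewrite in_itv /= leey andbT /holder_norm adde_ge0//; apply: ereal_sup_ubound; right.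
    - by rewrite in_itv /= leey andbT lee_fin addr_ge0// mulr_ge0// ltW.
  rewrite poweR_EFin xE -[leRHS]/((2 `^ p * (`|Y 0 w| `^ p + c0 `^ p * x))%:E) lee_fin.
  apply: le_trans (powR_add_le (ltW p0) (normr_ge0 _) (mulr_ge0 r0 (ltW c00))) _.
  by rewrite powRM ?(ltW c00)// rp [x * _]mulrC.
apply: (@le_trans _ _ (\int[P]_w ((2 `^ p)%:E * ((`|Y 0 w| `^ p)%:E + (c0 `^ p)%:E * Rw w)))%E).
  by apply: ge0_le_integral_nomeas => w _ //; exact: poweR_ge0.
have mY0p : measurable_fun setT (fun w => (`|Y 0 w| `^ p)%:E).
  by apply/measurable_EFinP; apply: measurable_powR_comp.
have p1' w : (0 <= (`|Y 0 w| `^ p)%:E)%E by rewrite lee_fin powR_ge0.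
have p2' w : (0 <= (c0 `^ p)%:E * Rw w)%E by rewrite mule_ge0// lee_fin powR_ge0.
rewrite (integralZ_ge0 P (powR_ge0 _ _) (emeasurable_funD mY0p (measurable_funeM _ mRw)) (fun w => adde_ge0 (p1' w) (p2' w))).
rewrite (integralD_ge0 P mY0p (measurable_funeM _ mRw) p1' p2').
rewrite (integralZ_ge0 P (powR_ge0 _ _) mRw Rw0).
rewrite -mulrA EFinM lee_wpmul2l ?lee_fin ?powR_ge0// mulrDl mul1r EFinD; apply: leeD => //.
by rewrite -mulrA EFinM lee_wpmul2l ?lee_fin ?powR_ge0.
Qed.

End kolmogorov_moment.

(** * Estimates of the coefficients *)

Section hs_operators.
Context {R : realType} {U : hilbertType R}.

Lemma hs_enum : separable U -> exists b : nat -> U, onseq_total b /\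
  forall (V : hilbertType R) (L : U -> V), L 0 = 0 ->
    (hs_norm L `^ 2 = \sum_(n <oo) (`|L (b n)| ^+ 2)%:E)%E.
Proof.
move=> sepU; have [b [tb _ _ bP]] := basis_enum sepU (some_onbP sepU).
exists b; split=> // V L L0; rewrite /hs_norm -poweRrM mulVf// poweRe1.
  by apply: bP => [x|]; rewrite ?lee_fin ?sqr_ge0// L0 normr0 expr0n.
by apply: esum_ge0 => e _; rewrite lee_fin sqr_ge0.
Qed.

Variable b : nat -> U.
Hypothesis tb : onseq_total b.
Hypothesis hb : forall (V : hilbertType R) (L : U -> V), L 0 = 0 ->
  (hs_norm L `^ 2 = \sum_(n <oo) (`|L (b n)| ^+ 2)%:E)%E.

Lemma hs_sqr_le_pointwise (V V' : hilbertType R) (L : U -> V) (L' : U -> V') (c : R) :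
  L 0 = 0 -> L' 0 = 0 -> (forall u, `|L u| <= c * `|L' u|) ->
  (hs_norm L `^ 2 <= (c ^+ 2)%:E * hs_norm L' `^ 2)%E.
Proof.
move=> z z' h; rewrite !hb// -nneseriesZl; last by move=> i _; rewrite lee_fin sqr_ge0.
apply: lee_nneseries => [i _ _|n _]; first by rewrite lee_fin sqr_ge0.
by rewrite -EFinM lee_fin -exprMn lerXn2r// nnegrE// (le_trans _ (h _)).
Qed.

Lemma hs_sqr_le (V : hilbertType R) (L : U -> V) (c : R) :
  0 <= c -> (hs_norm L <= c%:E)%E -> (hs_norm L `^ 2 <= (c ^+ 2)%:E)%E.
Proof.
move=> c0 h; rewrite -(powR_mulrn 2 c0) -poweR_EFin; apply: gt0_ler_poweR => //.
- by rewrite in_itv /= leey andbT poweR_ge0.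
- by rewrite in_itv /= leey andbT lee_fin.
Qed.

Lemma onseq_comb_norm_le (H : hilbertType R) (f : nat -> H) (a : nat -> R) n : onseq f ->
  `|\sum_(i < n) a i *: f i| ^+ 2 <= \sum_(i < n) a i ^+ 2.
Proof.
move=> [f1 f2]; elim: n => [|n IH]; first by rewrite !big_ord0 normr0 expr0n.
have z : inner (\sum_(i < n) a i *: f i) (f n) = 0.
  by rewrite inner_suml big1// => i _; rewrite innerZl f1 ?mulr0// neq_ltn ltn_ord.
rewrite !big_ord_recr/= normD2 innerZr z !mulr0 addr0.
apply: lerD => //; rewrite normrZ exprMn real_normK ?num_real//.
by have [->|->] := f2 n; rewrite ?normr0 ?expr0n/= ?mulr0 ?sqr_ge0// expr1n mulr1.
Qed.

(* With [z = sum_{n<N} l(Q b_n) b_n] one has [sum_{n<N} l(Q b_n)^2 = l(Q z) <= |l| |Q| |z|],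
   and [|l|^2 <= sum_n l(b_n)^2]. *)
Lemma hs_sqr_comp_bounded (V : hilbertType R) (e : nat -> V) (L : {linear U -> V})
    (Q : {linear U -> U}) (K : R) : onseq_total e -> continuous L -> 0 <= K ->
  (forall u, `|Q u| <= K * `|u|) ->
  (hs_norm (fun u => L (Q u)) `^ 2 <= (K ^+ 2)%:E * hs_norm L `^ 2)%E.
Proof.
move=> te cL K0 hQ; rewrite !hb ?linear0//.
(* Interchanging the sums over the bases of [U] and [V] reduces the claim to each scalar functional
   [l u = <e_i, L u>]. *)
have swap (f : nat -> V) : (\sum_(n <oo) (`|f n| ^+ 2)%:E =
    \sum_(i <oo) \sum_(n <oo) (inner (e i) (f n) ^+ 2)%:E)%E.
  rewrite nneseries_interchange; last by move=> i j; rewrite lee_fin sqr_ge0.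
  by apply: eq_eseriesr => n _; rewrite (parseval_series _ te).
rewrite !swap -nneseriesZl; last first.
  by move=> i _; apply: nneseries_ge0 => n _ _; rewrite lee_fin sqr_ge0.
apply: lee_nneseries => [i _ _|i _].
  by apply: nneseries_ge0 => n _ _; rewrite lee_fin sqr_ge0.
pose l u := inner (e i) (L u).
have lD u v : l (u + v) = l u + l v by rewrite /l linearD innerDr.
have lZ a u : l (a *: u) = a * l u by rewrite /l linearZ innerZr.
have cl : continuous l by move=> u; apply: continuous_comp; [exact: cL|exact: continuous_inner].
have lsum (I : Type) (r : seq I) (a : I -> R) (v : I -> U) :
    l (\sum_(j <- r) a j *: v j) = \sum_(j <- r) a j * l (v j).
  by rewrite /l linear_sum inner_sumr; apply: eq_bigr => j _; exact: lZ.
pose N := (\sum_(n <oo) (l (b n) ^+ 2)%:E)%E.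
have N0 : (0 <= N)%E by apply: nneseries_ge0 => n _ _; rewrite lee_fin sqr_ge0.
have [K00|K1] := eqVneq K 0.
  have Q0 u : Q u = 0 by apply/normr0_eq0/eqP; rewrite eq_le normr_ge0 andbT (le_trans (hQ u))// K00 mul0r.
  rewrite (_ : (\sum_(n <oo) _)%E = 0%E); first by rewrite mule_ge0// lee_fin sqr_ge0.
  by apply: eseries0 => n _ _; rewrite Q0 linear0 inner0r expr0n.
have [Nfin|] := ltP N +oo%E; last first.
  by rewrite leye_eq => /eqP Ninf; rewrite -/N Ninf gt0_muley ?leey// lte_fin exprn_gt0// lt0r K1.
have [x xE] : exists x, N = x%:E by exists (fine N); rewrite fineK// ge0_fin_numE.
have x0 : 0 <= x by rewrite -lee_fin -xE.
have lbound u : `|l u| ^+ 2 <= x * `|u| ^+ 2.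
  have c : l (proj b n u) @[n --> \oo] --> l u.
    by apply: (@cvg_comp _ _ _ (fun n => proj b n u) l _ (nbhs u)); [exact: tb.2|exact: cl].
  have c' : `|l (proj b n u)| ^+ 2 @[n --> \oo] --> `|l u| ^+ 2.
    by rewrite expr2; under eq_fun do rewrite expr2; apply: cvgM; exact: cvg_norm.
  apply: (cvgr_to_le c'); apply: nearW => n; rewrite /proj lsum.
  have -> : \sum_(i < n) inner (b i) u * l (b i) = inner (\sum_(i < n) l (b i) *: b i) u.
    by rewrite inner_suml; apply: eq_bigr => j _; rewrite innerZl mulrC.
  have h := cauchy_schwarz (\sum_(i < n) l (b i) *: b i) u.
  apply: (@le_trans _ _ ((`|\sum_(i < n) l (b i) *: b i| * `|u|) ^+ 2)).
    by rewrite lerXn2r// nnegrE.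
  rewrite exprMn ler_wpM2r ?sqr_ge0//; apply: le_trans (@onseq_comb_norm_le _ b (fun k => l (b k)) n tb.1) _.
  rewrite -lee_fin -xE -sumEFin.
  have := @nneseries_lim_ge R (fun n => (l (b n) ^+ 2)%:E) xpredT 0 n _.
  by rewrite big_mkord; apply => k _ _; rewrite lee_fin sqr_ge0.
rewrite -/N xE -EFinM; apply: (lime_le (is_cvg_nneseries (fun n _ _ => _))).
  by move=> k _ _; rewrite lee_fin sqr_ge0.
apply: nearW => n; rewrite big_mkord sumEFin lee_fin.
set s := \sum_(i < n) _; pose z := \sum_(i < n) l (Q (b i)) *: b i.
have s0 : 0 <= s by apply: sumr_ge0 => k _; exact: sqr_ge0.
have sE : s = l (Q z).
  rewrite /z linear_sum; under [X in l X]eq_bigr do rewrite linearZ.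
  by rewrite lsum; apply: eq_bigr => k _; rewrite expr2.
have zs : `|z| ^+ 2 <= s by exact: (@onseq_comb_norm_le _ b (fun k => l (Q (b k))) n tb.1).
have : s ^+ 2 <= K ^+ 2 * x * s.
  rewrite {1}sE -(real_normK (num_real (l (Q z)))); apply: le_trans (lbound _) _.
  rewrite mulrAC [K ^+ 2 * s * x]mulrC ler_wpM2l//; apply: (@le_trans _ _ ((K * `|z|) ^+ 2)).
    by rewrite lerXn2r// nnegrE// mulr_ge0.
  by rewrite exprMn ler_wpM2l// sqr_ge0.
have [->|sn] := eqVneq s 0; first by move=> _; rewrite mulr_ge0// sqr_ge0.
by rewrite expr2 ler_pM2r// lt0r sn.
Qed.

End hs_operators.

Lemma holder_semi_lipschitz (R : realType) (E : normedZmodType R) (W : zmodType)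
    (nrm : W -> \bar R) (f : E -> W) : nrm 0 = 0%E ->
  (holder_semi setT nrm 1 f < +oo)%E ->
  exists2 L : R, 0 <= L & forall x y, (nrm (f x - f y)%R <= (L * `|x - y|)%:E)%E.
Proof.
move=> n0 h; have s0 : (0 <= holder_semi setT nrm 1 f)%E by apply: ereal_sup_ubound; right.
exists (fine (holder_semi setT nrm 1 f)); first exact: fine_ge0.
move=> x y; have [->|xy] := eqVneq x y; first by rewrite !subrr normr0 mulr0 n0.
have d0 : 0 < `|x - y| by rewrite normr_gt0 subr_eq0.
have : (nrm (f x - f y)%R * ((`|x - y| `^ 1)^-1)%:E <= holder_semi setT nrm 1 f)%E.
  by apply: ereal_sup_ubound; left; exists (x, y).
rewrite powRr1// EFinM fineK ?ge0_fin_numE// => h'.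
by move: h'; rewrite lee_pdivrMr.
Qed.

Section coefficient_estimates.
Context {R : realType} {H U : hilbertType R} (bas : set H) (lam : H -> R).
Hypotheses (onb : orthonormal_basis bas) (sepH : separable H).
Variables (c0 : R) (c0_gt0 : 0 < c0) (lam_lt : forall h, bas h -> c0 <= - lam h).
Variables (Hr : interpolation_family bas lam) (S : semigroup_action Hr).
Variable b : nat -> U.
Hypothesis hb : forall (V : hilbertType R) (L : U -> V), L 0 = 0 ->
  (hs_norm L `^ 2 = \sum_(n <oo) (`|L (b n)| ^+ 2)%:E)%E.
Variables (T gam alp bet chi vth kap : R).
Hypotheses (T_gt0 : 0 < T) (alp0 : 0 <= alp) (bet0 : 0 <= bet) (bc : bet <= chi) (th0 : 0 < vth).
Hypotheses (kap1 : kap < 1) (kapF : alp + vth <= kap) (kapB : 2 * (bet + vth) <= kap) (kapC : 2 * chi <= kap).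
Variables (F : Hr gam -> Hr (gam - alp)) (B : Hr gam -> hsop U (Hr (gam - bet))).
Variables (basN : nat -> set H) (hbasN : forall N, basN N `<=` bas) (hbas0 : basN 0%N = bas).
Local Notation m := (Num.min 0 (gam - 1)).
Variables (PN : nat -> {linear Hr m -> Hr m}) (QN : nat -> {linear U -> U}).
Hypothesis contPN : forall N, continuous (PN N).
Hypothesis hPN : forall N (v : H),
  PN N (iemb Hr m v) = iemb Hr m (vsum (basN N) (fun h => inner h v *: h)).
Variables (LF LB KQ Gc cF cB : R) (rho : nat -> R).
Hypotheses (LF0 : 0 <= LF) (LB0 : 0 <= LB) (KQ0 : 0 <= KQ) (Gc0 : 0 <= Gc) (cF0 : 0 <= cF) (cB0 : 0 <= cB).
Hypothesis F_growth : forall x, `|F x| <= cF * (1 + `|x|).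
Hypothesis F_lip : forall x y, `|F x - F y| <= LF * `|x - y|.
Hypothesis B_growth : forall N x,
  (hs_norm (fun u => B x (QN N u)) `^ 2 <= ((cB * (1 + `|x|)) ^+ 2)%:E)%E.
Hypothesis B_lip : forall x y,
  (hs_norm (fun u => B x (QN 0%N u) - B y (QN 0%N u))%R `^ 2 <= ((KQ * LB * `|x - y|) ^+ 2)%:E)%E.
Hypothesis rho0 : forall N, 0 <= rho N.
Hypothesis rho_bas : forall N h, (0 < N)%N -> bas h -> ~ basN N h -> `|lam h|^-1 <= rho N.
Hypothesis B_trunc_growth : forall N x, (0 < N)%N ->
  (hs_norm (fun u => iincl Hr (gam - bet) (gam - chi) (B x (QN 0%N u - QN N u)%R)) `^ 2 <=
   ((rho N `^ vth * (Gc * (1 + `|x|))) ^+ 2)%:E)%E.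

Definition drift_conv N t (x : Hr gam) : Hr gam :=
  propagator S gam (PN N) t (iincl Hr (gam - alp) m (F x)).
Definition noise_conv N t (x : Hr gam) (u : U) : Hr gam :=
  propagator S gam (PN N) t (iincl Hr (gam - bet) m (B x (QN N u))).
(** One constant for all six estimates below: [1 + T] pays for weakening the singularities to [kap],
    and the 2 for splitting a square into three parts in [noise_conv_trunc]. *)
Definition conv_const : R := 2 * ((1 + T) * (cF + LF + cB + KQ * LB + Gc)).

Let m0 : m <= 0. Proof. by rewrite ge_min lexx. Qed.
Let m1 : m <= gam - 1. Proof. by rewrite ge_min lexx orbT. Qed.
Let mg : m <= gam. Proof. by have := m1; lra. Qed.
Let malp : m <= gam - alp. Proof. by have := m1; have := kapF; have := kap1; have := th0; lra. Qed.
Let mbet : m <= gam - bet. Proof. by have := m1; have := kapB; have := kap1; have := th0; lra. Qed.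
Let mchi : m <= gam - chi. Proof. by have := m1; have := kapC; have := kap1; lra. Qed.
Let chi0 : 0 <= chi. Proof. exact: le_trans bc. Qed.
Let kap0 : 0 <= kap. Proof. by have := kapC; have := chi0; lra. Qed.
Let T1 : 1 <= 1 + T. Proof. by rewrite lerDl ltW. Qed.
Let T10 : 0 <= 1 + T. Proof. exact: le_trans T1. Qed.

Let smoothing N s t (y : Hr s) := @propagator_smoothing R H bas lam onb c0 c0_gt0 lam_lt Hr S m gam m0 mg sepH
  (basN N) (@hbasN N) (PN N) (@contPN N) (hPN N) s t y.
Let smoothing_incl N s s' t (y : Hr s) := @propagator_smoothing_incl R H bas lam onb c0 c0_gt0 lam_lt Hr S m gam m0 mg sepH
  (basN N) (@hbasN N) (PN N) (@contPN N) (hPN N) s s' t y.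
Let time N s t t' (y : Hr s) := @propagator_time R H bas lam onb c0 c0_gt0 lam_lt Hr S m gam m0 mg sepH
  (basN N) (@hbasN N) (PN N) (@contPN N) (hPN N) s t t' vth y.
Let sub N s t (x y : Hr s) := @propagatorB R H bas lam onb c0 c0_gt0 lam_lt Hr S m gam m0 mg sepH
  (basN N) (@hbasN N) (PN N) (@contPN N) (hPN N) s t x y.
Let zero N s t := @propagator0 R H bas lam onb c0 c0_gt0 lam_lt Hr S m gam m0 mg sepH
  (basN N) (@hbasN N) (PN N) (@contPN N) (hPN N) s t.

Let basN0N N : basN N `<=` basN 0%N.
Proof. by rewrite hbas0; exact: hbasN. Qed.
Let rho_bas' N (N0 : (0 < N)%N) h : bas h -> basN 0%N h -> ~ basN N h -> `|lam h|^-1 <= rho N.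
Proof. by move=> bh _; exact: rho_bas. Qed.
Let trunc N (N0 : (0 < N)%N) s t (y : Hr s) := @propagator_trunc R H bas lam onb c0 c0_gt0 lam_lt Hr S m gam m0 mg sepH
  (basN 0%N) (basN N) (@hbasN 0%N) (@hbasN N) (PN 0%N) (PN N) (@contPN 0%N) (@contPN N) (hPN 0%N) (hPN N)
  (rho N) (rho0 N) (rho_bas' N0) (@basN0N N) s t vth y.

Let weight (r a M : R) : 0 < r <= T -> 0 <= a -> a <= kap -> 0 <= M ->
  r `^ (- a) * M <= r `^ (- kap) * ((1 + T) * M).
Proof.
move=> /andP[r0 rT] a0 ak M0; rewrite mulrA ler_wpM2r// [X in _ <= X]mulrC.
by apply: powRN_le => //; exact: ltW.
Qed.

(** The noise enters through the square of a norm, which doubles the exponent of the singularity: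
    hence [2 * a <= kap]. *)
Let weight2 (r a M : R) : 0 < r <= T -> 0 <= a -> 2 * a <= kap -> 0 <= M ->
  (r `^ (- a) * M) ^+ 2 <= r `^ (- kap) * ((1 + T) * M) ^+ 2.
Proof.
move=> rT a0 ak M0; have /andP[r0 _] := rT.
have e : (r `^ (- a) * M) ^+ 2 = r `^ (- (2 * a)) * M ^+ 2.
  by rewrite exprMn expr2 -powR_add//; congr (r `^ _ * _); ring.
rewrite e; apply: le_trans (weight rT _ ak (sqr_ge0 M)) _; first by rewrite mulr_ge0.
rewrite ler_wpM2l ?powR_ge0// exprMn ler_wpM2r ?sqr_ge0//.
by rewrite expr2 ler_peMl.
Qed.

Let hs_weight (V : hilbertType R) (L : U -> Hr gam) (L' : U -> V) (r a K M : R) :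
  0 < r <= T -> 0 <= a -> 2 * a <= kap -> 0 <= K -> 0 <= M -> L 0 = 0 -> L' 0 = 0 ->
  (forall u, `|L u| <= K * r `^ (- a) * `|L' u|) -> (hs_norm L' `^ 2 <= (M ^+ 2)%:E)%E ->
  (hs_norm L `^ 2 <= (r `^ (- kap) * ((1 + T) * (K * M)) ^+ 2)%:E)%E.
Proof.
move=> rT a0 ak K0 M0 L0 L'0 hL hL'.
apply: le_trans (hs_sqr_le_pointwise hb L0 L'0 hL) _.
apply: le_trans (lee_wpmul2l _ hL') _; first by rewrite lee_fin sqr_ge0.
rewrite -EFinM lee_fin -exprMn; apply: le_trans (weight2 rT a0 ak (mulr_ge0 K0 M0)).
by rewrite [K * _]mulrC -mulrA.
Qed.

Let cF_le : (1 + T) * cF <= conv_const.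
Proof.
rewrite /conv_const mulrCA ler_wpM2l//; have := mulr_ge0 KQ0 LB0.
by have := cF0; have := LF0; have := cB0; have := Gc0; lra.
Qed.

Let cB_le : (1 + T) * cB <= conv_const.
Proof.
rewrite /conv_const mulrCA ler_wpM2l//; have := mulr_ge0 KQ0 LB0.
by have := cF0; have := LF0; have := cB0; have := Gc0; lra.
Qed.

Let LF_le : (1 + T) * LF <= conv_const.
Proof.
rewrite /conv_const mulrCA ler_wpM2l//; have := mulr_ge0 KQ0 LB0.
by have := cF0; have := LF0; have := cB0; have := Gc0; lra.
Qed.

Lemma conv_const_ge0 : 0 <= conv_const.
Proof. by apply: le_trans cF_le; exact: mulr_ge0. Qed.

Let split_weight (r a : R) : 0 < r -> r `^ vth * r `^ (- (a + vth)) = r `^ (- a).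
Proof. by move=> r0; rewrite -powR_add//; congr (r `^ _); ring. Qed.

(** The drift has the singularity [r^{-alp}], weaker than [r^{-kap}]. The surplus is kept as the
    factor [r^vth], which [mild_problem_incr] uses between the two times. *)
Lemma drift_conv_le N r x : 0 < r <= T ->
  `|drift_conv N r x| <= r `^ (- kap) * (r `^ vth * (conv_const * (1 + `|x|))).
Proof.
move=> rT; have /andP[r0 _] := rT.
apply: le_trans (smoothing N (F x) malp r0 _) _.
  by rewrite subKr alp0 /=; have := kapF; have := kap1; have := th0; lra.
rewrite subKr -(split_weight alp r0) -mulrA [X in _ <= X]mulrCA ler_wpM2l ?powR_ge0//.
apply: le_trans (weight rT _ kapF (normr_ge0 _)) _; first by have := alp0; have := th0; lra.
rewrite ler_wpM2l ?powR_ge0//; apply: (@le_trans _ _ ((1 + T) * (cF * (1 + `|x|)))).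
  by rewrite ler_wpM2l.
by rewrite mulrA ler_wpM2r// addr_ge0.
Qed.

Lemma drift_conv_time N r r' x : 0 < r -> r <= r' -> r' <= T ->
  `|drift_conv N r' x - drift_conv N r x| <=
  r `^ (- kap) * ((r' - r) `^ vth * (conv_const * (1 + `|x|))).
Proof.
move=> r0 rr' rT'; have rT : 0 < r <= T by rewrite r0 (le_trans rr').
apply: le_trans (time N (F x) malp r0 rr' (ltW th0) _ _) _; rewrite ?subKr//.
  by have := kapF; have := kap1; lra.
rewrite -mulrA [X in _ <= X]mulrCA ler_wpM2l ?powR_ge0//.
apply: le_trans (weight rT _ kapF (normr_ge0 _)) _; first by have := alp0; have := th0; lra.
rewrite ler_wpM2l ?powR_ge0//; apply: (@le_trans _ _ ((1 + T) * (cF * (1 + `|x|)))).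
  by rewrite ler_wpM2l.
by rewrite mulrA ler_wpM2r// addr_ge0.
Qed.

(** [G_0 F(x) - G_N F(x')] is split as [(G_0 - G_N) F(x) + G_N (F(x) - F(x'))]; only the first
    difference spends [vth]. *)
Lemma drift_conv_trunc N r x x' : (0 < N)%N -> 0 < r <= T ->
  `|drift_conv 0%N r x - drift_conv N r x'| <=
  r `^ (- kap) * (conv_const * (`|x - x'| + rho N `^ vth * (2 + `|x| + `|x'|))).
Proof.
move=> N0 rT; have /andP[r0 _] := rT.
have rh0 : 0 <= rho N `^ vth by exact: powR_ge0.
have adm : admissible m gam (gam - alp) r.
  by split; [exact: malp|exact: ltW|rewrite subKr; have := kapF; have := kap1; have := th0; lra|left].
rewrite -(subrKA (drift_conv N r x)); apply: le_trans (ler_normD _ _) _.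
rewrite mulrDr mulrDr addrC; apply: lerD.
  rewrite -(sub N _ _ adm); apply: le_trans (smoothing N _ malp r0 _) _.
    by rewrite subKr alp0 /=; have := kapF; have := kap1; have := th0; lra.
  rewrite subKr; apply: le_trans (weight rT alp0 _ (normr_ge0 _)) _.
    by have := kapF; have := th0; lra.
  rewrite ler_wpM2l ?powR_ge0//; apply: (@le_trans _ _ ((1 + T) * (LF * `|x - x'|))).
    by rewrite ler_wpM2l.
  by rewrite mulrA ler_wpM2r.
apply: le_trans (trunc N0 (F x) malp r0 (ltW th0) _ _) _; rewrite ?subKr//.
  by have := kapF; have := kap1; lra.
rewrite -mulrA [X in _ <= _ * X]mulrCA [X in _ <= X]mulrCA ler_wpM2l//.
apply: le_trans (weight rT _ kapF (normr_ge0 _)) _; first by have := alp0; have := th0; lra.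
rewrite ler_wpM2l ?powR_ge0//; apply: (@le_trans _ _ ((1 + T) * (cF * (1 + `|x|)))).
  by rewrite ler_wpM2l.
rewrite mulrA; apply: ler_pM; [exact: mulr_ge0|exact: addr_ge0|exact: cF_le|].
by have := normr_ge0 x'; lra.
Qed.

Let admB r : 0 < r -> admissible m gam (gam - bet) r.
Proof.
by move=> r0; split; [exact: mbet|exact: ltW|rewrite subKr; have := kapB; have := kap1; have := th0; have := bet0; lra|left].
Qed.

Lemma noise_conv0 N r x : 0 < r -> noise_conv N r x 0 = 0.
Proof. by move=> r0; rewrite /noise_conv linear0 linear0; exact: zero (admB r0). Qed.

Let BQ0 N x : B x (QN N 0) = 0. Proof. by rewrite linear0 linear0. Qed.

Let bet2 : 0 <= bet + vth. Proof. by have := bet0; have := th0; lra. Qed.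

Lemma noise_conv_le N r x : 0 < r <= T ->
  (hs_norm (noise_conv N r x) `^ 2 <= (r `^ (- kap) * (r `^ vth * (conv_const * (1 + `|x|))) ^+ 2)%:E)%E.
Proof.
move=> rT; have /andP[r0 _] := rT.
have M0 : 0 <= cB * (1 + `|x|) by rewrite mulr_ge0// addr_ge0.
have := @hs_weight _ (noise_conv N r x) (fun u => B x (QN N u)) r (bet + vth) (r `^ vth) _
  rT bet2 kapB (powR_ge0 _ _) M0 (noise_conv0 N x r0) (BQ0 N x) _ (B_growth N x).
move=> h; apply: le_trans (h _) _ => [u|].
  rewrite split_weight//; apply: le_trans (smoothing N _ mbet r0 _) _; rewrite subKr// bet0 /=.
  by have := kapB; have := kap1; have := th0; have := bet0; lra.
have n1 := mulr_ge0 T10 (mulr_ge0 (powR_ge0 r vth) M0).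
have n2 := mulr_ge0 (powR_ge0 r vth) (mulr_ge0 conv_const_ge0 (addr_ge0 ler01 (normr_ge0 x))).
rewrite lee_fin ler_wpM2l ?powR_ge0// lerXn2r ?nnegrE ?n1 ?n2//.
rewrite mulrCA ler_wpM2l ?powR_ge0// mulrA ler_wpM2r// addr_ge0.
Qed.

Lemma noise_conv_time N r r' x : 0 < r -> r <= r' -> r' <= T ->
  (hs_norm (fun u => noise_conv N r' x u - noise_conv N r x u)%R `^ 2 <=
   (r `^ (- kap) * ((r' - r) `^ vth * (conv_const * (1 + `|x|))) ^+ 2)%:E)%E.
Proof.
move=> r0 rr' rT'; have rT : 0 < r <= T by rewrite r0 (le_trans rr').
have M0 : 0 <= cB * (1 + `|x|) by rewrite mulr_ge0// addr_ge0.
have z : noise_conv N r' x 0 - noise_conv N r x 0 = 0.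
  by rewrite !noise_conv0 ?subrr// (lt_le_trans r0).
have := @hs_weight _ (fun u => noise_conv N r' x u - noise_conv N r x u) (fun u => B x (QN N u))
  r (bet + vth) ((r' - r) `^ vth) _ rT bet2 kapB (powR_ge0 _ _) M0 z (BQ0 N x) _ (B_growth N x).
move=> h; apply: le_trans (h _) _ => [u|].
  have := time N (B x (QN N u)) mbet r0 rr' (ltW th0); rewrite subKr; apply => //.
  by have := kapB; have := kap1; have := th0; have := bet0; lra.
have n1 := mulr_ge0 T10 (mulr_ge0 (powR_ge0 (r' - r) vth) M0).
have n2 := mulr_ge0 (powR_ge0 (r' - r) vth) (mulr_ge0 conv_const_ge0 (addr_ge0 ler01 (normr_ge0 x))).
rewrite lee_fin ler_wpM2l ?powR_ge0// lerXn2r ?nnegrE ?n1 ?n2//.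
rewrite mulrCA ler_wpM2l ?powR_ge0// mulrA ler_wpM2r// addr_ge0.
Qed.

(* G_0 B(x) Q_0 - G_N B(x') Q_N = (G_0 - G_N) B(x) Q_0 + G_N (B(x) - B(x')) Q_0
   + G_N B(x') (Q_0 - Q_N): no Lipschitz bound on [B(.) Q_N] uniform in [N] is assumed. *)
Lemma noise_conv_trunc N r x x' : (0 < N)%N -> 0 < r <= T ->
  (hs_norm (fun u => noise_conv 0%N r x u - noise_conv N r x' u)%R `^ 2 <=
   (r `^ (- kap) * (conv_const * (`|x - x'| + rho N `^ vth * (2 + `|x| + `|x'|))) ^+ 2)%:E)%E.
Proof.
move=> N0 rT; have /andP[r0 _] := rT.
have rh0 : 0 <= rho N `^ vth by exact: powR_ge0.
pose GN y := propagator S gam (PN N) r (iincl Hr (gam - bet) m y).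
pose D1 u := noise_conv 0%N r x u - GN (B x (QN 0%N u)).
pose D2 u := GN (B x (QN 0%N u) - B x' (QN 0%N u)).
pose D3 u := GN (B x' (QN 0%N u - QN N u)).
have GN0 : GN 0 = 0 by exact: zero (admB r0).
have D10 : D1 0 = 0 by rewrite /D1 noise_conv0// BQ0 GN0 subrr.
have D20 : D2 0 = 0 by rewrite /D2 !BQ0 subrr GN0.
have Q0 : QN 0%N 0 - QN N 0 = 0 by rewrite (linear0 (QN 0%N)) (linear0 (QN N)) subrr.
have D30 : D3 0 = 0 by rewrite /D3 Q0 linear0 GN0.
have De u : noise_conv 0%N r x u - noise_conv N r x' u = D1 u + (D2 u + D3 u).
  have -> : D3 u = GN (B x' (QN 0%N u) - B x' (QN N u)) by rewrite /D3 (linearB (B x')).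
  by rewrite /D1 /D2 /GN !(sub N _ _ (admB r0)) !subrKA.
set M1 := rho N `^ vth * (cB * (1 + `|x|)); set M2 := KQ * LB * `|x - x'|.
set M3 := rho N `^ vth * (Gc * (1 + `|x'|)).
have M10 : 0 <= M1 by rewrite !mulr_ge0// addr_ge0.
have M20 : 0 <= M2 by rewrite !mulr_ge0.
have M30 : 0 <= M3 by rewrite !mulr_ge0// addr_ge0.
have b01 : 0 <= gam - (gam - bet) <= 1.
  by rewrite subKr bet0 /=; have := kapB; have := kap1; have := th0; have := bet0; lra.
have h1 : (hs_norm D1 `^ 2 <= (r `^ (- kap) * ((1 + T) * M1) ^+ 2)%:E)%E.
  apply: (@hs_weight _ D1 (fun u => B x (QN 0%N u)) r (bet + vth) (rho N `^ vth) (cB * (1 + `|x|))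
    rT bet2 kapB rh0 _ D10 (BQ0 _ _) _ (B_growth _ _)) => [|u].
    by rewrite mulr_ge0// addr_ge0.
  have := trunc N0 (B x (QN 0%N u)) mbet r0 (ltW th0); rewrite subKr; apply => //.
  by have := kapB; have := kap1; have := th0; have := bet0; lra.
have h2 : (hs_norm D2 `^ 2 <= (r `^ (- kap) * ((1 + T) * M2) ^+ 2)%:E)%E.
  rewrite -[M2]mul1r.
  apply: (@hs_weight _ D2 (fun u => B x (QN 0%N u) - B x' (QN 0%N u)) r bet 1 M2
    rT bet0 _ ler01 M20 D20 _ _ (B_lip _ _)) => [||u].
  - by have := kapB; have := th0; lra.
  - by rewrite !BQ0 subrr.
  - by rewrite mul1r; have := smoothing N (B x (QN 0%N u) - B x' (QN 0%N u)) mbet r0 b01; rewrite subKr.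
have h3 : (hs_norm D3 `^ 2 <= (r `^ (- kap) * ((1 + T) * M3) ^+ 2)%:E)%E.
  rewrite -[M3]mul1r.
  (* The rate is already part of the hypothesis on the noise, so smoothing spends [chi] alone,
     without [vth]. *)
  apply: (@hs_weight _ D3 (fun u => iincl Hr (gam - bet) (gam - chi) (B x' (QN 0%N u - QN N u))) r chi 1 M3
    rT chi0 kapC ler01 M30 D30 _ _ (B_trunc_growth _ N0)) => [|u].
  - by rewrite Q0 !linear0.
  - rewrite mul1r; have := smoothing_incl N (B x' (QN 0%N u - QN N u)) mchi _ r0; rewrite subKr; apply.
      by have := bc; lra.
    by rewrite chi0 /=; have := kapC; have := kap1; lra.
under [X in hs_norm X]eq_fun do rewrite De.
have D230 : D2 0 + D3 0 = 0 by rewrite D20 D30 addr0.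
apply: le_trans (hs_sqr_add_le (@hb _) D10 D230) _.
apply: le_trans (leeD2l _ (lee_wpmul2l _ (hs_sqr_add_le (@hb _) D20 D30))) _ => //.
set k := r `^ (- kap) in h1 h2 h3 *.
have k0 : 0 <= k by exact: powR_ge0.
apply: (@le_trans _ _ (2 * (k * ((1 + T) * M1) ^+ 2) +
   2 * (2 * (k * ((1 + T) * M2) ^+ 2) + 2 * (k * ((1 + T) * M3) ^+ 2)))%:E).
  have two : (0 <= (2 : R)%:E)%E by rewrite lee_fin.
  exact: leeD (lee_wpmul2l two h1) (lee_wpmul2l two (leeD (lee_wpmul2l two h2) (lee_wpmul2l two h3))).
rewrite lee_fin; apply: (@le_trans _ _ (k * (2 * ((1 + T) * (M1 + M2 + M3))) ^+ 2)).
  have p1 := mulr_ge0 T10 M10; have p2 := mulr_ge0 T10 M20; have p3 := mulr_ge0 T10 M30.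
  rewrite !mulrDr; move: ((1 + T) * M1) ((1 + T) * M2) ((1 + T) * M3) p1 p2 p3 => x1 x2 x3 p1 p2 p3.
  have -> : 2 * (k * x1 ^+ 2) + (2 * (2 * (k * x2 ^+ 2)) + 2 * (2 * (k * x3 ^+ 2))) =
       k * (2 * x1 ^+ 2 + 4 * x2 ^+ 2 + 4 * x3 ^+ 2) by ring.
  rewrite ler_wpM2l//.
  have := mulr_ge0 p1 p2; have := mulr_ge0 p1 p3; have := mulr_ge0 p2 p3; have := sqr_ge0 x1.
  by rewrite !expr2; nra.
have s0 : 0 <= M1 + M2 + M3 by rewrite !addr_ge0.
have dx := normr_ge0 (x - x').
have px := normr_ge0 x; have px' := normr_ge0 x'.
have w0 : 0 <= `|x - x'| + rho N `^ vth * (2 + `|x| + `|x'|) by rewrite addr_ge0// mulr_ge0// !addr_ge0.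
have n1 : 0 <= 2 * ((1 + T) * (M1 + M2 + M3)) by rewrite mulr_ge0// mulr_ge0.
have n2 := mulr_ge0 conv_const_ge0 w0.
rewrite ler_wpM2l// lerXn2r ?nnegrE ?n1 ?n2//.
rewrite /conv_const -!mulrA ler_wpM2l// ler_wpM2l//.
apply: (@le_trans _ _ ((cB + KQ * LB + Gc) * (`|x - x'| + rho N `^ vth * (2 + `|x| + `|x'|)))); last first.
  by rewrite ler_wpM2r//; have := cF0; have := LF0; lra.
rewrite /M1 /M2 /M3 mulrDl mulrDl; apply: lerD; first apply: lerD.
- rewrite mulrCA ler_wpM2l//; apply: (@le_trans _ _ (rho N `^ vth * (2 + `|x| + `|x'|))).
    by rewrite ler_wpM2l//; lra.
  by rewrite lerDr.
- by rewrite ler_wpM2l ?mulr_ge0// lerDl mulr_ge0// !addr_ge0.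
- rewrite mulrCA ler_wpM2l//; apply: (@le_trans _ _ (rho N `^ vth * (2 + `|x| + `|x'|))).
    by rewrite ler_wpM2l//; lra.
  by rewrite lerDr.
Qed.

End coefficient_estimates.

(** * The rate of convergence in the Hoelder norm *)

Section holder_rate.
Context {R : realType} {d : measure_display} {Omega : measurableType d} {V : hilbertType R}.
Variables (P : probability Omega R) (T : R) (e : nat -> V).
Hypotheses (T_gt0 : 0 < T) (te : onseq_total e).
Variables (X : nat -> R -> Omega -> V) (th p iota Cr M C2 C3 : R).
Hypotheses (th0 : 0 < th) (p1 : 1 <= p) (iota0 : 0 < iota) (Cr0 : 0 < Cr).
Hypotheses (M0 : 0 <= M) (C20 : 0 <= C2) (C30 : 0 <= C3).
Hypothesis contX : forall N w, {within `[0, T], continuous (fun t => X N t w)}.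
Hypothesis mX : forall N t i, 0 <= t <= T -> measurable_fun setT (fun w => inner (e i) (X N t w)).
Local Notation rho N := (Cr * N%:R `^ (- iota)).
Hypothesis X_moment : forall N t, 0 <= t <= T ->
  (\int[P]_w ((1 + `|X N t w|) `^ p)%:E <= M%:E)%E.
Hypothesis X_incr : forall N t1 t2, 0 <= t2 -> t2 <= t1 -> t1 <= T ->
  (\int[P]_w (`|X N t1 w - X N t2 w| `^ p)%:E <= (C2 * (t1 - t2) `^ (th * p))%:E)%E.
Hypothesis X_trunc : forall N t, (0 < N)%N -> 0 <= t <= T ->
  (\int[P]_w (`|X 0%N t w - X N t w| `^ p)%:E <= (C3 * rho N `^ (th * p))%:E)%E.

Let p0 : 0 < p. Proof. by have := p1; lra. Qed.

Let mXX N1 N2 s t : 0 <= s <= T -> 0 <= t <= T -> measurable_fun setT (fun w => `|X N1 s w - X N2 t w|).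
Proof.
move=> sT tT; apply: (measurable_norm_coord te) => // i; under eq_fun do rewrite innerBr.
by apply: measurable_funB; apply: mX.
Qed.

Let mXXX N s t : 0 <= s <= T -> 0 <= t <= T ->
  measurable_fun setT (fun w => `|(X 0%N s w - X N s w) - (X 0%N t w - X N t w)|).
Proof.
move=> sT tT; apply: (measurable_norm_coord te) => // i; under eq_fun do rewrite !innerBr.
by do !apply: measurable_funB; apply: mX.
Qed.

Let T0T : 0 <= (0 : R) <= T. Proof. by rewrite lexx ltW. Qed.

Let integral_sub_le (f g h : Omega -> R) (a : R) : measurable_fun setT g -> measurable_fun setT h ->
  (forall w, 0 <= f w <= g w + h w) -> (forall w, 0 <= g w) -> (forall w, 0 <= h w) ->
  (\int[P]_w (g w `^ p)%:E <= a%:E)%E -> (\int[P]_w (h w `^ p)%:E <= a%:E)%E ->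
  (\int[P]_w (f w `^ p)%:E <= (2 `^ p * (a + a))%:E)%E.
Proof.
move=> mg mh fgh g0 h0 ig ih.
have mg' : measurable_fun setT (fun w => (g w `^ p)%:E) by apply/measurable_EFinP; exact: measurable_powR_comp.
have mh' : measurable_fun setT (fun w => (h w `^ p)%:E) by apply/measurable_EFinP; exact: measurable_powR_comp.
have pg w : (0 <= (g w `^ p)%:E)%E by rewrite lee_fin powR_ge0.
have ph w : (0 <= (h w `^ p)%:E)%E by rewrite lee_fin powR_ge0.
apply: (@le_trans _ _ (\int[P]_w ((2 `^ p)%:E * ((g w `^ p)%:E + (h w `^ p)%:E)))%E).
  apply: ge0_le_integral_nomeas => w _; first by rewrite lee_fin powR_ge0.
  rewrite -EFinD -EFinM lee_fin; have /andP[f0 fle] := fgh w.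
  by apply: le_trans (ler_powR_base (ltW p0) f0 fle) _; apply: powR_add_le => //; exact: ltW.
rewrite (integralZ_ge0 P (powR_ge0 _ _) (emeasurable_funD mg' mh') (fun w => adde_ge0 (pg w) (ph w))).
rewrite (integralD_ge0 P mg' mh' pg ph) EFinM EFinD lee_wpmul2l ?lee_fin ?powR_ge0//.
exact: (leeD ig ih).
Qed.

Let powR_split (x s : R) : s <= th -> x `^ (th * p) = x `^ (s * p) * x `^ ((th - s) * p).
Proof.
move=> sth; rewrite -powRD; first by congr (x `^ _); ring.
have -> : s * p + (th - s) * p = th * p by ring.
by rewrite mulf_eq0 (gt_eqF th0) (gt_eqF p0).
Qed.

(* Interpolation between the temporal regularity [h^th] and the rate [rho^th] gives the
   increments of the error the size [h^s rho^(th - s)]. *)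
Let error_incr N s t1 t2 : (0 < N)%N -> 0 <= s -> s <= th -> 0 <= t2 -> t2 <= t1 -> t1 <= T ->
  (\int[P]_w (`|(X 0%N t1 w - X N t1 w) - (X 0%N t2 w - X N t2 w)| `^ p)%:E <=
   (2 `^ p * ((C2 + C3) + (C2 + C3)) * rho N `^ ((th - s) * p) * (t1 - t2) `^ (s * p))%:E)%E.
Proof.
move=> N0 s0 sth t20 t21 t1T; have h0 : 0 <= t1 - t2 by rewrite subr_ge0.
have r0 : 0 <= rho N by rewrite mulr_ge0 ?powR_ge0// ltW.
have t1T' : 0 <= t1 <= T by rewrite t1T (le_trans t20).
have t2T' : 0 <= t2 <= T by rewrite t20 (le_trans t21).
have q0 : 0 <= th - s by rewrite subr_ge0.
have C230 : 0 <= C2 + C3 by exact: addr_ge0.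
set a := (C2 + C3) * (rho N `^ ((th - s) * p) * (t1 - t2) `^ (s * p)).
have -> : 2 `^ p * (C2 + C3 + (C2 + C3)) * rho N `^ ((th - s) * p) * (t1 - t2) `^ (s * p) =
    2 `^ p * (a + a) by rewrite /a; ring.
(* Over times shorter than [rho N] the regularity of each process is used, over longer ones the
   error at the two endpoints. *)
have [hr|rh] := leP (t1 - t2) (rho N).
  have ha : C2 * (t1 - t2) `^ (th * p) <= a.
    rewrite (powR_split _ sth) /a; apply: ler_pM; rewrite ?mulr_ge0 ?powR_ge0 ?lerDl// mulrC.
    by rewrite ler_wpM2r ?powR_ge0// ler_powR_base ?mulr_ge0 ?(ltW p0).
  apply: (@integral_sub_le _ (fun w => `|X 0%N t1 w - X 0%N t2 w|) (fun w => `|X N t1 w - X N t2 w|)) => //.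
  - exact: mXX.
  - exact: mXX.
  - by move=> w; rewrite normr_ge0 /= subrBB ler_normB.
  - by apply: le_trans (X_incr 0%N t20 t21 t1T) _; rewrite lee_fin.
  - by apply: le_trans (X_incr N t20 t21 t1T) _; rewrite lee_fin.
have ha : C3 * rho N `^ (th * p) <= a.
  rewrite (powR_split _ sth) /a; apply: ler_pM; rewrite ?mulr_ge0 ?powR_ge0 ?lerDr// mulrC.
  by rewrite ler_wpM2l ?powR_ge0// ler_powR_base ?mulr_ge0 ?(ltW p0)// ltW.
apply: (@integral_sub_le _ (fun w => `|X 0%N t1 w - X N t1 w|) (fun w => `|X 0%N t2 w - X N t2 w|)) => //.
- exact: mXX.
- exact: mXX.
- by move=> w; rewrite normr_ge0 /= ler_normB.
- by apply: le_trans (X_trunc N0 t1T') _; rewrite lee_fin.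
- by apply: le_trans (X_trunc N0 t2T') _; rewrite lee_fin.
Qed.

Lemma holder_rate (del eps : R) : 0 <= del < th - p^-1 -> 0 < eps ->
  (ereal_sup
     [set (\int[P]_w (holder_norm `[0%R, T] enorm del (fun t => X N t w)) `^ p +
           (N%:R `^ (iota * (th - del - p^-1 - eps)))%:E *
           (\int[P]_w (holder_norm `[0%R, T] enorm del (fun t => (X 0%N t w - X N t w)%R)) `^ p) `^ p^-1)
       | N in [set N | (0 < N)%N]] < +oo)%E.
Proof.
move=> /andP[del0 delth] eps0; have pinv0 : 0 < p^-1 by rewrite invr_gt0.
have [|K1 K10 HK1] := @kolmogorov_chentsov R d Omega V P T p th del T_gt0 p1 del0; first by lra.
(* [eps] may exceed the available room; a smaller value keeps [s <= th] and gives an even better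
   rate. *)
pose eps' := Num.min eps ((th - del - p^-1) / 2).
have e'0 : 0 < eps' by rewrite lt_min eps0 /= divr_gt0//; lra.
have e'1 : eps' <= eps by rewrite ge_min lexx.
have e'2 : eps' <= (th - del - p^-1) / 2 by rewrite ge_min lexx orbT.
pose s := del + p^-1 + eps'.
have s0 : 0 <= s by rewrite /s; lra.
have sth : s <= th by rewrite /s; lra.
have [|K2 K20 HK2] := @kolmogorov_chentsov R d Omega V P T p s del T_gt0 p1 del0; first by rewrite /s; lra.
(* The last summand accounts for the error at time 0: there
   [rho^(th p) = rho^(s p) rho^((th - s) p)] and [rho <= Cr]. *)
pose C4 := 2 `^ p * ((C2 + C3) + (C2 + C3)) + C3 * Cr `^ (s * p).
have C40 : 0 <= C4 by rewrite addr_ge0 ?mulr_ge0 ?powR_ge0 ?addr_ge0.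
pose bound := K1 * (M + C2) + (K2 * C4) `^ p^-1 * Cr `^ (th - s).
apply: (@le_lt_trans _ _ bound%:E); last exact: ltry.
apply: ge_ereal_sup => _ [N /= N0 <-].
have N1 : 1 <= N%:R :> R by rewrite ler1n.
have Ngt0 : 0 < N%:R :> R by rewrite ltr0n.
have r0 : 0 < rho N by rewrite mulr_gt0// powR_gt0.
have Npow a : 0 <= a -> N%:R `^ (- a) <= 1 :> R.
  by move=> a0; rewrite -[X in _ <= X](powRr0 N%:R); apply: ler_powR; rewrite ?oppr_le0.
have rCr : rho N <= Cr.
  by rewrite ler_piMr ?(ltW Cr0)// Npow// ltW.
have mnX : measurable_fun setT (fun w => `|X N 0 w|).
  by apply: (measurable_norm_coord te) => // i; exact: mX.
rewrite EFinD; apply: leeD.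
  apply: (HK1 (X N) (M + C2)) => //; first exact: addr_ge0.
  - by move=> u v uT vT; exact: mXX.
  - move=> u v u0 uv vT; apply: le_trans (X_incr N u0 uv vT) _.
    by rewrite lee_fin ler_wpM2r ?powR_ge0// lerDr.
  - apply: (@le_trans _ _ M%:E); last by rewrite lee_fin lerDl.
    apply: le_trans (X_moment N T0T); apply: ge0_le_integral_nomeas => w _; rewrite lee_fin ?powR_ge0//.
    by apply: ler_powR_base; rewrite ?(ltW p0)// lerDr.
pose A := C4 * rho N `^ ((th - s) * p).
have A0 : 0 <= A by rewrite mulr_ge0// powR_ge0.
have HA : (\int[P]_w (holder_norm `[0%R, T] enorm del (fun t => (X 0%N t w - X N t w)%R)) `^ p <= (K2 * A)%:E)%E.
  apply: (HK2 (fun t w => X 0%N t w - X N t w)) => //.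
  - move=> w; have c0 : {within `[0, T], continuous (fun t => X 0%N t w)} := @contX 0%N w.
    have cN : {within `[0, T], continuous (fun t => X N t w)} := @contX N w.
    by move=> x; apply: cvgB; [exact: c0|exact: cN].
  - by move=> u v uT vT; exact: mXXX.
  - exact: mXX.
  - move=> u v u0 uv vT; apply: le_trans (error_incr N0 s0 sth u0 uv vT) _.
    rewrite lee_fin ler_wpM2r ?powR_ge0// /A ler_wpM2r ?powR_ge0// lerDl.
    by rewrite mulr_ge0// powR_ge0.
  - apply: le_trans (X_trunc N0 T0T) _; rewrite lee_fin (powR_split _ sth) mulrA ler_wpM2r ?powR_ge0//.
    apply: (@le_trans _ _ (C3 * Cr `^ (s * p))); last first.
      by rewrite lerDr !mulr_ge0 ?powR_ge0 ?addr_ge0.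
    apply: ler_wpM2l => //; apply: ler_powR_base; [exact: mulr_ge0 s0 (ltW p0)|exact: ltW|exact: rCr].
apply: (@le_trans _ _ ((N%:R `^ (iota * (th - del - p^-1 - eps)))%:E * ((K2 * A)%:E `^ p^-1))%E).
  rewrite lee_wpmul2l ?lee_fin ?powR_ge0//; apply: gt0_ler_poweR => //; first exact: ltW.
  - by rewrite in_itv /= leey andbT; apply: integral_ge0 => w _; exact: poweR_ge0.
  - by rewrite in_itv /= leey andbT lee_fin mulr_ge0.
rewrite poweR_EFin -EFinM lee_fin /A mulrA powRM ?mulr_ge0 ?powR_ge0// mulrCA ler_wpM2l ?powR_ge0//.
rewrite -powRrM mulfK ?gt_eqF// powRM ?powR_ge0 ?(ltW Cr0)// mulrCA ler_piMr ?powR_ge0//.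
rewrite -powRrM -powR_add//.
(* The rate obtained is [N^{-iota (th - s)}] with [th - s = th - del - 1/p - eps']; as
   [eps' <= eps], it compensates the weight. *)
have -> : iota * (th - del - p^-1 - eps) + - iota * (th - s) = - (iota * (eps - eps')).
  by rewrite /s; ring.
by apply: Npow; rewrite mulr_ge0 ?subr_ge0// ltW.
Qed.

End holder_rate.

(** * Constants extracted from the hypotheses, and the main estimate *)

Lemma spectral_gap (R : realType) (H : Type) (bas : set H) (lam : H -> R) : bas !=set0 ->
  (ereal_sup [set (lam h)%:E | h in bas] < 0)%E ->
  exists2 c : R, 0 < c & forall h, bas h -> c <= - lam h.
Proof.
move=> [h0 bh0]; set s := ereal_sup _ => s0.
have ub h : bas h -> ((lam h)%:E <= s)%E by move=> bh; apply: ereal_sup_ubound; exists h.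
have sfin : s \is a fin_num.
  by rewrite fin_numE -ltNye -ltey (lt_le_trans (ltNyr _) (ub _ bh0)) (lt_trans s0 (ltry _)).
exists (- fine s); first by rewrite oppr_gt0 -lte_fin fineK.
by move=> h /ub; rewrite -{1}(fineK sfin) lee_fin lerN2.
Qed.

Lemma bounded_linear_bound (R : realType) (V W : normedModType R) (f : {linear V -> W}) :
  continuous f -> exists2 K : R, 0 <= K & forall u, `|f u| <= K * `|u|.
Proof.
move=> /linear_bounded_continuous/linear_boundedP[K [Kr hK]].
exists (Num.max 0 (K + 1)); first by rewrite le_max lexx.
by move=> u; apply: (hK (Num.max 0 (K + 1))); rewrite lt_max ltrDl ltr01 orbT.
Qed.

Lemma truncation_rate (R : realType) (H : hilbertType R) (bas : set H) (basN : nat -> set H)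
    (lam : H -> R) (iota : R) :
  (ereal_sup [set ((N%:R `^ iota)%:E *
       ereal_sup ([set (`|lam h|^-1)%:E | h in bas `\` basN N] `|` [set 0]))
     | N in [set N | (0 < N)%N]] < +oo)%E ->
  exists2 C : R, 1 <= C &
    forall N h, (0 < N)%N -> bas h -> ~ basN N h -> `|lam h|^-1 <= C * N%:R `^ (- iota).
Proof.
set s := ereal_sup _ => sfin.
have s0 : (0 <= s)%E.
  apply: (@le_trans _ _ ((1%:R `^ iota)%:E * ereal_sup ([set (`|lam h|^-1)%:E | h in bas `\` basN 1%N] `|` [set 0%E]))%E).
    by rewrite mule_ge0 ?lee_fin ?powR_ge0//; apply: ereal_sup_ubound; right.
  by apply: ereal_sup_ubound; exists 1%N.
(* The added 1 gives [C >= 1], so that [N^{-iota vth}] is at most [(C N^{-iota})^vth]. *)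
exists (fine s + 1); first by rewrite lerDr fine_ge0.
move=> N h N0 bh nh; have Nr : 0 < N%:R :> R by rewrite ltr0n.
have le1 : ((N%:R `^ iota)%:E * (`|lam h|^-1)%:E <= s)%E.
  apply: (@le_trans _ _ ((N%:R `^ iota)%:E * ereal_sup ([set (`|lam h|^-1)%:E | h in bas `\` basN N] `|` [set 0%E]))%E).
    rewrite lee_wpmul2l ?lee_fin ?powR_ge0//; apply: ereal_sup_ubound; left.
    by exists h.
  by apply: ereal_sup_ubound; exists N.
rewrite -EFinM -(@fineK _ s) ?ge0_fin_numE// lee_fin mulrC in le1.
rewrite -powR_invr// ler_pdivlMr ?powR_gt0//; apply: le_trans le1 _.
by rewrite lerDl.
Qed.

Section noise_bounds.
Context {R : realType} {U V M : hilbertType R}.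

Lemma hs_norm0 : hs_norm (0 : U -> V) = 0%E.
Proof.
rewrite /hs_norm esum1 ?poweR0r ?invr_eq0// => u _.
by rewrite normr0 expr0n.
Qed.

Lemma noise_growth (V' : hilbertType R) (B : M -> hsop U V) (Q : nat -> U -> U)
    (E : V -> V') (iota vth : R) :
  (ereal_sup [set ereal_sup [set ((hs_norm (fun u => B v (Q N u)) +
        (N%:R `^ (iota * vth))%:E * hs_norm (fun u => E (B v (Q 0%N u - Q N u)%R)))
       * ((1 + `|v|)^-1)%:E)
     | v in [set: M]] | N in [set N | (0 < N)%N]] < +oo)%E ->
  exists2 G : R, 0 <= G & forall N v, (0 < N)%N ->
    (hs_norm (fun u => B v (Q N u)) <= (G * (1 + `|v|))%:E)%E /\
    (hs_norm (fun u => E (B v (Q 0%N u - Q N u)%R)) <=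
       (N%:R `^ (- (iota * vth)) * (G * (1 + `|v|)))%:E)%E.
Proof.
set s := ereal_sup _ => sfin.
have hs0 (W : hilbertType R) (L : U -> W) : (0 <= hs_norm L)%E by exact: poweR_ge0.
have sub N v : (0 < N)%N -> ((hs_norm (fun u => B v (Q N u)) +
    (N%:R `^ (iota * vth))%:E * hs_norm (fun u => E (B v (Q 0%N u - Q N u)%R))) * ((1 + `|v|)^-1)%:E <= s)%E.
  move=> N0; apply: (@le_trans _ _ (ereal_sup [set ((hs_norm (fun u => B v (Q N u)) +
      (N%:R `^ (iota * vth))%:E * hs_norm (fun u => E (B v (Q 0%N u - Q N u)%R))) * ((1 + `|v|)^-1)%:E)%E
     | v in [set: M]])).
    by apply: ereal_sup_ubound; exists v.
  by apply: ereal_sup_ubound; exists N.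
have s0 : (0 <= s)%E.
  apply: le_trans (sub 1%N 0 isT); rewrite mule_ge0 ?lee_fin ?invr_ge0 ?addr_ge0//.
  by rewrite adde_ge0// mule_ge0// lee_fin powR_ge0.
have [g gE] : exists g, s = g%:E by exists (fine s); rewrite fineK// ge0_fin_numE.
exists g; first by rewrite -lee_fin -gE.
move=> N v N0; have Nr : 0 < N%:R :> R by rewrite ltr0n.
have v0 : 0 < 1 + `|v| by rewrite ltr_pwDl.
have := sub N v N0; rewrite gE lee_pdivrMr// -EFinM => h.
have n0 : 0 < N%:R `^ (iota * vth) :> R by rewrite powR_gt0.
split; first by apply: le_trans h; rewrite leeDl// mule_ge0// lee_fin ltW.
have h2 : ((N%:R `^ (iota * vth))%:E * hs_norm (fun u => E (B v (Q 0%N u - Q N u)%R)) <= (g * (1 + `|v|))%:E)%E.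
  by apply: le_trans h; rewrite leeDr.
by rewrite -powR_invr// EFinM lee_pdivlMl.
Qed.

End noise_bounds.

Section noise_composition.
Context {R : realType} {U V M : hilbertType R}.
Variables (b : nat -> U) (e : nat -> V).
Hypotheses (tb : onseq_total b) (te : onseq_total e).
Hypothesis hb : forall (V : hilbertType R) (L : U -> V), L 0 = 0 ->
  (hs_norm L `^ 2 = \sum_(n <oo) (`|L (b n)| ^+ 2)%:E)%E.
Variables (B : M -> hsop U V) (Q : nat -> {linear U -> U}) (LB K : R).
Hypotheses (LB0 : 0 <= LB) (K0 : 0 <= K) (hQ : forall u, `|Q 0%N u| <= K * `|u|).
Hypothesis lipB : forall x y, (hs_norm (fun u => B x u - B y u)%R <= (LB * `|x - y|)%:E)%E.

Lemma hs_comp_lipschitz x y :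
  (hs_norm (fun u => B x (Q 0%N u) - B y (Q 0%N u))%R `^ 2 <= ((K * LB * `|x - y|) ^+ 2)%:E)%E.
Proof.
have cL : continuous (GRing.sub_fun (hsfun (B x)) (hsfun (B y))).
  by move=> u; apply: cvgB; exact: hsfun_cont.
apply: le_trans (hs_sqr_comp_bounded tb hb te cL K0 hQ) _.
rewrite -mulrA exprMn [leRHS]EFinM lee_wpmul2l ?lee_fin ?sqr_ge0//.
by apply: hs_sqr_le; rewrite ?mulr_ge0//; exact: lipB.
Qed.

(** The growth hypothesis concerns [N >= 1]; for [N = 0] growth follows from the Lipschitz bound on
    [B], its value at 0 and the boundedness of [Q 0]. *)
Lemma hs_comp_growth (G : R) : 0 <= G ->
  (forall N v, (0 < N)%N -> (hs_norm (fun u => B v (Q N u)) <= (G * (1 + `|v|))%:E)%E) ->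
  exists2 c : R, 0 <= c &
    forall N v, (hs_norm (fun u => B v (Q N u)) `^ 2 <= ((c * (1 + `|v|)) ^+ 2)%:E)%E.
Proof.
move=> G0 hG; have [b0 b0E] : exists b0, hs_norm (B 0) = b0%:E.
  exists (fine (hs_norm (B 0))); rewrite fineK// ge0_fin_numE; first exact: hsfun_fin.
  exact: poweR_ge0.
have b00 : 0 <= b0 by rewrite -lee_fin -b0E; exact: poweR_ge0.
have a0 : 0 <= K * (2 * (LB + b0)) by rewrite mulr_ge0// mulr_ge0// addr_ge0.
exists (G + K * (2 * (LB + b0))); first exact: addr_ge0.
move=> N v; have v0 : 0 <= 1 + `|v| by rewrite addr_ge0.
have [->|N0] := posnP N; last first.
  apply: hs_sqr_le; first by rewrite mulr_ge0// addr_ge0.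
  by apply: le_trans (hG N v N0) _; rewrite lee_fin ler_wpM2r// lerDl.
apply: (@le_trans _ _ ((K * (2 * (LB + b0)) * (1 + `|v|)) ^+ 2)%:E); last first.
  have h0 := mulr_ge0 a0 v0; have h1 := mulr_ge0 (addr_ge0 G0 a0) v0.
  by rewrite lee_fin lerXn2r ?nnegrE// ler_wpM2r// lerDr.
apply: le_trans (hs_sqr_comp_bounded tb hb te (@hsfun_cont _ _ _ (B v)) K0 hQ) _.
rewrite -mulrA exprMn [leRHS]EFinM lee_wpmul2l ?lee_fin ?sqr_ge0//.
have BE : hsfun (B v) = (fun u => (B v u - B 0 u) + B 0 u) :> (U -> V).
  by apply/funext => u; rewrite subrK.
rewrite BE; apply: le_trans (hs_sqr_add_le (@hb _) _ _) _; rewrite ?linear0 ?subrr ?addr0//.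
have h1 : (hs_norm (fun u => B v u - B 0 u)%R `^ 2 <= ((LB * `|v|) ^+ 2)%:E)%E.
  by apply: hs_sqr_le; [exact: mulr_ge0|have := lipB v 0; rewrite subr0].
have h2 : (hs_norm (B 0%R) `^ 2 <= (b0 ^+ 2)%:E)%E by apply: hs_sqr_le; rewrite ?b0E.
have two : (0 <= (2 : R)%:E)%E by rewrite lee_fin.
apply: le_trans (leeD (lee_wpmul2l two h1) (lee_wpmul2l two h2)) _.
rewrite -!EFinM -EFinD lee_fin; set x := LB * `|v|.
have x0 : 0 <= x by rewrite mulr_ge0.
apply: (@le_trans _ _ ((2 * (x + b0)) ^+ 2)).
  by have := mulr_ge0 x0 b00; have := sqr_ge0 x; have := sqr_ge0 b0; rewrite !expr2; nra.
have h3 : 0 <= 2 * (x + b0) by rewrite mulr_ge0// addr_ge0.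
have h4 : 0 <= 2 * (LB + b0) * (1 + `|v|) by rewrite mulr_ge0// mulr_ge0// addr_ge0.
rewrite lerXn2r ?nnegrE// -mulrA ler_wpM2l// mulrDl mulrDr mulr1.
by apply: lerD; rewrite ?lerDr// mulrDr mulr1 lerDl mulr_ge0.
Qed.

End noise_composition.

Section initial_value.
Context {R : realType} {H : hilbertType R} (bas : set H) (lam : H -> R).
Variables (b : nat -> H) (onb : orthonormal_basis bas) (enb : enumerates bas b).
Variables (c0 : R) (c0_gt0 : 0 < c0) (lam_lt : forall h, bas h -> c0 <= - lam h).
Variable Hr : interpolation_family bas lam.

Lemma norm_iincl_le r s (v : Hr r) : s <= r ->
  `|iincl Hr r s v| <= Num.min c0 1 `^ (- (r - s)) * `|v|.
Proof.
case: enb => tb b1 b2 b3 sr; set k := Num.min c0 1.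
have k0 : 0 < k by rewrite lt_min c0_gt0 ltr01.
apply: (norm_le_coord onb tb b1 b2 b3 c0_gt0 lam_lt); first exact: powR_ge0.
move=> n; rewrite (coord_incl onb tb b1 b2 b3 c0_gt0 lam_lt)// [leLHS]normrM [X in _ <= _ * X]normrM mulrA ler_wpM2r//.
have mk : k <= mu lam b n := mu_ge b1 lam_lt n.
have m0 : 0 < mu lam b n := lt_le_trans k0 mk.
rewrite !ger0_norm ?powR_ge0//.
have -> : mu lam b n `^ r = mu lam b n `^ (r - s) * mu lam b n `^ s.
  by rewrite -powR_add// subrK.
rewrite mulrA ler_peMl ?powR_ge0//; apply: (@le_trans _ _ (k `^ (- (r - s)) * k `^ (r - s))).
  by rewrite -powR_add// addNr powRr0.
by rewrite ler_wpM2l ?powR_ge0// ler_powR_base ?subr_ge0// ltW.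
Qed.

(** What is known to be measurable is the image of [xi] in the rougher space. Coordinates agree in
    both spaces, so the finer norm of [xi] is again a series of measurable terms. *)
Lemma measurable_norm_lift (d : measure_display) (Omega : measurableType d) r s (xi : Omega -> Hr r) :
  s <= r -> (forall n, measurable_fun setT (fun w => inner (unit_coord b Hr s n) (iincl Hr r s (xi w)))) ->
  measurable_fun setT (fun w => `|xi w|).
Proof.
case: enb => tb b1 b2 b3 sr mx.
apply: (measurable_norm_coord (unit_coord_total onb tb b1 b2 b3 c0_gt0 lam_lt Hr r)) => // n.
under eq_fun do rewrite -(coordE b1 c0_gt0 lam_lt) -(coord_incl onb tb b1 b2 b3 c0_gt0 lam_lt n _ sr).
by apply: measurable_funM => //; apply: measurable_funM => //; exact: mx.
Qed.

End initial_value.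

Lemma moment_affine (R : realType) (d : measure_display) (Omega : measurableType d)
    (P : probability Omega R) (f : Omega -> R) (p C : R) : 0 <= p -> 0 <= C ->
  measurable_fun setT f -> (forall w, 0 <= f w) -> (\int[P]_w (f w `^ p)%:E < +oo)%E ->
  exists M : R, (\int[P]_w ((1 + C * f w) `^ p)%:E <= M%:E)%E.
Proof.
move=> p0 C0 mf f0 fin.
have mfp : measurable_fun setT (fun w => (f w `^ p)%:E).
  by apply/measurable_EFinP; exact: measurable_powR_comp.
have fp0 w : (0 <= (f w `^ p)%:E)%E by rewrite lee_fin powR_ge0.
have [I IE] : exists I, (\int[P]_w (f w `^ p)%:E)%E = I%:E.
  exists (fine (\int[P]_w (f w `^ p)%:E)%E); rewrite fineK// ge0_fin_numE//.
  exact: integral_ge0.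
exists (2 `^ p * (1 + C `^ p * I)).
apply: (@le_trans _ _ (\int[P]_w ((2 `^ p)%:E * (1%:E + (C `^ p)%:E * (f w `^ p)%:E)))%E).
  apply: ge0_le_integral_nomeas => w _; first by rewrite lee_fin powR_ge0.
  apply: (@le_trans _ _ (2 `^ p * (1 + C `^ p * f w `^ p))%:E); last by [].
  rewrite lee_fin; apply: le_trans (powR_add_le p0 ler01 (mulr_ge0 C0 (f0 w))) _.
  by rewrite powR1 powRM.
have Cf0 w : (0 <= (C `^ p)%:E * (f w `^ p)%:E)%E by rewrite mule_ge0// lee_fin powR_ge0.
have mCf : measurable_fun setT (fun w => ((C `^ p)%:E * (f w `^ p)%:E)%E).
  exact: emeasurable_funM.
have m1 : measurable_fun setT (fun _ : Omega => 1%:E : \bar R) by exact: measurable_cst.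
rewrite (integralZ_ge0 P (powR_ge0 _ _) (emeasurable_funD m1 mCf)); last first.
  by move=> w; rewrite adde_ge0.
rewrite (integralD_ge0 P m1 mCf) // (integralZ_ge0 P (powR_ge0 _ _) mfp fp0) IE.
have -> : (\int[P]_w 1%:E = 1%:E)%E.
  by rewrite integral_cst//= mul1e; exact: probability_setT.
by [].
Qed.

Theorem corollary4p4 (R : realType) (H U : hilbertType R)
  (sepH : separable H) (sepU : separable U)
  (bas : set H) (bas0 : bas !=set0) (onb : orthonormal_basis bas)
  (T iota : R) (T0 : 0 < T) (iota0 : 0 < iota)
  (d : measure_display) (Omega : measurableType d) (P : probability Omega R)
  (Fil : R -> set (set Omega)) (hFil : normal_filtration P T Fil)
  (W : R -> U -> Omega -> R) (hW : cylindrical_wiener P T Fil W)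
  (lam : H -> R) (hlam : (ereal_sup [set (lam h)%:E | h in bas] < 0)%E)
  (Hr : interpolation_family bas lam) (S : semigroup_action Hr)
  (gam alp bet chi : R)
  (halp : 0 <= alp < 1) (hbet : 0 <= bet < 2^-1) (hchi : bet <= chi < 2^-1)
  (F : Hr gam -> Hr (gam - alp)) (contF : continuous F)
  (B : Hr gam -> hsop U (Hr (gam - bet))) (contB : hs_continuous B)
  (lipFB : forall A : set (Hr gam), bounded_set A ->
    (holder_semi A enorm 1 F +
     holder_semi A hs_norm 1 (fun v => B v : U -> Hr (gam - bet)%R) < +oo)%E)
  (basN : nat -> set H) (hbasN : forall N, basN N `<=` bas)
  (hbas0 : basN 0%N = bas)
  (hrate : (ereal_sup
     [set ((N%:R `^ iota)%:E *
           ereal_sup ([set (`|lam h|^-1)%:E | h in bas `\` basN N] `|` [set 0]))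
        | N in [set N | (0 < N)%N]] < +oo)%E)
  (PN : nat -> {linear Hr (Num.min 0 (gam - 1)) -> Hr (Num.min 0 (gam - 1))})
  (contPN : forall N, continuous (PN N))
  (hPN : forall N (v : H),
     PN N (iemb Hr (Num.min 0 (gam - 1)) v) =
     iemb Hr (Num.min 0 (gam - 1)) (vsum (basN N) (fun h => inner h v *: h)))
  (QN : nat -> {linear U -> U}) (contQN : forall N, continuous (QN N))
  (X : nat -> R -> Omega -> Hr gam)
  (adX : forall N, adapted T Fil (X N))
  (contX : forall N w, {within `[0, T], continuous (fun t => X N t w)})
  (eqX : forall N t, 0 <= t <= T ->
     mild_eq S P T Fil W F B (PN N) (QN N) (X 0%N 0) (X N) t)
  (vth p : R) (hvth : 0 < vth < Num.min (1 - alp) (2^-1 - bet))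
  (hp : vth^-1 < p)
  (xi : Omega -> Hr (gam + vth))
  (hxi : forall w, iincl Hr (gam + vth) gam (xi w) = X 0%N 0 w)
  (momxi : (\int[P]_w (`|xi w| `^ p)%:E < +oo)%E)
  (lipF : (holder_semi setT enorm 1 F < +oo)%E)
  (lipB : (holder_semi setT hs_norm 1
     (fun v => B v : U -> Hr (gam - bet)%R) < +oo)%E)
  (growB : (ereal_sup
     [set ereal_sup
       [set ((hs_norm (fun u => B v (QN N u)) +
              (N%:R `^ (iota * vth))%:E *
              hs_norm (fun u => iincl Hr (gam - bet)%R (gam - chi)%R
                                  (B v (QN 0%N u - QN N u)%R)))
             * ((1 + `|v|)^-1)%:E)
         | v in [set: Hr gam]]
       | N in [set N | (0 < N)%N]] < +oo)%E) :
  forall delta eps : R, 0 <= delta < vth - p^-1 -> 0 < eps ->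
  (ereal_sup
     [set (\int[P]_w (holder_norm `[0%R, T] enorm delta (fun t => X N t w)) `^ p +
           (N%:R `^ (iota * (vth - delta - p^-1 - eps)))%:E *
           (\int[P]_w (holder_norm `[0%R, T] enorm delta (fun t => (X 0%N t w - X N t w)%R)) `^ p) `^ p^-1)
       | N in [set N | (0 < N)%N]] < +oo)%E.
Proof.
move=> del eps hdel heps; have /andP[th0] := hvth; rewrite lt_min => /andP[tha thb].
have /andP[alp0 alp1] := halp; have /andP[bet0 bet1] := hbet; have /andP[bc chi1] := hchi.
(* [vth < 1/2 - bet <= 1/2], so [1/vth < p] places [p] above 2; this makes the power [p/2] of the
   bracket convex. *)
have p2 : 2 <= p.
  have h : vth <= 2^-1 by lra.
  by apply: le_trans (ltW hp); rewrite -[leLHS]invrK lef_pV2 ?posrE.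
have p0 : 0 <= p by lra.
have p1 : 1 <= p by lra.
have vth01 : 0 <= vth <= 1 by rewrite ltW //=; lra.
pose m := Num.min 0 (gam - 1).
have m0 : m <= 0 by rewrite ge_min lexx.
have mg : m <= gam by rewrite ge_min; apply/orP; right; lra.
(* The drift spends [alp + vth]. The noise, entering squared, spends twice [bet + vth], or twice
   [chi] where the rate comes from the hypothesis on [QN]. *)
pose kap := Num.max (alp + vth) (Num.max (2 * (bet + vth)) (2 * chi)).
have kap1 : kap < 1 by rewrite /kap !gt_max; clear - tha thb chi1; apply/and3P; split; lra.
have kapF : alp + vth <= kap by rewrite le_max lexx.
have kapB : 2 * (bet + vth) <= kap by rewrite !le_max lexx orbT.
have kapC : 2 * chi <= kap by rewrite !le_max lexx !orbT.
have kap01 : 0 <= kap < 1 by rewrite kap1 andbT; apply: le_trans kapF; lra.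
have [c0 c0_gt0 lam_lt] := spectral_gap bas0 hlam.
have [bH enb] := basis_enum sepH onb; have [tbH b1 b2 b3] := enb.
have te r := unit_coord_total onb tbH b1 b2 b3 c0_gt0 lam_lt Hr r.
pose e := unit_coord bH Hr gam.
have [b [tb hb]] := hs_enum sepU.
have [KQ KQ0 hKQ] := bounded_linear_bound (contQN 0%N).
have [LF LF0 F_lip'] := holder_semi_lipschitz (congr1 EFin (normr0 _)) lipF.
have [LB LB0 B_lip'] := holder_semi_lipschitz hs_norm0 lipB.
have [Cr Cr1 hCr] := truncation_rate hrate.
have [Gc Gc0 hGc] := noise_growth (E := iincl Hr (gam - bet) (gam - chi)) growB.
have Cr0 : 0 < Cr by exact: lt_le_trans Cr1.
pose rho N := Cr * N%:R `^ (- iota).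
have rho0 N : 0 <= rho N by rewrite mulr_ge0 ?powR_ge0// ltW.
have F_lip x y : `|F x - F y| <= LF * `|x - y| by rewrite -lee_fin; exact: F_lip'.
pose cF := `|F 0| + LF.
have cF0 : 0 <= cF by exact: addr_ge0.
have F_growth x : `|F x| <= cF * (1 + `|x|).
  rewrite -[F x](subrK (F 0)); apply: le_trans (ler_normD _ _) _.
  apply: le_trans (lerD (F_lip x 0) (lexx _)) _; rewrite subr0 mulrDr mulr1 mulrDl.
  have f0 := normr_ge0 (F 0); have h := mulr_ge0 f0 (normr_ge0 x).
  by rewrite /cF; clear - h f0 LF0; lra.
have B_lip := hs_comp_lipschitz tb (te _) hb LB0 KQ0 hKQ B_lip'.
have [cB cB0 B_growth] := hs_comp_growth tb (te _) hb LB0 KQ0 hKQ B_lip' Gc0 (fun N v N0 => (hGc N v N0).1).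
have B_trunc N x : (0 < N)%N ->
  (hs_norm (fun u => iincl Hr (gam - bet) (gam - chi) (B x (QN 0%N u - QN N u)%R)) `^ 2 <=
   ((rho N `^ vth * (Gc * (1 + `|x|))) ^+ 2)%:E)%E.
  move=> N0; have x0 : 0 <= Gc * (1 + `|x|) by rewrite mulr_ge0// addr_ge0.
  apply: hs_sqr_le; first by rewrite mulr_ge0// powR_ge0.
  apply: le_trans (hGc N x N0).2 _; rewrite lee_fin ler_wpM2r//.
  rewrite /rho powRM ?powR_ge0 ?(ltW Cr0)// -powRrM mulNr ler_peMl ?powR_ge0//.
  by rewrite -[leLHS](powRr0 Cr); apply: ler_powR => //; exact: ltW.
have cc0 := conv_const_ge0 T0 LF0 LB0 KQ0 Gc0 cF0 cB0.
have F_le := drift_conv_le onb sepH c0_gt0 lam_lt S T0 alp0 th0 kap1 kapF hbasN contPN hPN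
  LF0 LB0 KQ0 Gc0 cF0 cB0 F_growth.
have F_time := drift_conv_time onb sepH c0_gt0 lam_lt S T0 alp0 th0 kap1 kapF hbasN contPN hPN
  LF0 LB0 KQ0 Gc0 cF0 cB0 F_growth.
have F_trunc := drift_conv_trunc onb sepH c0_gt0 lam_lt S T0 alp0 th0 kap1 kapF hbasN hbas0 contPN hPN
  LF0 LB0 KQ0 Gc0 cF0 cB0 F_growth F_lip rho0 hCr.
have B_le := noise_conv_le onb sepH c0_gt0 lam_lt S hb T0 bet0 th0 kap1 kapB hbasN contPN hPN
  LF0 LB0 KQ0 Gc0 cF0 cB0 B_growth.
have B_time := noise_conv_time onb sepH c0_gt0 lam_lt S hb T0 bet0 th0 kap1 kapB hbasN contPN hPN
  LF0 LB0 KQ0 Gc0 cF0 cB0 B_growth.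
have B_trunc' := noise_conv_trunc onb sepH c0_gt0 lam_lt S hb T0 bet0 bc th0 kap1 kapB kapC hbasN hbas0
  contPN hPN LF0 LB0 KQ0 Gc0 cF0 cB0 B_growth B_lip rho0 hCr B_trunc.
(* A bound for the norm of the inclusion of [Hr (gam + vth)] into [Hr gam], coming from the spectral
   gap. *)
pose Ci := Num.min c0 1 `^ (- vth).
have Ci0 : 0 <= Ci by exact: powR_ge0.
have sg : gam <= gam + vth by rewrite lerDl ltW.
have gth : gam + vth - gam = vth by ring.
have hCi w : `|X 0%N 0 w| <= Ci * `|xi w|.
  by rewrite -hxi; have := norm_iincl_le onb enb c0_gt0 lam_lt (xi w) sg; rewrite gth.
have T0T : 0 <= (0 : R) <= T by rewrite lexx ltW.
have mxi : measurable_fun setT (fun w => `|xi w|).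
  apply: (measurable_norm_lift onb enb c0_gt0 lam_lt sg) => n.
  by under eq_fun do rewrite hxi; exact: (adapted_coord_measurable hFil e (adX 0%N) n T0T).
have C10 : 0 <= 1 + Ci by exact: addr_ge0.
have [Mx momx] := moment_affine p0 C10 mxi (fun w => normr_ge0 (xi w)) momxi.
(* A single scalar dominating the initial value in both spaces: in [Hr gam] for the size of [y], in
   [Hr (gam + vth)] for its increments and truncation. *)
pose x0 w := (1 + Ci) * `|xi w|.
have mx0 : measurable_fun setT x0 by exact: measurable_funM.
have x00 w : 0 <= x0 w by exact: mulr_ge0.
have xix0 w : `|xi w| <= x0 w by rewrite ler_peMl// lerDl.
have Xx0 w : `|X 0%N 0 w| <= x0 w.
  by apply: le_trans (hCi w) _; rewrite ler_wpM2r// lerDr.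
pose y N t w := propagator S gam (PN N) t (iincl Hr gam m (X 0%N 0 w)).
have y_le N t w : 0 <= t <= T -> `|y N t w| <= x0 w.
  move=> /andP[t0 _]; apply: le_trans (Xx0 w).
  exact: (propagator_contraction onb c0_gt0 lam_lt S m0 mg sepH (@hbasN N) (@contPN N) (hPN N) _ t0).
have y_time N t1 t2 w : 0 <= t2 -> t2 <= t1 -> t1 <= T -> `|y N t1 w - y N t2 w| <= (t1 - t2) `^ vth * x0 w.
  move=> t20 t21 _; apply: (@le_trans _ _ ((t1 - t2) `^ vth * `|xi w|)); last by rewrite ler_wpM2l ?powR_ge0.
  exact: (propagator_time_smooth onb c0_gt0 lam_lt S m0 mg sepH (@hbasN N) (@contPN N) (hPN N) t20 t21 vth01 (hxi w)).
have y_trunc N t w : (0 < N)%N -> 0 <= t <= T -> `|y 0%N t w - y N t w| <= rho N `^ vth * x0 w.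
  move=> N0 /andP[t0 _]; apply: (@le_trans _ _ (rho N `^ vth * `|xi w|)); last by rewrite ler_wpM2l ?powR_ge0.
  have sub : basN N `<=` basN 0%N by rewrite hbas0; exact: hbasN.
  exact: (propagator_trunc_smooth onb c0_gt0 lam_lt S m0 mg sepH (@hbasN 0%N) (@hbasN N) (@contPN 0%N) (@contPN N)
    (hPN 0%N) (hPN N) (rho0 N) (fun h bh _ => hCr N h N0 bh) sub t0 (ltW th0) (hxi w)).
have mild N t : 0 <= t <= T -> exists2 J : Omega -> Hr gam,
    ito_approx P T Fil W e t (fun s w => noise_conv S B PN QN N (t - s) (X N s w)) J &
    {ae P, forall w, exists2 I : Hr gam,
      is_bochner_integral t (fun s => drift_conv S F PN N (t - s) (X N s w)) I & X N t w = y N t w + I + J w}.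
  move=> tT; have [J HJ HI] := @eqX N t tT; exists J => //.
  apply: (ito_integral_approx hFil (ltW T0) e) => // s w /andP[_ st].
  by apply: (noise_conv0 onb sepH c0_gt0 lam_lt S bet0 th0 kap1 kapB B hbasN QN contPN hPN); rewrite subr_gt0.
have [M M0 hM] := mild_problem_moment hFil T0 hW tb (te gam) (@hb _) th0 (andP vth01).2 p2 kap01 cc0 adX contX
  mx0 x00 momx mild y_le F_le B_le.
have [C2 C20 hC2] := mild_problem_incr hFil T0 hW tb (te gam) (@hb _) th0 (andP vth01).2 p2 kap01 cc0 adX contX
  mx0 x00 momx mild y_le y_time F_le F_time B_le B_time.
have [C3 C30 hC3] := mild_problem_trunc hFil T0 hW tb (te gam) (@hb _) th0 (andP vth01).2 p2 kap01 cc0 adX contX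
  mx0 x00 momx mild y_le y_trunc F_le F_trunc B_le B_trunc'.
have mX N t i : 0 <= t <= T -> measurable_fun setT (fun w => inner (e i) (X N t w)).
  by move=> tT; exact: (adapted_coord_measurable hFil e (adX N) i tT).
exact: (holder_rate T0 (te gam) th0 p1 iota0 Cr0 M0 C20 C30 contX mX hM hC2 hC3 hdel heps).
Qed.
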